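(* Fix one of the four types of finite elements (linear, bilinear, Crouzeix-Raviart, rotated-$Q_1$) and assume the unisolvence conditions stated in the context. There is a constant $C$ (depending only on $\epsilon$ and $\bar\kappa$, and additionally on $\lambda$ in the rotated-$Q_1$ case; independent of the interface location, $\beta^\pm$ and $\kappa$) such that on every $T\in\mathcal T_h^i$ without obscure points and for every $u\in PH^2_{int}(T)$: (a) for rotated-$Q_1$ and Crouzeix-Raviart finite elements, $$\|I^P_{h,T}u-u\|_{0,T^-}+h|I^P_{h,T}u-u|_{1,T^-}\le C\frac{1+\kappa}{\rho}h^2(|u|_{1,T}+|u|_{2,T}),$$ $$\|I^P_{h,T}u-u\|_{0,T^+}+h|I^P_{h,T}u-u|_{1,T^+}\le C\frac{1+\kappa}{\rho^2}h^2(|u|_{1,T}+|u|_{2,T});$$ (b) for linear finite elements, $$\|I^P_{h,T}u-u\|_{0,T^-}+h|I^P_{h,T}u-u|_{1,T^-}\le C\frac{1+\kappa}{\rho}h^2(|u|_{1,T}+|u|_{2,T}),$$ $$\|I^P_{h,T}u-u\|_{0,T^+}+h|I^P_{h,T}u-u|_{1,T^+}\le C\frac{1+\kappa}{\rho^{3/2}}h^2(|u|_{1,T}+|u|_{2,T});$$ (c) for bilinear finite elements, $$\|I^P_{h,T}u-u\|_{0,T}+h|I^P_{h,T}u-u|_{1,T}\le C\frac{1+\kappa}{\rho}h^2(|u|_{1,T}+|u|_{2,T}).$$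
   Context: Mesh and interface. $\Omega\subset\mathbb R^2$ is a bounded domain that is a union of finitely many rectangles; a curve $\Gamma$ separates $\Omega$ into subdomains $\Omega^-,\Omega^+$. $\mathcal T_h$ is a Cartesian triangular or rectangular mesh of $\Omega$ with maximum edge length $h$; a typical element has vertices $A_1=(0,0),A_2=(h,0),A_3=(h,h)$ (triangle), or additionally $A_4=(0,h)$ (rectangle). An element whose interior meets $\Gamma$ is an interface element; $\mathcal T_h^i$ is the set of these. Standing hypotheses: $\Gamma$ meets an edge of an element in at most two points unless the edge is part of $\Gamma$; if $\Gamma$ meets the boundary of an element at two points, these are on different edges; $\Gamma$ is piecewise $C^2$, and its portion in each interface element is $C^2$; $\Gamma$ is smooth enough that $PC^2_{int}(T)$ is dense in $PH^2_{int}(T)$ for every $T\in\mathcal T_h^i$. For $T\in\mathcal T_h^i$: $T^s=T\cap\Omega^s$, $s=\pm$; $D,E$ are the intersection points of $\Gamma$ with $\partial T$; $l$ is the line through $D$ and $E$ with unit normal $\bar{\mathbf n}$; $\mathbf n(\widetilde X)$ is the unit normal of $\Gamma$ at $\widetilde X\in\Gamma\cap T$; all normals are oriented from $T^-$ to $T^+$. In the local coordinates with origin $D$ and first axis along $l$, $\Gamma\cap T$ is a graph $\{(\xi,\omega(\xi)):\xi\in[0,\xi_E]\}$, where $E=(\xi_E,0)$. $\kappa$ is the maximum curvature of $\Gamma$. Coefficients: $\beta^\pm>0$ are constants with $\beta^+\ge\beta^-$, $\rho=\beta^-/\beta^+\le 1$, $\beta=\beta^\pm$ on $\Omega^\pm$.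 Function spaces. $PH^2_{int}(T)=\{u: u|_{T^s}\in H^2(T^s), s=\pm;\ [u]_\Gamma=0,\ [\beta\nabla u\cdot\mathbf n]_\Gamma=0 \text{ on }\Gamma\cap T\}$; $PC^2_{int}(T)$ is defined likewise with $C^2(T^s)$; $[\cdot]_\Gamma$ is the jump across $\Gamma$. On these, $\|\cdot\|_{k,T}^2=\|\cdot\|_{k,T^+}^2+\|\cdot\|_{k,T^-}^2$ and $|\cdot|_{k,T}^2=|\cdot|_{k,T^+}^2+|\cdot|_{k,T^-}^2$ with $\|\cdot\|_{k,T^s},|\cdot|_{k,T^s}$ the $H^k(T^s)$ norm and semi-norm. Finite elements: $\Pi_T=\mathrm{Span}\{1,x,y\}$ (linear or Crouzeix-Raviart, triangles), $\mathrm{Span}\{1,x,y,xy\}$ (bilinear, rectangles), or $\mathrm{Span}\{1,x,y,x^2-y^2\}$ (rotated-$Q_1$, rectangles). $\mathcal I=\{1,2,3\}$ for triangles and $\{1,2,3,4\}$ for rectangles. The nodes $M_i$ are the vertices of $T$ (linear, bilinear) or the midpoints of the edges of $T$ (Crouzeix-Raviart, rotated-$Q_1$). $\mathcal I$ is partitioned into $\mathcal I^\pm=\{i: M_i\in T^\pm\}$. For $p\in\Pi_T$, $T$ rectangular, $d(p)$ is the coefficient of its second degree term. A point $X\in T$ is obscure if one of the lines $\overline{XM_i}$, $i\in\mathcal I$, intersects $\Gamma$ more than once. Unisolvence conditions. Fixed $\epsilon\in(0,\sqrt2/2)$, $\bar\kappa\in(0,1]$ with $h<\min\{\sqrt{\bar\kappa}/(\sqrt2(1+(1-2\epsilon^2)^{-3/2})\kappa),\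 \epsilon/\kappa\}$; in the bilinear case $\sqrt{\bar\kappa}<\frac1{4\sqrt2}$; in the rotated-$Q_1$ case $\sqrt{\bar\kappa}\le\frac{\rho(1-\lambda)}{4-(3+\lambda)\rho}$ for some $\lambda\in(0,1)$. On each $T\in\mathcal T_h^i$ a point $F\in\Gamma\cap T$ is fixed with $\mathbf n(F)=\bar{\mathbf n}$ (linear, Crouzeix-Raviart), with orthogonal projection $F_\bot$ onto $l$ equal to the midpoint of $\overline{DE}$ (bilinear), arbitrary (rotated-$Q_1$). IFE shape functions. Under these conditions $\phi^P_{i,T}$ is the unique function equal to $\phi^{P-}_{i,T}\in\Pi_T$ on $T^-$ and $\phi^{P+}_{i,T}\in\Pi_T$ on $T^+$ with: $\phi^{P-}_{i,T}|_l=\phi^{P+}_{i,T}|_l$ and, for rectangular $T$, $d(\phi^{P-}_{i,T})=d(\phi^{P+}_{i,T})$; $\beta^-\nabla\phi^{P-}_{i,T}(F)\cdot\mathbf n(F)=\beta^+\nabla\phi^{P+}_{i,T}(F)\cdot\mathbf n(F)$; $\phi^P_{i,T}(M_j)=\delta_{ij}$, $j\in\mathcal I$. The interpolation is $I^P_{h,T}u=\sum_{i\in\mathcal I}u(M_i)\phi^P_{i,T}$ for $T\in\mathcal T_h^i$. *)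

(* Defs.v *)
From HB Require Import structures.
From mathcomp Require Import all_boot all_order all_algebra.
From mathcomp Require Import all_classical all_reals all_analysis.
Set Implicit Arguments.
Unset Strict Implicit.
Unset Printing Implicit Defensive.
Import Order.TTheory GRing.Theory Num.Theory.
Import numFieldNormedType.Exports.
Local Open Scope classical_set_scope.
Local Open Scope ring_scope.

(* Sides of the interface are booleans: [true] is "+", [false] is "-". *)

Section Plane.
Context {R : realType}.
Local Notation plane := (R * R)%type.

Definition ex : plane := (1, 0).
Definition ey : plane := (0, 1).

Definition dot (v w : plane) : R := v.1 * w.1 + v.2 * w.2.
(* The library's norm on a product is the sup norm, hence the explicit
   Euclidean norm. *)
Definition enorm (v : plane) : R := Num.sqrt (dot v v).

Definition segment (a b : plane) : set plane :=
  [set (1 - t) *: a + t *: b | t in `[0, 1]].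

Definition grad (f : plane -> R) (X : plane) : plane := ('D_ex f X, 'D_ey f X).

Fixpoint Ck (k : nat) (f : plane -> R) : Prop :=
  if k is k'.+1 then
    [/\ continuous f, forall X, derivable f X ex /\ derivable f X ey,
        Ck k' (fun X => 'D_ex f X) & Ck k' (fun X => 'D_ey f X)]
  else continuous f.

Definition C2_line (f : R -> R) : Prop :=
  [/\ forall x, derivable f x 1, forall x, derivable (derive1 f) x 1
    & continuous (derive1 (derive1 f))].

(* A C^2 function on a closed interval is represented by a C^2 extension
   to the whole line. *)
Definition C2_arc (c : R -> plane) (a b : R) : Prop :=
  let c1 t := (c t).1 in let c2 t := (c t).2 in
  [/\ a < b, C2_line c1, C2_line c2
    & forall t, t \in `[a, b] -> (derive1 c1 t, derive1 c2 t) != 0].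

Definition curvature (c : R -> plane) (t : R) : R :=
  let c1 t := (c t).1 in let c2 t := (c t).2 in
  `|derive1 c1 t * derive1 (derive1 c2) t - derive1 c2 t * derive1 (derive1 c1) t|
    / enorm (derive1 c1 t, derive1 c2 t) ^+ 3.

Definition piecewise_C2_curve (Gam : set plane) : Prop :=
  exists (c : R -> plane) (n : nat) (t : nat -> R),
    [/\ (0 < n)%N, {within `[t 0%N, t n], continuous c},
        Gam = c @` `[t 0%N, t n]
      & forall i, (i < n)%N -> exists2 a : R -> plane,
          C2_arc a (t i) (t i.+1) & {in `[t i, t i.+1], c =1 a}].

Definition curvatures (Gam : set plane) : set R :=
  [set k | exists (c : R -> plane) (a b t : R),
     [/\ C2_arc c a b, c @` `[a, b] `<=` Gam, t \in `[a, b]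
       & k = curvature c t]].

Definition is_max_curvature (Gam : set plane) (k : R) : Prop :=
  curvatures Gam k /\ ubound (curvatures Gam) k.

Definition is_domain (A : set plane) : Prop :=
  [/\ open A, A !=set0 & connected A].

Definition rectangle (k : plane * plane) : set plane :=
  `[k.1.1, k.2.1] `*` `[k.1.2, k.2.2].

Definition rectangular_domain (Om : set plane) : Prop :=
  is_domain Om /\
  exists2 K : seq (plane * plane),
    forall k, k \in K -> k.1.1 < k.2.1 /\ k.1.2 < k.2.2
    & Om = (\bigcup_(k in [set` K]) rectangle k)°.

End Plane.

Section Sobolev.
Context {R : realType}.
Local Notation plane := (R * R)%type.
Local Notation leb := (@lebesgue_measure R).
Local Notation leb2 := (leb \x leb)%E.

Definition L2 (G : set plane) (f : plane -> R) : Prop :=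
  (f \_ G) \in Lfun leb2 2%:E.

Definition L2norm (G : set plane) (f : plane -> R) : R :=
  fine ('N[leb2]_2%:E[EFin \o (f \_ G)])%E.

Definition test_fun (G : set plane) (phi : plane -> R) : Prop :=
  [/\ forall k, Ck k phi, compact (closure [set X | phi X != 0])
    & closure [set X | phi X != 0] `<=` G°].

Definition is_weak_deriv (G : set plane) (v : plane) (f g : plane -> R) :=
  forall phi, test_fun G phi ->
    \int[leb2]_(X in G) (f X * 'D_v phi X)
      = - \int[leb2]_(X in G) (g X * phi X).

(* The L^2 weak derivative in direction [v]: a representative of the class,
   which is unique up to a null set; 0 if there is none. *)
Definition wD (G : set plane) (v : plane) (f : plane -> R) : plane -> R :=
  xget (cst 0) [set g | L2 G g /\ is_weak_deriv G v f g].

Definition has_wD (G : set plane) (v : plane) (f : plane -> R) : Prop :=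
  exists2 g, L2 G g & is_weak_deriv G v f g.

Definition H1 (G : set plane) (f : plane -> R) : Prop :=
  [/\ L2 G f, has_wD G ex f & has_wD G ey f].

Definition H2 (G : set plane) (f : plane -> R) : Prop :=
  [/\ H1 G f, H1 G (wD G ex f) & H1 G (wD G ey f)].

Definition semi1 (G : set plane) (f : plane -> R) : R :=
  Num.sqrt (L2norm G (wD G ex f) ^+ 2 + L2norm G (wD G ey f) ^+ 2).

Definition semi2 (G : set plane) (f : plane -> R) : R :=
  Num.sqrt (L2norm G (wD G ex (wD G ex f)) ^+ 2
          + L2norm G (wD G ey (wD G ex f)) ^+ 2
          + L2norm G (wD G ey (wD G ey f)) ^+ 2).

Definition H1norm (G : set plane) (f : plane -> R) : R :=
  Num.sqrt (L2norm G f ^+ 2 + semi1 G f ^+ 2).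

Definition H2norm (G : set plane) (f : plane -> R) : R :=
  Num.sqrt (L2norm G f ^+ 2 + semi1 G f ^+ 2 + semi2 G f ^+ 2).

(* [t] is the trace on the arc [p @` `]a, b[] of [f] in H^1(G): the restriction
   of functions C^1 up to the boundary, extended by continuity.  Convergence on
   the arc is in L^2_loc for the arc length ([w] is the length element), so
   that nothing is required at the end points, where G may have a cusp. *)
Definition is_trace (G : set plane) (p : R -> plane) (w : R -> R) (a b : R)
    (f : plane -> R) (t : R -> R) : Prop :=
  measurable_fun `]a, b[ t /\
  exists v : nat -> plane -> R,
    [/\ forall k, Ck 1 (v k),
        (fun k => H1norm G (fun X => v k X - f X)) @ \oo --> 0
      & forall c d, a < c -> d < b ->
        (fun k => \int[leb]_(x in `[c, d])
                    ((v k (p x) - t x) ^+ 2 * w x)%:E)%E @ \oo --> 0%E].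

End Sobolev.

Variant fe_type := FE_linear | FE_bilinear | FE_crouzeix_raviart | FE_rotated_Q1.

Definition triangular (ft : fe_type) : bool :=
  match ft with FE_linear | FE_crouzeix_raviart => true | _ => false end.

(* number of vertices, which is also the number of edges and of nodes *)
Definition nv (ft : fe_type) : nat := if triangular ft then 3 else 4.

Lemma nv_gt0 ft : (0 < nv ft)%N.
Proof. by case: ft. Qed.

Definition next_vertex (ft : fe_type) (i : 'I_(nv ft)) : 'I_(nv ft) :=
  Ordinal (ltn_pmod i.+1 (nv_gt0 ft)).

(* Elements are the images of the typical element with vertices (0,0), (h,0),
   (h,h) [, (0,h)] under a translation and possibly reflections of the axes;
   for triangles this gives all four halves of a mesh square. *)
Record element (R : realType) := Element {
  base : R * R;
  flipx : bool;
  flipy : bool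
}.

(* c0 + cx x + cy y + cd q(x, y), where q is the second degree term *)
Record shape_poly (R : realType) := ShapePoly {
  c0 : R;
  cx : R;
  cy : R;
  cd : R
}.

(* [omega] describes the interface in the element in the orthonormal frame with
   origin [ptD], first axis towards [ptE] and second axis [nbar]; only its
   values on [0, |DE|] matter. *)
Record local_interface (R : realType) := LocalInterface {
  ptD : R * R;
  ptE : R * R;
  nbar : R * R;
  omega : R -> R;
  ptF : R * R
}.

Record interface_problem (R : realType) := InterfaceProblem {
  Omega : set (R * R);
  Gamma : set (R * R);
  Omega_ : bool -> set (R * R);
  kappa : R;
  beta : bool -> R;
  mesh_size : R;
  mesh : set (element R);
  local : element R -> local_interface R
}.

Section Elements.
Context {R : realType}.
Local Notation plane := (R * R)%type.
Variables (ft : fe_type) (h : R).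
Implicit Type T : element R.

Definition emap T (X : plane) : plane :=
  ((base T).1 + (-1) ^+ flipx T * h * X.1,
   (base T).2 + (-1) ^+ flipy T * h * X.2).

Definition ref_set : set plane :=
  if triangular ft then [set X | 0 <= X.2 /\ X.2 <= X.1 <= 1]
  else [set X | 0 <= X.1 <= 1 /\ 0 <= X.2 <= 1].

Definition ref_vertex (i : nat) : plane :=
  match i with 0 => (0, 0) | 1 => (1, 0) | 2 => (1, 1) | _ => (0, 1) end.

Definition eset T : set plane := emap T @` ref_set.
Definition ebd T : set plane := eset T `\` (eset T)°.

Definition vertex T (i : 'I_(nv ft)) : plane := emap T (ref_vertex i).

Definition edge T (i : 'I_(nv ft)) : set plane :=
  segment (vertex T i) (vertex T (next_vertex i)).

Definition node T (i : 'I_(nv ft)) : plane :=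
  match ft return 'I_(nv ft) -> plane with
  | FE_linear | FE_bilinear => fun _ => vertex T i
  | FE_crouzeix_raviart | FE_rotated_Q1 => fun _ =>
      2^-1 *: (vertex T i + vertex T (next_vertex i))
  end i.

Definition quad_term (X : plane) : R :=
  match ft with
  | FE_linear | FE_crouzeix_raviart => 0
  | FE_bilinear => X.1 * X.2
  | FE_rotated_Q1 => X.1 ^+ 2 - X.2 ^+ 2
  end.

Definition peval (p : shape_poly R) (X : plane) : R :=
  c0 p + cx p * X.1 + cy p * X.2 + cd p * quad_term X.

End Elements.

Section LocalInterface.
Context {R : realType}.
Local Notation plane := (R * R)%type.
Variable L : local_interface R.

Definition xiE : R := enorm (ptE L - ptD L).
Definition tau : plane := xiE^-1 *: (ptE L - ptD L).
Definition xi_of (X : plane) : R := dot (X - ptD L) tau.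
Definition graph_pt (xi : R) : plane := ptD L + xi *: tau + omega L xi *: nbar L.
Definition speed (xi : R) : R := Num.sqrt (1 + derive1 (omega L) xi ^+ 2).

(* the unit normal of Gamma at a point X of Gamma in the element *)
Definition normal (X : plane) : plane :=
  (speed (xi_of X))^-1 *: (nbar L - derive1 (omega L) (xi_of X) *: tau).

End LocalInterface.

Section Problem.
Context {R : realType}.
Local Notation plane := (R * R)%type.
Local Notation leb := (@lebesgue_measure R).
Variables (ft : fe_type) (P : interface_problem R).
Implicit Type T : element R.

Definition Tset T : set plane := eset ft (mesh_size P) T.
Definition Tsub T (s : bool) : set plane := Tset T `&` Omega_ P s.
Definition nodeP T (i : 'I_(nv ft)) : plane := node (mesh_size P) T i.
Definition rho : R := beta P false / beta P true.

Definition separates : Prop :=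
  [/\ forall s, is_domain (Omega_ P s),
      Omega_ P false `&` Omega_ P true = set0,
      Omega P `\` Gamma P = Omega_ P false `|` Omega_ P true
    & forall s, Gamma P `&` Omega P `<=` closure (Omega_ P s)].

Definition cartesian_mesh : Prop :=
  [/\ 0 < mesh_size P, finite_set (mesh P),
      exists o : plane, forall T, mesh P T -> exists i j : int,
        base T = (o.1 + i%:~R * mesh_size P, o.2 + j%:~R * mesh_size P),
      closure (Omega P) = \bigcup_(T in mesh P) Tset T
    & forall T T', mesh P T -> mesh P T' -> T <> T' ->
        (Tset T)° `&` (Tset T')° = set0].

Definition interface_element T : Prop :=
  mesh P T /\ (Tset T)° `&` Gamma P !=set0.

Definition edge_hypothesis : Prop :=
  forall T, mesh P T -> forall i : 'I_(nv ft),
    edge (mesh_size P) T i `<=` Gamma P \/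
    (forall X Y Z, [set X; Y; Z] `<=` Gamma P `&` edge (mesh_size P) T i ->
       X = Y \/ Y = Z \/ X = Z).

Definition boundary_hypothesis : Prop :=
  forall T, mesh P T -> forall X Y, X <> Y ->
    Gamma P `&` ebd ft (mesh_size P) T = [set X; Y] ->
    forall i : 'I_(nv ft), ~ ([set X; Y] `<=` edge (mesh_size P) T i).

Definition local_interface_ok T : Prop :=
  let L := local P T in
  [/\ ptD L <> ptE L /\ Gamma P `&` ebd ft (mesh_size P) T = [set ptD L; ptE L],
      dot (nbar L) (nbar L) = 1 /\ dot (nbar L) (ptE L - ptD L) = 0,
      C2_line (omega L) /\ Gamma P `&` Tset T = graph_pt L @` `[0, xiE L],
      (* normals point from the side "-" to the side "+" *)
      forall X, Gamma P X -> (Tset T)° X ->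
        (\forall t \near 0^'+, Tsub T true (X + t *: normal L X)) /\
        (\forall t \near 0^'+, Tsub T false (X - t *: normal L X))
    & (Gamma P `&` Tset T) (ptF L)].

(* [u] stands for the representative that is continuous away from D and E
   (Sobolev embedding on both sides and [u] = 0), so that nodal values make
   sense; at D and E the pieces of T may have cusps. *)
Definition PH2_int T (u : plane -> R) : Prop :=
  let L := local P T in
  let trace s := is_trace (Tsub T s) (graph_pt L) (speed L) 0 (xiE L) in
  [/\ forall s, H2 (Tsub T s) u,
      {within Tset T `\` [set ptD L; ptE L], continuous u},
      exists t, forall s, trace s u t
    & exists g : bool -> R -> plane,
        (forall s, trace s (wD (Tsub T s) ex u) (fun xi => (g s xi).1) /\
                   trace s (wD (Tsub T s) ey u) (fun xi => (g s xi).2)) /\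
        {ae leb, forall xi, 0 < xi < xiE L ->
           beta P true * dot (g true xi) (normal L (graph_pt L xi))
             = beta P false * dot (g false xi) (normal L (graph_pt L xi))}].

(* C^2(T^s), up to the boundary: restrictions of C^2 functions of the plane *)
Definition PC2_int T (u : plane -> R) : Prop :=
  exists U : bool -> plane -> R,
    [/\ forall s, Ck 2 (U s),
        forall s X, closure (Tsub T s) X -> u X = U s X,
        forall X, (Gamma P `&` Tset T) X -> U true X = U false X
      & forall X, (Gamma P `&` Tset T) X ->
          beta P true * dot (grad (U true) X) (normal (local P T) X)
            = beta P false * dot (grad (U false) X) (normal (local P T) X)].

(* [v s] is the restriction to T^s of a broken function. *)
Definition pnorm0 T (v : bool -> plane -> R) : R :=
  Num.sqrt (\sum_s L2norm (Tsub T s) (v s) ^+ 2).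
Definition psemi1 T (v : bool -> plane -> R) : R :=
  Num.sqrt (\sum_s semi1 (Tsub T s) (v s) ^+ 2).
Definition psemi2 T (v : bool -> plane -> R) : R :=
  Num.sqrt (\sum_s semi2 (Tsub T s) (v s) ^+ 2).
Definition pnorm2 T (v : bool -> plane -> R) : R :=
  Num.sqrt (\sum_s H2norm (Tsub T s) (v s) ^+ 2).

Record standing_hypotheses : Prop := StandingHypotheses {
  hyp_domain : rectangular_domain (Omega P);
  hyp_separates : separates;
  hyp_curve : piecewise_C2_curve (Gamma P);
  hyp_curvature : is_max_curvature (Gamma P) (kappa P);
  hyp_mesh : cartesian_mesh;
  hyp_edges : edge_hypothesis;
  hyp_boundary : boundary_hypothesis;
  hyp_portion : forall T, interface_element T ->
    exists (c : R -> plane) (a b : R),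
      C2_arc c a b /\ Gamma P `&` Tset T = c @` `[a, b];
  hyp_local : forall T, interface_element T -> local_interface_ok T;
  hyp_beta : 0 < beta P false <= beta P true;
  hyp_dense : forall T, interface_element T ->
    forall u, PH2_int T u -> forall e, 0 < e ->
      exists2 w, PC2_int T w & pnorm2 T (fun=> (fun X => u X - w X)) < e
}.

(* The bounds on h are multiplied out: kappa may be 0. *)
Record unisolvence_conditions (eps kbar lam : R) : Prop :=
  UnisolvenceConditions {
  uni_h1 : mesh_size P * (Num.sqrt 2 * (1 + (1 - 2 * eps ^+ 2) `^ (- (3 / 2)))
             * kappa P) < Num.sqrt kbar;
  uni_h2 : mesh_size P * kappa P < eps;
  uni_bilinear : ft = FE_bilinear -> Num.sqrt kbar < 1 / (4 * Num.sqrt 2);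
  uni_rotated : ft = FE_rotated_Q1 ->
    Num.sqrt kbar <= rho * (1 - lam) / (4 - (3 + lam) * rho);
  uni_F : forall T, interface_element T ->
    let L := local P T in
    match ft with
    | FE_linear | FE_crouzeix_raviart => normal L (ptF L) = nbar L
    | FE_bilinear => ptD L + xi_of L (ptF L) *: tau L
                    = 2^-1 *: (ptD L + ptE L)
    | FE_rotated_Q1 => True
    end
}.

Definition obscure T (X : plane) : Prop :=
  Tset T X /\
  exists (i : 'I_(nv ft)) (Y Z : plane),
    Y <> Z /\ [set Y; Z] `<=` segment X (nodeP T i) `&` Gamma P.

(* [phi i s] is the polynomial of the i-th shape function on the side [s].
   Nodes may lie on the boundary of Omega, whence the closure. *)
Definition IFE_shape_functions T
    (phi : 'I_(nv ft) -> bool -> shape_poly R) : Prop :=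
  let L := local P T in
  forall i,
  [/\ forall t, let X := ptD L + t *: tau L in
        peval ft (phi i false) X = peval ft (phi i true) X,
      ~~ triangular ft -> cd (phi i false) = cd (phi i true),
      beta P false * dot (grad (peval ft (phi i false)) (ptF L))
                         (normal L (ptF L))
        = beta P true * dot (grad (peval ft (phi i true)) (ptF L))
                            (normal L (ptF L))
    & forall j s, closure (Tsub T s) (nodeP T j) ->
        peval ft (phi i s) (nodeP T j) = (i == j)%:R].

Definition interpolation T (phi : 'I_(nv ft) -> bool -> shape_poly R)
    (u : plane -> R) (s : bool) (X : plane) : R :=
  \sum_i u (nodeP T i) * peval ft (phi i s) X.

End Problem.

(* Main.v *)
(* Let [L] be the signed distance to the chord [l], [lam_i] the nodal basis and
   [q] the interpolant of the nodal values on the standard element.  A pair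
   satisfying the interface conditions is
     [phi^- = q - c sum_(i in I^+) L(M_i) lam_i],
     [phi^+ = q + c sum_(i in I^-) L(M_i) lam_i],
   where the flux condition determines [c] with denominator [1 - (1 - rho) S],
   [S] being the normal slope at [F] of the interpolant of [max L 0].  The
   unisolvence conditions bound [S] from above, which bounds the IFE shape
   functions by [C / rho] on the side "-" and by [C], [C / rho^(1/2)] or
   [C / rho] on the side "+".

   For a piecewise C^2 function [w] and [X] in [T^s], the first order Taylor
   polynomial of [w] at [X], continued across [l] by the interface conditions,
   is an IFE function, hence equal to its interpolant; so the error at [X] is
   [sum_i R_i phi_i(X)], where [R_i] is the difference of [w] and that function
   at [M_i].  As [X] is not obscure, the segment from [X] to [M_i] crosses the
   interface at most once, and Taylor's formula on both parts bounds [R_i] by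
   [h^2] times a weighted average of the second derivatives of [w] over the
   segment plus [kappa h^2] times its gradient at [X].  The average is a
   contraction in [L^2].

   In the general case [u] is approximated by piecewise C^2 functions; their
   values at the nodes converge because the [H^2] norm of a smooth function on
   a convex piece of [T^s] near a node controls its values there. *)

Require Import Defs.
From HB Require Import structures.
From mathcomp Require Import all_boot all_order all_algebra.
From mathcomp Require Import all_classical all_reals all_analysis.
From mathcomp Require Import measurable_realfun.
From mathcomp Require Import ring lra.
Set Implicit Arguments.
Unset Strict Implicit.
Unset Printing Implicit Defensive.
Import Order.TTheory GRing.Theory Num.Theory.
Import numFieldNormedType.Exports.
Local Open Scope classical_set_scope.
Local Open Scope ring_scope.

(** * Square-integrable functions *)

(** The powers of [rho] are products of two losses. Continuing a jet across the chord multiplies its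
    normal derivative by [1 / rho] when it starts on the side + and by [rho] when it starts on the
    side -; this costs [side_mult]. The shape functions cost the inverse of [side_gain]. On the side
    - the product is [1 / rho]; on the side + it is [1 / rho] times [1 / rho], [1 / sqrt rho] or 1.
    The bounds are proved for every pair that satisfies the interface conditions, with arbitrary
    nodal values. With zero nodal values they give uniqueness, and so the expansion of the jets in
    the shape functions. The obstacle is that T^s may have cusps at D and E, so no Sobolev or trace
    inequality is at hand there. The contraction of the segment averages uses no geometry of T^s;
    the nodal values are controlled on small convex patches with constants that depend on the
    element, which is harmless because they multiply a quantity tending to 0. Nodes are assigned to
    sides by the interface, but the sign of L refers to the chord. Both agree because there are no
    obscure points: some tangent of the interface separates the node from the other side, and the
    segment from its point of contact cannot cross again. *)

Section L2.
Context {R : realType}.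
Local Notation plane := (R * R)%type.
Local Notation leb := (@lebesgue_measure R).
Local Notation leb2 := (leb \x leb)%E.
Implicit Types (G : set plane) (f g : plane -> R).

Lemma patch_mulr G f X : (f \_ G) X = f X * \1_G X.
Proof.
rewrite patchE indicE; case: ifP => _ /=; first by rewrite mulr1.
by rewrite mulr0.
Qed.

Lemma L2_measurable G f : measurable G -> L2 G f -> measurable_fun G f.
Proof.
by move=> mG /andP[]; rewrite inE => mf _; exact/measurable_restrictT.
Qed.

Lemma L2_Lnorm_sqr G f : measurable G ->
  ('N[leb2]_2%:E[EFin \o (f \_ G)] `^ 2)%E = (\int[leb2]_(X in G) ((f X) ^+ 2)%:E)%E.
Proof.
move=> mG; rewrite poweR_Lnorm ?pnatr_eq0//.
rewrite [RHS]integral_mkcond; apply: eq_integral => X _.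
rewrite /= powR_mulrn // real_normK ?num_real//.
by rewrite /patch; case: ifP => // _; rewrite expr0n.
Qed.

Lemma L2P G f : measurable G -> L2 G f <->
  measurable_fun G f /\ (\int[leb2]_(X in G) ((f X) ^+ 2)%:E < +oo)%E.
Proof.
move=> mG; rewrite -L2_Lnorm_sqr //; split => [|[mf fi]].
  move=> fL; split; first exact: L2_measurable.
  move: fL => /andP[_]; rewrite inE /= /finite_norm => /(poweR_lty 2).
  by [].
rewrite /L2 inE; apply/andP; split; first by rewrite inE; apply/(measurable_restrictT f mG).
rewrite inE /= /finite_norm; apply: lty_poweRy fi.
by rewrite pnatr_eq0.
Qed.

Lemma L2norm_ge0 G f : 0 <= L2norm G f.
Proof. by rewrite /L2norm fine_ge0// Lnorm_ge0. Qed.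

Lemma L2norm_sqr G f : measurable G -> L2 G f ->
  ((L2norm G f) ^+ 2)%:E = (\int[leb2]_(X in G) ((f X) ^+ 2)%:E)%E.
Proof.
move=> mG fL; rewrite -L2_Lnorm_sqr // /L2norm.
have : ('N[leb2]_2%:E[EFin \o f \_ G] \is a fin_num)%E.
  rewrite ge0_fin_numE ?Lnorm_ge0//.
  by move: fL => /andP[_]; rewrite inE.
move=> /fineK => {2}<-; rewrite poweR_EFin powR_mulrn //.
by rewrite fine_ge0// Lnorm_ge0.
Qed.

Lemma L2D G f g : L2 G f -> L2 G g -> L2 G (fun X => f X + g X).
Proof.
rewrite /L2 => fL gL.
have -> : (fun X => f X + g X) \_ G = f \_ G + g \_ G.
  apply/funext => X; rewrite !patch_mulr fctE !patch_mulr; ring.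
apply: (@Lfun_addr_closed _ _ _ _ _ _).2 => //; by rewrite lee1n.
Qed.

Lemma L2Z G f a : L2 G f -> L2 G (fun X => a * f X).
Proof.
rewrite /L2 => fL.
have -> : (fun X => a * f X) \_ G = a \o* (f \_ G).
  apply/funext => X; transitivity ((f \_ G) X * a); rewrite // !patch_mulr; ring.
by apply: Lfun_scale => //; rewrite ler1n.
Qed.

Lemma L2N G f : L2 G f -> L2 G (fun X => - f X).
Proof. by move=> /(@L2Z _ _ (-1)); under eq_fun do rewrite mulN1r. Qed.

Lemma L2B G f g : L2 G f -> L2 G g -> L2 G (fun X => f X - g X).
Proof. by move=> fL /L2N; exact: L2D. Qed.

Lemma L2norm_le G f g : measurable G -> L2 G f -> L2 G g ->
  (forall X, G X -> `|f X| <= `|g X|) -> L2norm G f <= L2norm G g.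
Proof.
move=> mG fL gL fg; rewrite -(ler_pXn2r (isT : 0 < 2)%N) ?nnegrE ?L2norm_ge0//.
rewrite -lee_fin !L2norm_sqr//.
have [mf _] := (L2P f mG).1 fL; have [mg _] := (L2P g mG).1 gL.
apply: ge0_le_integral => //.
- by move=> X _; rewrite lee_fin sqr_ge0.
- by apply/measurable_EFinP; exact: measurable_funX.
- by apply/measurable_EFinP; exact: measurable_funX.
- move=> X GX; rewrite lee_fin -[f X ^+ 2]real_normK ?num_real// -[g X ^+ 2]real_normK ?num_real//.
  by rewrite ler_pXn2r ?nnegrE//; exact: fg.
Qed.

Lemma L2_le G f g : measurable G -> measurable_fun G f -> L2 G g ->
  (forall X, G X -> `|f X| <= `|g X|) -> L2 G f.
Proof.
move=> mG mf gL fg; apply/L2P => //; split => //.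
have [mg gi] := (L2P g mG).1 gL.
apply: le_lt_trans gi; apply: ge0_le_integral => //.
- by move=> X _; rewrite lee_fin sqr_ge0.
- by apply/measurable_EFinP; exact: measurable_funX.
- by apply/measurable_EFinP; exact: measurable_funX.
- move=> X GX; rewrite lee_fin -[f X ^+ 2]real_normK ?num_real// -[g X ^+ 2]real_normK ?num_real//.
  by rewrite ler_pXn2r ?nnegrE//; exact: fg.
Qed.

Lemma L2normD G f g : L2 G f -> L2 G g ->
  L2norm G (fun X => f X + g X) <= L2norm G f + L2norm G g.
Proof.
move=> fL gL; rewrite /L2norm.
have -> : (fun X => f X + g X) \_ G = f \_ G \+ g \_ G.
  apply/funext => X; rewrite /= !patch_mulr; ring.
have p1 : (1 <= 2%:E :> \bar R)%E by rewrite lee1n.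
have := @ler_LnormD _ _ _ leb2 2%:E p1 (Lfun_Sub p1 fL) (Lfun_Sub p1 gL).
by [].
Qed.

Lemma L2normZ G f a : L2 G f -> L2norm G (fun X => a * f X) = `|a| * L2norm G f.
Proof.
move=> fL; rewrite /L2norm.
have -> : (fun X => a * f X) \_ G = a \*: (f \_ G).
  by apply/funext => X; rewrite /= !patch_mulr -[RHS]/(a * _) mulrA.
have p1 : (1 <= 2%:E :> \bar R)%E by rewrite lee1n.
have /= -> := @LnormZ _ _ _ leb2 2%:E p1 (Lfun_Sub p1 fL) a.
rewrite fineM//.
by rewrite -(finite_norm_fine (Lfun_Sub p1 fL)).
Qed.

Lemma L2normN G f : L2 G f -> L2norm G (fun X => - f X) = L2norm G f.
Proof.
move=> fL; rewrite -[RHS]mul1r -(normrN1 R) -L2normZ //.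
by congr L2norm; apply/funext => X; rewrite mulN1r.
Qed.

Lemma L2normB G f g : L2 G f -> L2 G g ->
  L2norm G (fun X => f X - g X) <= L2norm G f + L2norm G g.
Proof.
by move=> fL gL; rewrite -(L2normN gL); apply: L2normD => //; exact: L2N.
Qed.

Lemma L2norm_ae G f g : measurable G -> L2 G f -> L2 G g ->
  {ae leb2, forall X, G X -> f X = g X} -> L2norm G f = L2norm G g.
Proof.
move=> mG fL gL fg; apply/eqP.
rewrite -(eqrXn2 (isT : 0 < 2)%N) ?L2norm_ge0//; apply/eqP/EFin_inj.
rewrite !L2norm_sqr//.
have [mf _] := (L2P f mG).1 fL; have [mg _] := (L2P g mG).1 gL.
apply: ae_eq_integral => //.
- by apply/measurable_EFinP; exact: measurable_funX.
- by apply/measurable_EFinP; exact: measurable_funX.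
- apply: (@filterS _ _ (ae_filter_ringOfSetsType leb2) _ _ _ fg) => X /= fgX GX; by rewrite fgX.
Qed.

End L2.

(** * Smooth functions with compact support *)

Section Partial.
Context {R : realType}.
Local Notation plane := (R * R)%type.
Implicit Types (f : plane -> R) (X : plane).

(** The difference quotients themselves agree, so derivability and the value of the derivative both
    pass to the one-variable slice without any existence assumption. *)
Lemma derive_exE f X :
  (fun h => h^-1 *: ((f \o shift X) (h *: ex) - f X)) =
  (fun h => h^-1 *: (((fun t => f (t, X.2)) \o shift X.1) (h *: 1) - f (X.1, X.2))).
Proof.
apply/funext => h /=; congr (_ *: (f _ - f _)); last by case: X.
by apply: injective_projections; rewrite /= ?scaler0 ?add0r.
Qed.

Lemma derive_eyE f X :
  (fun h => h^-1 *: ((f \o shift X) (h *: ey) - f X)) =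
  (fun h => h^-1 *: (((fun t => f (X.1, t)) \o shift X.2) (h *: 1) - f (X.1, X.2))).
Proof.
apply/funext => h /=; congr (_ *: (f _ - f _)); last by case: X.
by apply: injective_projections; rewrite /= ?scaler0 ?add0r.
Qed.

Lemma derivable_ex f X : derivable f X ex <-> derivable (fun t => f (t, X.2)) X.1 1.
Proof. by rewrite /derivable derive_exE. Qed.

Lemma derivable_ey f X : derivable f X ey <-> derivable (fun t => f (X.1, t)) X.2 1.
Proof. by rewrite /derivable derive_eyE. Qed.

Lemma derive_ex f X : 'D_ex f X = 'D_1 (fun t => f (t, X.2)) X.1.
Proof. by rewrite /derive derive_exE. Qed.

Lemma derive_ey f X : 'D_ey f X = 'D_1 (fun t => f (X.1, t)) X.2.
Proof. by rewrite /derive derive_eyE. Qed.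

Lemma is_derive_exP f X d :
  is_derive X ex f d <-> is_derive X.1 1 (fun t => f (t, X.2)) d.
Proof.
split=> -[H1 H2]; split.
- exact/derivable_ex.
- by rewrite -derive_ex.
- exact/derivable_ex.
- by rewrite derive_ex.
Qed.

Lemma is_derive_eyP f X d :
  is_derive X ey f d <-> is_derive X.2 1 (fun t => f (X.1, t)) d.
Proof.
split=> -[H1 H2]; split.
- exact/derivable_ey.
- by rewrite -derive_ey.
- exact/derivable_ey.
- by rewrite derive_ey.
Qed.

Lemma Ck_continuous k f : Ck k f -> continuous f.
Proof. by case: k => [//|k []]. Qed.

Lemma Ck_pred k f : Ck k.+1 f -> Ck k f.
Proof.
elim: k f => [f []|k IH f [cf df fx fy]]; first by [].
exact: And4 cf df (IH _ fx) (IH _ fy).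
Qed.

End Partial.

(** * Smooth cut-off functions of one variable *)

Section Smooth1.
Context {R : realType}.
Implicit Types (f g : R -> R) (x : R).

(** One-variable counterpart of [Ck]. Derivability everywhere already gives continuity, so
    continuity is asked for at order 0 only. *)
Fixpoint C1k (k : nat) f : Prop :=
  if k is k'.+1 then (forall x, derivable f x 1) /\ C1k k' (derive1 f)
  else continuous f.

Lemma derivable_continuous f : (forall x, derivable f x 1) -> continuous f.
Proof. by move=> df x; apply/differentiable_continuous/derivable1_diffP. Qed.

Lemma C1k_pred k f : C1k k.+1 f -> C1k k f.
Proof.
elim: k f => [f [/derivable_continuous cf _]|k IH f [df fx]]; first exact: cf.
by split; [exact: df|exact: IH].
Qed.

Lemma is_derive_derive1 f (x d : R) : is_derive x 1 f d -> derive1 f x = d.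
Proof. by move=> [_ <-]; rewrite derive1E. Qed.

Lemma C1kS k f f' : (forall x : R, is_derive x 1 f (f' x)) -> C1k k f' -> C1k k.+1 f.
Proof.
move=> ff' f'k; split; first by move=> x; case: (ff' x).
by have -> : derive1 f = f' by apply/funext => x; apply: is_derive_derive1.
Qed.

Lemma C1kS_is_derive k f (x : R) : C1k k.+1 f -> is_derive x 1 f (derive1 f x).
Proof. by move=> [df _]; split; [exact: df|rewrite derive1E]. Qed.

Lemma C1kD k f g : C1k k f -> C1k k g -> C1k k (fun x => f x + g x).
Proof.
elim: k f g => [f g fk gk|k IH f g fk gk]; first by move=> x; apply: cvgD; [exact: fk|exact: gk].
apply: (@C1kS _ _ (fun x => derive1 f x + derive1 g x)); last by apply: IH; [case: fk|case: gk].
by move=> x; exact: is_deriveD (C1kS_is_derive x fk) (C1kS_is_derive x gk).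
Qed.

Lemma C1kM k f g : C1k k f -> C1k k g -> C1k k (fun x => f x * g x).
Proof.
elim: k f g => [f g fk gk|k IH f g fk gk]; first by move=> x; apply: cvgM; [exact: fk|exact: gk].
apply: (@C1kS _ _ (fun x => derive1 f x * g x + f x * derive1 g x)); last first.
  by apply: C1kD; apply: IH; [exact: (proj2 fk)|exact: C1k_pred gk|exact: C1k_pred fk|exact: (proj2 gk)].
move=> x; have := is_deriveM (C1kS_is_derive x fk) (C1kS_is_derive x gk).
move=> h; apply: is_derive_eq h _; rewrite /GRing.scale /= addrC; congr (_ + _); exact: mulrC.
Qed.

Lemma C1k_cst k (a : R) : C1k k (fun=> a).
Proof.
elim: k a => [a|k IH a]; first exact: cst_continuous.
by apply: (@C1kS _ _ (fun=> 0)) => // x; exact: is_derive_cst.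
Qed.

Lemma C1kZ k f a : C1k k f -> C1k k (fun x => a * f x).
Proof. by move=> fk; apply: C1kM => //; exact: C1k_cst. Qed.

Lemma is_derive_affine (a b x : R) : is_derive x 1 (fun t => a * t + b) a.
Proof.
have h : is_derive x 1 ((a \*: id) + cst b : R -> R) (a *: 1 + 0).
  by apply: is_deriveD.
apply: is_derive_eq h _; by rewrite addr0 /GRing.scale /= mulr1.
Qed.

Lemma C1k_affine k f a b : C1k k f -> C1k k (fun x => f (a * x + b)).
Proof.
elim: k f => [f fk|k IH f fk].
  move=> x; apply: (@continuous_comp _ _ _ (fun x => a * x + b) f); last exact: fk.
  by apply: cvgD; [apply: cvgM; [exact: cvg_cst|exact: cvg_id]|exact: cvg_cst].
apply: (@C1kS _ _ (fun x => a * derive1 f (a * x + b))); last by apply: C1kZ; apply: IH; case: fk.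
move=> x; rewrite mulrC.
exact: (@is_derive1_comp _ f (fun t => a * t + b) x _ _ (C1kS_is_derive (a * x + b) fk) (is_derive_affine a b x)).
Qed.

(** The difference quotient at distance [h] is at most [C * |h|]. This serves the point 0, where the
    two pieces of [bump_half] are glued. *)
Lemma is_derive_quadratic_bound f (a C : R) : (forall x, `|f x - f a| <= C * (x - a) ^+ 2) ->
  is_derive a 1 f 0.
Proof.
move=> fC.
suff : (fun h => h^-1 *: ((f \o shift a) (h *: 1) - f a)) @ 0^' --> (0 : R).
  move=> h; split; first by apply/cvg_ex; exists 0.
  exact: (cvg_lim (@Rhausdorff R) h).
have C0 : 0 <= C.
  by have := fC (a + 1); rewrite addrAC subrr add0r expr1n mulr1; apply: le_trans.
apply/cvgrPdist_lt => e e0; near=> h.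
rewrite sub0r normrN /= /shift /= /GRing.scale /= mulr1 normrM.
have h0 : h != 0 by near: h; exact: nbhs_dnbhs_neq.
have hC : `|h| < e / (C + 1).
  near: h; apply: dnbhs0_lt; rewrite divr_gt0// ; lra.
have := fC (h + a); rewrite addrK => H.
have h0' : 0 < `|h| by rewrite normr_gt0.
apply: (@le_lt_trans _ _ (`|h|^-1 * (C * h ^+ 2))).
  by rewrite normfV ler_wpM2l// invr_ge0.
rewrite -[h ^+ 2]real_normK ?num_real// expr2 mulrCA [X in C * X]mulrA mulVf ?gt_eqF// mul1r.
rewrite ltr_pdivlMr in hC; last lra.
apply: le_lt_trans hC; rewrite mulrC ler_wpM2l//; lra.
Unshelve. all: by end_near. Qed.

(** The flat function [exp (- s / x)] extended by 0. The factor [x ^- m] closes the family under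
    differentiation, so that smoothness follows by induction on the order, for all [m] at once. *)
Definition bump_half (s : R) (m : nat) (x : R) : R :=
  if 0 < x then x ^- m * expR (- (s / x)) else 0.

(** A single term of the exponential series, [(s / x) ^ (m + 2) / (m + 2)!], bounds [exp (s / x)]
    from below; it absorbs [x ^- m] and leaves [x ^ 2]. *)
Lemma bump_half_bound s m x : 0 < s ->
  `|bump_half s m x| <= (m.+2)`!%:R / s ^+ m.+2 * x ^+ 2.
Proof.
move=> s0; rewrite /bump_half; case: ltP => x0; last first.
  by rewrite normr0 mulr_ge0// ?divr_ge0// ?sqr_ge0// exprn_ge0// ltW.
rewrite ger0_norm; last by rewrite mulr_ge0 ?expR_ge0// invr_ge0 exprn_ge0 ?ltW.
have sx : 0 <= s / x by rewrite ltW// divr_gt0.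
have e1 : (s / x) ^+ m.+2 / (m.+2)`!%:R <= expR (s / x).
  by apply: le_trans (expR_ge1Dxn m.+1 sx); rewrite lerDr.
rewrite expRN.
have fp : 0 < ((m.+2)`!%:R : R) by rewrite ltr0n fact_gt0.
have p1 : 0 < (s / x) ^+ m.+2 / (m.+2)`!%:R by rewrite divr_gt0// exprn_gt0// divr_gt0.
apply: (@le_trans _ _ (x ^- m * ((s / x) ^+ m.+2 / (m.+2)`!%:R)^-1)).
  apply: ler_wpM2l; first by rewrite invr_ge0 exprn_ge0// ltW.
  by rewrite lef_pV2// posrE expR_gt0.
rewrite invf_div expr_div_n invf_div.
have -> : x ^+ m.+2 = x ^+ m * x ^+ 2 by rewrite -exprD addn2.
have xm : x ^+ m != 0 by rewrite expf_neq0// gt_eqF.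
have sm : s ^+ m.+2 != 0 by rewrite expf_neq0// gt_eqF.
have xx : x ^+ 2 != 0 by rewrite expf_neq0// gt_eqF.
by rewrite le_eqVlt; apply/orP; left; apply/eqP; field; rewrite xm sm.
Qed.

Lemma bump_half_is_derive s m (x : R) : 0 < s ->
  is_derive x 1 (bump_half s m) (s * bump_half s m.+2 x - m%:R * bump_half s m.+1 x).
Proof.
move=> s0; case: (ltgtP x 0) => x0.
- rewrite /bump_half !ltNge ltW//= !mulr0 subr0.
  refine (@near_eq_is_derive _ _ _ (cst 0) _ x 1 0 _ (is_derive_cst _ _ _)).
  near=> y; rewrite ltNge ltW//=.
  by near: y; exact: lt_nbhsl.
- refine (@near_eq_is_derive _ _ _ (fun y : R => (y ^+ m)^-1 * expR (- (s / y))) _ x 1 _ _ _).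
    near=> y; rewrite /bump_half.
    have -> // : 0 < y by near: y; exact: lt_nbhsr.
  have x1 : x != 0 by rewrite gt_eqF.
  have d1 : is_derive x 1 (fun y : R => y ^+ m) (x ^+ m.-1 *+ m).
    have := @is_deriveX _ _ (@id R) m x 1 1 (is_derive_id x 1).
    have -> : (fun y : R => y ^+ m) = id ^+ m.
      by apply/funext => y; elim: (m) => [|k IHk]; rewrite ?expr0// !exprS IHk.
    move=> h; apply: is_derive_eq h _; by rewrite /GRing.scale /= mulr1 mulr_natl.
  have d2 := @is_deriveV R (fun y => y ^+ m) x _ 1 (expf_neq0 m x1) d1.
  have d3 : is_derive x 1 (fun y : R => - (s / y)) (s / x ^+ 2).
    have := is_deriveN (is_deriveZ s (@is_deriveV R id x 1 1 x1 (is_derive_id x 1))).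
    move=> h; apply: is_derive_eq h _; rewrite /GRing.scale /=; field; exact: x1.
  have d4 := @is_derive1_comp R expR (fun y => - (s / y)) x _ _ (is_derive_expR (- (s / x))) d3.
  apply: is_derive_eq (is_deriveM d2 d4) _.
  rewrite /bump_half x0 /GRing.scale /=.
  case: m d1 d2 => [|m] d1 d2.
    rewrite expr0 mulr0n mul0r subr0 invr1; field; exact: x1.
  rewrite /= -mulr_natl.
  have xm : x ^+ m != 0 by rewrite expf_neq0.
  rewrite !exprS; field; by rewrite x1 xm.
- rewrite x0 {2 3}/bump_half ltxx !mulr0 subr0.
  apply: (@is_derive_quadratic_bound _ _ ((m.+2)`!%:R / s ^+ m.+2)) => y.
  by rewrite /bump_half ltxx !subr0; exact: bump_half_bound.
Unshelve. all: by end_near. Qed.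

Lemma bump_half_C1k s m k : 0 < s -> C1k k (bump_half s m).
Proof.
move=> s0; elim: k m => [m|k IH m].
  by apply: derivable_continuous => x; case: (bump_half_is_derive m x s0).
apply: (C1kS (fun x => bump_half_is_derive m x s0)).
apply: C1kD; first exact: C1kZ.
by under eq_fun do rewrite -mulNr; exact: C1kZ.
Qed.

(** The parameter [1 / (n + 1)] tends to 0, so these functions tend pointwise to the indicator of
    []a, b[]; they stay between 0 and 1 and vanish outside the interval, as dominated convergence
    requires. *)
Definition smooth_bump (n : nat) (a b x : R) : R :=
  bump_half (n.+1%:R^-1) 0 (x - a) * bump_half (n.+1%:R^-1) 0 (b - x).

Lemma bump_C1k n a b k : C1k k (smooth_bump n a b).
Proof.
rewrite /smooth_bump; apply: C1kM.
  have := @C1k_affine k (bump_half n.+1%:R^-1 0) 1 (- a).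
  by under eq_fun do rewrite mul1r; apply; apply: bump_half_C1k.
have := @C1k_affine k (bump_half n.+1%:R^-1 0) (-1) b.
by under eq_fun do rewrite mulN1r addrC; apply; apply: bump_half_C1k.
Qed.

Lemma bump_half_itv s x : 0 < s -> 0 <= bump_half s 0 x <= 1.
Proof.
move=> s0; rewrite /bump_half; case: ltP => x0; last by rewrite lexx ler01.
by rewrite invr1 mul1r expR_ge0 /= expR_le1 oppr_le0 ltW// divr_gt0.
Qed.

Lemma bump_itv n a b x : 0 <= smooth_bump n a b x <= 1.
Proof.
have h1 := @bump_half_itv (n.+1%:R^-1) (x - a).
have h2 := @bump_half_itv (n.+1%:R^-1) (b - x).
have /andP[p1 p2] := h1 ltac:(by rewrite invr_gt0).
have /andP[p3 p4] := h2 ltac:(by rewrite invr_gt0).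
by rewrite /smooth_bump mulr_ge0//= mulr_ile1.
Qed.

Lemma bump_neq0 n a b x : smooth_bump n a b x != 0 -> a < x < b.
Proof.
rewrite /smooth_bump /bump_half subr_gt0; case: ifP => ax; last by rewrite mul0r eqxx.
by rewrite subr_gt0; case: ifP => //; rewrite mulr0 eqxx.
Qed.

Lemma bump_half_cvg x : 0 < x -> (fun n : nat => bump_half n.+1%:R^-1 0 x) @ \oo --> (1 : R).
Proof.
move=> x0; rewrite /bump_half x0.
under eq_fun do rewrite invr1 mul1r.
suff H : (fun n : nat => expR (- (n.+1%:R^-1 / x))) @ \oo --> expR (0 : R) by rewrite expR0 in H.
apply: continuous_cvg; first exact: continuous_expR.
rewrite -[X in _ --> X]oppr0; apply: cvgN.
have := cvgM (@cvg_harmonic R) (cvg_cst x^-1); rewrite mul0r; exact.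
Qed.

Lemma bump_cvg a b x : a < x < b -> (fun n => smooth_bump n a b x) @ \oo --> (1 : R).
Proof.
move=> /andP[ax xb]; rewrite /smooth_bump -[X in _ --> X]mulr1.
by apply: cvgM; apply: bump_half_cvg; rewrite subr_gt0.
Qed.

End Smooth1.

(** * Test functions supported in a box *)

Section BumpBox.
Context {R : realType}.
Local Notation plane := (R * R)%type.

Lemma continuous_fst : continuous (@fst R R).
Proof. by move=> X; exact: cvg_fst. Qed.

Lemma continuous_snd : continuous (@snd R R).
Proof. by move=> X; exact: cvg_snd. Qed.

Lemma Ck_tensor k (f g : R -> R) : (forall k, C1k k f) -> (forall k, C1k k g) ->
  Ck k (fun X : plane => f X.1 * g X.2).
Proof.
have cont (f' g' : R -> R) : C1k 0 f' -> C1k 0 g' -> continuous (fun X : plane => f' X.1 * g' X.2).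
  move=> fk gk X; apply: cvgM.
    by apply: (@continuous_comp _ _ _ fst f'); [exact: continuous_fst|exact: fk].
  by apply: (@continuous_comp _ _ _ snd g'); [exact: continuous_snd|exact: gk].
elim: k f g => [|k IH] f g fk gk; first exact: cont (fk 0%N) (gk 0%N).
have dx (X : plane) : is_derive X ex (fun X : plane => f X.1 * g X.2) (derive1 f X.1 * g X.2).
  apply/is_derive_exP => /=.
  have := is_deriveM (C1kS_is_derive X.1 (fk 1%N)) (is_derive_cst (g X.2) X.1 1).
  move=> h; apply: is_derive_eq h _; by rewrite scaler0 add0r /GRing.scale /= mulrC.
have dy (X : plane) : is_derive X ey (fun X : plane => f X.1 * g X.2) (f X.1 * derive1 g X.2).
  apply/is_derive_eyP => /=.
  have := is_deriveM (is_derive_cst (f X.1) X.2 1) (C1kS_is_derive X.2 (gk 1%N)).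
  move=> h; apply: is_derive_eq h _; by rewrite scaler0 addr0 /GRing.scale /=.
split.
- exact: cont (fk 0%N) (gk 0%N).
- by move=> X; split; [case: (dx X)|case: (dy X)].
- rewrite (_ : (fun X => _) = fun X => derive1 f X.1 * g X.2); last first.
    by apply/funext => X; case: (dx X).
  by apply: IH => // l; case: (fk l.+1).
- rewrite (_ : (fun X => _) = fun X => f X.1 * derive1 g X.2); last first.
    by apply/funext => X; case: (dy X).
  by apply: IH => // l; case: (gk l.+1).
Qed.

Definition bump2 n (a b c d : R) (X : plane) : R := smooth_bump n a b X.1 * smooth_bump n c d X.2.

Lemma closed_box (a b c d : R) : closed (`[a, b] `*` `[c, d] : set plane).
Proof.
apply: compact_closed.
  exact: norm_hausdorff.
by apply: compact_setX; exact: segment_compact.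
Qed.

Lemma bump2_test (G : set plane) n a b c d : `[a, b] `*` `[c, d] `<=` G° ->
  test_fun G (bump2 n a b c d).
Proof.
move=> sub; have H : closure [set X | bump2 n a b c d X != 0] `<=` `[a, b] `*` `[c, d].
  rewrite (closure_id (`[a, b] `*` `[c, d])).1; last exact: closed_box.
  apply: closureS => X /=; rewrite /bump2 mulf_eq0 negb_or => /andP[/bump_neq0 h1 /bump_neq0 h2].
  split; rewrite /= in_itv /=.
    by case/andP: h1 => /ltW -> /ltW ->.
  by case/andP: h2 => /ltW -> /ltW ->.
split.
- by move=> k; apply: Ck_tensor => l; exact: bump_C1k.
- apply: (@subclosed_compact _ _ (`[a, b] `*` `[c, d])) => //; first exact: closed_closure.
  by apply: compact_setX; exact: segment_compact.
- exact: subset_trans sub.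
Qed.

End BumpBox.

(** * Locally integrable functions with zero weak integral *)

Section PlaneMeasurable.
Context {R : realType}.
Local Notation plane := (R * R)%type.
Local Notation leb := (@lebesgue_measure R).
Local Notation leb2 := (leb \x leb)%E.

Definition obox (a b c d : R) : set plane := `]a, b[ `*` `]c, d[.

Lemma measurable_obox a b c d : measurable (obox a b c d).
Proof. by apply: measurableX; exact: measurable_itv. Qed.

Lemma obox_measure_lty a b c d : (leb2 (obox a b c d) < +oo)%E.
Proof.
rewrite /obox product_measure1E; [|exact: measurable_itv|exact: measurable_itv].
have h (x y : R) : (leb `]x, y[ < +oo)%E.
  by rewrite lebesgue_measure_itv /=; case: ifP => // _; rewrite -EFinB ltry.
apply: lte_mul_pinfty; [exact: measure_ge0| |exact: h].
by rewrite ge0_fin_numE; [exact: h|exact: measure_ge0].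
Qed.

(** Rational corners make the boxes a countable family. This gives the measurability of open sets
    and lets null sets be collected over all boxes. *)
Lemma rat_box_near (A : set plane) (X : plane) : nbhs X A ->
  exists q : (rat * rat) * (rat * rat),
    obox (ratr q.1.1) (ratr q.1.2) (ratr q.2.1) (ratr q.2.2) X /\
    `[ratr q.1.1, ratr q.1.2] `*` `[ratr q.2.1, ratr q.2.2] `<=` A.
Proof.
move=> /nbhs_ballP[e /= e0 eA].
have [a] : exists q : rat, ratr q \in `]X.1 - e, X.1[ by apply: rat_in_itvoo; lra.
have [b] : exists q : rat, ratr q \in `]X.1, X.1 + e[ by apply: rat_in_itvoo; lra.
have [c] : exists q : rat, ratr q \in `]X.2 - e, X.2[ by apply: rat_in_itvoo; lra.
have [d] : exists q : rat, ratr q \in `]X.2, X.2 + e[ by apply: rat_in_itvoo; lra.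
rewrite !in_itv /= => /andP[d1 d2] /andP[c1 c2] /andP[b1 b2] /andP[a1 a2].
exists ((a, b), (c, d)); split; first by split; rewrite /= in_itv /=; apply/andP; split.
move=> Y [] /=; rewrite !in_itv /= => /andP[y1 y2] /andP[y3 y4].
apply: eA; split; rewrite /= /ball /= ltr_norml; apply/andP; split; lra.
Qed.

Lemma open_measurable2 (A : set plane) : open A -> measurable A.
Proof.
move=> oA.
(* Boxes that are not contained in [A] are replaced by the empty set, so that the union runs over
   all rational quadruples. *)
pose F (q : (rat * rat) * (rat * rat)) : set plane :=
  let B := obox (ratr q.1.1) (ratr q.1.2) (ratr q.2.1) (ratr q.2.2) in
  if `[< B `<=` A >] then B else set0.
have -> : A = \bigcup_q F q.
  apply/seteqP; split => [X AX|X [q _]].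
    have [q [qX qA]] := rat_box_near (open_nbhs_nbhs (conj oA AX)).
    exists q => //; rewrite /F asboolT // => Y [/subset_itv_oo_cc Y1 /subset_itv_oo_cc Y2].
    exact: qA.
  by rewrite /F; case: ifP => // /asboolP; apply.
apply: countable_bigcupT_measurable => [|q]; first exact: countableP.
by rewrite /F; case: ifP => _; [exact: measurable_obox|exact: measurable0].
Qed.

Lemma closed_measurable2 (A : set plane) : closed A -> measurable A.
Proof. by move/closed_openC/open_measurable2/measurableC; rewrite setCK. Qed.

Lemma continuous_measurable2 (f : plane -> R) : continuous f -> measurable_fun setT f.
Proof.
move=> /continuousP cf; apply: (measurability _ (RGenOpens.measurableE R)).
move=> _ [_ [a [b ->] <-]]; rewrite setTI; apply: open_measurable2.
exact/cf/interval_open.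
Qed.

Definition oboxes : set (set plane) :=
  [set A | exists a b c d, A = obox a b c d].

Lemma oboxI : setI_closed oboxes.
Proof.
move=> _ _ [a [b [c [d ->]]]] [a' [b' [c' [d' ->]]]].
exists (Num.max a a'), (Num.min b b'), (Num.max c c'), (Num.min d d').
rewrite /obox; apply/seteqP; split => X /=; rewrite !in_itv /=.
  by move=> [[/andP[h1 h2] /andP[h3 h4]] [/andP[h5 h6] /andP[h7 h8]]];
    rewrite !gt_max !lt_min; split; apply/andP; split; apply/andP.
by rewrite !gt_max !lt_min => -[/andP[/andP[h1 h2] /andP[h3 h4]] /andP[/andP[h5 h6] /andP[h7 h8]]];
   split; split; apply/andP.
Qed.

(** Strips are countable unions of bounded boxes, so both projections are measurable for the
    generated sigma-algebra, and the product sigma-algebra is the smallest one with this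
    property. *)
Lemma measurable_oboxesE : @measurable _ (measurableTypeR R * measurableTypeR R)%type = <<s oboxes >>.
Proof.
apply/seteqP; split; last first.
  apply: smallest_sub; first exact: sigma_algebra_measurable.
  by move=> _ [a [b [c [d ->]]]]; exact: measurable_obox.
pose T' := g_sigma_algebraType oboxes.
have cover (x y : R) : <<s oboxes >> (`]x, y[ `*` setT : set plane).
  have -> : `]x, y[ `*` setT = \bigcup_n (obox x y (- n%:R) n%:R) :> set plane.
    apply/seteqP; split => [X [Xxy _]|X [n _ [h _]] //].
    have [n hn] : exists n, `|X.2| < n%:R.
      by exists (Num.bound `|X.2|); exact: archi_boundP.
    exists n => //; split => //=; rewrite in_itv /=.
    by rewrite -ltr_norml.
  apply: (@bigcupT_measurable _ T') => n; apply: sub_sigma_algebra.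
  by exists x, y, (- n%:R), n%:R.
have cover' (x y : R) : <<s oboxes >> (setT `*` `]x, y[ : set plane).
  have -> : setT `*` `]x, y[ = \bigcup_n (obox (- n%:R) n%:R x y) :> set plane.
    apply/seteqP; split => [X [_ Xxy]|X [n _ [_ h]] //].
    have [n hn] : exists n, `|X.1| < n%:R.
      by exists (Num.bound `|X.1|); exact: archi_boundP.
    exists n => //; split => //=; rewrite in_itv /=.
    by rewrite -ltr_norml.
  apply: (@bigcupT_measurable _ T') => n; apply: sub_sigma_algebra.
  by exists (- n%:R), n%:R, x, y.
apply: smallest_sub; first exact: smallest_sigma_algebra.
move=> A [] [B mB <-].
  have : measurable_fun setT (fst : T' -> measurableTypeR R).
    apply: (measurability _ (RGenOpens.measurableE R)).
    move=> _ [_ [a [b ->] <-]]; rewrite setTI.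
    have := cover a b; congr (<<s oboxes >> _).
    by apply/seteqP; split => X //= [].
  by move/(_ measurableT B mB); rewrite setTI.
have : measurable_fun setT (snd : T' -> measurableTypeR R).
  apply: (measurability _ (RGenOpens.measurableE R)).
  move=> _ [_ [a [b ->] <-]]; rewrite setTI.
  have := cover' a b; congr (<<s oboxes >> _).
  by apply/seteqP; split => X //= [].
by move/(_ measurableT B mB); rewrite setTI.
Qed.

(** Dynkin's pi-lambda argument: the measurable sets whose trace on the box carries zero integral
    form a Dynkin system, and it contains the boxes, which are stable under intersection and
    generate all measurable sets. *)
Lemma obox_integral0_ae (g : plane -> R) a b c d :
  leb2.-integrable (obox a b c d) (EFin \o g) ->
  (forall a' b' c' d', obox a' b' c' d' `<=` obox a b c d ->
     (\int[leb2]_(X in obox a' b' c' d') (g X)%:E = 0)%E) ->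
  {ae leb2, forall X, obox a b c d X -> g X = 0}.
Proof.
move=> ig g0; set B := obox a b c d.
have mB : measurable B := measurable_obox a b c d.
pose H := [set A : set plane | measurable A /\ (\int[leb2]_(X in A `&` B) (g X)%:E = 0)%E].
have iB (A : set plane) : measurable A -> leb2.-integrable (A `&` B) (EFin \o g).
  move=> mA; apply: (@integrableS _ _ _ leb2 B) => //; first exact: measurableI.
have dH : dynkin H.
  split.
  - by split; [exact: measurableT|rewrite setTI; exact: g0].
  - move=> A [mA A0]; split; first exact: measurableC.
    have EB : (A `&` B) `|` (~` A `&` B) = B by rewrite -setIUl setUv setTI.
    have : (\int[leb2]_(X in (A `&` B) `|` (~` A `&` B)) (g X)%:E = 0)%E by rewrite EB; exact: g0.
    rewrite integral_setU; last first.
    + rewrite disj_set2E; apply/eqP/seteqP; split => X //= [[h _] [h' _]]; exact: h'.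
    + rewrite -setIUl setUv setTI; exact: measurable_int ig.
    + by apply: measurableI => //; exact: measurableC.
    + exact: measurableI.
    + by rewrite A0 add0e.
  - move=> F tF HF; split; first by apply: bigcupT_measurable => n; case: (HF n).
    rewrite setI_bigcupl integral_bigcup.
    + by rewrite eseries0 // => n _ _; case: (HF n).
    + exact: trivIset_setIr.
    + by move=> n; apply: measurableI => //; case: (HF n).
    + rewrite -setI_bigcupl; apply: iB; apply: bigcupT_measurable => n.
      by case: (HF n).
have HA A : measurable A -> H A.
  move=> mA; have : <<s oboxes >> A by rewrite -measurable_oboxesE.
  move: A {mA}; apply: (@lambda_system_subset _ _ oboxI setT H).
  - exact/dynkin_lambda_system.
  - move=> _ [a' [b' [c' [d' ->]]]]; split; first exact: measurable_obox.
    have [a2 [b2 [c2 [d2 E]]]] := oboxI (ex_intro _ a' (ex_intro _ b' (ex_intro _ c' (ex_intro _ d' erefl))))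
      (ex_intro _ a (ex_intro _ b (ex_intro _ c (ex_intro _ d erefl)))).
    rewrite /B E; apply: g0; rewrite -E; exact: subIsetr.
  - by move=> X _.
have := @integral_ae_eq _ _ _ leb2 B mB (cst 0%E) (EFin \o g) ig (measurable_cst _).
case.
  move=> E EB mE; rewrite integral0.
  by case: (HA E mE) => _; rewrite (setIidl EB).
move=> N [mN N0 sub]; exists N; split => // X /= nX.
apply: sub => /= h; apply: nX => BX.
by case: (h BX).
Qed.

End PlaneMeasurable.

Lemma negligible_bigcup_count d (T : measurableType d) (R : realType)
    (mu : {measure set T -> \bar R}) (I : countType) (F : I -> set T) :
  (forall i, mu.-negligible (F i)) -> mu.-negligible (\bigcup_i F i).
Proof.
move=> F0; pose G n := if @unpickle I n is Some i then F i else set0.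
have : mu.-negligible (\bigcup_n G n).
  apply: negligible_bigcup => n; rewrite /G; case: (@unpickle I n) => [i|]; first exact: F0.
  exact: negligible_set0.
apply: negligibleS => x [i _ Fix]; exists (pickle i); first by [].
by rewrite /G pickleK.
Qed.

(** * The fundamental lemma of the calculus of variations *)

Section WeakUnique.
Context {R : realType}.
Local Notation plane := (R * R)%type.
Local Notation leb := (@lebesgue_measure R).
Local Notation leb2 := (leb \x leb)%E.

(** The majorant is [|f| <= 1 + f ^ 2], integrable on a set of finite measure. *)
Lemma L2_integrable_finite (G B : set plane) (f : plane -> R) : measurable G -> measurable B ->
  B `<=` G -> (leb2 B < +oo)%E -> L2 G f -> leb2.-integrable B (EFin \o f).
Proof.
move=> mG mB BG Bfin fL; have [mf fi] := (L2P f mG).1 fL.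
have mfB : measurable_fun B f by apply: measurable_funS mf.
have i2 : leb2.-integrable B (fun X => (1 + (f X) ^+ 2)%:E).
  apply: (@integrableD _ _ _ leb2 B mB (cst 1%:E) (fun X => ((f X) ^+ 2)%:E)).
    apply: (@measurable_bounded_integrable _ _ _ leb2 (cst 1) B mB Bfin (measurable_cst _)).
    by exists 1; split => // x x1 y _ /=; rewrite normr1 ltW.
  apply/integrableP; split; first by apply/measurable_EFinP; exact: measurable_funX.
  apply: le_lt_trans fi.
  under eq_integral do rewrite gee0_abs ?lee_fin ?sqr_ge0//.
  apply: ge0_subset_integral => //.
  - by apply/measurable_EFinP; exact: measurable_funX.
  - by move=> X _; rewrite lee_fin sqr_ge0.
have mfE : measurable_fun B (EFin \o f) by exact/measurable_EFinP.
refine (@le_integrable _ _ _ leb2 B mB _ _ mfE _ i2).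
move=> X _ /=; rewrite lee_fin.
rewrite [leRHS]ger0_norm ?addr_ge0 ?sqr_ge0//.
rewrite ler_norml; apply/andP; split; nra.
Qed.

(** Test functions increase to the indicator of a box inside the interior of [G], so dominated
    convergence gives zero integral over every such box. Hence [g] vanishes almost everywhere on
    each rational box of the interior, and countably many of these cover it. *)
Lemma weak_zero_ae (G : set plane) (g : plane -> R) : measurable G -> L2 G g ->
  (forall phi, test_fun G phi -> \int[leb2]_(X in G) (g X * phi X) = 0) ->
  {ae leb2, forall X, G° X -> g X = 0}.
Proof.
move=> mG gL g0.
have box0 a b c d : `[a, b] `*` `[c, d] `<=` G° ->
    (\int[leb2]_(X in obox a b c d) (g X)%:E = 0)%E.
  move=> sub; set B := obox a b c d.
  have mB : measurable B by exact: measurable_obox.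
  have BG : B `<=` G.
    move=> X [/subset_itv_oo_cc X1 /subset_itv_oo_cc X2].
    by apply: interior_subset; apply: sub.
  have iB := L2_integrable_finite mG mB BG (obox_measure_lty a b c d) gL.
  have mgB := measurable_int _ iB.
  have mphi n : measurable_fun B (bump2 n a b c d).
    apply: (@measurable_funS _ _ _ _ setT) => //.
    apply: continuous_measurable2.
    by have [/(_ 0%N) /Ck_continuous] := bump2_test n sub.
  have mb (n : nat) : measurable_fun B (fun X => ((g X) * bump2 n a b c d X)%:E).
    apply/measurable_EFinP; apply: measurable_funM => //; exact/measurable_EFinP.
  have bound n X : `|bump2 n a b c d X| <= 1.
    have /andP[h1 h2] := bump_itv n a b X.1; have /andP[h3 h4] := bump_itv n c d X.2.
    have p := mulr_ge0 h1 h3; rewrite /bump2 (ger0_norm p); exact: mulr_ile1.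
  have := @dominated_convergence _ _ _ leb2 B mB
     (fun n X => (g X * bump2 n a b c d X)%:E) (EFin \o g) (fun X => `|g X|%:E) mb mgB.
  case.
  - apply: aeW => X [/= ]; rewrite !in_itv /= => X1 X2.
    apply: cvg_EFin; first exact: nearW.
    rewrite -[X in _ --> X]mulr1; apply: cvgM; first exact: cvg_cst.
    by rewrite -[X in _ --> X]mulr1; apply: cvgM; exact: bump_cvg.
  - exact: integrable_abse iB.
  - apply: aeW => X n BX; rewrite lee_fin normrM ler_piMr//.
  - move=> _ _; rewrite (_ : (fun n => _) = cst 0%E).
      move=> h; rewrite -(cvg_lim (@ereal_hausdorff R) h); exact: lim_cst.
    apply/funext => n /=.
    have := g0 _ (bump2_test n sub).
    have E X : ((EFin \o (fun X => g X * bump2 n a b c d X)) \_ B) X = ((EFin \o (fun X => g X * bump2 n a b c d X)) \_ G) X.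
      rewrite /patch; case: ifPn => [XB|XB]; first by rewrite mem_set//; apply: BG; exact: set_mem.
      case: ifP => // _ /=; suff -> : bump2 n a b c d X = 0 by rewrite mulr0.
      apply/eqP; apply: contraNT XB => h; apply/mem_set.
      move: h; rewrite /bump2 mulf_eq0 negb_or => /andP[/bump_neq0 h1 /bump_neq0 h2].
      by split; rewrite /= in_itv.
    have inB : leb2.-integrable B (fun X => (g X * bump2 n a b c d X)%:E).
      refine (@le_integrable _ _ _ leb2 B mB _ _ (mb n) _ iB) => X _ /=; by rewrite lee_fin normrM ler_piMr.
    have E2 : (\int[leb2]_(X in G) (g X * bump2 n a b c d X)%:E = \int[leb2]_(X in B) (g X * bump2 n a b c d X)%:E)%E.
      rewrite integral_mkcond [RHS]integral_mkcond; apply: eq_integral => X _; exact/esym/E.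
    rewrite /Rintegral E2 => h.
    rewrite -[LHS]fineK ?h//; exact: integrable_fin_num.
have boxae (q : (rat * rat) * (rat * rat)) :
   `[ratr q.1.1, ratr q.1.2] `*` `[ratr q.2.1, ratr q.2.2] `<=` G° ->
   {ae leb2, forall X, obox (ratr q.1.1) (ratr q.1.2) (ratr q.2.1) (ratr q.2.2) X -> g X = 0}.
  move=> sub; apply: obox_integral0_ae.
    apply: (@L2_integrable_finite G) => //; first exact: measurable_obox.
      move=> X [/subset_itv_oo_cc X1 /subset_itv_oo_cc X2].
      by apply: interior_subset; apply: sub.
    exact: obox_measure_lty.
  move=> a' b' c' d' sub'.
  (* Empty boxes are set aside: the argument below recovers the closed box as the closure of the
     open one. *)
  have [a'b'|a'b'] := ltP a' b'; last first.
    rewrite (_ : obox _ _ _ _ = set0) ?integral_set0//.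
    apply/seteqP; split => X //= []; rewrite /= !in_itv /= => /andP[h1 h2]; lra.
  have [c'd'|c'd'] := ltP c' d'; last first.
    rewrite (_ : obox _ _ _ _ = set0) ?integral_set0//.
    apply/seteqP; split => X //= [_]; rewrite /= !in_itv /= => /andP[h1 h2]; lra.
  apply: box0 => X [/= X1 X2]; apply: sub.
  have Hc : closure (obox a' b' c' d') `<=`
     `[ratr q.1.1, ratr q.1.2] `*` `[ratr q.2.1, ratr q.2.2].
    pose K : set plane := `[ratr q.1.1, ratr q.1.2] `*` `[ratr q.2.1, ratr q.2.2].
    rewrite -/K (closure_id K).1; last exact: closed_box.
    apply: closureS => Y /sub' [h1 h2]; split; exact: subset_itv_oo_cc.
  have ei (x y u : R) : x < y -> u \in `[x, y] -> forall e : R, 0 < e ->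
      exists2 v : R, (x < v < y) & (`|u - v| < e).
    rewrite !in_itv /= => xy /andP[xu uy] e e0.
    (* Moving [u] towards the midpoint by the fraction [s] lands strictly inside the interval,
       within distance [e] of [u]. *)
    pose s := Num.min (1/2) (e / (2 * (y - x))).
    have yx : 0 < y - x by lra.
    have s0 : 0 < s by rewrite lt_min; apply/andP; split; [lra|rewrite divr_gt0//; lra].
    have s1 : s <= 1/2 by rewrite ge_min lexx.
    have s2 : s * (2 * (y - x)) <= e by rewrite -ler_pdivlMr; [rewrite ge_min lexx orbT|lra].
    exists (u + s * ((x + y) / 2 - u)).
      by apply/andP; split; nra.
    rewrite ltr_norml; apply/andP; split; nra.
  apply: Hc => A /nbhs_ballP[e /= e0 eA].
  have [v1 v1i v1e] := ei _ _ _ a'b' X1 e e0.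
  have [v2 v2i v2e] := ei _ _ _ c'd' X2 e e0.
  by exists (v1, v2); split; [split; rewrite /= in_itv|apply: eA; split].
pose F (q : (rat * rat) * (rat * rat)) := let B := `[ratr q.1.1, ratr q.1.2] `*` `[ratr q.2.1, ratr q.2.2] : set plane in
   if `[< B `<=` G° >] then
     ~` [set X | obox (ratr q.1.1) (ratr q.1.2) (ratr q.2.1) (ratr q.2.2) X -> g X = 0] else set0.
have : leb2.-negligible (\bigcup_q F q).
  apply: negligible_bigcup_count => q; rewrite /F.
  by case: asboolP => [/boxae //|_]; exact: negligible_set0.
apply: negligibleS => X /= /not_implyP[GX gX].
have [q [qX qG]] := rat_box_near (open_nbhs_nbhs (conj (@open_interior _ G) GX)).
exists q; first by [].
by rewrite /F asboolT //= => h; apply: gX; exact: h.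
Qed.

End WeakUnique.

(** * Calculus in the plane *)

Section PlaneCalculus.
Context {R : realType}.
Local Notation plane := (R * R)%type.
Implicit Types (f : plane -> R) (X : plane).

Lemma MVT_line (g dg : R -> R) (a b : R) : (forall x, is_derive x (1 : R) g (dg x)) ->
  exists c, (`|c - a| <= `|b - a| /\ `|c - b| <= `|b - a|) /\ g b - g a = dg c * (b - a).
Proof.
move=> gd; have cg : continuous g.
  by apply: derivable_continuous => x; case: (gd x).
wlog ab : a b / a <= b => [H|].
  have [/H//|/ltW/H [c [[h1 h2] E]]] := leP a b.
  exists c; split; first by rewrite (distrC b a); split.
  by rewrite -[LHS]opprB E -mulrN opprB.
have [c] := MVT_segment ab (fun x _ => gd x) (continuous_subspaceT cg).
rewrite in_itv /= => /andP[ac cb] E; exists c; split => //.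
rewrite (ger0_norm (_ : 0 <= c - a)); last lra.
rewrite (ger0_norm (_ : 0 <= b - a)); last lra.
rewrite (ler0_norm (_ : c - b <= 0)); last lra.
split; lra.
Qed.

Lemma C1_is_derive_ex f X : Ck 1 f -> is_derive X ex f ('D_ex f X).
Proof. by move=> [_ df _ _]; split => //; case: (df X). Qed.

Lemma C1_is_derive_ey f X : Ck 1 f -> is_derive X ey f ('D_ey f X).
Proof. by move=> [_ df _ _]; split => //; case: (df X). Qed.

Lemma C1_slice_x f y : Ck 1 f -> forall x : R, is_derive x (1 : R) (fun t => f (t, y)) ('D_ex f (x, y)).
Proof. by move=> cf x; exact/(is_derive_exP f (x, y))/C1_is_derive_ex. Qed.

Lemma C1_slice_y f x : Ck 1 f -> forall y : R, is_derive y (1 : R) (fun t => f (x, t)) ('D_ey f (x, y)).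
Proof. by move=> cf y; exact/(is_derive_eyP f (x, y))/C1_is_derive_ey. Qed.

(** Mean value theorem on the two legs of the path through [(X.1, Y.2)]. In the sup norm both
    intermediate points stay within [|Y - X|] of [X]. This stands in for total differentiability. *)
Lemma C1_increment f X Y : Ck 1 f -> exists P Q : plane,
  [/\ `|P - X| <= `|Y - X|, `|Q - X| <= `|Y - X|
    & f Y - f X = 'D_ex f P * (Y.1 - X.1) + 'D_ey f Q * (Y.2 - X.2)].
Proof.
move=> cf.
have [p [[p1 _] pE]] := MVT_line X.1 Y.1 (C1_slice_x Y.2 cf).
have [q [[q1 _] qE]] := MVT_line X.2 Y.2 (C1_slice_y X.1 cf).
exists (p, Y.2), (X.1, q); split.
- by rewrite !prod_normE /= ge_max !le_max p1 /= lexx orbT.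
- by rewrite !prod_normE /= ge_max !le_max subrr normr0 normr_ge0 /= q1 orbT.
- rewrite -pE -qE /=; case: X {p p1 pE q q1 qE} => x y; case: Y => x' y' /=; ring.
Qed.

(** Chain rule from continuous partial derivatives: the increment formula is divided by [h], and its
    intermediate points, chosen as functions of [h], tend to the point of the curve. *)
Lemma C1_curve f (c1 c2 : R -> R) (t a b : R) : Ck 1 f ->
  is_derive t (1 : R) c1 a -> is_derive t (1 : R) c2 b ->
  is_derive t (1 : R) (fun s => f (c1 s, c2 s))
    ('D_ex f (c1 t, c2 t) * a + 'D_ey f (c1 t, c2 t) * b).
Proof.
move=> cf [d1 e1] [d2 e2].
pose c s := (c1 s, c2 s) : plane.
have /choice [P] := fun h => C1_increment (c t) (c (h + t)) cf.
move=> /choice [Q PQ].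
have cc1 : c1 (h + t) @[h --> 0^'] --> c1 t.
  have h1 : {for t, continuous c1} by apply/differentiable_continuous/derivable1_diffP.
  have : c1 (h + t) @[h --> 0] --> c1 (0 + t).
    apply: (@continuous_comp _ _ _ (fun h => h + t) c1); last by rewrite add0r.
    by apply: cvgD; [exact: cvg_id|exact: cvg_cst].
  by rewrite add0r; apply: cvg_trans; apply: cvg_app; exact: cvg_within.
have cc2 : c2 (h + t) @[h --> 0^'] --> c2 t.
  have h1 : {for t, continuous c2} by apply/differentiable_continuous/derivable1_diffP.
  have : c2 (h + t) @[h --> 0] --> c2 (0 + t).
    apply: (@continuous_comp _ _ _ (fun h => h + t) c2); last by rewrite add0r.
    by apply: cvgD; [exact: cvg_id|exact: cvg_cst].
  by rewrite add0r; apply: cvg_trans; apply: cvg_app; exact: cvg_within.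
have cc : c (h + t) @[h --> 0^'] --> c t by exact: (cvg_pair cc1 cc2).
have near0 : forall e, 0 < e -> \forall h \near 0^', `|c (h + t) - c t| < e.
  by move=> e e0; have /cvgrPdist_lt/(_ e e0) := cc; apply: filterS => h; rewrite distrC.
have PX : P h @[h --> 0^'] --> c t.
  apply/cvgrPdist_lt => e e0; apply: filterS (near0 e e0) => h; apply: le_lt_trans.
  by rewrite distrC; case: (PQ h).
have QX : Q h @[h --> 0^'] --> c t.
  apply/cvgrPdist_lt => e e0; apply: filterS (near0 e e0) => h; apply: le_lt_trans.
  by rewrite distrC; case: (PQ h).
have [_ _ cx cy] := cf.
have l1 : h^-1 *: ((c1 \o shift t) (h *: 1) - c1 t) @[h --> 0^'] --> a by rewrite -e1; exact: d1.
have l2 : h^-1 *: ((c2 \o shift t) (h *: 1) - c2 t) @[h --> 0^'] --> b by rewrite -e2; exact: d2.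
have lx : 'D_ex f (P h) @[h --> 0^'] --> 'D_ex f (c t).
  by apply: (@continuous_cvg _ _ _ _ _ P ('D_ex f) (c t)); [exact: cx|exact: PX].
have ly : 'D_ey f (Q h) @[h --> 0^'] --> 'D_ey f (c t).
  by apply: (@continuous_cvg _ _ _ _ _ Q ('D_ey f) (c t)); [exact: cy|exact: QX].
have l : (fun h => 'D_ex f (P h) * (h^-1 *: ((c1 \o shift t) (h *: 1) - c1 t)) +
    'D_ey f (Q h) * (h^-1 *: ((c2 \o shift t) (h *: 1) - c2 t))) @ 0^' -->
    ('D_ex f (c t) * a + 'D_ey f (c t) * b).
  by apply: cvgD; [exact: cvgM lx l1|exact: cvgM ly l2].
suff L : h^-1 *: (((fun s => f (c1 s, c2 s)) \o shift t) (h *: 1) - f (c1 t, c2 t)) @[h --> 0^'] -->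
   ('D_ex f (c t) * a + 'D_ey f (c t) * b).
  by split; [apply/cvg_ex; eexists; exact: L|exact: (cvg_lim (@Rhausdorff R) L)].
apply: cvg_trans l; apply: near_eq_cvg; near=> h.
have [_ _ E] := PQ h.
rewrite /= /shift /= /GRing.scale /= mulr1 -/(c (h + t)) -/(c t) E /=; ring.
Unshelve. all: by end_near. Qed.

Lemma C1_line f X v (t : R) : Ck 1 f ->
  is_derive t (1 : R) (fun s => f (X + s *: v))
    ('D_ex f (X + t *: v) * v.1 + 'D_ey f (X + t *: v) * v.2).
Proof.
move=> cf.
have E s : X + s *: v = (v.1 * s + X.1, v.2 * s + X.2).
  by apply: injective_projections; rewrite /= addrC mulrC.
rewrite E; under eq_fun do rewrite E.
by apply: C1_curve => //; exact: is_derive_affine.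
Qed.

Lemma second_difference f (x y h : R) : Ck 2 f -> exists P : plane,
  `|P - (x, y)| <= `|h| /\
  f (x + h, y + h) - f (x + h, y) - f (x, y + h) + f (x, y) = 'D_ey ('D_ex f) P * h ^+ 2.
Proof.
move=> cf; have cf1 := Ck_pred cf; have [_ _ cx _] := cf.
have dphi (s : R) : is_derive s (1 : R) (fun s => f (s, y + h) - f (s, y)) ('D_ex f (s, y + h) - 'D_ex f (s, y)).
  exact: is_deriveB (C1_slice_x (y + h) cf1 s) (C1_slice_x y cf1 s).
have [p [[p1 _] pE]] := MVT_line x (x + h) dphi.
have [q [[q1 _] qE]] := MVT_line y (y + h) (C1_slice_y p cx).
have xh : x + h - x = h by rewrite addrAC subrr add0r.
have yh : y + h - y = h by rewrite addrAC subrr add0r.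
rewrite xh in p1 pE; rewrite yh in q1 qE.
exists (p, q); split; first by rewrite prod_normE /= ge_max p1 q1.
transitivity (f (x + h, y + h) - f (x + h, y) - (f (x, y + h) - f (x, y))); first ring.
rewrite pE qE; ring.
Qed.

Lemma second_difference' f (x y h : R) : Ck 2 f -> exists P : plane,
  `|P - (x, y)| <= `|h| /\
  f (x + h, y + h) - f (x + h, y) - f (x, y + h) + f (x, y) = 'D_ex ('D_ey f) P * h ^+ 2.
Proof.
move=> cf; have cf1 := Ck_pred cf; have [_ _ _ cy] := cf.
have dphi (s : R) : is_derive s (1 : R) (fun s => f (x + h, s) - f (x, s)) ('D_ey f (x + h, s) - 'D_ey f (x, s)).
  exact: is_deriveB (C1_slice_y (x + h) cf1 s) (C1_slice_y x cf1 s).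
have [q [[q1 _] qE]] := MVT_line y (y + h) dphi.
have [p [[p1 _] pE]] := MVT_line x (x + h) (C1_slice_x q cy).
have xh : x + h - x = h by rewrite addrAC subrr add0r.
have yh : y + h - y = h by rewrite addrAC subrr add0r.
rewrite xh in p1 pE; rewrite yh in q1 qE.
exists (p, q); split; first by rewrite prod_normE /= ge_max p1 q1.
transitivity (f (x + h, y + h) - f (x, y + h) - (f (x + h, y) - f (x, y))); first ring.
rewrite qE pE; ring.
Qed.

Lemma dist_halves (a b q e : R) : `|a - q| < e / 2 -> `|b - q| < e / 2 -> `|a - b| <= e.
Proof. by move=> aq bq; have := ler_distD q a b; rewrite (distrC q b); lra. Qed.

Lemma min_half (d1 d2 : R) : 0 < d1 -> 0 < d2 -> exists2 h, 0 < h & h < d1 /\ h < d2.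
Proof.
move=> d10 d20; exists (Num.min d1 d2 / 2); rewrite ?divr_gt0 ?lt_min ?d10//.
have m1 : Num.min d1 d2 <= d1 by rewrite ge_min lexx.
have m2 : Num.min d1 d2 <= d2 by rewrite ge_min lexx orbT.
have m0 : 0 < Num.min d1 d2 by rewrite lt_min d10.
split; lra.
Qed.

(** The second difference over a square of side [h] is [h ^ 2] times either mixed derivative, each
    taken at some point within [h] of [X]; continuity finishes as [h] shrinks. *)
Lemma Clairaut f X : Ck 2 f -> 'D_ey ('D_ex f) X = 'D_ex ('D_ey f) X.
Proof.
move=> cf; have [_ _ [_ _ _ c1] [_ _ c2 _]] := cf.
apply/eqP; rewrite -subr_eq0 -normr_le0; apply/ler_addgt0Pr => e e0; rewrite add0r.
have e20 : 0 < e / 2 by rewrite divr_gt0.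
have /cvgrPdist_lt/(_ _ e20) /nbhs_ballP[d1 /= d10 h1] := c1 X.
have /cvgrPdist_lt/(_ _ e20) /nbhs_ballP[d2 /= d20 h2] := c2 X.
have [h h0 [hd1 hd2]] := min_half d10 d20.
case: X h1 h2 => x y h1 h2.
have [P [P1 PE]] := second_difference x y h cf.
have [Q [Q1 QE]] := second_difference' x y h cf.
rewrite (gtr0_norm h0) in P1 Q1.
have PQ : 'D_ey ('D_ex f) P = 'D_ex ('D_ey f) Q.
  have : 'D_ey ('D_ex f) P * h ^+ 2 = 'D_ex ('D_ey f) Q * h ^+ 2 by exact: etrans (esym PE) QE.
  by apply: mulIf; rewrite expf_neq0// gt_eqF.
have /h1 {}h1 : ball (x, y) d1 P by rewrite -ball_normE /= distrC; exact: le_lt_trans hd1.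
have /h2 {}h2 : ball (x, y) d2 Q by rewrite -ball_normE /= distrC; exact: le_lt_trans hd2.
rewrite /= PQ in h1.
exact: (dist_halves h1 h2).
Qed.

End PlaneCalculus.

(** * Integrals of derivatives of functions supported in a box *)

Section CompactSupport.
Context {R : realType}.

Lemma continuous_pair_l (y : R) : continuous (fun x : R => (x, y)).
Proof. by move=> x; apply: (cvg_pair (cvg_id) (cvg_cst y)). Qed.

Lemma continuous_pair_r (x : R) : continuous (fun y : R => (x, y)).
Proof. by move=> y; apply: (cvg_pair (cvg_cst x) (cvg_id)). Qed.

Local Notation plane := (R * R)%type.
Local Notation leb := (@lebesgue_measure R).
Local Notation leb2 := (leb \x leb)%E.

Definition box_support (N : R) (f : plane -> R) : Prop :=
  forall X, f X != 0 -> `|X.1| < N /\ `|X.2| < N.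

Lemma box_supportW N f : box_support N f -> forall X, N <= `|X.1| \/ N <= `|X.2| -> f X = 0.
Proof.
move=> fN X NX; apply/eqP; apply: contraT => /fN [h1 h2].
by case: NX; rewrite leNgt ?h1 ?h2.
Qed.

Lemma compact_box_support (K : set plane) : compact K ->
  exists2 N : R, 0 < N & forall X, K X -> `|X.1| < N /\ `|X.2| < N.
Proof.
move=> /compact_bounded [M [_ MK]].
exists (`|M| + 2); first by have := normr_ge0 M; lra.
move=> X /(MK (`|M| + 1)) => /(_ _) h.
have {}h : `|X| <= `|M| + 1 by apply: h; have := ler_norm M; lra.
move: h; rewrite prod_normE ge_max => /andP[h1 h2]; split; lra.
Qed.

Lemma continuous_box_bounded N (f : plane -> R) : continuous f ->
  exists2 M, 0 < M & forall X, `|X.1| <= N -> `|X.2| <= N -> `|f X| <= M.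
Proof.
move=> cf.
have : compact (f @` (`[- N, N] `*` `[- N, N])).
  apply: continuous_compact; first exact: continuous_subspaceT.
  by apply: compact_setX; exact: segment_compact.
move=> /compact_bounded [M [_ MK]].
exists (`|M| + 1); first by have := normr_ge0 M; lra.
move=> X X1 X2; apply: (MK (`|M| + 1)); first by have := ler_norm M; lra.
by exists X => //; split; rewrite /= in_itv /= -ler_norml.
Qed.

Lemma box_support_bounded N f : continuous f -> box_support N f ->
  exists2 M, 0 < M & forall X, `|f X| <= M.
Proof.
move=> cf fN; have [M M0 MK] := continuous_box_bounded N cf.
exists M => // X; have [->|fX] := eqVneq (f X) 0; first by rewrite normr0 ltW.
by have [h1 h2] := fN X fX; apply: MK; exact: ltW.
Qed.

Lemma box_support_integrable N f : continuous f -> box_support N f ->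
  leb2.-integrable setT (EFin \o f).
Proof.
move=> cf fN; pose B := obox (- N) N (- N) N.
have mB : measurable B by exact: measurable_obox.
have [M M0 MK] := box_support_bounded cf fN.
have iB : leb2.-integrable B (EFin \o f).
  apply: measurable_bounded_integrable => //.
  - exact: obox_measure_lty.
  - by apply: measurable_funTS; exact: continuous_measurable2.
  - by exists M; split => [|x Mx X _]; [exact: num_real|apply: le_trans (MK X) (ltW Mx)].
have [+ _] := @integrable_mkcond _ _ R leb2 B (EFin \o f) mB; move=> /(_ iB).
apply: eq_integrable => // X _.
rewrite /patch; case: ifPn => // /negP XB /=.
suff -> : f X = 0 by [].
apply/eqP; apply: contraT => /fN [h1 h2]; exfalso; apply: XB; apply/mem_set.
by split; rewrite /= in_itv /= -ltr_norml.
Qed.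

Lemma box_support_L2 N f : continuous f -> box_support N f -> L2 setT f.
Proof.
move=> cf fN; apply/L2P => //; split; first exact: continuous_measurable2.
have cf2 : continuous (fun X => f X ^+ 2).
  have -> : (fun X => f X ^+ 2) = (fun X => f X * f X) by apply/funext => X; rewrite expr2.
  by move=> X; apply: cvgM; exact: cf.
have fN2 : box_support N (fun X => f X ^+ 2).
  by move=> X; rewrite expf_eq0 /= => /fN.
have /integrableP[_] := box_support_integrable cf2 fN2.
by under eq_integral do rewrite gee0_abs ?lee_fin ?sqr_ge0//.
Qed.

Lemma integral_derivative0 (g dg : R -> R) (N : R) : 0 < N ->
  (forall x, is_derive x (1 : R) g (dg x)) -> continuous dg ->
  (forall x, N <= `|x| -> g x = 0) -> (forall x, N <= `|x| -> dg x = 0) ->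
  (\int[leb]_x (dg x)%:E = 0)%E.
Proof.
move=> N0 gd cdg g0 dg0.
pose I : set R := `[- N, N]%classic.
transitivity (\int[leb]_(x in I) (dg x)%:E)%E.
  rewrite [RHS]integral_mkcond; apply: eq_integral => x _; rewrite /patch; case: ifPn => // /negP xN.
  rewrite dg0 //; rewrite leNgt; apply/negP => h; apply: xN; apply/mem_set.
  by rewrite /I /= in_itv /= -ler_norml ltW.
have cg : continuous g by apply: derivable_continuous => x; case: (gd x).
rewrite /I (@continuous_FTC2 _ dg g).
- by rewrite !g0 ?subee// ?normrN ger0_norm// ltW.
- lra.
- exact: continuous_subspaceT.
- split; first by move=> x _; case: (gd x).
  + by apply: cvg_at_right_filter; exact: cg.
  + by apply: cvg_at_left_filter; exact: cg.
- by move=> x _; apply: is_derive_derive1.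
Qed.

(** A derivative vanishes where the function vanishes on a neighbourhood, hence strictly outside the
    box; this is why later boxes are enlarged from [N] to [N + 1]. *)
Lemma derive_box_support (v : plane) N f : box_support N f ->
  forall X, N < `|X.1| \/ N < `|X.2| -> 'D_v f X = 0.
Proof.
move=> fN X NX.
have : \forall Y \near X, N < `|Y.1| \/ N < `|Y.2|.
  case: NX => h.
    have : \forall Y \near X, N < `|Y.1|.
      have c : {for X, continuous (fun Y : plane => `|Y.1|)}.
        by apply: (@continuous_comp _ _ _ fst (fun x : R => `|x|)); [exact: continuous_fst|exact: norm_continuous].
      exact: (c _ (lt_nbhsr h)).
    by apply: filterS => Y; left.
  have : \forall Y \near X, N < `|Y.2|.
    have c : {for X, continuous (fun Y : plane => `|Y.2|)}.
      by apply: (@continuous_comp _ _ _ snd (fun x : R => `|x|)); [exact: continuous_snd|exact: norm_continuous].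
    exact: (c _ (lt_nbhsr h)).
  by apply: filterS => Y; right.
move=> near; rewrite (@near_eq_derive _ _ _ f (cst 0)) ?derive_cst//.
apply: filterS near => Y NY /=; apply: (box_supportW fN).
by case: NY => /ltW; [left|right].
Qed.

Lemma integral_derive_ex0 (N : R) f : 0 < N -> Ck 1 f -> box_support N f ->
  (\int[leb2]_X ('D_ex f X)%:E = 0)%E.
Proof.
move=> N0 cf fN; have [_ _ cx _] := cf.
have fN1 : box_support (N + 1) ('D_ex f).
  move=> X fX; apply: contrapT => /not_andP h; move/eqP: fX; apply; apply: (derive_box_support ex fN).
  by case: h => /negP; rewrite -leNgt => h; [left|right]; lra.
have it := box_support_integrable cx fN1.
rewrite -(integral21_prod_meas1 it) /fubini_G.
apply: integral0_eq => y _.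
apply: (@integral_derivative0 (fun x => f (x, y)) (fun x => 'D_ex f (x, y)) (N + 1)).
- lra.
- exact: C1_slice_x.
- move=> x; apply: (@continuous_comp _ _ _ (fun x => (x, y)) ('D_ex f)); last exact: cx.
  exact: continuous_pair_l.
- by move=> x h; apply: (box_supportW fN); left => /=; lra.
- by move=> x h; apply: (box_supportW fN1); left.
Qed.

Lemma integral_derive_ey0 (N : R) f : 0 < N -> Ck 1 f -> box_support N f ->
  (\int[leb2]_X ('D_ey f X)%:E = 0)%E.
Proof.
move=> N0 cf fN; have [_ _ _ cy] := cf.
have fN1 : box_support (N + 1) ('D_ey f).
  move=> X fX; apply: contrapT => /not_andP h; move/eqP: fX; apply; apply: (derive_box_support ey fN).
  by case: h => /negP; rewrite -leNgt => h; [left|right]; lra.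
have it := box_support_integrable cy fN1.
rewrite -(integral12_prod_meas1 it) /fubini_F.
apply: integral0_eq => x _.
apply: (@integral_derivative0 (fun y => f (x, y)) (fun y => 'D_ey f (x, y)) (N + 1)).
- lra.
- exact: C1_slice_y.
- move=> y; apply: (@continuous_comp _ _ _ (fun y => (x, y)) ('D_ey f)); last exact: cy.
  exact: continuous_pair_r.
- by move=> y h; apply: (box_supportW fN); right => /=; lra.
- by move=> y h; apply: (box_supportW fN1); right.
Qed.

End CompactSupport.

(** * Weak derivatives *)

Section WeakDerivatives.
Context {R : realType}.
Local Notation plane := (R * R)%type.
Local Notation leb := (@lebesgue_measure R).
Local Notation leb2 := (leb \x leb)%E.
Implicit Types (G : set plane) (f g phi : plane -> R) (v : plane).

Lemma L2_mul_integrable G f phi : measurable G -> L2 G f -> L2 setT phi ->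
  leb2.-integrable G (fun X => (f X * phi X)%:E).
Proof.
move=> mG fL pL; have := Lfun2_mul_Lfun1 fL pL => /Lfun1_integrable h.
have [_] := @integrable_mkcond _ _ R leb2 G (fun X => (f X * phi X)%:E) mG; apply.
apply: eq_integrable h => // X _ /=.
rewrite !patch_mulr /patch !indicE in_setT mulr1.
by case: ifP => _ /=; rewrite ?mulr1 ?mulr0 ?mul0r.
Qed.

(** The two directions in which [Ck] provides derivatives. *)
Definition axis v := v = ex \/ v = ey.

Lemma test_box_support G phi : test_fun G phi ->
  exists2 N : R, 0 < N & box_support N phi.
Proof.
move=> [_ cK _]; have [N N0 NK] := compact_box_support cK.
by exists N => // X pX; apply: NK; apply: subset_closure.
Qed.

Lemma test_L2 G phi : test_fun G phi -> L2 setT phi.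
Proof.
move=> tp; have [N N0 NS] := test_box_support tp.
apply: box_support_L2 NS; case: tp => /(_ 0%N) c _ _; exact: Ck_continuous c.
Qed.

Lemma derive_box_support1 v N f : box_support N f -> box_support (N + 1) ('D_v f).
Proof.
move=> fN X fX; apply: contrapT => /not_andP h; move/eqP: fX; apply.
apply: (derive_box_support v fN).
by case: h => /negP; rewrite -leNgt => h; [left|right]; lra.
Qed.

Lemma Ck_derive_axis v k f : axis v -> Ck k.+1 f -> Ck k ('D_v f).
Proof. by case=> -> [_ _ h1 h2]. Qed.

Lemma test_derive_L2 G v phi : axis v -> test_fun G phi -> L2 setT ('D_v phi).
Proof.
move=> av tp; have [N N0 NS] := test_box_support tp.
apply: box_support_L2 (derive_box_support1 (v := v) NS).
by case: tp => /(_ 1%N) c _ _; exact: Ck_continuous (Ck_derive_axis av c).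
Qed.

Definition wderiv G v f g := L2 G g /\ is_weak_deriv G v f g.

Lemma wderiv_wD G v f : has_wD G v f -> wderiv G v f (wD G v f).
Proof.
move=> [g gL gw]; rewrite /wD.
by have [h1 h2] := @xgetI _ (cst 0) [set g | L2 G g /\ is_weak_deriv G v f g] g (conj gL gw).
Qed.

Lemma wderiv_has G v f g : wderiv G v f g -> has_wD G v f.
Proof. by case=> gL gw; exists g. Qed.

Lemma wderivB G v f f' g g' : measurable G -> axis v -> L2 G f -> L2 G f' ->
  wderiv G v f g -> wderiv G v f' g' -> wderiv G v (fun X => f X - f' X) (fun X => g X - g' X).
Proof.
move=> mG av fL f'L [gL gw] [g'L g'w]; split; first exact: L2B.
move=> phi tp.
have dL := test_derive_L2 av tp; have pL := test_L2 tp.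
under eq_Rintegral do rewrite mulrBl.
rewrite RintegralB//; [|exact: L2_mul_integrable|exact: L2_mul_integrable].
rewrite gw// g'w//.
under [in RHS]eq_Rintegral do rewrite mulrBl.
rewrite RintegralB//; [|exact: L2_mul_integrable|exact: L2_mul_integrable].
ring.
Qed.

Lemma wderiv_ae G v f f' g : measurable G -> axis v -> L2 G f -> L2 G f' ->
  {ae leb2, forall X, G X -> f X = f' X} -> wderiv G v f g -> wderiv G v f' g.
Proof.
move=> mG av fL f'L ff' [gL gw]; split=> // phi tp; rewrite -gw //; congr fine.
have dL := test_derive_L2 av tp.
apply: ae_eq_integral => //.
- exact: measurable_int (L2_mul_integrable mG f'L dL).
- exact: measurable_int (L2_mul_integrable mG fL dL).
- by apply: (@filterS _ _ (ae_filter_ringOfSetsType leb2) _ _ _ ff') => X /= E GX; rewrite E.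
Qed.

(** Test functions see only the interior of [G]; the rest of [G] is controlled by being a null
    set. *)
Lemma wderiv_unique G v f g g' : measurable G -> leb2.-negligible (G `\` G°) ->
  wderiv G v f g -> wderiv G v f g' -> {ae leb2, forall X, G X -> g X = g' X}.
Proof.
move=> mG nG [gL gw] [g'L g'w].
have : {ae leb2, forall X, G° X -> g X - g' X = 0}.
  apply: (weak_zero_ae mG (L2B gL g'L)) => phi tp.
  have pL := test_L2 tp.
  under eq_Rintegral do rewrite mulrBl.
  rewrite RintegralB//; [|exact: L2_mul_integrable|exact: L2_mul_integrable].
  by have := gw _ tp; rewrite g'w// => /oppr_inj ->; rewrite subrr.
rewrite /almost_everywhere /= => h; have := negligibleU h nG.
apply: negligibleS => X /= /not_implyP[GX gX].
have [GX'|GX'] := pselect (G° X).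
  by left => /(_ GX') /eqP; rewrite subr_eq0 => /eqP.
by right.
Qed.

Lemma wD_ae G v f g : measurable G -> leb2.-negligible (G `\` G°) ->
  wderiv G v f g -> {ae leb2, forall X, G X -> wD G v f X = g X}.
Proof.
by move=> mG nG fg; exact: (wderiv_unique mG nG (wderiv_wD (wderiv_has fg)) fg).
Qed.

Lemma L2norm_wD G v f g : measurable G -> leb2.-negligible (G `\` G°) ->
  wderiv G v f g -> L2norm G (wD G v f) = L2norm G g.
Proof.
move=> mG nG fg; apply: L2norm_ae => //; last exact: wD_ae.
- by have [] := wderiv_wD (wderiv_has fg).
- by case: fg.
Qed.

(** Integration by parts: [f * phi] is a C^1 function supported in a box, so the integral of its
    derivative over the plane is 0. Outside [G] both [phi] and its derivative vanish, which
    identifies integrals over [G] with integrals over the plane. *)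
Lemma classical_weak_deriv G v f : measurable G -> axis v -> Ck 1 f -> is_weak_deriv G v f ('D_v f).
Proof.
move=> mG av cf phi tp.
have [N N0 NS] := test_box_support tp.
have [cphi _ sub] := tp.
have out X : ~ G X -> phi X = 0 /\ 'D_v phi X = 0.
  move=> GX; have nX : ~ closure [set X | phi X != 0] X.
    by move=> /sub /interior_subset.
  have phi0 : \forall Y \near X, phi Y = 0.
    have oK : open (~` closure [set X | phi X != 0]).
      by apply: closed_openC; exact: closed_closure.
    apply: filterS (open_nbhs_nbhs (conj oK nX)) => Y nY; apply: contrapT => /eqP pY.
    by apply: nY; exact: subset_closure.
  split; first exact: nbhs_singleton phi0.
  by rewrite (@near_eq_derive _ _ _ phi (cst 0)) ?derive_cst.
have E (a b : plane -> R) : (forall X, ~ G X -> b X = 0) ->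
    \int[leb2]_(X in G) (a X * b X) = \int[leb2]_X (a X * b X).
  move=> b0; rewrite Rintegral_mkcond; apply: eq_Rintegral => X _.
  rewrite /patch; case: ifPn => // /negP XG; rewrite b0 ?mulr0// => h.
  by apply: XG; exact/mem_set.
rewrite !E; [|by move=> X /out []|by move=> X /out []].
have c1 := cphi 1%N.
pose psi X := f X * phi X.
have dv X : is_derive X v psi (f X * 'D_v phi X + 'D_v f X * phi X).
  have d1 : is_derive X v f ('D_v f X).
    by case: (av) => ->; [exact: C1_is_derive_ex|exact: C1_is_derive_ey].
  have d2 : is_derive X v phi ('D_v phi X).
    by case: (av) => ->; [exact: C1_is_derive_ex|exact: C1_is_derive_ey].
  by apply: is_derive_eq (is_deriveM d1 d2) _; rewrite /GRing.scale /= [phi X * _]mulrC.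
have psiC : Ck 1 psi.
  have mul (a b : plane -> R) : continuous a -> continuous b -> continuous (fun X => a X * b X).
    by move=> ca cb X; apply: cvgM; [exact: ca|exact: cb].
  have [cF dF cFx cFy] := cf; have [cP dP cPx cPy] := c1.
  have dx X : is_derive X ex psi (f X * 'D_ex phi X + 'D_ex f X * phi X).
    apply: is_derive_eq (is_deriveM (C1_is_derive_ex X cf) (C1_is_derive_ex X c1)) _.
    by rewrite /GRing.scale /= [phi X * _]mulrC.
  have dy X : is_derive X ey psi (f X * 'D_ey phi X + 'D_ey f X * phi X).
    apply: is_derive_eq (is_deriveM (C1_is_derive_ey X cf) (C1_is_derive_ey X c1)) _.
    by rewrite /GRing.scale /= [phi X * _]mulrC.
  split.
  - exact: mul.
  - by move=> X; split; [case: (dx X)|case: (dy X)].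
  - rewrite (_ : (fun X => _) = fun X => f X * 'D_ex phi X + 'D_ex f X * phi X); last first.
      by apply/funext => X; case: (dx X).
    by move=> X; apply: cvgD; [exact: (mul _ _ cF cPx)|exact: (mul _ _ cFx cP)].
  - rewrite (_ : (fun X => _) = fun X => f X * 'D_ey phi X + 'D_ey f X * phi X); last first.
      by apply/funext => X; case: (dy X).
    by move=> X; apply: cvgD; [exact: (mul _ _ cF cPy)|exact: (mul _ _ cFy cP)].
have psiN : box_support N psi.
  by move=> X; rewrite /psi mulf_eq0 negb_or => /andP[_]; exact: NS.
have int0 : (\int[leb2]_X ('D_v psi X)%:E = 0)%E.
  by case: (av) => ->; [exact: integral_derive_ex0 psiN|exact: integral_derive_ey0 psiN].
have cfv : continuous ('D_v f) by exact: Ck_continuous (Ck_derive_axis av cf).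
have cpv : continuous ('D_v phi) by exact: Ck_continuous (Ck_derive_axis av c1).
have i1 : leb2.-integrable setT (EFin \o (fun X => f X * 'D_v phi X)).
  apply: (@box_support_integrable _ (N + 1)).
    by move=> X; apply: cvgM; [exact: (Ck_continuous cf)|exact: cpv].
  move=> X; rewrite mulf_eq0 negb_or => /andP[_].
  exact: (derive_box_support1 (v := v) NS).
have i2 : leb2.-integrable setT (EFin \o (fun X => 'D_v f X * phi X)).
  apply: (@box_support_integrable _ N).
    by move=> X; apply: cvgM; [exact: cfv|exact: (Ck_continuous c1)].
  by move=> X; rewrite mulf_eq0 negb_or => /andP[_]; exact: NS.
have : \int[leb2]_X (f X * 'D_v phi X + 'D_v f X * phi X) = 0.
  rewrite /Rintegral (_ : (\int[leb2]_X _)%E = 0%E)//.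
  rewrite -int0; apply: eq_integral => X _; by case: (dv X) => _ ->.
rewrite RintegralD//.
by move/eqP; rewrite addr_eq0 => /eqP.
Qed.

Lemma bounded_L2 G f M : measurable G -> (leb2 G < +oo)%E -> measurable_fun G f ->
  (forall X, G X -> `|f X| <= M) -> L2 G f.
Proof.
move=> mG Gfin mf fM; apply/L2P => //; split => //.
have i2 : leb2.-integrable G (EFin \o (fun X => f X ^+ 2)).
  apply: measurable_bounded_integrable => //; first exact: measurable_funX.
  exists (M ^+ 2); split => [|x Mx X GX]; first exact: num_real.
  apply: le_trans (ltW Mx); rewrite /= normrX.
  rewrite ler_pXn2r ?nnegrE//; first exact: fM.
  exact: le_trans (fM X GX).
have /integrableP[_] := i2.
by under eq_integral do rewrite gee0_abs ?lee_fin ?sqr_ge0//.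
Qed.

Lemma continuous_L2 G f N : measurable G -> continuous f ->
  (forall X, G X -> `|X.1| < N /\ `|X.2| < N) -> L2 G f.
Proof.
move=> mG cf GN; have [M M0 MK] := continuous_box_bounded N cf.
apply: (@bounded_L2 _ _ M) => //.
- apply: le_lt_trans (obox_measure_lty (- N) N (- N) N).
  apply: le_measure; rewrite ?inE//; first exact: measurable_obox.
  by move=> X /GN [h1 h2]; split; rewrite /= in_itv /= -ltr_norml.
- by apply: measurable_funTS; exact: continuous_measurable2.
- by move=> X /GN [h1 h2]; apply: MK; exact: ltW.
Qed.

Lemma classical_wderiv G v f N : measurable G -> axis v -> Ck 1 f ->
  (forall X, G X -> `|X.1| < N /\ `|X.2| < N) -> wderiv G v f ('D_v f).
Proof.
move=> mG av cf GN; split; last exact: classical_weak_deriv.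
apply: (continuous_L2 (N := N)) => //; exact: Ck_continuous (Ck_derive_axis av cf).
Qed.

Lemma eq_wderiv G v f f' g : (forall X, G X -> f X = f' X) -> wderiv G v f g -> wderiv G v f' g.
Proof.
move=> ff' [gL gw]; split => // phi tp; rewrite -gw //.
by apply: eq_Rintegral => X /set_mem GX; rewrite ff'.
Qed.

End WeakDerivatives.

(** * Averages over segments *)

Section Averages.
Context {R : realType}.
Local Notation plane := (R * R)%type.
Local Notation leb := (@lebesgue_measure R).
Local Notation leb2 := (leb \x leb)%E.
Local Notation mR := (measurableTypeR R).
Local Notation mplane := (mR * mR)%type.

Lemma measurable_affine (a b : R) : measurable_fun [set: mR] (fun x : mR => (a * x + b : mR)).
Proof.
apply: continuous_measurable_fun => x.
by apply: cvgD; [apply: cvgM; [exact: cvg_cst|exact: cvg_id]|exact: cvg_cst].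
Qed.

(** The push-forward of [a] times Lebesgue measure under the affine map has the right values on
    half-open intervals, and these determine the measure. *)
Lemma lebesgue_measure_affine (a b : R) (A : set R) : 0 < a -> measurable A ->
  (a%:E * leb ((fun x : R => (a * x + b)%R) @^-1` A) = leb A)%E.
Proof.
move=> a0 mA.
have a0' : 0 <= a by exact: ltW.
have mf := measurable_affine a b.
apply/esym; transitivity (pushforward (mscale (NngNum a0') leb) (fun x : mR => (a * x + b : mR)) A); last by [].
apply: lebesgue_measure_unique => //.
move=> _ [[x y] _ <-] /=.
rewrite /pushforward /mscale /=.
have -> : (fun x0 : mR => a * x0 + b) @^-1` `]x, y] = `](x - b) / a, (y - b) / a]%classic.
  apply/seteqP; split => z /=; rewrite !in_itv /= => /andP[h1 h2]; apply/andP; split.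
  - by rewrite ltr_pdivrMr// ltrBlDr mulrC.
  - by rewrite ler_pdivlMr// lerBrDr mulrC.
  - by move: h1; rewrite ltr_pdivrMr// ltrBlDr mulrC.
  - by move: h2; rewrite ler_pdivlMr// lerBrDr mulrC.
rewrite !lebesgue_measure_itv /= !lte_fin ltr_pM2r ?invr_gt0// ltrD2r.
case: ifP => _; last by rewrite mule0.
rewrite -!EFinB -EFinM; congr EFin; field; exact: lt0r_neq0.
Qed.

Lemma ge0_integral_affine (a b : R) (f : R -> \bar R) : 0 < a ->
  measurable_fun [set: mR] (f : mR -> \bar R) -> (forall x, 0 <= f x)%E ->
  (a%:E * \int[leb]_x f (a * x + b)%R = \int[leb]_x f x)%E.
Proof.
move=> a0 mf f0.
have a0' : 0 <= a by exact: ltW.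
have mg := measurable_affine a b.
have := @ge0_integral_pushforward _ _ mR mR R (fun x : mR => (a * x + b : mR)) mg (mscale (NngNum a0') leb) setT f
  measurableT mf (fun x _ => f0 x).
have mfg : measurable_fun [set: mR] (f \o (fun x : mR => a * x + b)).
  exact: (@measurableT_comp _ _ _ mR mR _ f setT _ mf mg).
rewrite preimage_setT (ge0_integral_mscale (D := setT) leb measurableT (NngNum a0') mfg); last by move=> x _; exact: f0.
move=> <-; apply: eq_measure_integral => A mA _ /=.
by rewrite -(lebesgue_measure_affine b a0 mA).
Qed.

Lemma ge0_integral_affine2 (a : R) (M : plane) (f : plane -> \bar R) : 0 < a ->
  measurable_fun [set: mplane] (f : mplane -> \bar R) -> (forall x, 0 <= f x)%E ->
  ((a ^+ 2)%:E * \int[leb2]_X f (a *: X + M)%R = \int[leb2]_X f X)%E.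
Proof.
move=> a0 mf f0.
have mfa : measurable_fun [set: mplane] (fun X : mplane => f (a *: (X : plane) + M)).
  apply: (measurableT_comp mf).
  apply/measurable_fun_pairP; split.
    by apply: (measurableT_comp (measurable_affine a M.1)); exact: measurable_fst.
  by apply: (measurableT_comp (measurable_affine a M.2)); exact: measurable_snd.
rewrite (@fubini_tonelli1 _ _ mR mR R leb leb (fun X => f (a *: (X : plane) + M)) mfa) // (@fubini_tonelli1 _ _ mR mR R leb leb f mf) // /fubini_F.
have i1 x : (a%:E * \int[leb]_y f (a *: (x, y) + M)%R = \int[leb]_y f (a * x + M.1, y)%R)%E.
  apply: (@ge0_integral_affine a M.2 (fun y => f (a * x + M.1, y)) a0) => //.
  exact: (measurableT_comp mf (@pair1_measurable _ _ mR mR _)).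
rewrite expr2 EFinM -muleA -ge0_integralZl_EFin //; last first.
- exact: ltW.
- exact: (@measurable_fun_fubini_tonelli_F _ _ mR mR R leb (fun X => f (a *: (X : plane) + M))).
- by move=> x _; exact: integral_ge0.
under eq_integral do rewrite i1.
rewrite (ge0_integral_affine M.1 a0 (f := fun x => (\int[leb]_y f (x, y))%E)) //.
- exact: (@measurable_fun_fubini_tonelli_F _ _ mR mR R leb f).
- by move=> x; exact: integral_ge0.
Qed.

Lemma leb2_sigma_finite : sigma_finite [set: mplane] leb2.
Proof.
exists (fun n : nat => obox (- n%:R) n%:R (- n%:R) n%:R).
  apply/esym/seteqP; split => // X _.
  exists (Num.bound (`|X.1| + `|X.2|)) => //.
  have h : `|X.1| + `|X.2| < (Num.bound (`|X.1| + `|X.2|))%:R.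
    by apply: archi_boundP; rewrite addr_ge0.
  by split; rewrite /= in_itv /= -ltr_norml; apply: le_lt_trans h; rewrite ?lerDl ?lerDr.
by move=> n; split; [exact: measurable_obox|exact: obox_measure_lty].
Qed.

(* A copy of [leb2] carrying a sigma-finiteness instance, which Tonelli's theorem needs. *)
Definition leb2s : set mplane -> \bar R := leb2.
HB.instance Definition _ := Measure.on leb2s.
HB.instance Definition _ := Measure_isSigmaFinite.Build _ _ _ leb2s leb2_sigma_finite.

Definition I01 : set mR := `[0, 1]%classic.

Lemma measurable_I01 : measurable I01.
Proof. exact: measurable_itv. Qed.

Lemma leb_I01 : (leb I01 = 1)%E.
Proof. by rewrite /I01 lebesgue_measure_itv /= lte_fin ltr01 sube0. Qed.

Lemma bounded_I01_integrable (f : mR -> R) (B : R) : measurable_fun I01 f ->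
  (forall x, I01 x -> `|f x| <= B) -> leb.-integrable I01 (EFin \o f).
Proof.
move=> mf fB; apply: measurable_bounded_integrable => //.
- exact: measurable_I01.
- by rewrite [X in (X < _)%E]leb_I01 ltry.
- exists B; split; first exact: num_real.
  by move=> x Bx y Iy; apply: le_trans (ltW Bx); exact: fB.
Qed.

(** The integral of [(f - m) ^ 2] is nonnegative when [m] is the mean of [f] over an interval of
    length 1. *)
Lemma Jensen_sqr (f : mR -> R) (B : R) : measurable_fun I01 f ->
  (forall x, I01 x -> `|f x| <= B) ->
  (\int[leb]_(t in I01) f t) ^+ 2 <= \int[leb]_(t in I01) (f t ^+ 2).
Proof.
move=> mf fB; set m := \int[leb]_(t in I01) f t.
have i1 := bounded_I01_integrable mf fB.
have i2 : leb.-integrable I01 (EFin \o (fun t => f t ^+ 2)).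
  apply: (@bounded_I01_integrable _ (B ^+ 2)); first exact: measurable_funX.
  move=> x Ix; rewrite normrX ler_pXn2r ?nnegrE//; first exact: fB.
  exact: le_trans (fB x Ix).
have i3 : leb.-integrable I01 (EFin \o (fun t => 2 * m * f t)).
  have := @integrableZl _ mR R leb I01 measurable_I01 (2 * m) (EFin \o f) i1.
  by apply: eq_integrable; first exact: measurable_I01.
have i4 : leb.-integrable I01 (EFin \o (fun=> m ^+ 2)).
  by apply: (@bounded_I01_integrable _ `|m ^+ 2|).
have i23 : leb.-integrable I01 (EFin \o (fun t => f t ^+ 2 - 2 * m * f t)).
  exact: (@integrableB _ mR R leb I01 measurable_I01 _ _ i2 i3).
have : 0 <= \int[leb]_(t in I01) ((f t ^+ 2 - 2 * m * f t) + m ^+ 2).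
  apply: Rintegral_ge0 => t _.
  have -> : f t ^+ 2 - 2 * m * f t + m ^+ 2 = (f t - m) ^+ 2 by ring.
  exact: sqr_ge0.
rewrite RintegralD//; [|exact: measurable_I01].
rewrite RintegralB//; [|exact: measurable_I01].
rewrite RintegralZl//; [|exact: measurable_I01].
rewrite Rintegral_cst; [|exact: measurable_I01].
rewrite [X in fine X]leb_I01 /= -/m mulr1.
have -> : \int[leb]_(x in I01) f x ^+ 2 - 2 * m * m + m ^+ 2 = \int[leb]_(x in I01) f x ^+ 2 - m ^+ 2 by ring.
by rewrite subr_ge0.
Qed.

Definition seg_pt (X M : plane) (t : R) : plane := X + t *: (M - X).

Lemma seg_ptE X M t : seg_pt X M t = (1 - t) *: X + t *: M.
Proof. by rewrite /seg_pt scalerBr scalerBl scale1r addrA addrAC. Qed.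

Lemma measurable_seg_pt M : measurable_fun [set: mplane * mR] (fun z : mplane * mR => (seg_pt z.1 M z.2 : mplane)).
Proof.
have m1 : measurable_fun [set: mplane * mR] (fun z : mplane * mR => (z.1.1 : R)).
  exact: (measurableT_comp measurable_fst measurable_fst).
have m2 : measurable_fun [set: mplane * mR] (fun z : mplane * mR => (z.1.2 : R)).
  exact: (measurableT_comp measurable_snd measurable_fst).
have m3 : measurable_fun [set: mplane * mR] (fun z : mplane * mR => (z.2 : R)) by exact: measurable_snd.
apply/measurable_fun_pairP; split.
  rewrite (_ : _ \o _ = fun z : mplane * mR => z.1.1 + z.2 * (M.1 - z.1.1)) //.
  apply: measurable_funD => //; apply: measurable_funM => //.
  by apply: measurable_funB.
rewrite (_ : _ \o _ = fun z : mplane * mR => z.1.2 + z.2 * (M.2 - z.1.2)) //.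
apply: measurable_funD => //; apply: measurable_funM => //.
by apply: measurable_funB.
Qed.

(* the weight [1 - t] is exactly what makes the average over the segments
   towards [M] a contraction in L^2 *)
Definition seg_avg (K : plane -> R) (M X : plane) : R :=
  \int[leb]_(t in I01) ((1 - t) * K (seg_pt X M t)).

Section Contraction.
Variables (K : plane -> R) (B : R) (M : plane).
Hypotheses (mK : measurable_fun [set: mplane] (K : mplane -> R)) (K0 : forall X, 0 <= K X) (KB : forall X, K X <= B).

Let B0 : 0 <= B. Proof. exact: le_trans (K0 0) (KB 0). Qed.

Let k (z : mplane * mR) : R := (1 - z.2) * K (seg_pt z.1 M z.2).

Let mk : measurable_fun [set: mplane * mR] k.
Proof.
apply: measurable_funM; first by apply: measurable_funB => //; exact: measurable_snd.
exact: (measurableT_comp mK (measurable_seg_pt M)).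
Qed.

Let mkX (X : mplane) : measurable_fun [set: mR] (fun t : mR => k (X, t)).
Proof. exact: (measurableT_comp mk (pair1_measurable _)). Qed.

Let kB X t : I01 t -> `|k (X, t)| <= B.
Proof.
rewrite /I01 /= in_itv /= => /andP[t0 t1].
rewrite /k /= normrM ger0_norm ?subr_ge0// ger0_norm//.
have := K0 (seg_pt X M t); have := KB (seg_pt X M t); nra.
Qed.

Let k0 X t : I01 t -> 0 <= k (X, t).
Proof. by rewrite /I01 /= in_itv /= => /andP[t0 t1]; rewrite mulr_ge0// subr_ge0. Qed.

Lemma seg_avg_ge0 X : 0 <= seg_avg K M X.
Proof. by apply: Rintegral_ge0 => t; exact: (k0 X). Qed.

(** Boundedness of [K] makes the integral finite, so that passing to real values through [fine]
    loses nothing. *)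
Lemma seg_avg_EFin X :
  ((seg_avg K M X)%:E = \int[leb]_(t in I01) (k (X, t))%:E)%E.
Proof.
rewrite /seg_avg /Rintegral fineK//; apply: integrable_fin_num; first exact: measurable_I01.
apply: (@bounded_I01_integrable _ B); last by move=> t; exact: kB.
exact: measurable_funTS (mkX X).
Qed.

Let k1 (z : mplane * mR) : \bar R := (k z * \1_I01 z.2)%:E.

Let mind : measurable_fun [set: mplane * mR] (fun z : mplane * mR => \1_I01 z.2 : R).
Proof.
apply: (measurableT_comp (f := \1_I01 : mR -> R)); last exact: measurable_snd.
exact: measurable_indic measurable_I01.
Qed.

Lemma measurable_seg_avg : measurable_fun [set: mplane] (seg_avg K M : mplane -> R).
Proof.
apply/measurable_EFinP.
rewrite (_ : EFin \o _ = fun X => (\int[leb]_t k1 (X, t))%E); last first.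
  apply/funext => X /=; rewrite seg_avg_EFin [LHS]integral_mkcond.
  apply: eq_integral => t _; rewrite /k1 /patch /= indicE.
  by case: ifP => _ /=; rewrite ?mulr1 ?mulr0.
apply: (@measurable_fun_fubini_tonelli_F _ _ mplane mR R leb k1).
  by apply/measurable_EFinP; apply: measurable_funM.
move=> [X t]; rewrite lee_fin /= indicE.
have [It|It] := boolP (t \in I01); last by rewrite mulr0.
by rewrite mulr1; apply: k0; exact: set_mem.
Qed.

(** Jensen's inequality in [t], then Tonelli. For fixed [t] the substitution [X -> (1 - t) X + t M]
    has Jacobian [(1 - t) ^ 2], which the squared weight cancels exactly, so each slice contributes
    at most the full integral of [K ^ 2]. *)
Lemma seg_avg_contraction (A : set mplane) : measurable A ->
  (\int[leb2]_(X in A) ((seg_avg K M X) ^+ 2)%:E <= \int[leb2]_X ((K X) ^+ 2)%:E)%E.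
Proof.
move=> mA.
pose k2 (z : mplane * mR) : \bar R := ((k z) ^+ 2 * \1_I01 z.2)%:E.
have k20 z : (0 <= k2 z)%E by rewrite lee_fin mulr_ge0// ?sqr_ge0// indicE.
have mk2 : measurable_fun [set: mplane * mR] k2.
  by apply/measurable_EFinP; apply: measurable_funM => //; exact: measurable_funX.
have step1 X : (((seg_avg K M X) ^+ 2)%:E <= \int[leb]_t k2 (X, t))%E.
  have mI := measurable_funTS (D := I01) (mkX X).
  have J := Jensen_sqr mI (kB X).
  rewrite -lee_fin in J; apply: le_trans J _.
  rewrite /Rintegral fineK; last first.
    apply: integrable_fin_num; first exact: measurable_I01.
    apply: (@bounded_I01_integrable _ (B ^+ 2)); first exact: measurable_funX.
    move=> t It; rewrite normrX ler_pXn2r ?nnegrE//; exact: kB.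
  rewrite integral_mkcond; apply: ge0_le_integral => //.
  - move=> t _; rewrite /patch; case: ifP => // _; by rewrite lee_fin sqr_ge0.
  - apply/(measurable_restrictT _ measurable_I01).
    by apply/measurable_EFinP; exact: measurable_funX.
  - exact: (measurableT_comp mk2 (pair1_measurable _)).
  - move=> t _; rewrite /patch /k2 /= indicE; case: ifP => _ /=; by rewrite ?mulr1 ?mulr0.
apply: (@le_trans _ _ (\int[leb2]_X \int[leb]_t k2 (X, t))%E).
  rewrite integral_mkcond; apply: ge0_le_integral; first exact: measurableT.
  - by move=> X _; rewrite /patch; case: ifP => // _; rewrite lee_fin sqr_ge0.
  - apply/(measurable_restrictT _ mA); apply/measurable_EFinP; apply: measurable_funX.
    exact: measurable_funTS measurable_seg_avg.
  - exact: (@measurable_fun_fubini_tonelli_F _ _ mplane mR R leb k2).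
  - move=> X _; rewrite /patch; case: ifP => // _; exact: integral_ge0.
rewrite (@fubini_tonelli _ _ mplane mR R leb2s leb k2 mk2 k20).
have step2 t : (\int[leb2]_X k2 (X, t) <= (\int[leb2]_X ((K X) ^+ 2)%:E) * (\1_I01 t)%:E)%E.
  rewrite indicE; case: (boolP (t \in I01)) => [/set_mem|]; last first.
    move=> tI; rewrite mule0 (_ : (fun X => _) = cst 0%E) ?integral0//.
    by apply/funext => X; rewrite /k2 /= indicE (negbTE tI) mulr0.
  (* At [t = 1] the substitution degenerates to the constant [M], but there the weight is 0. *)
  rewrite /I01 /= in_itv /= => /andP[t0]; rewrite le_eqVlt => /predU1P[->|t1].
    rewrite (_ : (fun X => _) = cst 0%E) ?integral0 ?mule1 ?integral_ge0//.
      by move=> X _; rewrite lee_fin sqr_ge0.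
    by apply/funext => X; rewrite /k2 /k /= subrr mul0r expr0n mul0r.
  rewrite mule1 -(@ge0_integral_affine2 (1 - t) (t *: M) (fun X => ((K X) ^+ 2)%:E)) ?subr_gt0//; last first.
  - by move=> X; rewrite lee_fin sqr_ge0.
  - by apply/measurable_EFinP; exact: measurable_funX.
  rewrite -ge0_integralZl_EFin ?sqr_ge0//; last first.
  - apply/measurable_EFinP; apply: measurable_funX; apply: (measurableT_comp mK).
    have -> : (fun X : plane => (1 - t) *: X + t *: M) = (fun X => seg_pt X M t).
      by apply/funext => X; rewrite seg_ptE.
    exact: (measurableT_comp (measurable_seg_pt M) (pair2_measurable t)).
  - by move=> X _; rewrite lee_fin sqr_ge0.
  rewrite le_eqVlt; apply/orP; left; apply/eqP; apply: eq_integral => X _.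
  rewrite /k2 /k /= indicE mem_set /=; last by rewrite /I01 /= in_itv /= t0 ltW.
  by rewrite mulr1 exprMn EFinM seg_ptE.
apply: (@le_trans _ _ (\int[leb]_t ((\int[leb2]_X ((K X) ^+ 2)%:E) * (\1_I01 t)%:E))%E).
  apply: ge0_le_integral; first exact: measurableT.
  - by move=> t _; exact: integral_ge0.
  - exact: (@measurable_fun_fubini_tonelli_G _ _ mplane mR R leb2s k2).
  - apply: emeasurable_funM => //; apply/measurable_EFinP; exact: measurable_indic measurable_I01.
  - by move=> t _; exact: step2.
rewrite ge0_integralZl//; last first.
- by apply: integral_ge0 => X _; rewrite lee_fin sqr_ge0.
- by apply/measurable_EFinP; exact: measurable_indic measurable_I01.
rewrite (integral_indic _ measurableT measurable_I01) setIT.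
by rewrite [X in (_ * X <= _)%E]leb_I01 mule1.
Qed.

Lemma seg_avg_L2 (A : set plane) : measurable A -> L2 setT K ->
  L2 A (seg_avg K M) /\ L2norm A (seg_avg K M) <= L2norm setT K.
Proof.
move=> mA KL; have [_ Ki] := (L2P K measurableT).1 KL.
have JL : L2 A (seg_avg K M).
  apply/L2P => //; split; first exact: measurable_funTS measurable_seg_avg.
  exact: le_lt_trans (seg_avg_contraction mA) Ki.
split=> //; rewrite -(ler_pXn2r (isT : 0 < 2)%N) ?nnegrE ?L2norm_ge0//.
by rewrite -lee_fin !L2norm_sqr//; exact: seg_avg_contraction.
Qed.

End Contraction.
End Averages.

(** * Taylor expansion across an interface *)

Section Taylor.
Context {R : realType}.
Local Notation plane := (R * R)%type.
Local Notation leb := (@lebesgue_measure R).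
Local Notation leb2 := (leb \x leb)%E.
Local Notation mR := (measurableTypeR R).
Local Notation mplane := (mR * mR)%type.

(** The majorant [k] is only measurable, so the bound is stated in the extended reals, where its
    integral always makes sense. *)
Lemma FTC_bound (g dg : R -> R) (k : mR -> R) (a b : R) : a <= b ->
  (forall x, is_derive x (1 : R) g (dg x)) -> continuous dg ->
  measurable_fun [set: mR] k -> (forall t, a < t < b -> `|dg t| <= k t) ->
  (`|g b - g a|%:E <= \int[leb]_(t in `]a, b[) (k t)%:E)%E.
Proof.
rewrite le_eqVlt => /predU1P[-> _ _ _ _|ab gd cdg mk dk].
  by rewrite subrr normr0 set_itvoo0 integral_set0.
have cg : continuous g by apply: derivable_continuous => x; case: (gd x).
have E : (\int[leb]_(t in `[a, b]) (dg t)%:E = (g b)%:E - (g a)%:E)%E.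
  apply: continuous_FTC2 => //.
  - exact: continuous_subspaceT.
  - split; first by move=> x _; case: (gd x).
    + by apply: cvg_at_right_filter; exact: cg.
    + by apply: cvg_at_left_filter; exact: cg.
  - by move=> x _; apply: is_derive_derive1.
have mdg : measurable_fun [set: mR] dg by exact: continuous_measurable_fun.
rewrite -[(`|_|)%:E]/(`|(g b)%:E - (g a)%:E|)%E -E.
rewrite (integral_itv_bndoo _ _); last first.
  by apply/measurable_EFinP; exact: measurable_funTS.
apply: le_trans (le_abse_integral _ _ _) _ => //.
  by apply/measurable_EFinP; exact: measurable_funTS.
apply: ge0_le_integral => //.
- by apply: measurableT_comp => //; apply/measurable_EFinP; exact: measurable_funTS.
- by apply/measurable_EFinP; exact: measurable_funTS.
Qed.

(** The second derivative as a bilinear form. By symmetry a single mixed derivative occurs, in the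
    order used by [semi2]. *)
Definition hess (U : plane -> R) (X v w : plane) : R :=
  'D_ex ('D_ex U) X * (v.1 * w.1) + 'D_ey ('D_ex U) X * (v.2 * w.1 + v.1 * w.2)
  + 'D_ey ('D_ey U) X * (v.2 * w.2).

Definition hess_norm (U : plane -> R) (X : plane) : R :=
  `|'D_ex ('D_ex U) X| + `|'D_ey ('D_ex U) X| + `|'D_ey ('D_ey U) X|.

Lemma hess_bound U X v w (h c : R) :
  `|v.1| <= h -> `|v.2| <= h -> `|w.1| <= c -> `|w.2| <= c ->
  `|hess U X v w| <= 2 * (h * c) * hess_norm U X.
Proof.
move=> v1 v2 w1 w2; rewrite /hess /hess_norm.
have h0 : 0 <= h by exact: le_trans v1.
have c0 : 0 <= c by exact: le_trans w1.
have p (a b : R) : `|a| <= h -> `|b| <= c -> `|a * b| <= h * c.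
  by move=> ah bc; rewrite normrM; exact: ler_pM.
have p11 := p _ _ v1 w1; have p21 := p _ _ v2 w1; have p12 := p _ _ v1 w2; have p22 := p _ _ v2 w2.
move: ('D_ex ('D_ex U) X) ('D_ey ('D_ex U) X) ('D_ey ('D_ey U) X) => A B C.
have hc0 : 0 <= h * c by exact: mulr_ge0.
have e1 : `|A * (v.1 * w.1)| <= 2 * (h * c) * `|A|.
  by rewrite normrM mulrC ler_wpM2r//; apply: le_trans p11 _; rewrite ler_peMl// ler1n.
have e2 : `|B * (v.2 * w.1 + v.1 * w.2)| <= 2 * (h * c) * `|B|.
  rewrite normrM mulrC ler_wpM2r//; apply: le_trans (ler_normD _ _) _.
  by rewrite mulr_natl mulr2n lerD.
have e3 : `|C * (v.2 * w.2)| <= 2 * (h * c) * `|C|.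
  by rewrite normrM mulrC ler_wpM2r//; apply: le_trans p22 _; rewrite ler_peMl// ler1n.
have -> : 2 * (h * c) * (`|A| + `|B| + `|C|) = 2 * (h * c) * `|A| + 2 * (h * c) * `|B| + 2 * (h * c) * `|C| by ring.
apply: le_trans (ler_normD _ _) _; apply: lerD => //.
by apply: le_trans (ler_normD _ _) _; exact: lerD.
Qed.

Lemma dotZr (v w : plane) (a : R) : dot v (a *: w) = a * dot v w.
Proof. by rewrite /dot mulrDr; congr (_ + _); exact: mulrCA. Qed.

Lemma hess_expand (a0 c0 A C v1 v2 w1 w2 B B' : R) : B = B' ->
  a0 *: (0 : R) + w1 *: (A * v1 + B * v2) + (c0 *: (0 : R) + w2 *: (B' * v1 + C * v2)) =
  A * (v1 * w1) + B * (v2 * w1 + v1 * w2) + C * (v2 * w2).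
Proof. by move=> ->; rewrite !scaler0 /GRing.scale /=; ring. Qed.

Lemma dot_grad_line U X v w (t : R) : Ck 2 U ->
  is_derive t (1 : R) (fun s => dot (grad U (X + s *: v)) w) (hess U (X + t *: v) v w).
Proof.
move=> cU; have [_ _ cx cy] := cU.
have := is_deriveD (is_deriveM (C1_line X v t cx) (is_derive_cst w.1 t 1))
  (is_deriveM (C1_line X v t cy) (is_derive_cst w.2 t 1)).
move=> h; apply: is_derive_eq h _.
exact: (hess_expand _ _ _ _ _ _ _ _ (Clairaut _ cU)).
Qed.

Lemma hess_continuous U (c : R -> plane) v w : Ck 2 U -> continuous c ->
  continuous (fun t => hess U (c t) v w).
Proof.
move=> [_ _ [_ _ cxx cxy] [_ _ _ cyy]] cc.
have comp (f : plane -> R) (a : R) : continuous f -> continuous (fun t => f (c t) * a).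
  move=> cf t; apply: cvgM; last exact: cvg_cst.
  by apply: (@continuous_comp _ _ _ c f); [exact: cc|exact: cf].
by move=> t; exact: (cvgD (cvgD (comp _ _ cxx t) (comp _ _ cxy t)) (comp _ _ cyy t)).
Qed.

Lemma hess_norm_continuous U : Ck 2 U -> continuous (hess_norm U).
Proof.
move=> [_ _ [_ _ cxx cxy] [_ _ _ cyy]].
have comp (f : plane -> R) : continuous f -> continuous (fun X => `|f X|).
  move=> cf X; exact: (@continuous_comp _ _ _ f (fun x : R => `|x|) X (cf X) (@norm_continuous _ _ _)).
by move=> X; exact: (cvgD (cvgD (comp _ cxx X) (comp _ cxy X)) (comp _ cyy X)).
Qed.

Lemma hess_norm_ge0 U X : 0 <= hess_norm U X.
Proof. by rewrite /hess_norm !addr_ge0. Qed.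

Lemma continuous_seg_pt (X M : plane) : continuous (seg_pt X M).
Proof.
move=> t; apply: cvgD; first exact: cvg_cst.
by apply: cvgZl; exact: cvg_id.
Qed.

(** Value at [M] of the first order Taylor polynomial of [U] based at the moving point of the
    segment. It interpolates between the polynomial based at [X] and [U M], and its derivative in
    [t] is the integral remainder with weight [1 - t]. *)
Definition tangent_at (U : plane -> R) (X M : plane) (t : R) : R :=
  U (seg_pt X M t) + (1 - t) * dot (grad U (seg_pt X M t)) (M - X).

Lemma tangent_at_is_derive U X M t : Ck 2 U ->
  is_derive t (1 : R) (tangent_at U X M) ((1 - t) * hess U (seg_pt X M t) (M - X) (M - X)).
Proof.
move=> cU.
have d1 := C1_line X (M - X) t (Ck_pred cU).
have d2 := dot_grad_line X (M - X) (M - X) t cU.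
have d3 : is_derive t (1 : R) (fun s : R => 1 - s) (-1).
  have := is_deriveB (is_derive_cst (1 : R) t 1) (is_derive_id t (1 : R)).
  by move=> h; apply: is_derive_eq h _; rewrite sub0r.
have := is_deriveD d1 (is_deriveM d3 d2).
move=> h; apply: is_derive_eq h _.
rewrite /GRing.scale /= /dot /grad /=; ring.
Qed.

Lemma norm_sum3_le (A A' a d t D c : R) : `|d| <= c -> 0 <= t ->
  `|A + A' + a * d * (t * D)| <= `|A'| + `|a| * c * (t * `|D|) + `|A|.
Proof.
move=> dc t0; apply: le_trans (ler_normD _ _) _.
rewrite [leRHS]addrAC; apply: lerD; first by rewrite addrC ler_normD.
by rewrite !normrM (ger0_norm t0) ler_wpM2r ?mulr_ge0// ler_wpM2l.
Qed.

Section Segment.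
Variables (K : plane -> R) (B : R) (X M : plane) (h : R).
Hypotheses (mK : measurable_fun [set: mplane] (K : mplane -> R)) (K0 : forall Y, 0 <= K Y) (KB : forall Y, K Y <= B).
Hypotheses (h1 : `|(M - X).1| <= h) (h2 : `|(M - X).2| <= h).

Let k (c : R) (t : mR) : R := c * ((1 - t) * K (seg_pt X M t)).

Let mk c : measurable_fun [set: mR] (k c).
Proof.
apply: measurable_funM => //; apply: measurable_funM.
  by apply: measurable_funB => //.
exact: (measurableT_comp mK (measurableT_comp (measurable_seg_pt M) (@pair1_measurable _ _ mplane mR X))).
Qed.

Let segi (a b c : R) := (\int[leb]_(t in `]a, b[) (k c t)%:E)%E.

Let segiZ a b c : 0 <= c -> 0 <= a -> b <= 1 -> (segi a b c = c%:E * segi a b 1)%E.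
Proof.
move=> c0 a0 b1; rewrite /segi -ge0_integralZl_EFin//.
- by apply: eq_integral => t _; rewrite /k mul1r EFinM.
- move=> t /=; rewrite in_itv /= => /andP[t0 t1]; rewrite lee_fin /k mul1r mulr_ge0// subr_ge0.
  by apply: le_trans b1; exact: ltW.
- by apply/measurable_EFinP; exact: measurable_funTS.
Qed.

Let segi_le a b c c' : 0 <= c -> c <= c' -> 0 <= a -> b <= 1 -> (segi a b c <= segi a b c')%E.
Proof.
move=> c0 cc a0 b1; rewrite (segiZ c0 a0 b1) (segiZ (le_trans c0 cc) a0 b1).
apply: lee_wpmul2r; last by rewrite lee_fin.
apply: integral_ge0 => t /=; rewrite in_itv /= => /andP[t0' t1'].
rewrite lee_fin /k mul1r mulr_ge0// subr_ge0; apply: le_trans b1; exact: ltW.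
Qed.

Let segi_sum c t0 : 0 <= c -> 0 <= t0 -> t0 <= 1 ->
  (segi 0 t0 c + segi t0 1 c <= (c * seg_avg K M X)%:E)%E.
Proof.
move=> c0 t00 t01.
have -> : ((c * seg_avg K M X)%:E = \int[leb]_(t in I01) (k c t)%:E)%E.
  rewrite EFinM (seg_avg_EFin M mK K0 KB) -ge0_integralZl_EFin//.
  - exact: measurable_I01.
  - move=> t; rewrite /I01 /= in_itv /= => /andP[u0 u1].
    by rewrite lee_fin mulr_ge0// subr_ge0.
  - apply/measurable_EFinP; apply: measurable_funTS.
    by have := mk 1; rewrite /k; under eq_fun do rewrite mul1r.
rewrite /segi -ge0_integral_setU//.
- apply: ge0_subset_integral => //.
  + exact: measurableU.
  + exact: measurable_I01.
  + by apply/measurable_EFinP; exact: measurable_funTS.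
  + move=> t; rewrite /I01 /= in_itv /= => /andP[u0 u1].
    by rewrite lee_fin /k mulr_ge0// mulr_ge0// subr_ge0.
  + move=> t [] /=; rewrite /I01 /= !in_itv /= => /andP[/ltW u0 /ltW u1].
      by rewrite u0 (le_trans u1).
    by rewrite u1 (le_trans t00).
- by apply/measurable_EFinP; exact: measurable_funTS.
- move=> t [] /=; rewrite in_itv /= => /andP[u0 u1]; rewrite lee_fin /k mulr_ge0// mulr_ge0// subr_ge0 ltW//.
  exact: lt_le_trans t01.
- rewrite disj_set2E; apply/eqP/seteqP; split => t //= [].
  by rewrite !in_itv /= => /andP[u0 u1] /andP[u2 u3]; have := lt_trans u1 u2; rewrite ltxx.
Qed.

Let hh0 : 0 <= h. Proof. exact: le_trans h1. Qed.

Let tangent_increment U a b : Ck 2 U -> 0 <= a -> a <= b -> b <= 1 ->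
  (forall t, a < t < b -> hess_norm U (seg_pt X M t) <= K (seg_pt X M t)) ->
  (`|tangent_at U X M b - tangent_at U X M a|%:E <= segi a b (2 * h ^+ 2))%E.
Proof.
move=> cU a0 ab b1 HK.
apply: (FTC_bound ab (fun t => tangent_at_is_derive X M t cU)).
- move=> t; apply: cvgM; first by apply: cvgB; [exact: cvg_cst|exact: cvg_id].
  exact: (@hess_continuous U (seg_pt X M) (M - X) (M - X) cU (@continuous_seg_pt X M) t).
- exact: mk.
- move=> t /andP[at' tb]; have t1 : 0 <= 1 - t by rewrite subr_ge0; apply: le_trans b1; exact: ltW.
  rewrite normrM (ger0_norm t1) /k mulrCA ler_wpM2l//.
  apply: le_trans (hess_bound _ _ h1 h2 h1 h2) _.
  rewrite expr2 ler_wpM2l ?mulr_ge0//; apply: HK; by rewrite at'.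
Qed.

(** Before [b] the factor [1 - b] is at most [1 - t], so the increment of the gradient is controlled
    by the same weighted integral as the Taylor remainder, with one factor [h] fewer. *)
Let grad_increment U w b : Ck 2 U -> `|w.1| <= 1 -> `|w.2| <= 1 -> 0 <= b -> b <= 1 ->
  (forall t, 0 < t < b -> hess_norm U (seg_pt X M t) <= K (seg_pt X M t)) ->
  (((1 - b) * `|dot (grad U (seg_pt X M b)) w - dot (grad U X) w|)%:E <= segi 0 b (2 * h))%E.
Proof.
move=> cU w1 w2 b0 b1 HK.
have d t : is_derive t (1 : R) (fun s => (1 - b) * dot (grad U (seg_pt X M s)) w)
    ((1 - b) * hess U (seg_pt X M t) (M - X) w).
  exact: (is_deriveZ (1 - b) (dot_grad_line X (M - X) w t cU)).
have bb : 0 <= 1 - b by rewrite subr_ge0.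
have := FTC_bound (k := k (2 * h)) b0 d.
rewrite -mulrBr normrM (ger0_norm bb) /seg_pt scale0r addr0; apply.
- move=> t; apply: cvgM; first exact: cvg_cst.
  exact: (@hess_continuous U (seg_pt X M) (M - X) w cU (@continuous_seg_pt X M) t).
- exact: mk.
- move=> t /andP[t0 tb]; rewrite normrM (ger0_norm bb) /k mulrCA.
  apply: ler_pM => //; first by rewrite lerD2l lerN2 ltW.
  apply: le_trans (hess_bound _ _ h1 h2 w1 w2) _.
  by rewrite mulr1 ler_wpM2l ?mulr_ge0//; apply: HK; rewrite t0.
Qed.

(** The bound on the second derivatives may fail at the single parameter [t0], where the segment can
    touch the interface without changing side; the remainder is split there. *)
Lemma Taylor_same U t0 : Ck 2 U -> 0 <= t0 -> t0 <= 1 ->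
  (forall t, 0 < t < 1 -> t != t0 -> hess_norm U (seg_pt X M t) <= K (seg_pt X M t)) ->
  `|U M - (U X + dot (grad U X) (M - X))| <= 2 * h ^+ 2 * seg_avg K M X.
Proof.
move=> cU t00 t01 HK; rewrite -lee_fin.
have e0 : tangent_at U X M 0 = U X + dot (grad U X) (M - X).
  by rewrite /tangent_at /seg_pt scale0r addr0 subr0 mul1r.
have e1 : tangent_at U X M 1 = U M.
  by rewrite /tangent_at /seg_pt scale1r subrr mul0r addr0 addrC subrK.
have c0 : 0 <= 2 * h ^+ 2 by rewrite mulr_ge0// sqr_ge0.
apply: le_trans (segi_sum c0 t00 t01).
rewrite -e0 -e1.
have i1 := tangent_increment cU (lexx 0) t00 t01.
have i2 := tangent_increment cU t00 t01 (lexx 1).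
apply: le_trans (leeD (i1 _) (i2 _)).
- by rewrite -EFinD lee_fin [leRHS]addrC; exact: ler_distD.
- move=> t /andP[a b]; apply: HK; last by rewrite lt_eqF.
  by rewrite a /=; exact: lt_le_trans t01.
- move=> t /andP[a b]; apply: HK; last by rewrite gt_eqF.
  by rewrite b andbT; exact: le_lt_trans a.
Qed.

(** At the crossing point [Y] the gradient jumps only along [n], by the factor [r] on the normal
    derivative. The remainder consists of one Taylor remainder on each part and of the change of the
    normal derivative between [X] and [Y]. *)
Lemma Taylor_cross U1 U2 t0 n r : Ck 2 U1 -> Ck 2 U2 -> 0 <= t0 -> t0 <= 1 ->
  `|n.1| <= 1 -> `|n.2| <= 1 ->
  let Y := seg_pt X M t0 in
  U1 Y = U2 Y ->
  (forall w, dot (grad U2 Y) w = dot (grad U1 Y) w + (r - 1) * dot (grad U1 Y) n * dot n w) ->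
  (forall t, 0 < t < t0 -> hess_norm U1 (seg_pt X M t) <= K (seg_pt X M t)) ->
  (forall t, t0 < t < 1 -> hess_norm U2 (seg_pt X M t) <= K (seg_pt X M t)) ->
  `|U2 M - (U1 X + dot (grad U1 X) (M - X) + (r - 1) * dot (grad U1 X) n * dot n (M - Y))|
    <= (2 + 4 * `|r - 1|) * h ^+ 2 * seg_avg K M X.
Proof.
move=> cU1 cU2 t00 t01 n1 n2 Y UY gY HK1 HK2.
have MY : M - Y = (1 - t0) *: (M - X).
  by rewrite /Y /seg_pt opprD addrA scalerBl scale1r.
have e0 : tangent_at U1 X M 0 = U1 X + dot (grad U1 X) (M - X).
  by rewrite /tangent_at /seg_pt scale0r addr0 subr0 mul1r.
have e1 : tangent_at U2 X M 1 = U2 M.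
  by rewrite /tangent_at /seg_pt scale1r subrr mul0r addr0 addrC subrK.
have dMY w : dot w (M - Y) = (1 - t0) * dot w (M - X).
  by rewrite MY dotZr.
(* [A] and [A'] are the remainders beyond and before the crossing, [D] is the change of the normal
   derivative from [X] to [Y]. The factor [1 - t0] of [D] comes from [M - Y = (1 - t0) (M - X)]. *)
pose A := tangent_at U2 X M 1 - tangent_at U2 X M t0.
pose A' := tangent_at U1 X M t0 - tangent_at U1 X M 0.
pose D := dot (grad U1 Y) n - dot (grad U1 X) n.
have -> : U2 M - (U1 X + dot (grad U1 X) (M - X) + (r - 1) * dot (grad U1 X) n * dot n (M - Y))
   = A + A' + (r - 1) * dot n (M - X) * ((1 - t0) * D).
  rewrite /A /A' /D e0 e1 /tangent_at -/Y -UY gY dMY; ring.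
have i1 : (`|A'|%:E <= segi 0 t0 (2 * h ^+ 2))%E.
  exact: (tangent_increment cU1 (lexx 0) t00 t01).
have i2 : (`|A|%:E <= segi t0 1 (2 * h ^+ 2))%E.
  exact: (tangent_increment cU2 t00 t01 (lexx 1)).
have i3 : (((1 - t0) * `|D|)%:E <= segi 0 t0 (2 * h))%E.
  exact: (grad_increment cU1 n1 n2 t00 t01).
have ndot : `|dot n (M - X)| <= 2 * h.
  rewrite /dot mulr_natl mulr2n; apply: le_trans (ler_normD _ _) _; apply: lerD; rewrite normrM.
    by rewrite -[leRHS]mul1r ler_pM.
  by rewrite -[leRHS]mul1r ler_pM.
have r0 : 0 <= `|r - 1| by [].
have c0 : 0 <= (2 + 4 * `|r - 1|) * h ^+ 2 by rewrite mulr_ge0 ?sqr_ge0// addr_ge0// mulr_ge0.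
rewrite -lee_fin; apply: le_trans (segi_sum c0 t00 t01).
have tt : 0 <= 1 - t0 by rewrite subr_ge0.
apply: (@le_trans _ _ ((`|A'| + `|r - 1| * (2 * h) * ((1 - t0) * `|D|))%:E + `|A|%:E)%E).
  rewrite -EFinD lee_fin; exact: norm_sum3_le.
apply: leeD.
  rewrite EFinD EFinM.
  rewrite (segiZ c0 (lexx 0) t01).
  rewrite (segiZ _ (lexx 0) t01) in i1; last by rewrite mulr_ge0 ?sqr_ge0.
  rewrite (segiZ _ (lexx 0) t01) in i3; last by rewrite mulr_ge0.
  have -> : (2 + 4 * `|r - 1|) * h ^+ 2 = 2 * h ^+ 2 + `|r - 1| * (2 * h) * (2 * h) by ring.
  rewrite EFinD ge0_muleDl ?lee_fin ?mulr_ge0 ?sqr_ge0//; apply: leeD => //.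
  rewrite [X in (_ <= X * _)%E]EFinM -muleA; apply: lee_wpmul2l => //.
  by rewrite lee_fin !mulr_ge0.
apply: le_trans i2 _.
apply: segi_le => //; first by rewrite mulr_ge0 ?sqr_ge0.
by rewrite ler_wpM2r ?sqr_ge0// lerDl mulr_ge0.
Qed.

End Segment.
End Taylor.

(** * Shape polynomials *)

Ltac clear_props :=
  repeat match goal with H : ?A |- _ => match type of A with Prop => clear H end end.
Ltac lra_goal := clear_props; lra.

Section ShapePolynomials.
Context {R : realType}.
Local Notation plane := (R * R)%type.
Implicit Types (ft : fe_type) (p q : shape_poly R) (X v : plane).

Definition pgrad ft p X : plane :=
  match ft with
  | FE_bilinear => (cx p + cd p * X.2, cy p + cd p * X.1)
  | FE_rotated_Q1 => (cx p + cd p * (2 * X.1), cy p - cd p * (2 * X.2))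
  | _ => (cx p, cy p)
  end.

Lemma is_derive_quad (a b c x : R) :
  is_derive x (1 : R) (fun t => a + b * t + c * t ^+ 2) (b + c * (2 * x)).
Proof.
have := is_deriveD (is_deriveD (is_derive_cst a x 1) (is_deriveZ b (is_derive_id x (1 : R))))
  (is_deriveZ c (is_deriveX 2 (is_derive_id x (1 : R)))).
by move=> h; apply: is_derive_eq h _; rewrite /GRing.scale /= expr1; ring.
Qed.

Lemma peval_is_derive ft (p : shape_poly R) X :
  is_derive X ex (peval ft p) (pgrad ft p X).1 /\ is_derive X ey (peval ft p) (pgrad ft p X).2.
Proof.
pose a1 := c0 p + cy p * X.2 + (if ft is FE_rotated_Q1 then - cd p * X.2 ^+ 2 else 0).
pose b1 := cx p + (if ft is FE_bilinear then cd p * X.2 else 0).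
pose c1 := if ft is FE_rotated_Q1 then cd p else 0.
pose a2 := c0 p + cx p * X.1 + (if ft is FE_rotated_Q1 then cd p * X.1 ^+ 2 else 0).
pose b2 := cy p + (if ft is FE_bilinear then cd p * X.1 else 0).
split; [apply/is_derive_exP|apply/is_derive_eyP].
- have -> : (fun x => peval ft p (x, X.2)) = (fun t => a1 + b1 * t + c1 * t ^+ 2).
    by apply: funext => x; rewrite /peval /quad_term /a1 /b1 /c1 /=; case: (ft); ring.
  apply: is_derive_eq (is_derive_quad a1 b1 c1 X.1) _.
  by rewrite /pgrad /b1 /c1; case: (ft) => /=; ring.
- have -> : (fun y => peval ft p (X.1, y)) = (fun t => a2 + b2 * t + - c1 * t ^+ 2).
    by apply: funext => x; rewrite /peval /quad_term /a2 /b2 /c1 /=; case: (ft); ring.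
  apply: is_derive_eq (is_derive_quad a2 b2 (- c1) X.2) _.
  by rewrite /pgrad /b2 /c1; case: (ft) => /=; ring.
Qed.

Lemma grad_peval ft p X : grad (peval ft p) X = pgrad ft p X.
Proof.
by have [[_ e1] [_ e2]] := peval_is_derive ft p X; rewrite /grad e1 e2 -surjective_pairing.
Qed.

Definition padd p q : shape_poly R :=
  ShapePoly (c0 p + c0 q) (cx p + cx q) (cy p + cy q) (cd p + cd q).
Definition pscale (a : R) p : shape_poly R :=
  ShapePoly (a * c0 p) (a * cx p) (a * cy p) (a * cd p).

Lemma peval_padd ft p q X : peval ft (padd p q) X = peval ft p X + peval ft q X.
Proof. by rewrite /peval /=; ring. Qed.

Lemma peval_pscale ft a p X : peval ft (pscale a p) X = a * peval ft p X.
Proof. by rewrite /peval /=; ring. Qed.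

Lemma pgrad_padd ft p q X v :
  dot (pgrad ft (padd p q) X) v = dot (pgrad ft p X) v + dot (pgrad ft q X) v.
Proof. by rewrite /dot /pgrad; case: ft => /=; ring. Qed.

Lemma pgrad_pscale ft a p X v : dot (pgrad ft (pscale a p) X) v = a * dot (pgrad ft p X) v.
Proof. by rewrite /dot /pgrad; case: ft => /=; ring. Qed.

Definition psum n (a : 'I_n -> R) (p : 'I_n -> shape_poly R) : shape_poly R :=
  \big[padd/ShapePoly 0 0 0 0]_(i < n) pscale (a i) (p i).

Lemma peval_psum ft n (a : 'I_n -> R) (p : 'I_n -> shape_poly R) X :
  peval ft (psum a p) X = \sum_i a i * peval ft (p i) X.
Proof.
rewrite /psum; apply: (big_ind2 (fun P x => peval ft P X = x)).
- by rewrite /peval /=; ring.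
- by move=> ? ? ? ? <- <-; exact: peval_padd.
- by move=> i _; exact: peval_pscale.
Qed.

Lemma pgrad_psum ft n (a : 'I_n -> R) (p : 'I_n -> shape_poly R) X v :
  dot (pgrad ft (psum a p) X) v = \sum_i a i * dot (pgrad ft (p i) X) v.
Proof.
rewrite /psum; apply: (big_ind2 (fun P x => dot (pgrad ft P X) v = x)).
- by rewrite /dot /pgrad; case: ft => /=; ring.
- by move=> ? ? ? ? <- <-; exact: pgrad_padd.
- by move=> i _; exact: pgrad_pscale.
Qed.

Lemma cd_psum n (a : 'I_n -> R) (p : 'I_n -> shape_poly R) : cd (psum a p) = \sum_i a i * cd (p i).
Proof. by rewrite /psum; apply: (big_ind2 (fun P x => cd P = x)) => // ? ? ? ? <- <-. Qed.

Definition plin (D n : plane) : shape_poly R := ShapePoly (- dot D n) n.1 n.2 0.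

Lemma peval_plin ft D n X : peval ft (plin D n) X = dot (X - D) n.
Proof.
rewrite /peval /plin /dot; have -> : (X - D).1 = X.1 - D.1 by [].
have -> : (X - D).2 = X.2 - D.2 by [].
by rewrite /= mul0r addr0; ring.
Qed.

Lemma pgrad_plin ft D n X : pgrad ft (plin D n) X = n.
Proof. by rewrite /pgrad; case: ft; case: n => a b //=; rewrite !mul0r ?subr0 ?addr0. Qed.

(** An affine function that vanishes on a line is a multiple of the signed distance to it. It is
    applied to the difference of the two pieces of an IFE function, whose second degree terms
    cancel. *)
Lemma peval_vanish_line ft p D n t : (triangular ft \/ cd p = 0) ->
  dot n n = 1 -> dot t t = 1 -> dot n t = 0 ->
  (forall s, peval ft p (D + s *: t) = 0) ->
  exists c, (forall X, peval ft p X = c * dot (X - D) n) /\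
    forall X v, dot (pgrad ft p X) v = c * dot n v.
Proof.
move=> hp nn tt nt Hp.
have cdq X : cd p * quad_term ft X = 0.
  by case: hp => [|->]; rewrite ?mul0r// /quad_term; case: ft Hp => //; rewrite mulr0.
have pg X : pgrad ft p X = (cx p, cy p).
  rewrite /pgrad; case: hp => [|->]; case: ft {Hp cdq} => //=; by rewrite !mul0r ?subr0 ?addr0.
have E X : peval ft p X = c0 p + cx p * X.1 + cy p * X.2 by rewrite /peval cdq addr0.
have p0 := Hp 0; have p1 := Hp 1.
rewrite scale0r addr0 E in p0; rewrite scale1r E /= in p1.
have gt : cx p * t.1 + cy p * t.2 = 0 by lra.
(* The matrix with rows [n] and [t] is orthogonal, so its columns are orthonormal as well; its
   determinant squares to 1. *)
have orth : t.1 ^+ 2 + n.1 ^+ 2 = 1 /\ t.2 ^+ 2 + n.2 ^+ 2 = 1 /\ t.1 * t.2 + n.1 * n.2 = 0.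
  move: nn tt nt; rewrite /dot; case: n => a b; case: t {Hp p1 gt} => c d /= nn tt nt.
  have h1 : (a * d - b * c) ^+ 2 = 1.
    have -> : (a * d - b * c) ^+ 2 = (a*a+b*b)*(c*c+d*d) - (a*c+b*d)^+2 by ring.
    by rewrite nn tt nt; ring.
  have cE : c = - b * (a * d - b * c).
    have -> : - b * (a * d - b * c) = c * (a*a+b*b) - a * (a*c+b*d) by ring.
    by rewrite nn nt; ring.
  have dE : d = a * (a * d - b * c).
    have -> : a * (a * d - b * c) = d * (a*a+b*b) - b * (a*c+b*d) by ring.
    by rewrite nn nt; ring.
  set e := a * d - b * c in h1 cE dE.
  rewrite cE dE; split; [|split].
  - have -> : (- b * e) ^+ 2 + a ^+ 2 = b * b * e ^+ 2 + a * a by ring.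
    by rewrite h1; lra.
  - have -> : (a * e) ^+ 2 + b ^+ 2 = a * a * e ^+ 2 + b * b by ring.
    by rewrite h1; lra.
  - have -> : - b * e * (a * e) + a * b = a * b * (1 - e ^+ 2) by ring.
    by rewrite h1; ring.
have [u1 [u2 u3]] := orth.
pose c := cx p * n.1 + cy p * n.2.
have c1 : cx p = c * n.1.
  have -> : c * n.1 = cx p * (t.1^+2 + n.1 ^+2) + cy p * (t.1 * t.2 + n.1 * n.2) - t.1 * (cx p * t.1 + cy p * t.2) by rewrite /c; ring.
  by rewrite u1 u3 gt; ring.
have c2 : cy p = c * n.2.
  have -> : c * n.2 = cy p * (t.2^+2 + n.2 ^+2) + cx p * (t.1 * t.2 + n.1 * n.2) - t.2 * (cx p * t.1 + cy p * t.2) by rewrite /c; ring.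
  by rewrite u2 u3 gt; ring.
exists c; split.
  move=> X; rewrite E /dot c1 c2.
  have -> : c0 p = - (c * n.1) * D.1 - c * n.2 * D.2 by rewrite -c1 -c2; lra.
  by rewrite /=; ring.
by move=> X v; rewrite pg /dot /= c1 c2; ring.
Qed.

Definition refnode ft (i : nat) : plane :=
  match ft with
  | FE_linear | FE_bilinear => ref_vertex i
  | FE_crouzeix_raviart => match i with 0 => (2^-1, 0) | 1 => (1, 2^-1) | _ => (2^-1, 2^-1) end
  | FE_rotated_Q1 =>
    match i with 0 => (2^-1, 0) | 1 => (1, 2^-1) | 2 => (2^-1, 1) | _ => (0, 2^-1) end
  end.

Lemma node_emap ft h T (i : 'I_(nv ft)) : node h T i = emap h T (refnode ft i).
Proof.
have E (a b c d r : R) : c + d = 2 * r -> 2^-1 *: (a + b * c + (a + b * d)) = a + b * r.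
  move=> cd; rewrite -[LHS]/(2^-1 * (_ + _)); have -> : c = 2 * r - d by rewrite -cd addrK.
  by field.
case: ft i => i //=; rewrite /vertex /next_vertex; case: i => -[|[|[|[|//]]]] //= ?;
  rewrite /emap /modn /=; apply/pair_equal_spec; split; apply: E; by field.
Qed.

(** The basis dual to evaluation at the nodes [refnode ft i], on which [nodal_expansion] rests. *)
Definition lam ft (i : nat) : shape_poly R :=
  match ft with
  | FE_linear => match i with 0 => ShapePoly 1 (-1) 0 0 | 1 => ShapePoly 0 1 (-1) 0 | _ => ShapePoly 0 0 1 0 end
  | FE_crouzeix_raviart => match i with 0 => ShapePoly 1 0 (-2) 0 | 1 => ShapePoly (-1) 2 0 0 | _ => ShapePoly 1 (-2) 2 0 end
  | FE_bilinear => match i with 0 => ShapePoly 1 (-1) (-1) 1 | 1 => ShapePoly 0 1 0 (-1) | 2 => ShapePoly 0 0 0 1 | _ => ShapePoly 0 0 1 (-1) end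
  | FE_rotated_Q1 => match i with 0 => ShapePoly (3/4) 1 (-2) (-1) | 1 => ShapePoly (-(1/4)) 0 1 1
     | 2 => ShapePoly (-(1/4)) 1 0 (-1) | _ => ShapePoly (3/4) (-2) 1 1 end
  end.

Lemma nodal_expansion ft p X :
  peval ft p X = \sum_(i < nv ft) peval ft p (refnode ft i) * peval ft (lam ft i) X.
Proof.
case: ft; rewrite !big_ord_recl big_ord0 /= /peval /quad_term /=; by field.
Qed.

Lemma nodal_expansion_grad ft p X v :
  dot (pgrad ft p X) v =
  \sum_(i < nv ft) peval ft p (refnode ft i) * dot (pgrad ft (lam ft i) X) v.
Proof.
case: ft; rewrite !big_ord_recl big_ord0 /= /peval /quad_term /dot /pgrad /=; by field.
Qed.

Lemma itv01_mul (x y : R) : 0 <= x <= 1 -> 0 <= y <= 1 -> 0 <= x * y <= 1.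
Proof.
move=> /andP[x0 x1] /andP[y0 y1]; rewrite mulr_ge0//=.
by rewrite -[leRHS]mulr1 ler_pM.
Qed.

Lemma lam_bound ft (i : 'I_(nv ft)) X : ref_set ft X -> `|peval ft (lam ft i) X| <= 1.
Proof.
rewrite /ref_set ler_norml; case: ft i => /= i; case: i => -[|[|[|[|//]]]] //= _;
  rewrite /peval /quad_term /=; case: X => x y /=.
all: move=> [] || move=> [/andP[x0 x1] /andP[y0 y1]].
all: try (by move=> a /andP[b c]; apply/andP; split; lra).
all: move=> xb yb; have := (xb, yb) => -[/andP[x0 x1] /andP[y0 y1]].
all: have xc : 0 <= 1 - x <= 1 by apply/andP; split; lra.
all: have yc : 0 <= 1 - y <= 1 by apply/andP; split; lra.
- by have /andP[? ?] := itv01_mul xc yc; apply/andP; split; lra.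
- by have /andP[? ?] := itv01_mul xb yc; apply/andP; split; lra.
- by have /andP[? ?] := itv01_mul xb yb; apply/andP; split; lra.
- by have /andP[? ?] := itv01_mul xc yb; apply/andP; split; lra.
all: have s1 := sqr_ge0 (x - 1 / 2); have s2 := sqr_ge0 (y - 1 / 2).
all: have /andP[m1 _] := itv01_mul xb xc; have /andP[m2 _] := itv01_mul yb yc.
all: apply/andP; split; lra.
Qed.

Lemma pgrad_lam_bound ft (i : 'I_(nv ft)) X : ref_set ft X ->
  `|(pgrad ft (lam ft i) X).1| <= 2 /\ `|(pgrad ft (lam ft i) X).2| <= 2.
Proof.
rewrite /ref_set; case: ft i => /= i; case: i => -[|[|[|[|//]]]] //= _; case: X => x y /=.
all: move=> [/andP[a b] /andP[c d]] || move=> [a /andP[b c]].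
all: split; rewrite ler_norml; apply/andP; split; lra.
Qed.

End ShapePolynomials.

(** * The slope of the interpolated distance to the chord *)

Section ReferenceElement.
Context {R : realType}.
Local Notation plane := (R * R)%type.
Local Notation pos x := (Num.max x 0).

Lemma posE (x : R) : 0 <= x -> pos x = x.
Proof. by move=> ?; rewrite max_l. Qed.

Lemma posN (x : R) : x <= 0 -> pos x = 0.
Proof. by move=> ?; rewrite max_r. Qed.

Lemma pos_ge0 (x : R) : 0 <= pos x.
Proof. by rewrite le_max lexx orbT. Qed.

Lemma pos_le (x c : R) : 0 <= c -> x <= c -> pos x <= c.
Proof. by move=> c0 xc; rewrite ge_max xc. Qed.

Lemma pos_sub (x : R) : pos x - pos (- x) = x.
Proof.
by case/orP: (le_total 0 x) => x0; [rewrite posE// posN ?oppr_le0//; lra|rewrite (posN x0) posE; lra].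
Qed.

(** The positive part is nondecreasing and 1-Lipschitz; this form keeps the sign of [d], which a
    bound on absolute values would lose. *)
Lemma pos_diff (a d : R) : exists2 th, 0 <= th <= 1 & pos (a + d) - pos a = th * d.
Proof.
have [->|d0] := eqVneq d 0.
  by exists 0; rewrite ?lexx ?ler01// addr0 subrr mulr0.
exists ((pos (a + d) - pos a) / d); last by rewrite divfK.
have [dp|dn|E] := ltgtP d 0; last by rewrite E eqxx in d0.
- case/orP: (le_total 0 a) => a0; case/orP: (le_total 0 (a + d)) => ad.
  + by rewrite !posE// addrC addrA addNr add0r divff//= ler01 lexx.
  + rewrite (posN ad) (posE a0) sub0r -[d]opprK invrN mulrNN divr_ge0//=; last lra.
    rewrite ler_pdivrMr; lra.
  + have -> : pos (a + d) = 0 by rewrite posN//; lra.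
    by rewrite posN// subrr mul0r lexx ler01.
  + by rewrite !posN// subrr mul0r lexx ler01.
- case/orP: (le_total 0 a) => a0; case/orP: (le_total 0 (a + d)) => ad.
  + by rewrite !posE// addrC addrA addNr add0r divff//= ler01 lexx.
  + have -> : pos a = 0 by rewrite posN//; lra.
    by rewrite posN// subrr mul0r lexx ler01.
  + rewrite (posN a0) (posE ad) subr0 divr_ge0//=; last lra.
    rewrite ler_pdivrMr; lra.
  + by rewrite !posN// subrr mul0r lexx ler01.
Qed.

(** * IFE functions in terms of their nodal values *)

Section Core.
Variables (ft : fe_type) (D n t F nu : plane) (rho a0 g : R) (side : 'I_(nv ft) -> bool).
Let L i := dot (refnode ft i - D) n.
Definition IFE_slope : R := \sum_(i < nv ft) pos (L i) * dot (pgrad ft (lam ft i) F) nu.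
Let Den := 1 - (1 - rho) * IFE_slope.

(** Interpolation reproduces the affine function L, whose slope along [nu] is 1, and L is the
    difference of the positive parts of L and [- L]. Hence lower bounds for [1 - S] only involve the
    nodes below the chord. *)
Lemma IFE_slopeN : dot n nu = 1 ->
  1 - IFE_slope = - \sum_(i < nv ft) pos (- L i) * dot (pgrad ft (lam ft i) F) nu.
Proof.
move=> nnu; have := nodal_expansion_grad ft (plin D n) F nu.
rewrite pgrad_plin nnu => ->; rewrite /IFE_slope -sumrB -sumrN; apply: eq_bigr => i _.
rewrite peval_plin -/(L i) -{1}(pos_sub (L i)); ring.
Qed.

Hypotheses (rho0 : 0 < rho) (rho1 : rho <= 1) (a00 : 0 < a0) (a01 : a0 <= 1)
  (g0 : 0 < g) (g1 : g <= 1).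
Hypotheses (nn : dot n n = 1) (tt : dot t t = 1) (nt : dot n t = 0) (nnu : dot n nu = 1).
Hypotheses (nu1 : `|nu.1| <= 2) (nu2 : `|nu.2| <= 2) (Fr : ref_set ft F).
Hypotheses (Lp2 : forall i : 'I_(nv ft), pos (L i) <= 2).
Hypotheses (Den1 : a0 * rho <= Den) (Den2 : forall i : 'I_(nv ft), a0 * g * pos (- L i) <= Den).
Hypotheses (side1 : forall i : 'I_(nv ft), 0 < L i -> side i)
  (side0 : forall i : 'I_(nv ft), L i < 0 -> ~~ side i).

(** The two pieces differ by [c] times L, so the nodal values are [y i - c * max (L i) 0] for the
    lower piece and [y i - c * max (- L i) 0] for the upper one. [Den1] bounds [c] itself, as the
    lower piece requires; the upper piece only needs the products bounded through [Den2]. The linear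
    functional [ell] will be the value or a partial derivative at a point, and
    [520 = 4 * 2 * (1 + 2 * 32)]. *)
Lemma IFE_core (phi : bool -> shape_poly R) (y : 'I_(nv ft) -> R) (Y : R)
    (ell : shape_poly R -> R) :
  (forall s, peval ft (phi false) (D + s *: t) = peval ft (phi true) (D + s *: t)) ->
  (~~ triangular ft -> cd (phi false) = cd (phi true)) ->
  rho * dot (pgrad ft (phi false) F) nu = dot (pgrad ft (phi true) F) nu ->
  (forall i, peval ft (phi (side i)) (refnode ft i) = y i) ->
  (forall i, `|y i| <= Y) ->
  (forall p, ell p = \sum_(i < nv ft) peval ft p (refnode ft i) * ell (lam ft i)) ->
  (forall i : 'I_(nv ft), `|ell (lam ft i)| <= 2) ->
  a0 * rho * `|ell (phi false)| <= 520 * Y /\ a0 * g * `|ell (phi true)| <= 520 * Y.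
Proof.
move=> Hl Hd Hf Hn yY lE l2.
have nv4 : (nv ft)%:R <= 4 :> R by rewrite /nv; case: triangular; rewrite ler_nat.
have Y0 : 0 <= Y by apply: le_trans (yY (Ordinal (nv_gt0 ft))).
pose d := padd (phi true) (pscale (-1) (phi false)).
have d0 : triangular ft \/ cd d = 0.
  by case: (boolP (triangular ft)) => [|/Hd E]; [left|right; rewrite /d /= E mulN1r subrr].
have dl s : peval ft d (D + s *: t) = 0 by rewrite /d peval_padd peval_pscale Hl mulN1r subrr.
have [c [cE cG]] := peval_vanish_line d0 nn tt nt dl.
have pE X : peval ft (phi true) X = peval ft (phi false) X + c * dot (X - D) n.
  by rewrite -cE /d peval_padd peval_pscale mulN1r addrC subrK.
have gE v : dot (pgrad ft (phi true) F) v = dot (pgrad ft (phi false) F) v + c * dot n v.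
  by rewrite -(cG F) /d pgrad_padd pgrad_pscale mulN1r addrC subrK.
have fE (i : 'I_(nv ft)) : peval ft (phi false) (refnode ft i) = y i - c * pos (L i).
  have := Hn i; case: (boolP (side i)) => si yi.
    have Li : 0 <= L i by rewrite leNgt; apply/negP => /side0; rewrite si.
    by rewrite posE// -yi pE addrK.
  have Li : L i <= 0 by rewrite leNgt; apply/negP => /side1; rewrite (negbTE si).
  by rewrite posN// mulr0 subr0.
have tE (i : 'I_(nv ft)) : peval ft (phi true) (refnode ft i) = y i - c * pos (- L i).
  by rewrite pE fE -/(L i) -{2}(pos_sub (L i)); ring.
pose q := \sum_(i < nv ft) y i * dot (pgrad ft (lam ft i) F) nu.
have qE : dot (pgrad ft (phi false) F) nu = q - c * IFE_slope.
  rewrite nodal_expansion_grad /q /IFE_slope mulr_sumr -sumrB; apply: eq_bigr => i _.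
  by rewrite fE mulrBl mulrA.
(* [q] is the slope at [F] of the interpolant of the data; the flux condition reads
   [rho (q - c S) = q - c S + c]. *)
have cDen : c * Den = (rho - 1) * q.
  by move: Hf; rewrite gE nnu qE /Den mulr1; move: IFE_slope => S H; lra.
have sum_le (z : 'I_(nv ft) -> R) (w : 'I_(nv ft) -> R) Z W : (forall i, `|z i| <= Z) ->
    (forall i, `|w i| <= W) -> 0 <= Z -> 0 <= W -> `|\sum_(i < nv ft) z i * w i| <= 4 * (Z * W).
  move=> zZ wW Z0 W0; apply: le_trans (ler_norm_sum _ _ _) _.
  apply: (@le_trans _ _ (\sum_(i < nv ft) Z * W)).
    by apply: ler_sum => i _; rewrite normrM ler_pM.
  by rewrite sumr_const card_ord -[leLHS]mulr_natl ler_wpM2r// mulr_ge0.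
have lamnu (i : 'I_(nv ft)) : `|dot (pgrad ft (lam ft i) F) nu| <= 8.
  have [b1 b2] := pgrad_lam_bound i Fr.
  have p (a b : R) : `|a| <= 2 -> `|b| <= 2 -> `|a * b| <= 4.
    move=> ? ?; rewrite normrM; have -> : 4 = 2 * 2 :> R by ring.
    exact: ler_pM.
  rewrite /dot; apply: le_trans (ler_normD _ _) _; have := p _ _ b1 nu1; have := p _ _ b2 nu2; lra.
(* At most four nodes, each contributing at most [8 * Y]. *)
have q32 : `|q| <= 32 * Y by have := sum_le _ _ _ _ yY lamnu Y0 (ler0n _ _); lra.
have Den0 : 0 < Den by apply: lt_le_trans Den1; exact: mulr_gt0.
have cD : `|c| * Den <= 32 * Y.
  rewrite -[Den]gtr0_norm// -normrM cDen normrM; apply: le_trans q32.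
  by apply: ler_piMl => //; rewrite distrC ger0_norm ?subr_ge0// gerBl ltW.
have c0 : 0 <= `|c| by [].
split.
  rewrite lE; under eq_bigr do rewrite fE.
  have b i : `|y i - c * pos (L i)| <= Y + `|c| * 2.
    apply: le_trans (ler_normB _ _) _; apply: lerD => //.
    by rewrite normrM ler_wpM2l// ger0_norm ?pos_ge0.
  have YC : 0 <= Y + `|c| * 2 by rewrite addr_ge0// mulr_ge0.
  have ar : 0 <= a0 * rho by rewrite mulr_ge0// ltW.
  have ar1 : a0 * rho <= 1 by rewrite mulr_ile1// ltW.
  have aY : a0 * rho * Y <= Y by rewrite ler_piMl.
  have ac : a0 * rho * `|c| <= 32 * Y by apply: le_trans cD; rewrite mulrC ler_wpM2l.
  have := ler_wpM2l ar (sum_le _ _ _ _ b l2 YC (ler0n _ _)).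
  lra.
rewrite lE; under eq_bigr do rewrite tE.
have ag : 0 <= a0 * g by rewrite mulr_ge0// ltW.
have ag1 : a0 * g <= 1 by rewrite mulr_ile1// ltW.
pose W := 32 * Y / (a0 * g).
have ag_gt : 0 < a0 * g by exact: mulr_gt0.
have b i : `|y i - c * pos (- L i)| <= Y + W.
  apply: le_trans (ler_normB _ _) _; apply: lerD => //.
  rewrite normrM (ger0_norm (pos_ge0 _)) /W ler_pdivlMr// -mulrA [_ * (a0 * g)]mulrC.
  by apply: le_trans cD; rewrite ler_wpM2l.
have W0 : 0 <= W by rewrite /W divr_ge0// mulr_ge0.
have YC : 0 <= Y + W by rewrite addr_ge0.
have := ler_wpM2l ag (sum_le _ _ _ _ b l2 YC (ler0n _ _)).
have WE : a0 * g * W = 32 * Y by rewrite /W mulrC divfK// gt_eqF.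
have : a0 * g * Y <= Y by rewrite ler_piMl.
lra.
Qed.

End Core.

(* On a triangle both partial derivatives of the affine interpolant of
   [max L 0] are differences of values of [max L 0] at points that differ
   along one axis, which are [th * n.i] with [th] in [0, 1]. *)
Lemma slope_triangle (n1 n2 p q : R) : n1 ^+ 2 + n2 ^+ 2 = 1 ->
  (exists2 th, 0 <= th <= 1 & p = th * n1) -> (exists2 th, 0 <= th <= 1 & q = th * n2) ->
  0 <= n1 * p + n2 * q <= 1 /\ p ^+ 2 + q ^+ 2 <= n1 * p + n2 * q.
Proof.
move=> nn [a /andP[a0 a1] ->] [b /andP[b0 b1] ->].
have s1 := sqr_ge0 n1; have s2 := sqr_ge0 n2.
have x1 : 0 <= a * n1 ^+ 2 by exact: mulr_ge0.
have x2 : 0 <= b * n2 ^+ 2 by exact: mulr_ge0.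
have y1 : a * n1 ^+ 2 <= n1 ^+ 2 by exact: ler_piMl.
have y2 : b * n2 ^+ 2 <= n2 ^+ 2 by exact: ler_piMl.
have z1 : a * (a * n1 ^+ 2) <= a * n1 ^+ 2 by exact: ler_piMl.
have z2 : b * (b * n2 ^+ 2) <= b * n2 ^+ 2 by exact: ler_piMl.
have E1 : (a * n1) ^+ 2 = a * (a * n1 ^+ 2) by ring.
have E2 : (b * n2) ^+ 2 = b * (b * n2 ^+ 2) by ring.
by split; [apply/andP; split|]; lra.
Qed.

(** The squared gradient of the affine interpolant of [max (- L) 0] is at most its normal slope
    [1 - S]. This interpolant vanishes at some vertex, so its other vertex values are differences
    along at most two legs. The resulting quadratic bound is the origin of the half power of [rho]
    for linear elements. *)
Lemma slope_linear (n1 n2 l1 l2 l3 x y : R) : n1 ^+ 2 + n2 ^+ 2 = 1 ->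
  l2 = l1 + n1 -> l3 = l2 + n2 -> 0 <= y -> y <= x -> x <= 1 ->
  (1 - x) * l1 + (x - y) * l2 + y * l3 = 0 ->
  let S := n1 * (pos l2 - pos l1) + n2 * (pos l3 - pos l2) in
  [/\ 0 <= S <= 1, pos (- l1) ^+ 2 <= 2 * (1 - S), pos (- l2) ^+ 2 <= 2 * (1 - S)
    & pos (- l3) ^+ 2 <= 2 * (1 - S)].
Proof.
move=> nn E2 E3 y0 yx x1 l0 S.
have e1 : exists2 th, 0 <= th <= 1 & pos l2 - pos l1 = th * n1 by rewrite E2; exact: pos_diff.
have e2 : exists2 th, 0 <= th <= 1 & pos l3 - pos l2 = th * n2 by rewrite E3; exact: pos_diff.
have [S1 _] := slope_triangle nn e1 e2.
have d1 : exists2 th, 0 <= th <= 1 & pos (- l1) - pos (- l2) = th * n1.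
  by have := pos_diff (- l2) n1; rewrite E2 opprD subrK.
have d2 : exists2 th, 0 <= th <= 1 & pos (- l2) - pos (- l3) = th * n2.
  by have := pos_diff (- l3) n2; rewrite E3 opprD subrK.
have [_] := slope_triangle nn d1 d2.
have -> : n1 * (pos (- l1) - pos (- l2)) + n2 * (pos (- l2) - pos (- l3)) = 1 - S.
  have p1 := pos_sub l1; have p2 := pos_sub l2; have p3 := pos_sub l3.
  have -> : pos (- l1) = pos l1 - l1 by lra.
  have -> : pos (- l2) = pos l2 - l1 - n1 by lra.
  have -> : pos (- l3) = pos l3 - l1 - n1 - n2 by lra.
  by rewrite /S -nn; ring.
(* The line passes through a point of the triangle, so a convex combination of the three distances
   is 0 and they cannot all be negative. *)
have zero : pos (- l1) = 0 \/ pos (- l2) = 0 \/ pos (- l3) = 0.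
  have [?|a1] := leP 0 l1; first by left; rewrite posN// oppr_le0.
  have [?|a2] := leP 0 l2; first by right; left; rewrite posN// oppr_le0.
  have [?|a3] := leP 0 l3; first by right; right; rewrite posN// oppr_le0.
  exfalso.
  pose m := Num.max l1 (Num.max l2 l3).
  have m0 : m < 0 by rewrite /m !gt_max a1 a2.
  have [m1 m2 m3] : [/\ l1 <= m, l2 <= m & l3 <= m] by rewrite /m !le_max !lexx !orbT.
  have b1 : (1 - x) * l1 <= (1 - x) * m by rewrite ler_wpM2l// subr_ge0.
  have b2 : (x - y) * l2 <= (x - y) * m by rewrite ler_wpM2l// subr_ge0.
  have b3 : y * l3 <= y * m by rewrite ler_wpM2l.
  lra.
move: (pos (- l1)) (pos (- l2)) (pos (- l3)) zero => m1 m2 m3 zero Hs.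
have aux (a b : R) : (a + b) ^+ 2 <= 2 * (a ^+ 2 + b ^+ 2).
  by have := sqr_ge0 (a - b); rewrite !expr2; lra.
have h1 := aux (m1 - m2) (m2 - m3).
have h2 := sqr_ge0 (m1 - m2); have h3 := sqr_ge0 (m2 - m3).
have e : (m1 - m2 + (m2 - m3)) = m1 - m3 by ring.
rewrite e in h1.
have i2 : (m2 - m1) ^+ 2 = (m1 - m2) ^+ 2 by ring.
have i3 : (m3 - m1) ^+ 2 = (m1 - m3) ^+ 2 by ring.
have i4 : (m3 - m2) ^+ 2 = (m2 - m3) ^+ 2 by ring.
case: zero => [z|[z|z]]; subst; rewrite ?subr0 ?sub0r ?sqrrN in h1 h2 h3 i2 i3 i4 Hs *; split => //; rewrite ?expr0n /=; try lra.
Qed.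


(** Minus the derivative at [(F1, F2)] in the direction [(v1, v2)] of the bilinear function with the
    given vertex values. For the values of [max (- L) 0] it equals [1 - S]. *)
Definition bil_slopeN (F1 F2 v1 v2 m00 m10 m11 m01 : R) : R :=
  v1 * ((1 - F2) * (m00 - m10) + F2 * (m01 - m11))
  + v2 * ((1 - F1) * (m00 - m01) + F1 * (m10 - m11)).

Definition on_square_bd (X : plane) : Prop := X.1 = 0 \/ X.1 = 1 \/ X.2 = 0 \/ X.2 = 1.

Lemma small_mul (b m f : R) : - (1 / 10) <= b -> b <= 1 / 10 -> 0 <= m -> 0 <= f -> f <= 1 ->
  - (m / 10) <= b * m * f /\ b * m * f <= m / 10.
Proof.
move=> b1 b2 m0 g0 g1.
have u1 : (b + 1 / 10) * (m * f) >= 0 by rewrite mulr_ge0 ?mulr_ge0//; lra.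
have u2 : (1 / 10 - b) * (m * f) >= 0 by rewrite mulr_ge0 ?mulr_ge0//; lra.
have u3 : m * f <= m by rewrite ler_piMr.
by split; lra.
Qed.

(** The bounds 1/10 on slope and height are what the condition on [kbar] for bilinear elements
    provides. The last group says that D and E share no side of the square. *)
Definition bil_config (D1 D2 E1 E2 n1 n2 w om : R) : Prop :=
  let F1 := (D1 + E1) / 2 + om * n1 in let F2 := (D2 + E2) / 2 + om * n2 in
  [/\ [/\ n1 ^+ 2 + n2 ^+ 2 = 1, `|w| <= 1 / 10, `|om| <= 1 / 10
        & (E1 - D1) * n1 + (E2 - D2) * n2 = 0],
      [/\ 0 <= D1 <= 1, 0 <= D2 <= 1, 0 <= E1 <= 1 & 0 <= E2 <= 1],
      0 <= F1 <= 1 /\ 0 <= F2 <= 1,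
      on_square_bd (D1, D2) /\ on_square_bd (E1, E2)
    & [/\ ~ (D1 = 0 /\ E1 = 0), ~ (D1 = 1 /\ E1 = 1), ~ (D2 = 0 /\ E2 = 0) & ~ (D2 = 1 /\ E2 = 1)]].

Section Bilinear.
Variables (D1 D2 E1 E2 n1 n2 w om : R).
Let l00 := - (D1 * n1 + D2 * n2).
Let F1 := (D1 + E1) / 2 + om * n1.
Let F2 := (D2 + E2) / 2 + om * n2.
Let v1 := n1 + w * n2.
Let v2 := n2 - w * n1.
Let T := bil_slopeN F1 F2 v1 v2 (pos (- l00)) (pos (- (l00 + n1))) (pos (- (l00 + n1 + n2)))
  (pos (- (l00 + n2))).

Lemma bil_config_bounds : bil_config D1 D2 E1 E2 n1 n2 w om -> 0 <= n1 -> 0 <= n2 ->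
  [/\ l00 + D1 * n1 + D2 * n2 = 0, l00 + E1 * n1 + E2 * n2 = 0,
      [/\ n1 <= 1, n2 <= 1 & 1 <= n1 + n2], - (1 / 10) <= w /\ w <= 1 / 10
    & - (1 / 10) <= om /\ om <= 1 / 10].
Proof.
move=> [[nn wb omb l] _ _ _ _] n10 n20.
have n1_le : n1 <= 1 by rewrite -(@expr_le1 _ 2)//; move: (sqr_ge0 n2) nn; lra_goal.
have n2_le : n2 <= 1 by rewrite -(@expr_le1 _ 2)//; move: (sqr_ge0 n1) nn; lra_goal.
split.
- by rewrite /l00; ring.
- by rewrite /l00 -l; ring.
- split=> //; have := ler_wpM2l n10 n1_le; have := ler_wpM2l n20 n2_le.
  by move: nn; rewrite !expr2; lra_goal.
- by move: wb; rewrite ler_norml => /andP[? ?].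
- by move: omb; rewrite ler_norml => /andP[? ?].
Qed.

(* only the lowest vertex is below the line *)
Lemma bil_one_below : bil_config D1 D2 E1 E2 n1 n2 w om -> 0 <= n1 -> 0 <= n2 ->
  l00 < 0 -> 0 <= l00 + n1 -> 0 <= l00 + n2 -> - l00 / 10 <= T.
Proof.
move=> H n10 n20 a0 a1 a2; have [lD lE [k1 k2 ks] [w1 w2] [z1 z2]] := bil_config_bounds H n10 n20.
have [_ [D1b D2b E1b E2b] [F1b F2b] [Dbd Ebd] [e1 e2 e3 e4]] := H.
have n1p : 0 < n1 by move: a0 a1; lra_goal.
have n2p : 0 < n2 by move: a0 a2; lra_goal.
have axis (x y : R) : 0 <= x <= 1 -> 0 <= y <= 1 -> l00 + x * n1 + y * n2 = 0 ->
    on_square_bd (x, y) -> x = 0 \/ y = 0.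
  move=> /andP[x0 x1] /andP[y0 y1] l /= [|[|[|]]] /= E; subst; [by left| | by right|].
    right; have : y * n2 <= 0 by move: l a1; lra_goal.
    by rewrite pmulr_lle0// => ?; apply/eqP; rewrite eq_le y0 andbT.
  left; have : x * n1 <= 0 by move: l a2; lra_goal.
  by rewrite pmulr_lle0// => ?; apply/eqP; rewrite eq_le x0 andbT.
have aD := axis _ _ D1b D2b lD Dbd; have aE := axis _ _ E1b E2b lE Ebd.
(* D and E lie on the two sides that meet at the lowest vertex, one on each, so each coordinate of
   their midpoint is half of a single coordinate. *)
have [c1 c2] : (D1 + E1) / 2 <= 1 / 2 /\ (D2 + E2) / 2 <= 1 / 2.
  move: D1b D2b E1b E2b => /andP[? d1] /andP[? d2] /andP[? d3] /andP[? d4].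
  by case: aD => aD; case: aE => aE; try (by exfalso; auto); move: aD aE d1 d2 d3 d4; clear_props => *; split; lra.
have q1 : om * n1 <= 1 / 10.
  by apply: (@le_trans _ _ (1 / 10 * n1)); [exact: ler_wpM2r|move: k1; lra_goal].
have q2 : om * n2 <= 1 / 10.
  by apply: (@le_trans _ _ (1 / 10 * n2)); [exact: ler_wpM2r|move: k2; lra_goal].
have f1 : 4 / 10 <= 1 - F1 by rewrite /F1; move: c1 q1; lra_goal.
have f2 : 4 / 10 <= 1 - F2 by rewrite /F2; move: c2 q2; lra_goal.
have f1' : 1 - F1 <= 1 by case/andP: F1b; rewrite -/F1; lra_goal.
have f2' : 1 - F2 <= 1 by case/andP: F2b; rewrite -/F2; lra_goal.
have nl : 0 <= - l00 by rewrite oppr_ge0 ltW.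
have a3 : - (l00 + n1 + n2) <= 0 by move: a1 n20; lra_goal.
have -> : T = - l00 * (v1 * (1 - F2) + v2 * (1 - F1)).
  by rewrite /T /bil_slopeN (posE nl) (posN a3) !posN ?oppr_le0//; ring.
apply: ler_wpM2l => //.
have h1 : 4 / 10 * n1 <= (1 - F2) * n1 by exact: ler_wpM2r.
have h2 : 4 / 10 * n2 <= (1 - F1) * n2 by exact: ler_wpM2r.
have g2 : 0 <= 1 - F2 by move: f2; lra_goal.
have g1 : 0 <= 1 - F1 by move: f1; lra_goal.
have [h3 h4] := small_mul w1 w2 n20 g2 f2'; have [h5 h6] := small_mul w1 w2 n10 g1 f1'.
by rewrite /v1 /v2; move: h1 h2 h3 h6 ks; lra_goal.
Qed.

(* the two lowest vertices are below the line *)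
Lemma bil_two_below : bil_config D1 D2 E1 E2 n1 n2 w om -> 0 <= n1 -> 0 <= n2 ->
  l00 + n1 < 0 -> 0 <= l00 + n2 -> - l00 / 10 <= T.
Proof.
move=> H n10 n20 a1 a2; have [lD lE [k1 k2 ks] [w1 w2] [z1 z2]] := bil_config_bounds H n10 n20.
have [[nn _ _ _] [D1b D2b E1b E2b] [F1b F2b] [Dbd Ebd] [e1 e2 e3 e4]] := H.
have n12 : n1 < n2 by move: a1 a2; lra_goal.
have n2p : 0 < n2 by exact: le_lt_trans n12.
have axis (x y : R) : 0 <= x <= 1 -> 0 <= y <= 1 -> l00 + x * n1 + y * n2 = 0 ->
    on_square_bd (x, y) -> x = 0 \/ x = 1 \/ y = 1.
  move=> /andP[x0 x1] /andP[y0 y1] l /= [|[|[|]]] /= E; subst; [by left|by right; left| |by right; right].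
  by exfalso; have xn : x * n1 <= n1; [rewrite ler_piMl|move: xn l a1; lra_goal].
have top (x y : R) : 0 <= x <= 1 -> 0 <= y <= 1 -> l00 + x * n1 + y * n2 = 0 -> y = 1 ->
    x = 0 \/ (n1 = 0 /\ l00 + n2 = 0).
  move=> /andP[x0 x1] _ l E; subst.
  have xn : 0 <= x * n1 by exact: mulr_ge0.
  have /eqP : x * n1 = 0 by move: xn l a2; lra_goal.
  by rewrite mulf_eq0 => /orP[/eqP|/eqP] z; [left|right; split=> //; move: l; rewrite z; lra_goal].
have aD := axis _ _ D1b D2b lD Dbd; have aE := axis _ _ E1b E2b lE Ebd.
have tD := top _ _ D1b D2b lD; have tE := top _ _ E1b E2b lE.
have onetop (y x : R) : n1 = 0 -> l00 + n2 = 0 -> l00 + x * n1 + y * n2 = 0 -> y = 1.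
  move=> z1' z2'; rewrite z1' mulr0 addr0 => l.
  have /eqP : (1 - y) * n2 = 0 by move: l z2'; lra_goal.
  by rewrite mulf_eq0 (gt_eqF n2p) orbF subr_eq0 => /eqP.
(* D and E lie on the two opposite vertical sides. A point of the chord on the top side is either
   the corner with abscissa 0, or the line contains the top side, which would put both D and E
   there. *)
have c1 : (D1 + E1) / 2 = 1 / 2.
  have sD : D1 = 0 \/ D1 = 1.
    case: aD => [|[|/[dup] D21 /tD[|[y1 y2]]]]; [by left|by right|by left|].
    by exfalso; apply: e4; split => //; exact: onetop lE.
  have sE : E1 = 0 \/ E1 = 1.
    case: aE => [|[|/[dup] E21 /tE[|[y1 y2]]]]; [by left|by right|by left|].
    by exfalso; apply: e4; split => //; exact: onetop lD.
  by case: sD => sD; case: sE => sE; try (by exfalso; auto); rewrite sD sE ?add0r ?addr0.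
have q1 : om * n1 <= 1 / 10.
  by apply: (@le_trans _ _ (1 / 10 * n1)); [exact: ler_wpM2r|move: k1; lra_goal].
have f1 : 4 / 10 <= 1 - F1 by rewrite /F1; move: c1 q1; lra_goal.
move: F1b F2b; rewrite -/F1 -/F2 => /andP[f3 f4] /andP[f5 f6].
have n2big : 7 / 10 <= n2.
  rewrite leNgt; apply/negP => n7.
  have h1 : n1 * n1 <= n2 * n2 by apply: ler_pM => //; exact: ltW.
  have h2 : n2 * n2 <= 7 / 10 * (7 / 10) by apply: ler_pM => //; exact: ltW.
  by move: nn h1 h2; rewrite !expr2; lra_goal.
pose b := - (l00 + n1).
have b0 : 0 < b by rewrite oppr_gt0.
have v2b : 6 / 10 <= v2.
  by have [_] := small_mul w1 w2 n10 ler01 (lexx 1); rewrite /v2; move: n2big k1; lra_goal.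
have nl : 0 <= - l00 by move: a1 n10; lra_goal.
have a3 : - (l00 + n1 + n2) <= 0 by move: a2 n10; lra_goal.
have -> : T = (1 - F2) * v1 * n1 + v2 * ((1 - F1) * n1 + b).
  rewrite /T /bil_slopeN (posE nl) (posN a3) (posE (ltW b0)) (@posN (- (l00 + n2))) ?oppr_le0//.
  by rewrite /b; ring.
have -> : - l00 = b + n1 by rewrite /b; ring.
have g : 0 <= 1 - F2 by rewrite subr_ge0.
have t1 : - (n1 / 10) <= (1 - F2) * v1 * n1.
  have nn1 : 0 <= n1 * n1 * (1 - F2) by apply: mulr_ge0 => //; exact: mulr_ge0.
  have g0 : 0 <= (1 - F2) * n2 by exact: mulr_ge0.
  have g1 : (1 - F2) * n2 <= 1 by rewrite mulr_ile1// gerBl.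
  by have [] := small_mul w1 w2 n10 g0 g1; rewrite /v1; move: nn1; lra_goal.
have t2 : 6 / 10 * (4 / 10 * n1 + b) <= v2 * ((1 - F1) * n1 + b).
  apply: ler_pM => //; [by move: n10 b0; lra_goal|].
  by rewrite lerD2r; exact: ler_wpM2r.
by move: t1 t2 n10 b0; lra_goal.
Qed.

(* only the highest vertex is above the line *)
Lemma bil_three_below : bil_config D1 D2 E1 E2 n1 n2 w om -> 0 <= n1 -> 0 <= n2 ->
  l00 + n1 < 0 -> l00 + n2 < 0 -> - l00 / 10 <= T.
Proof.
move=> H n10 n20 a1 a2; have [lD lE [k1 k2 ks] [w1 w2] [z1 z2]] := bil_config_bounds H n10 n20.
have [[nn _ _ _] [D1b D2b E1b E2b] [F1b F2b] [Dbd Ebd] [e1 e2 e3 e4]] := H.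
move: F1b F2b; rewrite -/F1 -/F2 => /andP[f3 f4] /andP[f5 f6].
have l2 : - l00 <= 2.
  have dd (d n : R) : 0 <= d <= 1 -> 0 <= n -> n <= 1 -> d * n <= 1.
    by move=> /andP[? ?] ? ?; exact: mulr_ile1.
  by move: (dd _ _ D1b n10 k1) (dd _ _ D2b n20 k2); rewrite /l00; lra_goal.
have vn : v1 * n1 + v2 * n2 = 1 by rewrite -nn /v1 /v2; ring.
have nl : 0 <= - l00 by move: a1 n10; lra_goal.
have nl1 : 0 <= - (l00 + n1) by rewrite oppr_ge0 ltW.
have nl2 : 0 <= - (l00 + n2) by rewrite oppr_ge0 ltW.
have [a3|a3] := leP (l00 + n1 + n2) 0.
  have nl3 : 0 <= - (l00 + n1 + n2) by rewrite oppr_ge0.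
  have -> : T = v1 * n1 + v2 * n2.
    by rewrite /T /bil_slopeN (posE nl) (posE nl1) (posE nl2) (posE nl3); ring.
  by rewrite vn; move: l2; lra_goal.
have axis (x y : R) : 0 <= x <= 1 -> 0 <= y <= 1 -> l00 + x * n1 + y * n2 = 0 ->
    on_square_bd (x, y) -> x = 1 \/ y = 1.
  move=> /andP[x0 x1] /andP[y0 y1] l /= [|[|[|]]] /= E; subst; [|by left| |by right].
    by exfalso; have yn : y * n2 <= n2; [rewrite ler_piMl|move: yn l a2; lra_goal].
  by exfalso; have xn : x * n1 <= n1; [rewrite ler_piMl|move: xn l a1; lra_goal].
have aD := axis _ _ D1b D2b lD Dbd; have aE := axis _ _ E1b E2b lE Ebd.
set a := l00 + n1 + n2 in a3.
(* The chord joins [(d, 1)] and [(1, e)], so [a = n1 (1 - d) = n2 (1 - e)]. Substituting one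
   expression in each summand gives [n1 n2 (1 - (d ^ 2 + e ^ 2) / 2)]. Without perturbation the
   slope is thus at least [1 - n1 n2], hence at least 1/2. *)
have aprod : a * (n1 * ((D2 + E2) / 2) + n2 * ((D1 + E1) / 2)) <= n1 * n2.
  have key (d e : R) : a = n1 * (1 - d) -> a = n2 * (1 - e) ->
      a * (n1 * ((1 + e) / 2) + n2 * ((1 + d) / 2)) <= n1 * n2.
    move=> ad ae; have n12 : 0 <= n1 * n2 by exact: mulr_ge0.
    have -> : a * (n1 * ((1 + e) / 2) + n2 * ((1 + d) / 2)) = n1 * n2 - n1 * n2 * ((e ^+ 2 + d ^+ 2) / 2).
      have -> : a * (n1 * ((1 + e) / 2) + n2 * ((1 + d) / 2)) = (a * n1 * (1 + e) + a * n2 * (1 + d)) / 2 by field.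
      by rewrite {1}ae ad; field.
    by rewrite gerBl mulr_ge0// divr_ge0// addr_ge0 ?sqr_ge0.
  case: aD => aD; case: aE => aE; try (by exfalso; auto).
    move: lD lE (key E1 D2); rewrite aD aE [1 + E1]addrC [D2 + 1]addrC /a => h1 h2; apply.
      by move: h2; lra_goal.
    by move: h1; lra_goal.
  move: lD lE (key D1 E2); rewrite aD aE [D1 + 1]addrC /a => h1 h2; apply.
    by move: h1; lra_goal.
  by move: h2; lra_goal.
have n12 : n1 * n2 <= 1 / 2 by move: (sqr_ge0 (n1 - n2)) nn; rewrite !expr2; lra_goal.
have na : - (l00 + n1 + n2) <= 0 by rewrite oppr_le0 ltW.
have -> : T = v1 * n1 + v2 * n2 - a * (v1 * F2 + v2 * F1).
  by rewrite /T /bil_slopeN (posE nl) (posE nl1) (posE nl2) (posN na) /a; ring.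
have an1 : a <= n1 by rewrite /a; move: a2; lra_goal.
have an2 : a <= n2 by rewrite /a; move: a1; lra_goal.
have ale : a <= 3 / 4.
  rewrite leNgt; apply/negP => a34.
  have : 3 / 4 * (3 / 4) <= n1 * n2 by apply: ler_pM; move: a34 an1 an2; lra_goal.
  by move: n12; lra_goal.
have p1 : om * (2 * (n1 * n2)) <= 1 / 10.
  have g0 : 0 <= 2 * (n1 * n2) by rewrite !mulr_ge0.
  have g1 : 2 * (n1 * n2) <= 1 by move: n12; lra_goal.
  by have [_] := small_mul z1 z2 ler01 g0 g1; lra_goal.
have p2 : w * (n2 * F2 - n1 * F1) <= 1 / 10.
  have g1 : 0 <= n2 * F2 by exact: mulr_ge0.
  have g2 : 0 <= n1 * F1 by exact: mulr_ge0.
  have g3 : n2 * F2 <= 1 by exact: mulr_ile1.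
  have g4 : n1 * F1 <= 1 by exact: mulr_ile1.
  apply: (@le_trans _ _ `|w * (n2 * F2 - n1 * F1)|); first exact: ler_norm.
  rewrite normrM -[1 / 10]mulr1; apply: ler_pM => //; rewrite ler_norml ?w1//.
  by apply/andP; split; move: g1 g2 g3 g4; lra_goal.
have E : a * (v1 * F2 + v2 * F1) = a * (n1 * ((D2 + E2) / 2) + n2 * ((D1 + E1) / 2))
    + a * (om * (2 * (n1 * n2)) + w * (n2 * F2 - n1 * F1)).
  by rewrite /F1 /F2 /v1 /v2; field.
have p3 : a * (om * (2 * (n1 * n2)) + w * (n2 * F2 - n1 * F1)) <= 3 / 4 * (1 / 5).
  apply: (@le_trans _ _ (a * (1 / 5))).
    by apply: (ler_wpM2l (ltW a3)); move: p1 p2; lra_goal.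
  by apply: ler_wpM2r => //; rewrite divr_ge0.
by rewrite vn E; move: aprod p3 n12 l2; lra_goal.
Qed.

End Bilinear.

Definition bilT (D1 D2 E1 E2 n1 n2 w om : R) : R :=
  let l00 := - (D1 * n1 + D2 * n2) in
  bil_slopeN ((D1 + E1) / 2 + om * n1) ((D2 + E2) / 2 + om * n2) (n1 + w * n2) (n2 - w * n1)
    (pos (- l00)) (pos (- (l00 + n1))) (pos (- (l00 + n1 + n2))) (pos (- (l00 + n2))).

Definition bil_bound (D1 D2 E1 E2 n1 n2 w om : R) : Prop :=
  let l00 := - (D1 * n1 + D2 * n2) in let T := bilT D1 D2 E1 E2 n1 n2 w om in
  [/\ pos (- l00) / 10 <= T, pos (- (l00 + n1)) / 10 <= T,
      pos (- (l00 + n1 + n2)) / 10 <= T & pos (- (l00 + n2)) / 10 <= T].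

Lemma on_square_bd_swap (x y : R) : on_square_bd (x, y) -> on_square_bd (y, x).
Proof. by rewrite /on_square_bd /= => -[|[|[|]]] ->; auto. Qed.

Lemma on_square_bd_flip (x y : R) : on_square_bd (x, y) -> on_square_bd (1 - x, y).
Proof. by rewrite /on_square_bd /= => -[|[|[|]]] ->; rewrite ?subr0 ?subrr; auto. Qed.

Lemma bil_config_swap D1 D2 E1 E2 n1 n2 w om :
  bil_config D1 D2 E1 E2 n1 n2 w om -> bil_config D2 D1 E2 E1 n2 n1 (- w) om.
Proof.
move=> [[h1 h2 h3 h4] [h5 h6 h7 h8] [h9 h10] [h11 h12] [h13 h14 h15 h16]].
split; split => //; rewrite ?normrN//; try exact: on_square_bd_swap; lra.
Qed.

Lemma bil_config_flip D1 D2 E1 E2 n1 n2 w om :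
  bil_config D1 D2 E1 E2 n1 n2 w om -> bil_config (1 - D1) D2 (1 - E1) E2 (- n1) n2 (- w) om.
Proof.
have c (x : R) : 0 <= x <= 1 -> 0 <= 1 - x <= 1 by move=> /andP[? ?]; apply/andP; split; lra.
move=> [[h1 h2 h3 h4] [h5 h6 h7 h8] [h9 h10] [h11 h12] [h13 h14 h15 h16]].
split; split => //; rewrite ?normrN//; try exact: on_square_bd_flip; try exact: c.
- by rewrite sqrrN.
- lra.
- have -> : (1 - D1 + (1 - E1)) / 2 + om * - n1 = 1 - ((D1 + E1) / 2 + om * n1) by field.
  exact: c.
- by move=> [? ?]; apply: h14; split; lra.
- by move=> [? ?]; apply: h13; split; lra.
Qed.

Lemma bil_bound_swap D1 D2 E1 E2 n1 n2 w om :
  bil_bound D2 D1 E2 E1 n2 n1 (- w) om -> bil_bound D1 D2 E1 E2 n1 n2 w om.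
Proof.
rewrite /bil_bound /bilT [D2 * n2 + _]addrC [_ + n2 + n1]addrAC.
set T := bil_slopeN _ _ _ _ _ _ _ _; set T' := bil_slopeN _ _ _ _ _ _ _ _.
have -> : T = T' by rewrite /T /T' /bil_slopeN; ring.
by move=> [].
Qed.

Lemma bil_bound_flip D1 D2 E1 E2 n1 n2 w om :
  bil_bound (1 - D1) D2 (1 - E1) E2 (- n1) n2 (- w) om -> bil_bound D1 D2 E1 E2 n1 n2 w om.
Proof.
rewrite /bil_bound /bilT; set l := - (D1 * n1 + D2 * n2).
have -> : - ((1 - D1) * - n1 + D2 * n2) = l + n1 by rewrite /l; ring.
rewrite addrK [l + n1 + n2]addrAC.
set T := bil_slopeN _ _ _ _ _ _ _ _; set T' := bil_slopeN _ _ _ _ _ _ _ _.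
have -> : T = T' by rewrite /T /T' /bil_slopeN; field.
by move=> [].
Qed.

Lemma bil_bound_nonneg D1 D2 E1 E2 n1 n2 w om : 0 <= n1 -> 0 <= n2 ->
  bil_config D1 D2 E1 E2 n1 n2 w om -> bil_bound D1 D2 E1 E2 n1 n2 w om.
Proof.
move=> n10 n20 H; have Hs := bil_config_swap H.
set l := - (D1 * n1 + D2 * n2); set T := bilT D1 D2 E1 E2 n1 n2 w om.
(* As [n1] and [n2] are nonnegative, L is smallest at the origin, so the bound for this vertex
   implies the other three. *)
suff h : pos (- l) / 10 <= T.
  have le (x : R) : 0 <= x -> pos (- (l + x)) / 10 <= T.
    move=> x0; apply: le_trans h; rewrite ler_wpM2r// ge_max le_max le_max lexx orbT andbT.
    by apply/orP; left; lra.
  split; [exact: h|exact: le| |exact: le].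
  by rewrite -addrA; apply: le; exact: addr_ge0.
have l00 : E1 * n1 + E2 * n2 = D1 * n1 + D2 * n2 by case: H => -[_ _ _ ? _ _ _ _]; lra.
have [a0|a0] := leP 0 l.
  by rewrite /T /bilT -/l /bil_slopeN ?posN; lra.
rewrite posE; last lra.
have lE : l + E1 * n1 + E2 * n2 = 0 by rewrite /l; lra.
have [a1|a1] := leP 0 (l + n1); have [a2|a2] := leP 0 (l + n2).
- exact: bil_one_below.
- have ls : - (D2 * n2 + D1 * n1) = l by rewrite /l; ring.
  have := bil_two_below Hs n20 n10; rewrite ls => H'; apply: le_trans (H' a2 a1) _.
  by rewrite /T /bilT -/l [l + n2 + n1]addrAC /bil_slopeN le_eqVlt; apply/orP; left; apply/eqP; ring.
- exact: bil_two_below.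
- exact: bil_three_below.
Qed.

(** The symmetries of the square reduce everything to a normal with nonnegative coordinates. Swap
    and flip reverse the orientation, and with it the tangent, which explains the sign change of
    [w]. *)
Lemma bil_bounds D1 D2 E1 E2 n1 n2 w om :
  bil_config D1 D2 E1 E2 n1 n2 w om -> bil_bound D1 D2 E1 E2 n1 n2 w om.
Proof.
have step E1' E2' D1' D2' m1 m2 v : 0 <= m2 -> bil_config D1' D2' E1' E2' m1 m2 v om ->
    bil_bound D1' D2' E1' E2' m1 m2 v om.
  move=> m20 H; case/orP: (le_total 0 m1) => m10; first exact: bil_bound_nonneg.
  by apply: bil_bound_flip; apply: bil_bound_nonneg (bil_config_flip H) => //; rewrite oppr_ge0.
move=> H; case/orP: (le_total 0 n2) => n20; first exact: step.
apply: bil_bound_swap; apply: bil_bound_flip; apply: bil_bound_swap; apply: step.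
  by rewrite oppr_ge0.
by apply: bil_config_swap; apply: bil_config_flip; exact: bil_config_swap.
Qed.



(* The slope on the line [n1 X + n2 Y + c = 0], in coordinates centred in the
   square; the nodal values of [L] are [c +- n1 / 2] and [c +- n2 / 2]. *)
Definition rq_slope (n1 n2 v1 v2 c X Y : R) : R :=
  let p2 := pos (c + n1 / 2) in let p4 := pos (c - n1 / 2) in
  let p1 := pos (c - n2 / 2) in let p3 := pos (c + n2 / 2) in
  let d := p2 + p4 - p1 - p3 in
  v1 * (p2 - p4 + 2 * d * X) + v2 * (p3 - p1 - 2 * d * Y).

(** With [0 <= n2 <= n1] the nodal values of L are ordered as [c - n1/2], [c - n2/2], [c + n2/2],
    [c + n1/2]. Each of the five positions of 0 among them makes the slope a polynomial; the
    products [u1], [u2], [u3] are the certificates that it is at most 1. *)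
Lemma rq_slope_le1_ordered (n1 n2 c X Y : R) : n1 ^+ 2 + n2 ^+ 2 = 1 -> 0 <= n2 -> n2 <= n1 ->
  `|X| <= 1 / 2 -> `|Y| <= 1 / 2 -> n1 * X + n2 * Y + c = 0 -> rq_slope n1 n2 n1 n2 c X Y <= 1.
Proof.
move=> nn n20 n21; rewrite !ler_norml => /andP[X1 X2] /andP[Y1 Y2] l.
have n10 : 0 <= n1 by exact: le_trans n21.
have h1 : - (n1 / 2) <= n1 * X /\ n1 * X <= n1 / 2.
  have u1 : 0 <= n1 * (X + 1 / 2) by rewrite mulr_ge0//; lra.
  have u2 : 0 <= n1 * (1 / 2 - X) by rewrite mulr_ge0//; lra.
  by split; lra.
have h2 : - (n2 / 2) <= n2 * Y /\ n2 * Y <= n2 / 2.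
  have u1 : 0 <= n2 * (Y + 1 / 2) by rewrite mulr_ge0//; lra.
  have u2 : 0 <= n2 * (1 / 2 - Y) by rewrite mulr_ge0//; lra.
  by split; lra.
have [x1 x2] := h1; have [y1 y2] := h2.
set x := n1 * X in l x1 x2; set y := n2 * Y in l y1 y2.
have SE p2 p4 p1 p3 : n1 * (p2 - p4 + 2 * (p2 + p4 - p1 - p3) * X) + n2 * (p3 - p1 - 2 * (p2 + p4 - p1 - p3) * Y)
    = n1 * (p2 - p4) + n2 * (p3 - p1) + 2 * (p2 + p4 - p1 - p3) * (x - y).
  by rewrite /x /y; ring.
rewrite /rq_slope SE.
have cE : x = - c - y by lra.
rewrite {}cE in x1 x2 SE *.
have mn : 0 <= n1 * n2 by exact: mulr_ge0.
have mm : n2 * n2 <= n1 * n2 by exact: ler_wpM2r.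
have s1 := sqr_ge0 (n1 - n2); have s2 := sqr_ge0 n2.
have nn' : n1 * n1 + n2 * n2 = 1 by rewrite -nn; ring.
clear SE h1 h2 l X1 X2 Y1 Y2 nn; clearbody x y; clear x X Y.
have [c1|c1] := leP (n1 / 2) c.
  by rewrite !posE; move: c1 n20 n21 n10 nn' mn x1 x2 y1 y2; lra_goal.
have [c2|c2] := leP c (- (n1 / 2)).
  by rewrite !posN; move: c2 n20 n21 n10 nn' mn x1 x2 y1 y2; lra_goal.
have p1 : 0 <= c + n1 / 2 by move: c2; lra_goal.
have q1 : c - n1 / 2 <= 0 by move: c1; lra_goal.
rewrite (posE p1) (posN q1).
have [c3|c3] := leP (n2 / 2) c.
  rewrite (@posE (c - n2 / 2)) ?(@posE (c + n2 / 2)); try by move: c3 n20; lra_goal.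
  have u1 : 0 <= (n1 - 2 * c) * (n2 / 2 + y) by apply: mulr_ge0; move: c1 y1; lra_goal.
  have u2 : 0 <= (n1 - 2 * c) * (n1 / 2 + c - n2).
    by apply: mulr_ge0; move: c1 c3 n21; lra_goal.
  by move: u1 u2 c1 c3 n20 n21 nn' mn mm s1 s2 x1 x2 y1 y2; lra_goal.
have [c4|c4] := leP c (- (n2 / 2)).
  rewrite (@posN (c - n2 / 2)) ?(@posN (c + n2 / 2)); try by move: c4 n20; lra_goal.
  have u1 : 0 <= (n1 + 2 * c) * (n2 / 2 + y) by apply: mulr_ge0; move: c2 y1; lra_goal.
  have u2 : 0 <= (- (n2 / 2) - c) * (- c + n2 / 2) by apply: mulr_ge0; move: c4 n20; lra_goal.
  have u3 : 0 <= (- (n2 / 2) - c) * n2 by apply: mulr_ge0 n20; move: c4; lra_goal.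
  by move: u1 u2 u3 c2 c4 n20 n21 nn' mn mm s1 s2 x1 x2 y1 y2; lra_goal.
rewrite (@posN (c - n2 / 2)) ?(@posE (c + n2 / 2)); try by move: c3 c4; lra_goal.
have u1 : 0 <= (n1 - n2) * (n2 / 2 + y) by apply: mulr_ge0; move: n21 y1; lra_goal.
have u2 : 0 <= (n2 / 2 - c) * n2 by apply: mulr_ge0 n20; move: c3; lra_goal.
by move: u1 u2 c3 c4 n20 n21 nn' mn mm s1 s2 x1 x2 y1 y2; lra_goal.
Qed.

Lemma rq_slope_le1 (n1 n2 c X Y : R) : n1 ^+ 2 + n2 ^+ 2 = 1 ->
  `|X| <= 1 / 2 -> `|Y| <= 1 / 2 -> n1 * X + n2 * Y + c = 0 -> rq_slope n1 n2 n1 n2 c X Y <= 1.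
Proof.
have flip1 a b c' x y : rq_slope (- a) b (- a) b c' (- x) y = rq_slope a b a b c' x y.
  by rewrite /rq_slope ?(mulNr a) ?(mulNr b) !opprK; ring.
have flip2 a b c' x y : rq_slope a (- b) a (- b) c' x (- y) = rq_slope a b a b c' x y.
  by rewrite /rq_slope ?(mulNr a) ?(mulNr b) !opprK; ring.
have swap a b c' x y : rq_slope b a b a c' y x = rq_slope a b a b c' x y.
  by rewrite /rq_slope; ring.
have pos12 a b x y : a ^+ 2 + b ^+ 2 = 1 -> 0 <= a -> 0 <= b ->
    `|x| <= 1 / 2 -> `|y| <= 1 / 2 -> a * x + b * y + c = 0 -> rq_slope a b a b c x y <= 1.
  move=> nn a0 b0 hx hy l; case/orP: (le_total b a) => ab; first exact: rq_slope_le1_ordered.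
  by rewrite -swap; apply: rq_slope_le1_ordered => //; lra.
have pos2 a b x y : a ^+ 2 + b ^+ 2 = 1 -> 0 <= b ->
    `|x| <= 1 / 2 -> `|y| <= 1 / 2 -> a * x + b * y + c = 0 -> rq_slope a b a b c x y <= 1.
  move=> nn b0 hx hy l; case/orP: (le_total 0 a) => a0; first exact: pos12.
  by rewrite -flip1; apply: pos12; rewrite ?sqrrN ?normrN ?oppr_ge0//; lra.
move=> nn hx hy l; case/orP: (le_total 0 n2) => b0; first exact: pos2.
by rewrite -flip2; apply: pos2; rewrite ?sqrrN ?normrN ?oppr_ge0//; lra.
Qed.

(* [(n1 + w n2, n2 - w n1)] is the perturbed normal, and the point is moved
   off the line by [om] *)
Lemma rq_slope_perturbed (n1 n2 c X Y w om B : R) : n1 ^+ 2 + n2 ^+ 2 = 1 ->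
  `|X| <= 1 / 2 -> `|Y| <= 1 / 2 -> n1 * X + n2 * Y + c = 0 ->
  `|X + om * n1| <= 1 / 2 -> `|Y + om * n2| <= 1 / 2 -> `|w| <= B -> `|om| <= 2 * B ->
  rq_slope n1 n2 (n1 + w * n2) (n2 - w * n1) c (X + om * n1) (Y + om * n2) <= 1 + 5 * B.
Proof.
move=> nn hX hY l hX' hY' wB omB.
have S1 := rq_slope_le1 nn hX hY l.
have abs1 (a b : R) : a ^+ 2 + b ^+ 2 = 1 -> `|a| <= 1.
  move=> ab; rewrite -(@expr_le1 _ 2)// real_normK ?num_real//; have := sqr_ge0 b; lra.
have na := abs1 _ _ nn; have nb : `|n2| <= 1 by apply: (abs1 n2 n1); rewrite addrC.
have B0 : 0 <= B by exact: le_trans wB.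
have := S1; rewrite /rq_slope; set p2 := pos _; set p4 := pos _; set p1 := pos _; set p3 := pos _.
set d := p2 + p4 - p1 - p3.
have [t2 /andP[t20 t21] e2] := pos_diff (c - n1 / 2) n1.
have [t1 /andP[t10 t11] e1] := pos_diff (c - n2 / 2) n2.
have E2 : p2 - p4 = t2 * n1 by rewrite -e2 /p2 /p4; congr (Num.max _ _ - _); field.
have E1 : p3 - p1 = t1 * n2 by rewrite -e1 /p3 /p1; congr (Num.max _ _ - _); field.
have half (a : R) : exists2 th, `|th| <= 1 / 2 & pos (c + a / 2) + pos (c - a / 2) = 2 * pos c + th * a.
  have [t /andP[t0 t1'] e] := pos_diff c (a / 2).
  have [u /andP[u0 u1] f] := pos_diff c (- (a / 2)).
  exists ((t - u) / 2); last by rewrite -[c - _]/(c + - _); clear - e f; lra.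
  by rewrite ler_norml; clear - t0 t1' u0 u1; apply/andP; split; lra.
have [a ha ea] := half n1; have [b hb eb] := half n2.
have dE : d = a * n1 - b * n2 by rewrite /d; move: ea eb; rewrite -/p1 -/p2 -/p3 -/p4; clear; lra.
have bound (x y Z W : R) : `|x| <= Z -> `|y| <= W -> `|x * y| <= Z * W.
  by move=> xz yw; rewrite normrM ler_pM.
have nn' : `|n1| ^+ 2 + `|n2| ^+ 2 = 1 by rewrite !real_normK ?num_real.
have m12 : 0 <= (`|n1| - `|n2|) ^+ 2 by exact: sqr_ge0.
(* A rational substitute for the sharp bound [sqrt 2]. *)
have r2 : `|n1| + `|n2| <= 3 / 2.
  rewrite leNgt; apply/negP => rb; clear - nn' m12 rb.
  have : 3 / 2 * (3 / 2) < (`|n1| + `|n2|) * (`|n1| + `|n2|) by apply: ltr_pM; lra.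
  lra.
have d1 : `|d| <= (`|n1| + `|n2|) / 2.
  rewrite dE; apply: le_trans (ler_normB _ _) _.
  by move: (bound _ _ _ _ ha (lexx `|n1|)) (bound _ _ _ _ hb (lexx `|n2|)); clear; lra.
pose g1 := p2 - p4 + 2 * d * (X + om * n1).
pose g2 := p3 - p1 - 2 * d * (Y + om * n2).
have gb (t a' x : R) : 0 <= t -> t <= 1 -> `|x| <= 1 / 2 -> `|t * a' + 2 * d * x| <= `|a'| + `|d|.
  move=> t0 t1' x2; apply: le_trans (ler_normD _ _) _; apply: lerD.
    by rewrite normrM (ger0_norm t0) ler_piMl.
  by rewrite mulrAC normrM ler_piMl// normrM (ger0_norm (ler0n _ _)); clear - x2; lra.
have b1 : `|g1| <= `|n1| + `|d| by rewrite /g1 E2; exact: gb.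
have b2 : `|g2| <= `|n2| + `|d| by rewrite /g2 E1 -mulrN; apply: gb => //; rewrite normrN.
have dr : `|d| * (`|n1| + `|n2|) <= 1.
  apply: (@le_trans _ _ ((`|n1| + `|n2|) / 2 * (`|n1| + `|n2|))); first by rewrite ler_wpM2r// addr_ge0.
  by clear - nn' m12; lra.
(* Tilting the normal costs [2 B]: with [g1], [g2] the gradient at the moved point, the bracket is
   at most [2 |n1| |n2| + |d| (|n1| + |n2|)], and each summand is at most 1. *)
have bw : `|w * (n2 * g1 - n1 * g2)| <= B * 2.
  apply: (bound) => //; apply: le_trans (ler_normB _ _) _.
  by move: (bound _ _ _ _ (lexx `|n2|) b1) (bound _ _ _ _ (lexx `|n1|) b2); clear - nn' m12 dr; lra.
(* Moving the point off the line costs [3 B], whence [5 B] in all. *)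
have bo : `|2 * d * (om * (n1 ^+ 2 - n2 ^+ 2))| <= 3 / 2 * (2 * B * 1).
  apply: (bound).
    by rewrite normrM (ger0_norm (ler0n _ _)); clear - d1 r2; lra.
  apply: (bound) => //; have q1 := sqr_ge0 n1; have q2 := sqr_ge0 n2.
  by rewrite ler_norml; clear - nn q1 q2; apply/andP; split; lra.
move=> S1'; have := ler_norm (w * (n2 * g1 - n1 * g2)); have := ler_norm (2 * d * (om * (n1 ^+ 2 - n2 ^+ 2))).
have -> : (n1 + w * n2) * (p2 - p4 + 2 * d * (X + om * n1)) + (n2 - w * n1) * (p3 - p1 - 2 * d * (Y + om * n2))
  = n1 * (p2 - p4 + 2 * d * X) + n2 * (p3 - p1 - 2 * d * Y) + 2 * d * (om * (n1 ^+ 2 - n2 ^+ 2))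
    + w * (n2 * g1 - n1 * g2) by rewrite /g1 /g2; ring.
by move: bw bo S1'; clear; lra.
Qed.

End ReferenceElement.

(** * Bounds on IFE functions on the reference element *)

Section ReferenceBounds.
Context {R : realType}.
Local Notation plane := (R * R)%type.
Local Notation pos x := (Num.max x 0).

Lemma orthonormal_rot (n t : plane) : dot n n = 1 -> dot t t = 1 -> dot n t = 0 ->
  exists2 e : R, `|e| = 1 & t = (- (e * n.2), e * n.1).
Proof.
rewrite /dot => nn tt nt; exists (n.1 * t.2 - n.2 * t.1).
  apply/eqP; rewrite -(@eqrXn2 _ 2)// expr1n real_normK ?num_real//; apply/eqP.
  have -> : (n.1 * t.2 - n.2 * t.1) ^+ 2 = (n.1 * n.1 + n.2 * n.2) * (t.1 * t.1 + t.2 * t.2) - (n.1 * t.1 + n.2 * t.2) ^+ 2 by ring.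
  by rewrite nn tt nt; ring.
case: t tt nt => t1 t2 /= tt nt; congr pair.
  have -> : - ((n.1 * t2 - n.2 * t1) * n.2) = t1 * (n.1 * n.1 + n.2 * n.2) - n.1 * (n.1 * t1 + n.2 * t2) by ring.
  by rewrite nn nt; ring.
have -> : (n.1 * t2 - n.2 * t1) * n.1 = t2 * (n.1 * n.1 + n.2 * n.2) - n.2 * (n.1 * t1 + n.2 * t2) by ring.
by rewrite nn nt; ring.
Qed.

Lemma unit_coord (n : plane) : dot n n = 1 -> `|n.1| <= 1 /\ `|n.2| <= 1.
Proof.
rewrite /dot -!expr2 => nn; have s1 := sqr_ge0 n.1; have s2 := sqr_ge0 n.2.
by split; rewrite -(@expr_le1 _ 2)// real_normK ?num_real//; lra.
Qed.

Lemma ref_set_box ft (X : plane) : ref_set ft X -> 0 <= X.1 <= 1 /\ 0 <= X.2 <= 1.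
Proof.
rewrite /ref_set; case: triangular => //= -[a /andP[b c]].
by split; apply/andP; split => //; [exact: le_trans b|exact: le_trans c].
Qed.

Lemma refnode_ref_set ft (i : 'I_(nv ft)) : ref_set ft (refnode ft i : plane).
Proof.
rewrite /ref_set; case: ft i => /= i; case: i => -[|[|[|[|//]]]] //= _; split; lra.
Qed.

Lemma ref_dist (ft : fe_type) (D n : plane) (i : 'I_(nv ft)) : dot n n = 1 -> ref_set ft D ->
  `|dot (refnode ft i - D) n| <= 2.
Proof.
move=> /unit_coord[n1 n2] /ref_set_box[/andP[d0 d1] /andP[d2 d3]].
have [/andP[m0 m1] /andP[m2 m3]] := ref_set_box (refnode_ref_set i).
rewrite /dot; apply: le_trans (ler_normD _ _) _; have -> : 2 = 1 + 1 :> R by ring.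
apply: lerD; rewrite normrM -[1]mulr1; apply: ler_pM => //; rewrite ler_norml /=; apply/andP; split; lra.
Qed.

Definition IFE_gain ft (rho : R) : R :=
  match ft with FE_linear => Num.sqrt rho | FE_bilinear => 1 | _ => rho end.

(* [w] is the slope of the interface at the point [F], and [om] its height
   over the chord [DE] there *)
Definition ref_config ft (rho la : R) (D E n t F : plane) (w om : R) : Prop :=
  [/\ ref_set ft D, ref_set ft E & ref_set ft F] /\
  [/\ dot n n = 1, dot t t = 1, dot n t = 0 & dot (E - D) n = 0] /\
  match ft with
  | FE_linear | FE_crouzeix_raviart => w = 0
  | FE_bilinear => [/\ `|w| <= 1 / 10, `|om| <= 1 / 10,
      F = 2^-1 *: (D + E) + om *: n, on_square_bd D /\ on_square_bd E
    & [/\ ~ (D.1 = 0 /\ E.1 = 0), ~ (D.1 = 1 /\ E.1 = 1),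
          ~ (D.2 = 0 /\ E.2 = 0) & ~ (D.2 = 1 /\ E.2 = 1)]]
  | FE_rotated_Q1 => exists B s a,
      [/\ `|w| <= B, `|om| <= 2 * B, B <= 3 / 5 * s, 0 <= a <= 1
        & F = D + a *: (E - D) + om *: n] /\
      [/\ 0 <= s, s <= 1 & 4 * s * (1 - rho) <= rho * (1 - la) * (1 - s)]
  end.

Lemma slope_Den_ge (rho S : R) : rho <= 1 -> S <= 1 -> rho <= 1 - (1 - rho) * S.
Proof. by move=> r1 S1; have : 0 <= (1 - rho) * (1 - S); [rewrite mulr_ge0 ?subr_ge0|lra]. Qed.

Lemma half_dist (x : R) : 0 <= x <= 1 -> `|x - 1 / 2| <= 1 / 2.
Proof. by move=> /andP[? ?]; rewrite ler_norml; apply/andP; split; lra. Qed.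

Lemma half_dist_convex (a d f : R) : 0 <= a <= 1 -> 0 <= d <= 1 -> 0 <= f <= 1 ->
  `|d + a * (f - d) - 1 / 2| <= 1 / 2.
Proof.
move=> /andP[a0 a1] /andP[d0 d1] /andP[f0 f1]; apply: half_dist.
have u1 : 0 <= a * f by exact: mulr_ge0.
have u2 : 0 <= (1 - a) * d by rewrite mulr_ge0// subr_ge0.
have u3 : 0 <= a * (1 - f) by rewrite mulr_ge0// subr_ge0.
have u4 : 0 <= (1 - a) * (1 - d) by rewrite mulr_ge0 ?subr_ge0.
by apply/andP; split; move: u1 u2 u3 u4; lra_goal.
Qed.

(** The chain is [1 - (1 - rho) S >= rho - 5 B (1 - rho) >= rho - 3 s (1 - rho) >= rho - rho (1 -
    la) = la * rho]. *)
Lemma Den_RQ1_arith (rho la s B S : R) : 4 * s * (1 - rho) <= rho * (1 - la) * (1 - s) ->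
  (1 - rho) * S <= (1 - rho) * (1 + 5 * B) -> (1 - rho) * B <= (1 - rho) * (3 / 5 * s) ->
  0 <= rho * (1 - la) * s -> 0 <= s * (1 - rho) -> la * rho <= 1 - (1 - rho) * S.
Proof. lra. Qed.

Section Den.
Variables (rho la : R) (D E n t F : plane) (w om : R).
Hypotheses (rho0 : 0 < rho) (rho1 : rho <= 1) (lam0 : 0 < la) (lam1 : la < 1).
Let nu := n - w *: t.

Lemma slope_linearE F' : IFE_slope FE_linear D n F' n =
  n.1 * (pos (dot (refnode FE_linear 1 - D) n) - pos (dot (refnode FE_linear 0 - D) n)) +
  n.2 * (pos (dot (refnode FE_linear 2 - D) n) - pos (dot (refnode FE_linear 1 - D) n)).
Proof. by rewrite /IFE_slope !big_ord_recl big_ord0 /= [in X in X = _]/dot /pgrad /=; ring. Qed.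

Lemma Den_linear : ref_config FE_linear rho la D E n t F w om ->
  let Den := 1 - (1 - rho) * IFE_slope FE_linear D n F nu in
  rho <= Den /\ forall i : 'I_(nv FE_linear),
    1 / 2 * Num.sqrt rho * pos (- dot (refnode FE_linear i - D) n) <= Den.
Proof.
move=> [[[D2 /andP[D12 D1]] _ _] [[nn _ _ _] w0]].
rewrite /nu w0 scale0r subr0 slope_linearE.
set l1 := dot (refnode FE_linear 0 - D) n; set l2 := dot (refnode FE_linear 1 - D) n.
set l3 := dot (refnode FE_linear 2 - D) n.
have e2 : l2 = l1 + n.1 by rewrite /l2 /l1 /dot /=; ring.
have e3 : l3 = l2 + n.2 by rewrite /l2 /l3 /dot /=; ring.
have e : (1 - D.1) * l1 + (D.1 - D.2) * l2 + D.2 * l3 = 0 by rewrite /l1 /l2 /l3 /dot /=; ring.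
have nn' : n.1 ^+ 2 + n.2 ^+ 2 = 1 by rewrite -nn /dot; ring.
have [/andP[S0 S1] h1 h2 h3] := slope_linear nn' e2 e3 D2 D12 D1 e.
set S := _ + _ in S0 S1 h1 h2 h3 *.
split; first exact: slope_Den_ge.
(* The denominator dominates both [rho] and [1 - S], since it equals [rho + (1 - rho) (1 - S)] and
   [(1 - S) + rho S]; then [sqrt rho * m <= rho + m ^ 2 / 4] concludes. *)
have key m : m ^+ 2 <= 2 * (1 - S) -> 1 / 2 * Num.sqrt rho * m <= 1 - (1 - rho) * S.
  move=> mS; have q2 : Num.sqrt rho * Num.sqrt rho = rho by rewrite -expr2 sqr_sqrtr// ltW.
  have : 0 <= (1 - rho) * (1 - S) by rewrite mulr_ge0 ?subr_ge0.
  have : 0 <= rho * S by rewrite mulr_ge0// ltW.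
  have := sqr_ge0 (Num.sqrt rho - m / 2); have := sqr_ge0 (Num.sqrt rho); have := sqr_ge0 m.
  have := rho1; rewrite !expr2; set q := Num.sqrt rho in q2 *; move: mS; rewrite expr2 => mS.
  rewrite mulrBr !mulrBl q2; lra.
by move=> [[|[|[|//]]] i3]; exact: key.
Qed.

(** Each partial derivative of the interpolant is twice the difference of its values at two
    midpoints that are half a side apart along the axis, so the argument for triangles applies. *)
Lemma Den_CR : ref_config FE_crouzeix_raviart rho la D E n t F w om ->
  rho <= 1 - (1 - rho) * IFE_slope FE_crouzeix_raviart D n F nu.
Proof.
move=> [_ [[nn _ _ _] w0]]; rewrite /nu w0 scale0r subr0; apply: slope_Den_ge => //.
have nn' : n.1 ^+ 2 + n.2 ^+ 2 = 1 by rewrite -nn /dot; ring.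
set l1 := dot (refnode FE_crouzeix_raviart 0 - D) n; set l2 := dot (refnode FE_crouzeix_raviart 1 - D) n.
set l3 := dot (refnode FE_crouzeix_raviart 2 - D) n.
have e1 : exists2 th, 0 <= th <= 1 & 2 * (pos l2 - pos l3) = th * n.1.
  have [th th1 th2] := pos_diff l3 (n.1 / 2); exists th => //.
  have -> : l2 = l3 + n.1 / 2 by rewrite /l2 /l3 /dot /=; field.
  by rewrite th2; field.
have e2 : exists2 th, 0 <= th <= 1 & 2 * (pos l3 - pos l1) = th * n.2.
  have [th th1 th2] := pos_diff l1 (n.2 / 2); exists th => //.
  have -> : l3 = l1 + n.2 / 2 by rewrite /l1 /l3 /dot /=; field.
  by rewrite th2; field.
have [/andP[_ S1] _] := slope_triangle nn' e1 e2; apply: le_trans S1.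
rewrite le_eqVlt; apply/orP; left; apply/eqP.
by rewrite /IFE_slope !big_ord_recl big_ord0 /= -/l1 -/l2 -/l3 /dot /pgrad /=; ring.
Qed.

Lemma Den_bilinear : ref_config FE_bilinear rho la D E n t F w om ->
  let Den := 1 - (1 - rho) * IFE_slope FE_bilinear D n F nu in
  rho <= Den /\ forall i : 'I_(nv FE_bilinear),
    1 / 10 * pos (- dot (refnode FE_bilinear i - D) n) <= Den.
Proof.
move=> [[rD rE rF] [[nn tt nt l] [wb omb FE [bD bE] [h1 h2 h3 h4]]]].
have [D1 D2] := ref_set_box rD; have [E1 E2] := ref_set_box rE; have [F1 F2] := ref_set_box rF.
have [e e1 tE] := orthonormal_rot nn tt nt.
have nn' : n.1 ^+ 2 + n.2 ^+ 2 = 1 by rewrite -nn /dot; ring.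
have nuE : nu = (n.1 + w * e * n.2, n.2 - w * e * n.1).
  rewrite /nu tE; case: (n) => a b /=; rewrite /GRing.scale /=; congr pair; rewrite /= /GRing.scale /=; ring.
have nnu : dot n nu = 1 by rewrite nuE /dot /= -nn /dot; ring.
have F1E : F.1 = (D.1 + E.1) / 2 + om * n.1 by rewrite FE /= /GRing.scale /= mulrC.
have F2E : F.2 = (D.2 + E.2) / 2 + om * n.2 by rewrite FE /= /GRing.scale /= mulrC.
have cfg : bil_config D.1 D.2 E.1 E.2 n.1 n.2 (w * e) om.
  split; split => //; rewrite -?F1E -?F2E//.
  by rewrite normrM e1 mulr1.
have [b00 b10 b11 b01] := bil_bounds cfg.
have SE : 1 - IFE_slope FE_bilinear D n F nu = bilT D.1 D.2 E.1 E.2 n.1 n.2 (w * e) om.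
  rewrite IFE_slopeN// /bilT /bil_slopeN -F1E -F2E !big_ord_recl big_ord0 nuE /=.
  set l00 := - (D.1 * n.1 + D.2 * n.2).
  have -> : dot ((0, 0) - D) n = l00 by rewrite /l00 /dot /=; ring.
  have -> : dot ((1, 0) - D) n = l00 + n.1 by rewrite /l00 /dot /=; ring.
  have -> : dot ((1, 1) - D) n = l00 + n.1 + n.2 by rewrite /l00 /dot /=; ring.
  have -> : dot ((0, 1) - D) n = l00 + n.2 by rewrite /l00 /dot /=; ring.
  by rewrite /dot /=; ring.
rewrite /bil_bound -SE in b00 b10 b11 b01.
set l00 := - (D.1 * n.1 + D.2 * n.2) in b00 b10 b11 b01.
set S := IFE_slope _ _ _ _ _ in b00 b10 b11 b01 *.
have p0 : 0 <= pos (- l00) by exact: pos_ge0.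
have S1 : S <= 1 by move: b00 p0; lra.
split; first exact: slope_Den_ge.
(* For [S >= 0] the right-hand side is at least [1 - S]; for [S < 0] it is at least 1, which
   suffices as [m <= 2]. *)
have key m : 0 <= m -> m <= 2 -> m / 10 <= 1 - S -> 1 / 10 * m <= 1 - (1 - rho) * S.
  move=> m0 m2 mS; have [S0|S0] := leP 0 S.
    have : 0 <= rho * S by rewrite mulr_ge0// ltW.
    lra.
  have : 0 <= (1 - rho) * (- S) by rewrite mulr_ge0 ?subr_ge0// oppr_ge0 ltW.
  lra.
have le2 (i : 'I_(nv FE_bilinear)) : pos (- dot (refnode FE_bilinear i - D) n) <= 2.
  have := ref_dist i nn rD; rewrite ler_norml => /andP[? ?]; apply: pos_le => //; lra.
move=> i; apply: key; [exact: pos_ge0|exact: le2|].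
have -> : dot (refnode FE_bilinear i - D) n =
    l00 + (refnode FE_bilinear i).1 * n.1 + (refnode FE_bilinear i).2 * n.2.
  by rewrite /dot /l00 /=; ring.
by case: i => -[|[|[|[|//]]]] /= _; rewrite ?mul0r ?mul1r ?addr0.
Qed.

Lemma Den_RQ1 : ref_config FE_rotated_Q1 rho la D E n t F w om ->
  la * rho <= 1 - (1 - rho) * IFE_slope FE_rotated_Q1 D n F nu.
Proof.
move=> [[rD rE rF] [[nn tt nt l] [B [s [a [[wB omB Bs /andP[a0 a1] FE] [s0 s1 sr]]]]]]].
have [/andP[D1 D1'] /andP[D2 D2']] := ref_set_box rD; have [/andP[E1 E1'] /andP[E2 E2']] := ref_set_box rE.
have [/andP[F1 F1'] /andP[F2 F2']] := ref_set_box rF.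
have [e e1 tE] := orthonormal_rot nn tt nt.
have nn' : n.1 ^+ 2 + n.2 ^+ 2 = 1 by rewrite -nn /dot; ring.
have nuE : nu = (n.1 + w * e * n.2, n.2 - w * e * n.1).
  rewrite /nu tE; case: (n) => ? ? /=; rewrite /GRing.scale /=; congr pair; rewrite /= /GRing.scale /=; ring.
pose X := D.1 + a * (E.1 - D.1) - 1 / 2; pose Y := D.2 + a * (E.2 - D.2) - 1 / 2.
pose c := dot ((2^-1, 2^-1) - D) n.
have a01 : 0 <= a <= 1 by rewrite a0.
have hX : `|X| <= 1 / 2 by apply: half_dist_convex; rewrite // ?D1 ?E1.
have hY : `|Y| <= 1 / 2 by apply: half_dist_convex; rewrite // ?D2 ?E2.
have F1E : X + om * n.1 = F.1 - 1 / 2 by rewrite FE /X /= /GRing.scale /=; ring.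
have F2E : Y + om * n.2 = F.2 - 1 / 2 by rewrite FE /Y /= /GRing.scale /=; ring.
have XY : n.1 * X + n.2 * Y + c = 0.
  have -> : n.1 * X + n.2 * Y + c = a * dot (E - D) n by rewrite /X /Y /c /dot /=; field.
  by rewrite l mulr0.
have hX' : `|X + om * n.1| <= 1 / 2 by rewrite F1E; apply: half_dist; rewrite F1.
have hY' : `|Y + om * n.2| <= 1 / 2 by rewrite F2E; apply: half_dist; rewrite F2.
have wB' : `|w * e| <= B by rewrite normrM e1 mulr1.
have := rq_slope_perturbed nn' hX hY XY hX' hY' wB' omB.
have -> : rq_slope n.1 n.2 (n.1 + w * e * n.2) (n.2 - w * e * n.1) c (X + om * n.1) (Y + om * n.2)
   = IFE_slope FE_rotated_Q1 D n F nu.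
  rewrite /IFE_slope !big_ord_recl big_ord0 /= /rq_slope F1E F2E nuE.
  have -> : dot ((2^-1, 0) - D) n = c - n.2 / 2 by rewrite /c /dot /=; field.
  have -> : dot ((1, 2^-1) - D) n = c + n.1 / 2 by rewrite /c /dot /=; field.
  have -> : dot ((2^-1, 1) - D) n = c + n.2 / 2 by rewrite /c /dot /=; field.
  have -> : dot ((0, 2^-1) - D) n = c - n.1 / 2 by rewrite /c /dot /=; field.
  by rewrite /dot /=; field.
set S := IFE_slope _ _ _ _ _ => SB.
have r0 : 0 <= 1 - rho by rewrite subr_ge0.
have b1 : (1 - rho) * S <= (1 - rho) * (1 + 5 * B) by exact: ler_wpM2l.
have b2 : (1 - rho) * B <= (1 - rho) * (3 / 5 * s) by exact: ler_wpM2l.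
have b3 : 0 <= rho * (1 - la) * s by rewrite !mulr_ge0 ?subr_ge0// ltW.
have b4 : 0 <= s * (1 - rho) by exact: mulr_ge0.
exact: Den_RQ1_arith sr b1 b2 b3 b4.
Qed.

End Den.

Lemma IFE_ref_bound ft (rho la : R) (D E n t F : plane) (w om : R) (side : 'I_(nv ft) -> bool)
    (phi : bool -> shape_poly R) (y : 'I_(nv ft) -> R) (Y : R) :
  0 < rho -> rho <= 1 -> 0 < la -> la < 1 -> ref_config ft rho la D E n t F w om ->
  (ft <> FE_linear -> ft <> FE_crouzeix_raviart -> `|w| <= 1) ->
  (forall i : 'I_(nv ft), 0 < dot (refnode ft i - D) n -> side i) ->
  (forall i : 'I_(nv ft), dot (refnode ft i - D) n < 0 -> ~~ side i) ->
  (forall s, peval ft (phi false) (D + s *: t) = peval ft (phi true) (D + s *: t)) ->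
  (~~ triangular ft -> cd (phi false) = cd (phi true)) ->
  rho * dot (pgrad ft (phi false) F) (n - w *: t) = dot (pgrad ft (phi true) F) (n - w *: t) ->
  (forall i, peval ft (phi (side i)) (refnode ft i) = y i) -> (forall i, `|y i| <= Y) ->
  forall X, ref_set ft X ->
  let C := 5200 / la * Y in
  [/\ rho * `|peval ft (phi false) X| <= C, IFE_gain ft rho * `|peval ft (phi true) X| <= C,
      rho * `|(pgrad ft (phi false) X).1| <= C /\ rho * `|(pgrad ft (phi false) X).2| <= C
    & IFE_gain ft rho * `|(pgrad ft (phi true) X).1| <= C /\
      IFE_gain ft rho * `|(pgrad ft (phi true) X).2| <= C].
Proof.
move=> r0 r1 l0 l1 cfg w1 s1 s0 Hl Hd Hf Hn yY X rX.
have [[rD rE rF] [[nn tt nt lE] _]] := cfg.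
(* One constant for all four types: 1/10 comes from the bilinear bounds and [la] from the rotated-Q1
   ones. It turns 520 into [5200 / la]. *)
pose nu := n - w *: t; pose a0 := la / 10.
have g0 : 0 < IFE_gain ft rho by rewrite /IFE_gain; case: (ft) => //; rewrite sqrtr_gt0.
have g1 : IFE_gain ft rho <= 1.
  by rewrite /IFE_gain; case: (ft) => //; rewrite -sqrtr1 ler_sqrt.
have w1' : `|w| <= 1.
  by move: cfg w1 => [_ [_]]; case: (ft) => [->|_ ->|->|_ ->] //; rewrite normr0.
have nnu : dot n nu = 1.
  have -> : dot n nu = dot n n - w * dot n t by rewrite /nu /dot /= /GRing.scale /=; ring.
  by rewrite nn nt mulr0 subr0.
have [n1 n2] := unit_coord nn; have [t1 t2] := unit_coord tt.
have nub (a b : R) : `|a| <= 1 -> `|b| <= 1 -> `|a - w * b| <= 2.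
  move=> ha hb; apply: le_trans (ler_normB _ _) _; have -> : 2 = 1 + 1 :> R by ring.
  by apply: lerD => //; rewrite normrM mulr_ile1.
have nu1 : `|nu.1| <= 2 by exact: nub.
have nu2 : `|nu.2| <= 2 by exact: nub.
have a00 : 0 < a0 by rewrite divr_gt0.
have a01 : a0 <= 1 by rewrite /a0; lra.
have Lp2 (i : 'I_(nv ft)) : pos (dot (refnode ft i - D) n) <= 2.
  have := ref_dist i nn rD; rewrite ler_norml => /andP[? ?]; exact: pos_le.
have Lm2 (i : 'I_(nv ft)) : pos (- dot (refnode ft i - D) n) <= 2.
  have := ref_dist i nn rD; rewrite ler_norml => /andP[? ?]; apply: pos_le => //; lra.
have [Den1 Den2] : a0 * rho <= 1 - (1 - rho) * IFE_slope ft D n F nu /\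
    forall i : 'I_(nv ft), a0 * IFE_gain ft rho * pos (- dot (refnode ft i - D) n)
      <= 1 - (1 - rho) * IFE_slope ft D n F nu.
  (* When the gain is [rho], the second bound follows from the first, because [max (- L) 0] is at
     most 2 on the reference element. *)
  have weak (d : R) : la * rho <= d -> a0 * rho <= d /\
      forall i : 'I_(nv ft), a0 * rho * pos (- dot (refnode ft i - D) n) <= d.
    have lr : 0 < la * rho by exact: mulr_gt0.
    move=> ld; split; first by rewrite /a0; lra.
    move=> i; apply: (@le_trans _ _ (a0 * rho * 2)); last by rewrite /a0; lra.
    by rewrite ler_wpM2l// mulr_ge0// ltW.
  have rl : la * rho <= rho by rewrite ler_piMl// ltW.
  have a0le (c x d : R) : 1 / 10 <= c -> 0 <= x -> c * x <= d -> a0 * x <= d.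
    by move=> cb x0; apply: le_trans; rewrite ler_wpM2r// /a0; lra.
  case: (ft) cfg weak {s1 s0 Hl Hd Hf Hn yY rX rD rE rF w1 g0 g1 Lp2 Lm2 phi side y} => cfg weak.
  - have [d1 d2] := Den_linear r0 r1 cfg; split; first by apply: (a0le 1) => //; [lra|exact: ltW|rewrite mul1r].
    move=> i; rewrite -mulrA; apply: (a0le (1 / 2)); first lra.
      by rewrite mulr_ge0 ?sqrtr_ge0// pos_ge0.
    by rewrite mulrA; exact: d2.
  - have [d1 d2] := Den_bilinear r0 r1 cfg; split; first by apply: (a0le 1) => //; [lra|exact: ltW|rewrite mul1r].
    by move=> i; rewrite mulr1; apply: (a0le (1 / 10)); [lra|exact: pos_ge0|exact: d2].
  - by apply: weak; apply: le_trans rl _; exact: Den_CR cfg.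
  - by apply: weak; by apply: (Den_RQ1 _ _ _ cfg).
have conv (r x : R) : a0 * r * x <= 520 * Y -> r * x <= 5200 / la * Y.
  move=> H; have -> : r * x = (a0 * r * x) * (10 / la) by rewrite /a0; field; exact: lt0r_neq0.
  have -> : 5200 / la * Y = 520 * Y * (10 / la) by field; exact: lt0r_neq0.
  by rewrite ler_wpM2r// divr_ge0// ltW.
have core (ell : shape_poly R -> R) :
    (forall p, ell p = \sum_(i < nv ft) peval ft p (refnode ft i) * ell (lam ft i)) ->
    (forall i : 'I_(nv ft), `|ell (lam ft i)| <= 2) ->
    rho * `|ell (phi false)| <= 5200 / la * Y /\
    IFE_gain ft rho * `|ell (phi true)| <= 5200 / la * Y.
  move=> lE' l2.
  have [c1 c2] := IFE_core r0 r1 a00 a01 g0 g1 nn tt nt nnu nu1 nu2 rF Lp2 Den1 Den2 s1 s0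
    Hl Hd Hf Hn yY lE' l2.
  by split; exact: conv.
have dx (p : plane) : dot p (1, 0) = p.1 by rewrite /dot /= mulr1 mulr0 addr0.
have dy (p : plane) : dot p (0, 1) = p.2 by rewrite /dot /= mulr1 mulr0 add0r.
have one2 : 1 <= 2 :> R by rewrite ler1n.
have [v1 v2] := core (fun p => peval ft p X) (fun p => nodal_expansion ft p X)
  (fun i => le_trans (lam_bound i rX) one2).
have [x1 x2] : rho * `|(pgrad ft (phi false) X).1| <= 5200 / la * Y /\
    IFE_gain ft rho * `|(pgrad ft (phi true) X).1| <= 5200 / la * Y.
  apply: (core (fun p => (pgrad ft p X).1)) => [p|i]; last by case: (pgrad_lam_bound i rX).
  by rewrite -dx nodal_expansion_grad; apply: eq_bigr => i _; rewrite dx.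
have [y1 y2] : rho * `|(pgrad ft (phi false) X).2| <= 5200 / la * Y /\
    IFE_gain ft rho * `|(pgrad ft (phi true) X).2| <= 5200 / la * Y.
  apply: (core (fun p => (pgrad ft p X).2)) => [p|i]; last by case: (pgrad_lam_bound i rX).
  by rewrite -dy nodal_expansion_grad; apply: eq_bigr => i _; rewrite dy.
by split.
Qed.

End ReferenceBounds.

(** * Geometry of elements *)

Section ElementGeometry.
Context {R : realType}.
Local Notation plane := (R * R)%type.
Local Notation leb := (@lebesgue_measure R).
Local Notation leb2 := (leb \x leb)%E.
Implicit Types (ft : fe_type) (h : R) (T : element R) (X Y Z : plane).

Definition eunmap h T X : plane :=
  (((-1) ^+ flipx T) * (X.1 - (base T).1) / h, ((-1) ^+ flipy T) * (X.2 - (base T).2) / h).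

Lemma signrb (b : bool) : (-1) ^+ b * (-1) ^+ b = 1 :> R.
Proof. by rewrite -expr2 sqrr_sign. Qed.

Lemma emapK h T X : h != 0 -> eunmap h T (emap h T X) = X.
Proof.
move=> h0; rewrite /eunmap /emap; case: X => x y /=; congr pair.
  have -> : (-1) ^+ flipx T * ((base T).1 + (-1) ^+ flipx T * h * x - (base T).1) / h
    = ((-1) ^+ flipx T * (-1) ^+ flipx T) * x :> R by field.
  by rewrite signrb mul1r.
have -> : (-1) ^+ flipy T * ((base T).2 + (-1) ^+ flipy T * h * y - (base T).2) / h
    = ((-1) ^+ flipy T * (-1) ^+ flipy T) * y :> R by field.
by rewrite signrb mul1r.
Qed.

Lemma eunmapK h T X : h != 0 -> emap h T (eunmap h T X) = X.
Proof.
move=> h0; rewrite /eunmap /emap; case: X => x y /=; congr pair.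
  have -> : (base T).1 + (-1) ^+ flipx T * h * ((-1) ^+ flipx T * (x - (base T).1) / h)
    = (base T).1 + ((-1) ^+ flipx T * (-1) ^+ flipx T) * (x - (base T).1) by field.
  by rewrite signrb; ring.
have -> : (base T).2 + (-1) ^+ flipy T * h * ((-1) ^+ flipy T * (y - (base T).2) / h)
    = (base T).2 + ((-1) ^+ flipy T * (-1) ^+ flipy T) * (y - (base T).2) by field.
by rewrite signrb; ring.
Qed.

Lemma eunmap_seg h T X Y t :
  eunmap h T (seg_pt X Y t) = seg_pt (eunmap h T X) (eunmap h T Y) t.
Proof. by rewrite /eunmap /seg_pt; apply/pair_equal_spec; split; rewrite /= /GRing.scale /=; ring. Qed.

(** The element as an intersection of half-planes, numbered so that the i-th function vanishes on
    the i-th edge. These functions are affine along segments, which makes convexity arguments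
    immediate. *)
Definition ref_cstr ft (i : nat) X : R :=
  if triangular ft then match i with 0 => X.2 | 1 => 1 - X.1 | _ => X.1 - X.2 end
  else match i with 0 => X.2 | 1 => 1 - X.1 | 2 => 1 - X.2 | _ => X.1 end.

Lemma ref_setE ft X : ref_set ft X <-> forall i : 'I_(nv ft), 0 <= ref_cstr ft i X.
Proof.
rewrite /ref_set /ref_cstr /nv; case: triangular => /=; split.
- by move=> [a /andP[b c]] [[|[|[|//]]] i3] /=; lra.
- move=> H; have := H (Ordinal (isT : 0 < 3)%N); have := H (Ordinal (isT : 1 < 3)%N).
  by have := H (Ordinal (isT : 2 < 3)%N) => /= *; split; [lra|apply/andP; split; lra].
- by move=> [/andP[a b] /andP[c d]] [[|[|[|[|//]]]] i3] /=; lra.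
- move=> H; have := H (Ordinal (isT : 0 < 4)%N); have := H (Ordinal (isT : 1 < 4)%N).
  have := H (Ordinal (isT : 2 < 4)%N); have := H (Ordinal (isT : 3 < 4)%N) => /= *.
  by split; apply/andP; split; lra.
Qed.

Lemma ref_cstr_seg ft i X Y t :
  ref_cstr ft i (seg_pt X Y t) = (1 - t) * ref_cstr ft i X + t * ref_cstr ft i Y.
Proof.
rewrite /ref_cstr /seg_pt; case: triangular; case: i => [|[|[|i]]];
  rewrite /= /GRing.scale /=; ring.
Qed.

Definition ecstr ft h T i X : R := ref_cstr ft i (eunmap h T X).
Definition eint ft h T : set plane := [set X | forall i : 'I_(nv ft), 0 < ecstr ft h T i X].

Lemma ecstr_seg ft h T i X Y t :
  ecstr ft h T i (seg_pt X Y t) = (1 - t) * ecstr ft h T i X + t * ecstr ft h T i Y.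
Proof. by rewrite /ecstr eunmap_seg ref_cstr_seg. Qed.

Lemma refnode_cstr ft (i : 'I_(nv ft)) :
  exists j : 'I_(nv ft), ref_cstr ft j (refnode ft i : plane) = 0.
Proof.
rewrite /ref_cstr; case: ft i => /= i; case: i => -[|[|[|[|//]]]] //= _.
all: try (by exists (Ordinal (isT : (0 < 3)%N)) => /=; lra).
all: try (by exists (Ordinal (isT : (1 < 3)%N)) => /=; lra).
all: try (by exists (Ordinal (isT : (2 < 3)%N)) => /=; lra).
all: try (by exists (Ordinal (isT : (0 < 4)%N)) => /=; lra).
all: try (by exists (Ordinal (isT : (1 < 4)%N)) => /=; lra).
all: try (by exists (Ordinal (isT : (2 < 4)%N)) => /=; lra).
all: by exists (Ordinal (isT : (3 < 4)%N)) => /=; lra.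
Qed.

Section Fixed.
Variables (ft : fe_type) (h : R) (T : element R).
Hypothesis h0 : 0 < h.
Let hn : h != 0. Proof. exact: lt0r_neq0. Qed.

Lemma esetE X : eset ft h T X <-> ref_set ft (eunmap h T X).
Proof.
split; first by move=> [Y rY <-]; rewrite emapK.
by move=> rX; exists (eunmap h T X) => //; rewrite eunmapK.
Qed.

Lemma eset_cstr X : eset ft h T X <-> forall i : 'I_(nv ft), 0 <= ecstr ft h T i X.
Proof. by rewrite esetE ref_setE. Qed.

Lemma eint_eset : eint ft h T `<=` eset ft h T.
Proof. by move=> X eX; apply/eset_cstr => i; apply: ltW; exact: eX. Qed.

Lemma continuous_ecstr i : continuous (ecstr ft h T i).
Proof.
have c1 : continuous (fun X : plane => (eunmap h T X).1).
  move=> X; apply: cvgM; last exact: cvg_cst.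
  apply: cvgM; first exact: cvg_cst.
  by apply: cvgB; [exact: continuous_fst|exact: cvg_cst].
have c2 : continuous (fun X : plane => (eunmap h T X).2).
  move=> X; apply: cvgM; last exact: cvg_cst.
  apply: cvgM; first exact: cvg_cst.
  by apply: cvgB; [exact: continuous_snd|exact: cvg_cst].
rewrite /ecstr /ref_cstr; case: triangular; case: i => [|[|[|i]]] X //=;
  try (by apply: cvgB; [exact: cvg_cst|exact: c1]);
  try (by apply: cvgB; [exact: cvg_cst|exact: c2]);
  try exact: c1; try exact: c2.
- by apply: cvgB; [exact: c1|exact: c2].
- by apply: cvgB; [exact: c1|exact: c2].
Qed.

Lemma open_eint : open (eint ft h T).
Proof.
rewrite openE => X eX; rewrite /interior /=.
have : \forall Y \near X, forall i : 'I_(nv ft), 0 < ecstr ft h T i Y; last by [].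
apply: (@filter_forall _ _ (fun i : 'I_(nv ft) => [set Y | 0 < ecstr ft h T i Y]) (nbhs X)) => i.
apply: (@open_nbhs_nbhs _ X (ecstr ft h T i @^-1` [set x | 0 < x])); split; last exact: eX.
by apply: open_comp; [move=> Y _; exact: continuous_ecstr|exact: open_gt].
Qed.

Lemma closed_eset : closed (eset ft h T).
Proof.
have -> : eset ft h T = \bigcap_(i in [set: 'I_(nv ft)]) (ecstr ft h T i @^-1` [set x | 0 <= x]).
  by apply/seteqP; split => [X /eset_cstr eX i _|X eX]; [exact: eX|apply/eset_cstr => i; exact: (eX i)].
apply: closed_bigI => i _; apply: closed_comp; last exact: closed_ge.
by move=> X _; exact: continuous_ecstr.
Qed.

Lemma measurable_eset : measurable (eset ft h T).
Proof. by apply: closed_measurable2; exact: closed_eset. Qed.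

Lemma eint_seg X Y t : eint ft h T X -> eset ft h T Y -> 0 <= t < 1 -> eint ft h T (seg_pt X Y t).
Proof.
move=> eX /eset_cstr eY /andP[t0 t1] i; rewrite ecstr_seg ltr_pwDl//.
  by rewrite mulr_gt0 ?subr_gt0.
by rewrite mulr_ge0.
Qed.

Definition ecentre : plane := emap h T (if triangular ft then (2 / 3, 1 / 3) else (1 / 2, 1 / 2)).

Lemma ecentre_eint : eint ft h T ecentre.
Proof.
move=> i; rewrite /ecstr /ecentre emapK// /ref_cstr; case: ft i => /= i; case: i => -[|[|[|[|//]]]] //= _; lra.
Qed.

(** From a point where some constraint vanishes, an arbitrarily small step away from the centre
    makes it negative and leaves the element. *)
Lemma interior_eset : (eset ft h T)° = eint ft h T.
Proof.
apply/seteqP; split => X; last first.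
  by move=> eX; apply: (@filterS _ _ _ _ _ eint_eset); exact: (open_nbhs_nbhs (conj open_eint eX)).
move=> iX i.
have sX : eset ft h T X by exact: nbhs_singleton.
have /eset_cstr cX := sX.
rewrite lt_neqAle cX andbT eq_sym; apply/negP => /eqP e0.
have c : (fun t : R => seg_pt X ecentre t) @ (0 : R) --> X.
  have := @continuous_seg_pt R X ecentre 0; rewrite /continuous_at.
  by rewrite {2}/seg_pt scale0r addr0.
have /nbhs_ballP[e /= e0' He] : \forall t \near (0 : R), eset ft h T (seg_pt X ecentre t) by exact: c.
have /eset_cstr/(_ i) : eset ft h T (seg_pt X ecentre (- (e / 2))).
  by apply: He; rewrite /ball /= sub0r normrN normrN gtr0_norm ?divr_gt0//; lra.
rewrite ecstr_seg e0 mulr0 add0r mulNr oppr_ge0 leNgt => /negP; apply.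
by rewrite mulr_gt0 ?divr_gt0//; exact: ecentre_eint.
Qed.

Lemma ref_cstr_edge (i : 'I_(nv ft)) X : ref_set ft X -> ref_cstr ft i X = 0 ->
  exists2 t, 0 <= t <= 1 & X = seg_pt (ref_vertex i) (ref_vertex (next_vertex i)) t.
Proof.
rewrite /ref_set /ref_cstr /next_vertex; case: ft i => /= i; case: i => -[|[|[|[|//]]]] //= _; case: X => x y /=.
all: move=> [] H1 H2 H3.
all: have a1 : 0 <= x <= 1 by lra.
all: have a2 : 0 <= y <= 1 by lra.
all: have b1 : 0 <= 1 - x <= 1 by lra.
all: have b2 : 0 <= 1 - y <= 1 by lra.
all: rewrite /modn /seg_pt /=.
all: [> exists x | exists y | exists (1 - x) | exists x | exists y | exists (1 - x) | exists (1 - y)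
  | exists x | exists y | exists (1 - x) | exists x | exists y | exists (1 - x) | exists (1 - y)].
all: try assumption.
all: clear a1 a2 b1 b2 H1 H2; by apply/pair_equal_spec; split; rewrite /= /GRing.scale /=; lra.
Qed.

Lemma emap_seg X Y t : emap h T (seg_pt X Y t) = seg_pt (emap h T X) (emap h T Y) t.
Proof. by rewrite /emap /seg_pt; apply/pair_equal_spec; split; rewrite /= /GRing.scale /=; ring. Qed.

Lemma ecstr_edge (i : 'I_(nv ft)) X : eset ft h T X -> ecstr ft h T i X = 0 -> edge h T i X.
Proof.
move=> /esetE rX cX; have [t t01 E] := ref_cstr_edge rX cX.
exists t; first by rewrite /= in_itv.
by rewrite /vertex -seg_ptE -emap_seg -E eunmapK.
Qed.

Lemma node_eset (i : 'I_(nv ft)) : eset ft h T (node h T i).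
Proof. by rewrite node_emap; exists (refnode ft i) => //; exact: refnode_ref_set. Qed.

Lemma node_boundary (i : 'I_(nv ft)) : ~ eint ft h T (node h T i).
Proof.
rewrite node_emap => H; have [j j0] := refnode_cstr i.
by have := H j; rewrite /ecstr emapK// j0 ltxx.
Qed.

Lemma eset_diam X Y : eset ft h T X -> eset ft h T Y -> `|(Y - X).1| <= h /\ `|(Y - X).2| <= h.
Proof.
move=> [x rx <-] [y ry <-].
have [/andP[a1 a2] /andP[a3 a4]] := ref_set_box rx; have [/andP[b1 b2] /andP[b3 b4]] := ref_set_box ry.
have aux (b : bool) (c u v : R) : 0 <= u -> u <= 1 -> 0 <= v -> v <= 1 ->
   `|c + (-1) ^+ b * h * v - (c + (-1) ^+ b * h * u)| <= h.
  move=> u0 u1 v0 v1; have -> : c + (-1) ^+ b * h * v - (c + (-1) ^+ b * h * u) = (-1) ^+ b * (h * (v - u)) by ring.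
  rewrite normrM normr_sign mul1r normrM (gtr0_norm h0) ger_pMr// ler_norml; apply/andP; split; lra.
by split; exact: aux.
Qed.

Lemma ecstr_affine i : exists a b c : R, (a != 0 \/ b != 0) /\
  forall X, ecstr ft h T i X = a * X.1 + b * X.2 + c.
Proof.
pose sx : R := (-1) ^+ flipx T; pose sy : R := (-1) ^+ flipy T.
have sxh : sx / h != 0 by rewrite mulf_neq0 ?signr_eq0// invr_eq0.
have syh : sy / h != 0 by rewrite mulf_neq0 ?signr_eq0// invr_eq0.
have k2 : exists a b c : R, (a != 0 \/ b != 0) /\ forall X, (eunmap h T X).2 = a * X.1 + b * X.2 + c.
  exists 0, (sy / h), (- (sy / h * (base T).2)); split; first by right.
  by move=> X; rewrite /= -/sy; ring.
have k1 : exists a b c : R, (a != 0 \/ b != 0) /\ forall X, (eunmap h T X).1 = a * X.1 + b * X.2 + c.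
  exists (sx / h), 0, (- (sx / h * (base T).1)); split; first by left.
  by move=> X; rewrite /= -/sx; ring.
have neg (f : plane -> R) : (exists a b c : R, (a != 0 \/ b != 0) /\ forall X, f X = a * X.1 + b * X.2 + c) ->
    exists a b c : R, (a != 0 \/ b != 0) /\ forall X, 1 - f X = a * X.1 + b * X.2 + c.
  move=> [a [b [c [ab fE]]]]; exists (- a), (- b), (1 - c); rewrite !oppr_eq0; split => // X.
  by rewrite fE; ring.
have dd : exists a b c : R, (a != 0 \/ b != 0) /\
    forall X, (eunmap h T X).1 - (eunmap h T X).2 = a * X.1 + b * X.2 + c.
  exists (sx / h), (- (sy / h)), (- (sx / h * (base T).1) + sy / h * (base T).2); split; first by left.
  by move=> X; rewrite /= -/sx -/sy; ring.
rewrite /ecstr /ref_cstr; case: triangular; case: i => [|[|[|i]]]; try exact: k1; try exact: k2;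
  try exact: dd; exact: neg.
Qed.

End Fixed.

Lemma line_null (a b c : R) : a != 0 \/ b != 0 ->
  leb2.-negligible [set X : plane | a * X.1 + b * X.2 + c = 0].
Proof.
move=> ab; set A := [set X | _].
have cA : closed A.
  have -> : A = (fun X : plane => a * X.1 + b * X.2 + c) @^-1` [set 0] by [].
  apply: closed_comp; last exact: closed_eq.
  move=> X _; apply: cvgD; last exact: cvg_cst.
  by apply: cvgD; apply: cvgM; try exact: cvg_cst; [exact: continuous_fst|exact: continuous_snd].
have mA : measurable A by exact: closed_measurable2.
exists A; split => //.
have [b0|b0] := eqVneq b 0; last first.
  rewrite /product_measure1 integral0_eq// => x _ /=.
  have -> : xsection A x = [set - (a * x + c) / b].
    apply/seteqP; split => y; rewrite /xsection /= inE /A /=.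
      by move=> H; apply: (mulIf b0); rewrite divfK//; lra.
    by move=> ->; field.
  exact: lebesgue_measure_set1.
have a0 : a != 0 by case: ab => //; rewrite b0 eqxx.
have -> : A = [set - c / a] `*` [set: R].
  apply/seteqP; split => -[x y]; rewrite /A /= b0 mul0r addr0.
    by move=> H; split => //; apply: (mulIf a0); rewrite divfK//; lra.
  by move=> [-> _]; field.
rewrite product_measure1E; [|exact: measurable_set1|exact: measurableT].
transitivity (0 * leb [set: R])%E; last by rewrite mul0e.
by congr (_ * _)%E; exact: lebesgue_measure_set1.
Qed.

Lemma eset_null ft h T : 0 < h -> leb2.-negligible (eset ft h T `\` eint ft h T).
Proof.
move=> h0.
have N (i : nat) : leb2.-negligible [set X | ecstr ft h T i X = 0].
  have [a [b [c [ab E]]]] := ecstr_affine ft T h0 i.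
  have -> : [set X | ecstr ft h T i X = 0] = [set X : plane | a * X.1 + b * X.2 + c = 0].
    by apply/seteqP; split => X /=; rewrite E.
  exact: line_null.
have [A [mA A0 sA]] := negligible_bigcup_count N.
exists A; split => // X [/(eset_cstr _ _ h0) sX nX]; apply: sA.
have [i i0] : exists i : 'I_(nv ft), ecstr ft h T i X = 0.
  apply: contrapT => H; apply: nX => i; rewrite lt_neqAle sX andbT eq_sym.
  by apply/eqP => E; apply: H; exists i.
by exists (val i).
Qed.

Lemma connected_side (A O1 O2 : set plane) X : connected A -> open O1 -> open O2 ->
  O1 `&` O2 = set0 -> A `<=` O1 `|` O2 -> A X -> O1 X -> A `<=` O1.
Proof.
move=> cA o1 o2 O12 AO AX OX.
have AE : A `&` O1 = A.
  apply: cA; first by exists X.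
  - by exists O1.
  - exists (~` O2); first exact: open_closedC.
    apply/seteqP; split => Y [AY OY]; split => //.
      by move=> OY2; have : set0 Y by rewrite -O12.
    by case: (AO _ AY).
by rewrite -AE => Y [].
Qed.

Lemma connected_seg (I : set R) X Y : is_interval I -> connected (seg_pt X Y @` I).
Proof.
move=> /connected_intervalP cI; apply: connected_continuous_connected => //.
by apply: continuous_subspaceT; exact: continuous_seg_pt.
Qed.

End ElementGeometry.

(** * Graphs over a chord *)

Section Graph.
Context {R : realType}.
Implicit Types (g dg om : R -> R).

Lemma MVT_between g dg (lo hi a b : R) : (forall x, is_derive x (1 : R) g (dg x)) ->
  lo <= a <= hi -> lo <= b <= hi ->
  exists2 c, lo <= c <= hi & g b - g a = dg c * (b - a).
Proof.
move=> gd; have cg : continuous g.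
  by apply: derivable_continuous => x; case: (gd x).
wlog ab : a b / a <= b => [H|].
  have [/H//|/ltW/H H' ha hb] := leP a b.
  have [c hc E] := H' hb ha; exists c => //.
  by rewrite -[LHS]opprB E -mulrN opprB.
move=> /andP[a1 a2] /andP[b1 b2].
have [c] := MVT_segment ab (fun x _ => gd x) (continuous_subspaceT cg).
rewrite in_itv /= => /andP[ac cb] E; exists c => //.
by rewrite (le_trans a1)// (le_trans cb).
Qed.

Lemma is_derive_sine (d1 : R -> R) (d2 x : R) : is_derive x (1 : R) d1 d2 ->
  is_derive x (1 : R) (fun t : R => d1 t / Num.sqrt (1 + d1 t ^+ 2))
    (d2 / Num.sqrt (1 + d1 x ^+ 2) ^+ 3).
Proof.
move=> dd; have p0 : 0 < 1 + d1 x ^+ 2 by rewrite ltr_pwDl// sqr_ge0.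
have q0 : Num.sqrt (1 + d1 x ^+ 2) != 0 by rewrite gt_eqF// sqrtr_gt0.
have d3 : is_derive x (1 : R) (fun t => 1 + d1 t ^+ 2) (2 * d1 x * d2).
  have h := is_deriveD (is_derive_cst (1 : R) x 1) (is_deriveX 2 dd).
  by apply: is_derive_eq h _; rewrite /GRing.scale /= expr1 add0r; ring.
have d4 : is_derive x (1 : R) (fun t => Num.sqrt (1 + d1 t ^+ 2)) _ :=
  @is_derive1_comp R Num.sqrt (fun t => 1 + d1 t ^+ 2) x _ _ (is_derive1_sqrt p0) d3.
have h := is_deriveM dd (@is_deriveV R (fun t => Num.sqrt (1 + d1 t ^+ 2)) x _ 1 q0 d4).
apply: is_derive_eq h _; rewrite /GRing.scale /=.
have E : d1 x ^+ 2 = Num.sqrt (1 + d1 x ^+ 2) ^+ 2 - 1 by rewrite sqr_sqrtr ?ltW//; ring.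
set q := Num.sqrt _ in q0 E *.
have -> : d1 x * (- q ^- 2 * ((2 * q)^-1 * (2 * d1 x * d2))) + q^-1 * d2 = d2 * (q ^+ 2 - d1 x ^+ 2) / q ^+ 3.
  by field.
by rewrite E opprB addrCA subrr addr0 mulr1.
Qed.

(* The sine of the angle between the graph and its chord vanishes somewhere
   by Rolle, and its derivative is the curvature. *)
Lemma graph_slope_bound (om d1 d2 : R -> R) (xE kap : R) : 0 < xE -> 0 <= kap ->
  (forall x, is_derive x (1 : R) om (d1 x)) -> (forall x, is_derive x (1 : R) d1 (d2 x)) ->
  om 0 = 0 -> om xE = 0 ->
  (forall x, 0 <= x <= xE -> `|d2 x| <= kap * Num.sqrt (1 + d1 x ^+ 2) ^+ 3) ->
  forall x, 0 <= x <= xE -> d1 x ^+ 2 <= (kap * xE) ^+ 2 * (1 + d1 x ^+ 2).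
Proof.
move=> xE0 k0 dom dd1 om0 omE kd x xb.
have [c] : exists2 c, c \in `]0, xE[%R & om xE - om 0 = d1 c * (xE - 0).
  apply: (MVT xE0).
  apply: continuous_subspaceT; apply: derivable_continuous => y; by case: (dom y).
rewrite in_itv /= => /andP[c0 cE]; rewrite om0 omE !subr0 => /esym/eqP.
rewrite mulf_eq0 (gt_eqF xE0) orbF => /eqP d1c.
have cb : 0 <= c <= xE by rewrite !ltW.
have [y yb] := MVT_between (fun t => is_derive_sine (dd1 t)) cb xb.
rewrite d1c mul0r subr0 => E.
have p t : 0 < 1 + d1 t ^+ 2 by rewrite ltr_pwDl// sqr_ge0.
have q t : 0 < Num.sqrt (1 + d1 t ^+ 2) by rewrite sqrtr_gt0.
have S : `|d1 x / Num.sqrt (1 + d1 x ^+ 2)| <= kap * xE.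
  rewrite E normrM; apply: ler_pM => //.
    rewrite normrM [`|_ ^-1|]gtr0_norm ?invr_gt0 ?exprn_gt0// ler_pdivrMr ?exprn_gt0//.
    exact: kd.
  by rewrite ler_norml; move: xb cb => /andP[? ?] /andP[? ?]; apply/andP; split; lra.
have S' : `|d1 x| <= kap * xE * Num.sqrt (1 + d1 x ^+ 2).
  by move: S; rewrite normrM normfV [`|Num.sqrt _|]gtr0_norm// ler_pdivrMr.
have kx : 0 <= kap * xE * Num.sqrt (1 + d1 x ^+ 2) by apply: le_trans S'.
rewrite -[X in _ <= _ * X](sqr_sqrtr (ltW (p x))) -exprMn -[leLHS]real_normK ?num_real//.
by apply: lerXn2r.
Qed.

(** The mean value theorem from both ends bounds the height by [W x] and by [W (xE - x)]; the
    smaller of the two is at most [W xE / 2]. *)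
Lemma graph_height_bound (om d1 : R -> R) (xE W : R) : 0 < xE ->
  (forall x, is_derive x (1 : R) om (d1 x)) -> om 0 = 0 -> om xE = 0 ->
  (forall x, 0 <= x <= xE -> `|d1 x| <= W) ->
  forall x, 0 <= x <= xE -> `|om x| <= W * (xE / 2).
Proof.
move=> xE0 dom om0 omE dW x xb; have /andP[x0 xE1] := xb.
have z0 : (0 : R) <= 0 <= xE by rewrite lexx ltW.
have z1 : 0 <= xE <= xE by rewrite lexx andbT ltW.
have W0 : 0 <= W by apply: le_trans (dW 0 z0).
have [c cb] := MVT_between dom z0 xb; rewrite om0 !subr0 => E1.
have [c' cb'] := MVT_between dom z1 xb; rewrite omE !subr0 => E2.
have h1 : `|om x| <= W * x by rewrite E1 normrM (ger0_norm x0) ler_wpM2r// dW.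
have h2 : `|om x| <= W * (xE - x).
  have xx : `|x - xE| = xE - x by rewrite distrC ger0_norm ?subr_ge0.
  by rewrite E2 normrM xx ler_wpM2r ?subr_ge0// dW.
lra.
Qed.

Lemma nbhs_inside (a b x : R) (A : set R) : a < b -> a <= x <= b -> nbhs x A ->
  exists2 y, a < y < b & A y.
Proof.
move=> ab /andP[ax xb] /nbhs_ballP[e /= e0 eA].
pose d := Num.min (e / 2) ((b - a) / 4).
have d0 : 0 < d by rewrite lt_min divr_gt0//= divr_gt0// subr_gt0.
have de : d <= e / 2 by rewrite ge_min lexx.
have dl : d <= (b - a) / 4 by rewrite ge_min lexx orbT.
have [xm|xm] := leP x ((a + b) / 2).
  exists (x + d); first by apply/andP; split; lra.
  by apply: eA; rewrite /ball /= opprD addrA subrr sub0r normrN gtr0_norm; lra.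
exists (x - d); first by apply/andP; split; lra.
by apply: eA; rewrite /ball /= opprB addrC subrK gtr0_norm; lra.
Qed.

(** Some tangent of the graph passes strictly below the point [(xM, eM)]. If the point lies over the
    open chord, the tangent at [xM] does; over an end point, a nearby tangent does by continuity;
    otherwise the tangent is found by the mean value theorem. *)
Lemma tangent_below (om d1 : R -> R) (xE xM eM : R) : 0 < xE -> 0 < eM ->
  (forall x, is_derive x (1 : R) om (d1 x)) -> continuous d1 ->
  om 0 = 0 -> om xE = 0 -> (0 < xM < xE -> om xM < eM) ->
  exists2 x, 0 < x < xE & 0 < eM - om x - d1 x * (xM - x).
Proof.
move=> xE0 eM0 dom cd1 om0 omE inside.
have com : continuous om by apply: derivable_continuous => y; case: (dom y).
have endpt : om xM = 0 -> 0 <= xM <= xE -> exists2 x, 0 < x < xE & 0 < eM - om x - d1 x * (xM - x).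
  move=> omM xMb; apply: (nbhs_inside xE0 xMb).
  have c : continuous (fun x => eM - om x - d1 x * (xM - x)).
    move=> x; apply: cvgB; first by apply: cvgB; [exact: cvg_cst|exact: com].
    by apply: cvgM; [exact: cd1|apply: cvgB; [exact: cvg_cst|exact: cvg_id]].
  apply: (@open_nbhs_nbhs _ xM ((fun x => eM - om x - d1 x * (xM - x)) @^-1` [set x | 0 < x])).
  split; first by apply: open_comp; [move=> Y _; exact: c|exact: open_gt].
  by rewrite /= omM subrr mulr0 !subr0.
have [out|] := ltP (xM * (xE - xM)) 0; last first.
  have [m0|m0] := eqVneq xM 0; first by move=> _; apply: endpt; rewrite m0// lexx ltW.
  have [mE|mE] := eqVneq xM xE; first by move=> _; apply: endpt; rewrite mE// lexx andbT ltW.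
  move=> H; have xMb : 0 < xM < xE.
    have [mn|mp|/eqP] := ltgtP xM 0; last by rewrite (negbTE m0).
      have : xM * (xE - xM) < 0 by rewrite nmulr_rlt0//; lra.
      by rewrite ltNge H.
    rewrite ltNge; apply/negP; rewrite le_eqVlt eq_sym (negbTE mE) /= => mb.
    have : xM * (xE - xM) < 0 by rewrite pmulr_rlt0//; lra.
    by rewrite ltNge H.
  by exists xM => //; rewrite subrr mulr0 subr0 subr_gt0; exact: inside.
have ne x : 0 <= x <= xE -> x - xM != 0.
  move=> /andP[x0 x1]; apply/eqP => E; have Ex : x = xM by lra.
  by move: out; rewrite ltNge mulr_ge0// -Ex// subr_ge0.
have df x : x - xM != 0 -> is_derive x (1 : R) (fun t => (eM - om t) / (t - xM))
    ((- d1 x * (x - xM) - (eM - om x)) / (x - xM) ^+ 2).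
  move=> n0.
  have g1 : is_derive x (1 : R) (fun t => t - xM) 1.
    by have h := is_deriveB (is_derive_id x (1 : R)) (is_derive_cst xM x 1); apply: is_derive_eq h _; rewrite subr0.
  have g2 : is_derive x (1 : R) (fun t => eM - om t) (- d1 x).
    by have h := is_deriveB (is_derive_cst eM x 1) (dom x); apply: is_derive_eq h _; rewrite sub0r.
  have h := is_deriveM g2 (@is_deriveV R (fun t => t - xM) x _ 1 n0 g1).
  by apply: is_derive_eq h _; rewrite /GRing.scale /=; field.
(* The quotient is minus the slope of the line from [(xM, eM)] to the graph point at [t]. As [om]
   vanishes at both ends, its increment has the sign of [xM * (xE - xM)], which is negative here; a
   negative derivative at [c] says that the tangent at [c] passes below the point. *)
have [c] : exists2 c, c \in `]0, xE[%R & (eM - om xE) / (xE - xM) - (eM - om 0) / (0 - xM)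
    = ((- d1 c * (c - xM) - (eM - om c)) / (c - xM) ^+ 2) * (xE - 0).
  apply: (@MVT _ (fun t => (eM - om t) / (t - xM)) (fun c => (- d1 c * (c - xM) - (eM - om c)) / (c - xM) ^+ 2)) => // [y|].
    by rewrite in_itv /= => /andP[y0 y1]; apply: df; apply: ne; rewrite !ltW.
  apply: continuous_in_subspaceT => y; rewrite inE /= in_itv /= => yb.
  have [dv _] := df y (ne y yb).
  by apply: differentiable_continuous; apply/derivable1_diffP.
rewrite in_itv /= => /andP[c0 cE] E.
have cn : c - xM != 0 by apply: ne; rewrite !ltW.
have xEn : xE - xM != 0 by apply: ne; rewrite lexx andbT ltW.
have xn : 0 - xM != 0 by apply: ne; rewrite lexx ltW.
have mn : xM != 0 by move: xn; rewrite sub0r oppr_eq0.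
exists c; first by rewrite c0.
have neg : (- d1 c * (c - xM) - (eM - om c)) / (c - xM) ^+ 2 * xE < 0.
  move: E; rewrite om0 omE !subr0 => <-.
  have -> : eM / (xE - xM) - eM / (0 - xM) = eM * xE / (xM * (xE - xM)).
    by rewrite sub0r invrN mulrN opprK; field; rewrite mn xEn.
  by rewrite pmulr_rlt0 ?mulr_gt0// invr_lt0.
move: neg; rewrite pmulr_llt0// pmulr_llt0 ?invr_gt0 ?exprn_even_gt0//; lra.
Qed.

End Graph.

(** * The interface in its local frame *)

Section InterfaceFrame.
Context {R : realType}.
Local Notation plane := (R * R)%type.

Lemma dotC (v w : plane) : dot v w = dot w v.
Proof. by rewrite /dot mulrC [v.2 * _]mulrC. Qed.

Lemma dot_ge0 (v : plane) : 0 <= dot v v.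
Proof. by rewrite /dot -!expr2 addr_ge0 ?sqr_ge0. Qed.

Lemma dot_eq0 (v : plane) : dot v v = 0 -> v = 0.
Proof.
rewrite /dot -!expr2 => /eqP; rewrite paddr_eq0 ?sqr_ge0// !sqrf_eq0 => /andP[/eqP a /eqP b].
by case: v a b => x y /= -> ->.
Qed.

Lemma enorm_sqr (v : plane) : enorm v ^+ 2 = dot v v.
Proof. by rewrite /enorm sqr_sqrtr// dot_ge0. Qed.

Lemma dot_addl (u v w : plane) : dot (u + v) w = dot u w + dot v w.
Proof. by rewrite /dot /=; ring. Qed.

Lemma dot_addr (u v w : plane) : dot w (u + v) = dot w u + dot w v.
Proof. by rewrite /dot /=; ring. Qed.

Lemma dotZl (a : R) (v w : plane) : dot (a *: v) w = a * dot v w.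
Proof. by rewrite /dot /= /GRing.scale /=; ring. Qed.

Lemma dotNr (v w : plane) : dot w (- v) = - dot w v.
Proof. by rewrite /dot /=; ring. Qed.

Lemma dotNl (v w : plane) : dot (- v) w = - dot v w.
Proof. by rewrite /dot /=; ring. Qed.

Lemma orthonormal_decomp (n t v : plane) : dot n n = 1 -> dot t t = 1 -> dot n t = 0 ->
  v = dot v t *: t + dot v n *: n.
Proof.
move=> nn tt nt; have [e e1 ->] := orthonormal_rot nn tt nt.
have ee : e ^+ 2 = 1 by rewrite -[LHS]real_normK ?num_real// e1 expr1n.
move: nn; rewrite /dot; case: n {nt} => a b; case: v => x y /= nn.
rewrite /GRing.scale /=; congr pair; rewrite /= /GRing.scale /=.
  have -> : (x * - (e * b) + y * (e * a)) * - (e * b) + (x * a + y * b) * a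
    = e ^+ 2 * (x * b * b - y * a * b) + x * a * a + y * b * a by ring.
  rewrite ee; have -> : 1 * (x * b * b - y * a * b) + x * a * a + y * b * a = x * (a * a + b * b) by ring.
  by rewrite nn mulr1.
have -> : (x * - (e * b) + y * (e * a)) * (e * a) + (x * a + y * b) * b
  = e ^+ 2 * (y * a * a - x * a * b) + x * a * b + y * b * b by ring.
rewrite ee; have -> : 1 * (y * a * a - x * a * b) + x * a * b + y * b * b = y * (a * a + b * b) by ring.
by rewrite nn mulr1.
Qed.

Lemma dot_decomp (n t v w : plane) : dot n n = 1 -> dot t t = 1 -> dot n t = 0 ->
  dot v w = dot v t * dot t w + dot v n * dot n w.
Proof.
move=> nn tt nt; rewrite {1}(orthonormal_decomp v nn tt nt) dot_addl !dotZl.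
by [].
Qed.

Section Frame.
Variables (ft : fe_type) (P : interface_problem R) (T : element R).
Hypothesis (h0 : 0 < mesh_size P).
Hypothesis lok : local_interface_ok ft P T.
Let L := local P T.
Let h := mesh_size P.

Lemma DE_neq : ptD L <> ptE L.
Proof. by case: lok => -[]. Qed.

Lemma Gamma_bd : Gamma P `&` ebd ft h T = [set ptD L; ptE L].
Proof. by case: lok => -[]. Qed.

Lemma nbar_unit : dot (nbar L) (nbar L) = 1.
Proof. by case: lok => _ []. Qed.

Lemma xiE_gt0 : 0 < xiE L.
Proof.
rewrite /xiE /enorm sqrtr_gt0 lt_neqAle dot_ge0 andbT eq_sym; apply/eqP => /dot_eq0 /eqP.
by rewrite subr_eq0 => /eqP /esym; exact: DE_neq.
Qed.

Lemma tau_unit : dot (tau L) (tau L) = 1.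
Proof.
rewrite /tau dotZl dotZr mulrA -invfM -expr2 enorm_sqr mulVf// -enorm_sqr sqrf_eq0.
by rewrite gt_eqF// xiE_gt0.
Qed.

Lemma nbar_tau : dot (nbar L) (tau L) = 0.
Proof. by rewrite /tau dotZr; case: lok => _ [_ ->]; rewrite mulr0. Qed.

Lemma ptE_E : ptE L = ptD L + xiE L *: tau L.
Proof. by rewrite /tau scalerA divff ?gt_eqF ?xiE_gt0// scale1r addrC subrK. Qed.

Definition eta_of X := dot (X - ptD L) (nbar L).

Lemma frameE X : X = ptD L + xi_of L X *: tau L + eta_of X *: nbar L.
Proof.
rewrite -addrA -(orthonormal_decomp (X - ptD L) nbar_unit tau_unit nbar_tau).
by rewrite addrC subrK.
Qed.

Lemma xi_graph x : xi_of L (graph_pt L x) = x.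
Proof.
rewrite /xi_of /graph_pt addrAC [ptD L + _]addrC addrK dot_addl (dotZl x) (dotZl (omega L x)) tau_unit nbar_tau.
by rewrite mulr1 mulr0 addr0.
Qed.

Lemma eta_graph x : eta_of (graph_pt L x) = omega L x.
Proof.
rewrite /eta_of /graph_pt addrAC [ptD L + _]addrC addrK dot_addl (dotZl x) (dotZl (omega L x)) nbar_unit.
by rewrite (dotC (tau L)) nbar_tau mulr1 mulr0 add0r.
Qed.

Lemma graph_on x : 0 <= x <= xiE L -> Gamma P (graph_pt L x) /\ Tset ft P T (graph_pt L x).
Proof.
move=> xb; have [_ _ [_ E] _ _] := lok.
have : (Gamma P `&` Tset ft P T) (graph_pt L x) by rewrite E; exists x => //=; rewrite in_itv.
by [].
Qed.

Lemma on_graph X : Gamma P X -> Tset ft P T X ->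
  [/\ 0 <= xi_of L X <= xiE L, eta_of X = omega L (xi_of L X) & X = graph_pt L (xi_of L X)].
Proof.
move=> gX tX; have [_ _ [_ E] _ _] := lok.
have : (Gamma P `&` Tset ft P T) X by split.
rewrite E => -[x xb <-]; rewrite xi_graph eta_graph.
by move: xb; rewrite /= in_itv.
Qed.

Lemma ptD_on : Gamma P (ptD L) /\ ebd ft h T (ptD L).
Proof. by have : (Gamma P `&` ebd ft h T) (ptD L) by rewrite Gamma_bd; left. Qed.

Lemma ptE_on : Gamma P (ptE L) /\ ebd ft h T (ptE L).
Proof. by have : (Gamma P `&` ebd ft h T) (ptE L) by rewrite Gamma_bd; right. Qed.

Lemma xi_ptD : xi_of L (ptD L) = 0.
Proof. by rewrite /xi_of subrr /dot /= !mul0r addr0. Qed.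

Lemma xi_ptE : xi_of L (ptE L) = xiE L.
Proof. by rewrite /xi_of ptE_E [_ + _ *: _]addrC addrK (dotZl (xiE L)) tau_unit mulr1. Qed.

Lemma omega0 : omega L 0 = 0.
Proof.
have [g [t _]] := ptD_on; have [_ + _] := on_graph g t.
by rewrite xi_ptD /eta_of subrr /dot /= !mul0r addr0.
Qed.

Lemma omegaE : omega L (xiE L) = 0.
Proof.
have [g [t _]] := ptE_on; have [_ + _] := on_graph g t.
rewrite xi_ptE /eta_of ptE_E [_ + _ *: _]addrC addrK (dotZl (xiE L)) (dotC (tau L)) nbar_tau mulr0.
by [].
Qed.

Lemma omega_is_derive x : is_derive x (1 : R) (omega L) (derive1 (omega L) x).
Proof.
have [_ _ [[d1 _ _] _] _ _] := lok.
by apply: (@DeriveDef _ _ _ _ _ _ _ (d1 x)); rewrite derive1E.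
Qed.

Lemma omega_is_derive2 x : is_derive x (1 : R) (derive1 (omega L)) (derive1 (derive1 (omega L)) x).
Proof.
have [_ _ [[_ d2 _] _] _ _] := lok.
by apply: (@DeriveDef _ _ _ _ _ _ _ (d2 x)); rewrite derive1E.
Qed.

Lemma omega_continuous : continuous (omega L).
Proof. by apply: derivable_continuous => x; case: (omega_is_derive x). Qed.

Lemma domega_continuous : continuous (derive1 (omega L)).
Proof. by apply: derivable_continuous => x; case: (omega_is_derive2 x). Qed.

Lemma graph_coord_derive x :
  is_derive x (1 : R) (fun t => (graph_pt L t).1) ((tau L).1 + derive1 (omega L) x * (nbar L).1) /\
  is_derive x (1 : R) (fun t => (graph_pt L t).2) ((tau L).2 + derive1 (omega L) x * (nbar L).2).
Proof.
have aux (a b c : R) : is_derive x (1 : R) (fun t => a + t * b + omega L t * c) (b + derive1 (omega L) x * c).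
  have hb := is_deriveD (is_deriveD (is_derive_cst a x (1 : R)) (is_deriveM (is_derive_id x (1 : R)) (is_derive_cst b x 1)))
    (is_deriveM (omega_is_derive x) (is_derive_cst c x 1)).
  by apply: is_derive_eq hb _; rewrite /GRing.scale /=; ring.
by split; exact: aux.
Qed.

Lemma graph_coord_derive2 x :
  is_derive x (1 : R) (fun t => (tau L).1 + derive1 (omega L) t * (nbar L).1) (derive1 (derive1 (omega L)) x * (nbar L).1) /\
  is_derive x (1 : R) (fun t => (tau L).2 + derive1 (omega L) t * (nbar L).2) (derive1 (derive1 (omega L)) x * (nbar L).2).
Proof.
have aux (a c : R) : is_derive x (1 : R) (fun t => a + derive1 (omega L) t * c) (derive1 (derive1 (omega L)) x * c).
  have hb := is_deriveD (is_derive_cst a x (1 : R)) (is_deriveM (omega_is_derive2 x) (is_derive_cst c x 1)).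
  by apply: is_derive_eq hb _; rewrite /GRing.scale /=; ring.
by split; exact: aux.
Qed.

Lemma graph_curvature x :
  curvature (graph_pt L) x = `|derive1 (derive1 (omega L)) x| / Num.sqrt (1 + derive1 (omega L) x ^+ 2) ^+ 3.
Proof.
have e1 : derive1 (fun t => (graph_pt L t).1) = (fun t => (tau L).1 + derive1 (omega L) t * (nbar L).1).
  by apply: funext => t; apply: is_derive_derive1; case: (graph_coord_derive t).
have e2 : derive1 (fun t => (graph_pt L t).2) = (fun t => (tau L).2 + derive1 (omega L) t * (nbar L).2).
  by apply: funext => t; apply: is_derive_derive1; case: (graph_coord_derive t).
rewrite /curvature e1 e2.
have [/is_derive_derive1 -> /is_derive_derive1 ->] := graph_coord_derive2 x.
have [e e1' tE] := orthonormal_rot nbar_unit tau_unit nbar_tau.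
have ee : e ^+ 2 = 1 by rewrite -[LHS]real_normK ?num_real// e1' expr1n.
have nn := nbar_unit; rewrite /dot in nn.
set n := nbar L in nn tE *; set w := derive1 (omega L) x; set w2 := derive1 (derive1 (omega L)) x.
have -> : ((tau L).1 + w * n.1) * (w2 * n.2) - ((tau L).2 + w * n.2) * (w2 * n.1) = - (e * w2 * (n.1 * n.1 + n.2 * n.2)).
  by rewrite tE /=; ring.
have -> : enorm ((tau L).1 + w * n.1, (tau L).2 + w * n.2) = Num.sqrt (1 + w ^+ 2).
  rewrite /enorm /dot tE /=; congr Num.sqrt.
  have -> : (- (e * n.2) + w * n.1) * (- (e * n.2) + w * n.1) + (e * n.1 + w * n.2) * (e * n.1 + w * n.2)
    = (e ^+ 2 + w ^+ 2) * (n.1 * n.1 + n.2 * n.2) by ring.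
  by rewrite nn ee mulr1.
by rewrite nn mulr1 normrN normrM e1' mul1r.
Qed.

Lemma graph_C2_arc : C2_arc (graph_pt L) 0 (xiE L).
Proof.
have [_ _ [[w1 w2 w3] _] _ _] := lok.
have e1 : derive1 (fun t => (graph_pt L t).1) = (fun t => (tau L).1 + derive1 (omega L) t * (nbar L).1).
  by apply: funext => t; apply: is_derive_derive1; case: (graph_coord_derive t).
have e2 : derive1 (fun t => (graph_pt L t).2) = (fun t => (tau L).2 + derive1 (omega L) t * (nbar L).2).
  by apply: funext => t; apply: is_derive_derive1; case: (graph_coord_derive t).
have f1 : derive1 (fun t => (tau L).1 + derive1 (omega L) t * (nbar L).1) = (fun t => derive1 (derive1 (omega L)) t * (nbar L).1).
  by apply: funext => t; apply: is_derive_derive1; case: (graph_coord_derive2 t).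
have f2 : derive1 (fun t => (tau L).2 + derive1 (omega L) t * (nbar L).2) = (fun t => derive1 (derive1 (omega L)) t * (nbar L).2).
  by apply: funext => t; apply: is_derive_derive1; case: (graph_coord_derive2 t).
split; first exact: xiE_gt0.
- rewrite /C2_line e1 f1; split; [|
    |by move=> x; apply: cvgM; [exact: w3|exact: cvg_cst]].
  + by move=> x; case: (graph_coord_derive x) => -[].
  + by move=> x; case: (graph_coord_derive2 x) => -[].
- rewrite /C2_line e2 f2; split; [|
    |by move=> x; apply: cvgM; [exact: w3|exact: cvg_cst]].
  + by move=> x; case: (graph_coord_derive x) => _ [].
  + by move=> x; case: (graph_coord_derive2 x) => _ [].
- move=> t _; rewrite e1 e2; apply/eqP => -[E1 E2].
  have : dot ((tau L).1 + derive1 (omega L) t * (nbar L).1, (tau L).2 + derive1 (omega L) t * (nbar L).2) (tau L) = 1.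
    have -> : dot ((tau L).1 + derive1 (omega L) t * (nbar L).1, (tau L).2 + derive1 (omega L) t * (nbar L).2) (tau L)
      = dot (tau L) (tau L) + derive1 (omega L) t * dot (nbar L) (tau L) by rewrite /dot /=; ring.
    by rewrite tau_unit nbar_tau mulr0 addr0.
  by rewrite E1 E2 /dot /= !mul0r addr0 => /esym/eqP; rewrite oner_eq0.
Qed.

Section Curvature.
Hypothesis (km : is_max_curvature (Gamma P) (kappa P)).

Lemma kappa_ge0 : 0 <= kappa P.
Proof.
case: km => -[c [a [b [t [_ _ _ ->]]]]] _; rewrite /curvature divr_ge0//.
by rewrite exprn_ge0// /enorm sqrtr_ge0.
Qed.

(** The graph over the chord is one of the arcs over which the maximal curvature is taken. *)
Lemma omega_curvature x : 0 <= x <= xiE L ->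
  `|derive1 (derive1 (omega L)) x| <= kappa P * Num.sqrt (1 + derive1 (omega L) x ^+ 2) ^+ 3.
Proof.
move=> xb; have q : 0 < Num.sqrt (1 + derive1 (omega L) x ^+ 2) ^+ 3.
  by rewrite exprn_gt0// sqrtr_gt0 ltr_pwDl// sqr_ge0.
rewrite -ler_pdivrMr// -graph_curvature; case: km => _; apply.
exists (graph_pt L), 0, (xiE L), x; split; [exact: graph_C2_arc| |by rewrite in_itv|by []].
by move=> X [y yb <-]; apply: (graph_on _).1; move: yb; rewrite /= in_itv.
Qed.

Lemma omega_slope x : 0 <= x <= xiE L ->
  derive1 (omega L) x ^+ 2 <= (kappa P * xiE L) ^+ 2 * (1 + derive1 (omega L) x ^+ 2).
Proof.
exact: (graph_slope_bound xiE_gt0 kappa_ge0 omega_is_derive omega_is_derive2 omega0 omegaE omega_curvature).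
Qed.

End Curvature.

Lemma xiE_le : xiE L ^+ 2 <= 2 * h ^+ 2.
Proof.
have [_ [dT _]] := ptD_on; have [_ [eT _]] := ptE_on.
have [a b] := eset_diam h0 dT eT.
rewrite /xiE enorm_sqr /dot -!expr2 mulr_natl mulr2n; apply: lerD.
  by rewrite -[leLHS]real_normK ?num_real// lerXn2r ?nnegrE// ltW.
by rewrite -[leLHS]real_normK ?num_real// lerXn2r ?nnegrE// ltW.
Qed.

End Frame.
End InterfaceFrame.

(** * Sides of the nodes *)

Section Sides.
Context {R : realType}.
Local Notation plane := (R * R)%type.

Lemma ballE (M X : plane) (e : R) : ball M e X <-> `|(X - M).1| < e /\ `|(X - M).2| < e.
Proof.
by split=> -[a b]; split; move: a b; rewrite /ball /= => a b; rewrite distrC.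
Qed.

Lemma ball_seg (M X Y : plane) (e t : R) : 0 <= t <= 1 -> ball M e X -> ball M e Y ->
  ball M e (seg_pt X Y t).
Proof.
move=> /andP[t0 t1] /ballE[x1 x2] /ballE[y1 y2].
have aux (m x y : R) : `|x - m| < e -> `|y - m| < e -> `|x + t * (y - x) - m| < e.
  rewrite !ltr_norml => /andP[a1 a2] /andP[b1 b2].
  have [->|tp] := eqVneq t 0; first by rewrite mul0r addr0 a1.
  have tp' : 0 < t by rewrite lt_neqAle eq_sym tp.
  have u1 : 0 < t * (y - m + e) by rewrite mulr_gt0//; lra.
  have u2 : 0 < t * (e - (y - m)) by rewrite mulr_gt0//; lra.
  have u3 : 0 <= (1 - t) * (x - m + e) by rewrite mulr_ge0//; lra.
  have u4 : 0 <= (1 - t) * (e - (x - m)) by rewrite mulr_ge0//; lra.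
  by apply/andP; split; lra.
by apply/ballE; split; exact: aux.
Qed.

Lemma seg_pt0 (X Y : plane) : seg_pt X Y 0 = X.
Proof. by rewrite /seg_pt scale0r addr0. Qed.

Lemma seg_pt1 (X Y : plane) : seg_pt X Y 1 = Y.
Proof. by rewrite /seg_pt scale1r addrC subrK. Qed.

Lemma seg_pt_inj (X Y : plane) s t : X <> Y -> seg_pt X Y s = seg_pt X Y t -> s = t.
Proof.
move=> XY /addrI /eqP; rewrite -subr_eq0 -scalerBl scaler_eq0 subr_eq0 subr_eq0.
by case/orP => /eqP // E; case: XY.
Qed.

Lemma near1 (A : set plane) (X Y : plane) (a : R) : a < 1 -> nbhs Y A ->
  exists2 t, a < t < 1 & A (seg_pt X Y t).
Proof.
move=> a1 nA; apply: (@nbhs_inside R a 1 1 (seg_pt X Y @^-1` A)) => //; first by rewrite lexx ltW.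
by have := @continuous_seg_pt R X Y 1; rewrite /continuous_at seg_pt1; apply.
Qed.

Lemma near0 (A : set plane) (X Y : plane) (a : R) : 0 < a -> nbhs X A ->
  exists2 t, 0 < t < a & A (seg_pt X Y t).
Proof.
move=> a1 nA; apply: (@nbhs_inside R 0 a 0 (seg_pt X Y @^-1` A)) => //; first by rewrite lexx ltW.
by have := @continuous_seg_pt R X Y 0; rewrite /continuous_at seg_pt0; apply.
Qed.

Section Hyp.
Variables (ft : fe_type) (P : interface_problem R) (T : element R).
Hypothesis (sh : standing_hypotheses ft P) (iT : interface_element ft P T).
Hypothesis (nob : forall X, ~ obscure ft P T X).
Let L := local P T.
Let h := mesh_size P.
Let O := Omega_ P.
Let Gam := Gamma P.
Let Ti := eint ft h T.
Let TS := Tset ft P T.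
Implicit Types (i : 'I_(nv ft)) (X Y : plane).

Lemma mesh_size_gt0 : 0 < mesh_size P.
Proof. by case: (hyp_mesh sh). Qed.
Let h0 := mesh_size_gt0.

Lemma lok : local_interface_ok ft P T.
Proof. exact: hyp_local sh _ iT. Qed.

(** Omega is the interior of a finite union of closed rectangles. This closed union contains the
    closure of Omega, hence the element, and taking interiors concludes. *)
Lemma eint_Omega : Ti `<=` Omega P.
Proof.
have [_ [K _ KE]] := hyp_domain sh.
have cK : closed (\bigcup_(k in [set` K]) rectangle k).
  apply: closed_bigcup => [|k _]; first exact: finite_seq.
  exact: closed_box.
have [_ _ _ cO _] := hyp_mesh sh.
have TK : TS `<=` \bigcup_(k in [set` K]) rectangle k.
  move=> X tX; have : closure (Omega P) X by rewrite cO; exists T => //; case: iT.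
  by move=> cX; apply: cK; apply: closure_subset cX; rewrite KE; exact: interior_subset.
rewrite KE => X eX; move: (@interiorS _ _ _ TK X); apply.
by rewrite /TS /Tset interior_eset.
Qed.

Lemma open_side s : open (O s).
Proof. by case: (hyp_separates sh) => /(_ s) []. Qed.

Lemma side_Gamma s X : O s X -> ~ Gam X.
Proof.
case: (hyp_separates sh) => _ _ E _ sX gX.
have : (Omega P `\` Gam) X by rewrite E; case: s sX; [right|left].
by case.
Qed.

Lemma side_disj s t X : O s X -> O t X -> s = t.
Proof.
case: (hyp_separates sh) => _ E _ _; case: s; case: t => // a b.
- by have : (O false `&` O true) X by []; rewrite E.
- by have : (O false `&` O true) X by []; rewrite E.
Qed.

Lemma side_cover X : Ti X -> ~ Gam X -> O false X \/ O true X.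
Proof.
move=> tX gX; case: (hyp_separates sh) => _ _ E _.
have : (Omega P `\` Gam) X by split => //; exact: eint_Omega.
by rewrite E.
Qed.

Lemma connected_same_side (A : set plane) s X : connected A -> A `<=` Ti -> A `&` Gam = set0 ->
  A X -> O s X -> A `<=` O s.
Proof.
move=> cA AT AG AX OX.
have d : O s `&` O (~~ s) = set0.
  by apply/seteqP; split => Y // [a b]; have := side_disj a b; case: (s).
have cov : A `<=` O s `|` O (~~ s); last exact: (connected_side cA (@open_side s) (@open_side (~~ s)) d cov AX OX).
move=> Y AY; have nG : ~ Gam Y by move=> gY; have : set0 Y by rewrite -AG.
by case: (side_cover (AT _ AY) nG); case: (s) => /=; auto.
Qed.

Lemma segment_pt X Y t : 0 <= t <= 1 -> segment X Y (seg_pt X Y t).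
Proof. by move=> t01; exists t; rewrite /= ?in_itv// seg_ptE. Qed.

Lemma seg_Gamma_unique (i : 'I_(nv ft)) X s t : TS X -> X <> nodeP P T i -> 0 <= s <= 1 -> 0 <= t <= 1 ->
  Gam (seg_pt X (nodeP P T i) s) -> Gam (seg_pt X (nodeP P T i) t) -> s = t.
Proof.
move=> tX XM s01 t01 gs gt; apply: contrapT => st; apply: (nob (X := X)); split => //.
exists i, (seg_pt X (nodeP P T i) s), (seg_pt X (nodeP P T i) t); split.
  by move=> E; apply: st; exact: seg_pt_inj E.
by move=> Y [|] ->; split => //; exact: segment_pt.
Qed.

Lemma nodeP_eset i : TS (nodeP P T i).
Proof. exact: node_eset. Qed.

(** One of D and E differs from the node. If the node were on the interface, the segment joining
    them would meet it at both ends and that point would be obscure. *)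
Lemma node_notin_Gamma i : ~ Gam (nodeP P T i).
Proof.
move=> gM; set M := nodeP P T i in gM.
have [X [tX gX XM]] : exists X, [/\ TS X, Gam X & X <> M].
  have [gD [tD _]] := ptD_on lok; have [gE [tE _]] := ptE_on lok.
  have [E|E] := pselect (ptD L = M); last by exists (ptD L).
  by exists (ptE L); split => // E'; apply: (DE_neq lok); rewrite -/L E E'.
have : (0 : R) = 1.
  by apply: (@seg_Gamma_unique i X) => //; rewrite ?seg_pt0 ?seg_pt1// ?lexx ?ler01.
by move/eqP; rewrite eq_sym oner_eq0.
Qed.

Lemma closed_Gamma : closed (Gam `&` TS).
Proof.
have [_ _ [_ E] _ _] := lok; rewrite E.
apply: compact_closed; first exact: norm_hausdorff.
apply: continuous_compact; last exact: segment_compact.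
apply: continuous_subspaceT => t; apply: cvgD.
  apply: cvgD; first exact: cvg_cst.
  by apply: cvgZl; exact: cvg_id.
by apply: cvgZl; exact: (omega_continuous lok).
Qed.

Lemma node_side i : exists s, exists2 e, 0 < e &
  forall X, ball (nodeP P T i) e X -> Ti X -> O s X.
Proof.
set M := nodeP P T i.
have nM : nbhs M (~` (Gam `&` TS)).
  apply: open_nbhs_nbhs; split; first exact: closed_openC closed_Gamma.
  by move=> [gM _]; exact: (node_notin_Gamma gM).
have /nbhs_ballP[e /= e0 He] := nM.
have bG X : ball M e X -> Ti X -> ~ Gam X.
  by move=> bX tX gX; apply: (He _ bX); split => //; exact: eint_eset.
have cT : Ti (ecentre ft h T) by exact: ecentre_eint.
have [t /andP[t0 t1] bt] := near0 (ecentre ft h T) ltr01 (nbhsx_ballx M e e0).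
set X0 := seg_pt M (ecentre ft h T) t in bt.
have tX0 : Ti X0.
  have -> : X0 = seg_pt (ecentre ft h T) M (1 - t).
    by rewrite /X0 !seg_ptE subKr addrC.
  by apply: eint_seg => //; [exact: nodeP_eset|apply/andP; split; lra].
have [s sX0] : exists s, O s X0 by case: (side_cover tX0 (bG _ bt tX0)); [exists false|exists true].
exists s, e => // X bX tX.
have b t' : 0 <= t' <= 1 -> ball M e (seg_pt X0 X t') /\ Ti (seg_pt X0 X t').
  move=> /andP[u0 u1]; split; first by apply: ball_seg => //; rewrite u0.
  have [->|ut] := eqVneq t' 1; first by rewrite seg_pt1.
  by apply: eint_seg => //; [exact: eint_eset|rewrite u0 lt_neqAle ut].
have cA : connected (seg_pt X0 X @` `[0, 1]).
  by apply: connected_seg; exact: interval_is_interval.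
apply: (connected_same_side cA _ _ _ sX0).
- by move=> Y [u /=]; rewrite in_itv /= => u01 <-; case: (b u u01).
- apply/seteqP; split => // Y [[u /=]]; rewrite in_itv /= => u01 <- gY.
  by case: (b u u01) => bY tY; exact: bG gY.
- by exists 0; rewrite ?seg_pt0//= in_itv /= lexx ler01.
- by exists 1; rewrite ?seg_pt1//= in_itv /= lexx ler01.
Qed.

(** A node may lie on the boundary of Omega and so in neither subdomain; its side is read off from
    the nearby interior points of the element, which form a convex set free of the interface. *)
Definition nside i : bool := xget true [set s | exists2 e, 0 < e &
  forall X, ball (nodeP P T i) e X -> Ti X -> O s X].

Lemma nsideP i : exists2 e, 0 < e & forall X, ball (nodeP P T i) e X -> Ti X -> O (nside i) X.
Proof. have [s sP] := node_side i.
exact: (@xgetPex _ true [set s | exists2 e, 0 < e &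
  forall X, ball (nodeP P T i) e X -> Ti X -> O s X] (ex_intro _ s sP)). Qed.

(** This gives access to the nodal conditions of the shape functions, which are stated on
    closures. *)
Lemma node_closure i : closure (Tsub ft P T (nside i)) (nodeP P T i).
Proof.
have [e e0 He] := nsideP i => B /nbhs_ballP[d /= d0 Hd].
have nn : nbhs (nodeP P T i) (ball (nodeP P T i) e `&` ball (nodeP P T i) d).
  by apply: filterI; exact: nbhsx_ballx.
have [t /andP[t0 t1] [b1 b2]] := near1 (ecentre ft h T) ltr01 nn.
have tX : Ti (seg_pt (ecentre ft h T) (nodeP P T i) t).
  by apply: eint_seg => //; [exact: ecentre_eint|exact: nodeP_eset|rewrite t1 ltW].
exists (seg_pt (ecentre ft h T) (nodeP P T i) t); split; last exact: Hd.
by split; [exact: eint_eset|exact: He].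
Qed.

Lemma node_neq i X : Ti X -> X <> nodeP P T i.
Proof. by move=> tX E; apply: (@node_boundary R ft h T h0 i); rewrite -/(nodeP P T i) -E. Qed.

Lemma seg_final_side i X a : Ti X -> 0 <= a < 1 ->
  (forall t, a < t < 1 -> ~ Gam (seg_pt X (nodeP P T i) t)) ->
  forall t, a < t < 1 -> O (nside i) (seg_pt X (nodeP P T i) t).
Proof.
move=> tX /andP[a0 a1] nG t tb; set M := nodeP P T i.
have [e e0 He] := nsideP i.
have [u ub bu] := near1 X a1 (nbhsx_ballx M e e0).
have inT v : a < v < 1 -> Ti (seg_pt X M v).
  move=> /andP[v0 v1]; apply: eint_seg => //; first exact: nodeP_eset.
  by rewrite v1 andbT (le_trans a0)// ltW.
have cA : connected (seg_pt X M @` `]a, 1[) by apply: connected_seg; exact: interval_is_interval.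
apply: (connected_same_side cA _ _ _ (He _ bu (inT u ub))).
- by move=> Y [v /=]; rewrite in_itv /= => vb <-; exact: inT.
- apply/seteqP; split => // Y [[v /=]]; rewrite in_itv /= => vb <-; exact: nG.
- by exists u.
- by exists t.
Qed.

(** The parameter [t0] is the crossing if there is one. A single meeting point need not change the
    side, so in that case nothing is claimed about [nside]. *)
Lemma seg_sides i s X : Ti X -> O s X ->
  exists2 t0, 0 < t0 < 1 &
    [/\ forall t, 0 <= t < t0 -> O s (seg_pt X (nodeP P T i) t),
        forall t, t0 < t < 1 -> O (nside i) (seg_pt X (nodeP P T i) t)
      & Gam (seg_pt X (nodeP P T i) t0) \/ nside i = s].
Proof.
move=> tX sX; set M := nodeP P T i.
have inT v : 0 <= v < 1 -> Ti (seg_pt X M v) by move=> ?; apply: eint_seg => //; exact: nodeP_eset.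
have first_part a : 0 < a -> a <= 1 -> (forall t, 0 <= t < a -> ~ Gam (seg_pt X M t)) ->
    forall t, 0 <= t < a -> O s (seg_pt X M t).
  move=> a0 a1 nG t tb.
  have cA : connected (seg_pt X M @` `[0, a[) by apply: connected_seg; exact: interval_is_interval.
  apply: (connected_same_side cA _ _ _ sX).
  - move=> Y [v /=]; rewrite in_itv /= => /andP[v0 va] <-; apply: inT.
    by rewrite v0 (lt_le_trans va).
  - apply/seteqP; split => // Y [[v /=]]; rewrite in_itv /= => vb <-; exact: nG.
  - by exists 0; rewrite ?seg_pt0//= in_itv /= lexx.
  - by exists t.
have g0 : ~ Gam (seg_pt X M 0) by rewrite seg_pt0; exact: side_Gamma sX.
have g1 : ~ Gam (seg_pt X M 1) by rewrite seg_pt1; exact: node_notin_Gamma.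
have tX' : TS X by exact: eint_eset.
have [[t0 [t0b gt0]]|no] := pselect (exists t0, 0 <= t0 <= 1 /\ Gam (seg_pt X M t0)).
  have t00 : 0 < t0 < 1.
    move: t0b => /andP[u0 u1]; rewrite !lt_neqAle u0 u1 !andbT; apply/andP; split; apply/eqP => E.
      by apply: g0; rewrite E.
    by apply: g1; rewrite -E.
  have uniq t : 0 <= t <= 1 -> Gam (seg_pt X M t) -> t = t0.
    by move=> tb gt; apply: (@seg_Gamma_unique i X) => //; exact: node_neq.
  have /andP[u0 u1] := t00.
  exists t0 => //; split; last by left.
  - apply: first_part => //; first exact: ltW.
    move=> t /andP[a b] /uniq E; have : t = t0 by apply: E; rewrite a (le_trans (ltW b))// ltW.
    by move=> E'; rewrite E' ltxx in b.
  - apply: seg_final_side => //; first by rewrite u1 ltW.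
    move=> t /andP[a b] /uniq E; have : t = t0 by apply: E; rewrite (ltW b) andbT (le_trans (ltW u0))// ltW.
    by move=> E'; rewrite E' ltxx in a.
have nG t : 0 <= t <= 1 -> ~ Gam (seg_pt X M t) by move=> tb gt; apply: no; exists t.
have all t : 0 <= t < 1 -> O s (seg_pt X M t).
  by apply: first_part => // u /andP[a b]; apply: nG; rewrite a ltW.
have fin t : 0 < t < 1 -> O (nside i) (seg_pt X M t).
  apply: seg_final_side => //; first by rewrite lexx ltr01.
  by move=> u /andP[a b]; apply: nG; rewrite !ltW.
have k0 : (0 : R) < 1 / 2 by lra.
have k1 : (1 / 2 : R) < 1 by lra.
(* Without a crossing the whole segment is on one side, and any interior parameter would do. *)
exists (1 / 2); first by rewrite k0.
split.
- by move=> t /andP[a b]; apply: all; rewrite a /=; lra.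
- by move=> t /andP[a b]; apply: fin; rewrite b andbT; lra.
- right; apply: (@side_disj _ _ (seg_pt X M (1 / 2))); first by apply: fin; rewrite k0.
  by apply: all; rewrite k1 ltW.
Qed.

End Hyp.
End Sides.

(** * The side of a node and its position relative to the chord *)

Section NodeSign.
Context {R : realType}.
Local Notation plane := (R * R)%type.
Lemma dot_sub3 (A B C w : plane) : dot (A - B) w = dot (A - C) w - dot (B - C) w.
Proof. by rewrite /dot /=; ring. Qed.

Lemma seg_pt_dir (Y v0 v1 : plane) t a :
  seg_pt (Y + t *: v0) (Y + t *: v1) a = Y + t *: seg_pt v0 v1 a.
Proof. by rewrite /seg_pt; apply/pair_equal_spec; split; rewrite /= /GRing.scale /=; ring. Qed.

Variables (ft : fe_type) (P : interface_problem R) (T : element R).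
Hypothesis (sh : standing_hypotheses ft P) (iT : interface_element ft P T).
Hypothesis (nob : forall X, ~ obscure ft P T X).
Let L := local P T.
Let h := mesh_size P.
Let O := Omega_ P.
Let Gam := Gamma P.
Let Ti := eint ft h T.
Let TS := Tset ft P T.
Let h0 : 0 < h := mesh_size_gt0 sh.
Let lk : local_interface_ok ft P T := lok sh iT.
Implicit Types (i : 'I_(nv ft)) (X Y : plane).

Lemma tau_dot_nbar : dot (tau L) (nbar L) = 0.
Proof. by rewrite dotC; exact: (nbar_tau lk). Qed.

Lemma eta_frame (x y : R) : eta_of P T (ptD L + x *: tau L + y *: nbar L) = y.
Proof.
rewrite /eta_of -/L addrAC [ptD L + _]addrC addrK dot_addl (dotZl x) (dotZl y).
by rewrite tau_dot_nbar (nbar_unit lk) mulr0 mulr1 add0r.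
Qed.

Lemma xi_frame (x y : R) : xi_of L (ptD L + x *: tau L + y *: nbar L) = x.
Proof.
rewrite /xi_of addrAC [ptD L + _]addrC addrK dot_addl (dotZl x) (dotZl y).
by rewrite (nbar_tau lk) (tau_unit lk) mulr0 mulr1 addr0.
Qed.

Lemma ebd_eint X : ebd ft h T X -> TS X /\ ~ Ti X.
Proof. by rewrite /ebd (interior_eset _ _ h0) => -[]. Qed.

Lemma graph_eint x : 0 < x < xiE L -> Ti (graph_pt L x).
Proof.
move=> /andP[x0 x1].
have [g t] : Gam (graph_pt L x) /\ TS (graph_pt L x) by apply: (graph_on lk); rewrite !ltW.
apply: contrapT => nT.
have : (Gam `&` ebd ft h T) (graph_pt L x) by split => //; rewrite /ebd (interior_eset _ _ h0).
rewrite /Gam (Gamma_bd lk) => -[E|E]; have := xi_graph lk x; rewrite -/L E.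
  by rewrite xi_ptD => E'; rewrite -E' ltxx in x0.
by rewrite (xi_ptE lk) => E'; rewrite -E' ltxx in x1.
Qed.

(** Each constraint is affine along the chord and nonnegative at its ends; it could vanish in
    between only if both ends were on the corresponding edge, which the boundary hypothesis
    excludes. *)
Lemma chord_eint t : 0 < t < 1 -> Ti (seg_pt (ptD L) (ptE L) t).
Proof.
move=> /andP[t0 t1] i; rewrite ecstr_seg.
have [_ /ebd_eint[tD _]] := ptD_on lk; have [_ /ebd_eint[tE _]] := ptE_on lk.
have cD := (eset_cstr ft T h0 _).1 tD i; have cE := (eset_cstr ft T h0 _).1 tE i.
have [D0|D0] := eqVneq (ecstr ft h T i (ptD L)) 0; last first.
  apply: ltr_pwDl; last by apply: mulr_ge0 => //; exact: ltW.
  by apply: mulr_gt0; rewrite ?subr_gt0// lt_neqAle eq_sym D0.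
have [E0|E0] := eqVneq (ecstr ft h T i (ptE L)) 0; last first.
  apply: ltr_wpDl; first by apply: mulr_ge0 => //; rewrite subr_ge0 ltW.
  by apply: mulr_gt0; rewrite // lt_neqAle eq_sym E0.
exfalso; have mT : mesh P T by case: iT.
have := @hyp_boundary _ _ _ sh _ mT _ _ (DE_neq lk) (Gamma_bd lk) i; apply.
by move=> X [|] ->; exact: ecstr_edge.
Qed.

Definition sgb (b : bool) : R := if b then 1 else -1.

Lemma sgb_mul b : sgb b * sgb b = 1.
Proof. by case: b; rewrite /sgb ?mulr1// mulrNN mulr1. Qed.

Lemma sgb_norm b x : `|sgb b * x| = `|x|.
Proof. by case: b; rewrite /sgb ?mul1r// mulN1r normrN. Qed.

(* Close to a point of the interface, the directions pointing to one side of
   its tangent lead to one side of the interface. *)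
Lemma near_graph_side b x (v0 v1 : plane) : 0 < x < xiE L ->
  let G v := sgb b * (dot v (nbar L) - derive1 (omega L) x * dot v (tau L)) in
  0 < G v0 -> 0 < G v1 ->
  exists2 d, 0 < d & forall t a, 0 < t < d -> 0 <= a <= 1 ->
    let Y := graph_pt L x + t *: seg_pt v0 v1 a in Ti Y /\ ~ Gam Y.
Proof.
move=> xb G G0 G1; set Y0 := graph_pt L x.
have tY0 : Ti Y0 by exact: graph_eint.
have /nbhs_ballP[e /= e0 He] : nbhs Y0 Ti by apply: open_nbhs_nbhs; split => //; exact: open_eint.
pose c := Num.min (G v0) (G v1).
have c0 : 0 < c by rewrite lt_min G0.
pose C := `|dot v0 (tau L)| + `|dot v1 (tau L)| + 1.
have C0 : 0 < C by rewrite ltr_wpDl// addr_ge0.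
have ec0 : 0 < c / (2 * C) by rewrite divr_gt0// mulr_gt0.
have cx : derive1 (omega L) z @[z --> x] --> derive1 (omega L) x by exact: (domega_continuous lk).
have /cvgrPdist_lt dx := cx.
have /nbhs_ballP[d1 /= d10 Hd1] := dx _ ec0.
pose M := `|v0.1| + `|v1.1| + `|v0.2| + `|v1.2| + 1.
have M0 : 0 < M by rewrite ltr_wpDl// !addr_ge0.
have [d d0 [dd1 dd2]] := min_half (divr_gt0 e0 M0) (divr_gt0 d10 C0).
exists d => // t a /andP[t0 td] /andP[a0 a1]; set v := seg_pt v0 v1 a; set Y := Y0 + t *: v.
have conv (p q : R) : `|p + a * (q - p)| <= `|p| + `|q|.
  have -> : p + a * (q - p) = (1 - a) * p + a * q by ring.
  apply: le_trans (ler_normD _ _) _; rewrite !normrM (ger0_norm a0) (ger0_norm (_ : 0 <= 1 - a)) ?subr_ge0//.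
  by apply: lerD; apply: ler_piMl => //; lra.
have v1b : `|v.1| < M.
  by apply: le_lt_trans (conv v0.1 v1.1) _; rewrite /M; have := normr_ge0 v0.2; have := normr_ge0 v1.2; lra.
have v2b : `|v.2| < M.
  by apply: le_lt_trans (conv v0.2 v1.2) _; rewrite /M; have := normr_ge0 v0.1; have := normr_ge0 v1.1; lra.
have dv (w : plane) : dot v w = dot v0 w + a * (dot v1 w - dot v0 w).
  by rewrite /v /seg_pt dot_addl (dotZl a) dot_addl dotNl.
have vt : `|dot v (tau L)| < C by rewrite dv; apply: le_lt_trans (conv _ _) _; rewrite /C; lra.
have Gv : c <= G v.
  have -> : G v = (1 - a) * G v0 + a * G v1 by rewrite /G !dv; ring.
  have h1 : c <= G v0 by rewrite ge_min lexx.
  have h2 : c <= G v1 by rewrite ge_min lexx orbT.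
  have u1 : 0 <= (1 - a) * (G v0 - c) by rewrite mulr_ge0 ?subr_ge0.
  have u2 : 0 <= a * (G v1 - c) by rewrite mulr_ge0 ?subr_ge0.
  by lra.
have tY : Ti Y.
  have YY : Y - Y0 = t *: v by rewrite /Y addrC addrA addNr add0r.
  suff [b1 b2] : `|(Y - Y0).1| < e /\ `|(Y - Y0).2| < e.
    have bY : ball Y0 e Y by split; rewrite /ball /= distrC.
    exact: He.
  rewrite YY.
  have tM : t * M < e by move: dd1; rewrite ltr_pdivlMr// => H; apply: lt_trans H; rewrite ltr_pM2r.
  by split; rewrite /= /GRing.scale /= normrM (gtr0_norm t0); apply: lt_trans tM; rewrite ltr_pM2l.
split => // gY.
have YE : Y = ptD L + (x + t * dot v (tau L)) *: tau L + (omega L x + t * dot v (nbar L)) *: nbar L.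
  rewrite /Y /Y0 /graph_pt {1}(orthonormal_decomp v (nbar_unit lk) (tau_unit lk) (nbar_tau lk)).
  rewrite -/L; move: (dot v (tau L)) (dot v (nbar L)) (tau L) (nbar L) (ptD L) => p q tt n D.
  by apply/pair_equal_spec; split; rewrite /= /GRing.scale /=; ring.
have [_ +  _] := on_graph lk gY (eint_eset h0 tY).
rewrite YE eta_frame xi_frame => E.
(* If the point were on the interface, [G v] would be, up to sign, the change of slope from [x] to
   [z] times the tangential component of [v]. By the choice of [d] this is at most [c / 2], whereas
   [G v] is at least [c]. *)
have [z [[zx _] Ez]] := MVT_line x (x + t * dot v (tau L)) (omega_is_derive lk).
have xs : x + t * dot v (tau L) - x = t * dot v (tau L) by ring.
rewrite -/L xs in Ez zx.
have zd : `|derive1 (omega L) x - derive1 (omega L) z| < c / (2 * C).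
  apply: Hd1; rewrite /ball /= distrC; apply: le_lt_trans zx _.
  rewrite normrM (gtr0_norm t0); move: dd2; rewrite ltr_pdivlMr//; apply: le_lt_trans.
  by apply: ler_pM => //; exact: ltW.
have key : t * (sgb b * (dot v (nbar L) - derive1 (omega L) x * dot v (tau L))) =
    t * (sgb b * ((derive1 (omega L) z - derive1 (omega L) x) * dot v (tau L))).
  by rewrite mulrCA [RHS]mulrCA; congr (_ * _); move: Ez E; lra.
have {}key : G v = sgb b * ((derive1 (omega L) z - derive1 (omega L) x) * dot v (tau L)).
  by rewrite /G; apply: (mulfI (lt0r_neq0 t0)).
have : `|G v| <= c / (2 * C) * C.
  by rewrite key sgb_norm normrM distrC; apply: ler_pM => //; exact: ltW.
have -> : c / (2 * C) * C = c / 2 by field; rewrite gt_eqF.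
move=> H; have := le_trans (ler_norm _) H; move: Gv c0; lra.
Qed.

(** A tangent of the interface, at some point Y, leaves the node strictly on the side to which the
    normal of sign [b] points. So the segment from Y to the node starts on the side [b], and it
    cannot meet the interface again because Y is not obscure. *)
Lemma node_side_sign i b : 0 < sgb b * eta_of P T (nodeP P T i) -> nside P T i = b.
Proof.
set M := nodeP P T i => eM.
have tM : TS M by exact: nodeP_eset.
have nM : ~ Ti M by exact: (node_boundary h0).
have gM : ~ Gam M := node_notin_Gamma sh iT nob (i := i).
pose xM := xi_of L M.
have MF : M = ptD L + xM *: tau L + eta_of P T M *: nbar L by exact: (frameE lk).
have dsg x : is_derive x (1 : R) (fun t => sgb b * omega L t) (sgb b * derive1 (omega L) x).
  exact: (is_deriveZ (sgb b) (omega_is_derive lk x)).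
have csg : continuous (fun x => sgb b * derive1 (omega L) x).
  by move=> x; apply: cvgM; [exact: cvg_cst|exact: (domega_continuous lk)].
have [||| x xb Gx] := @tangent_below _ _ _ (xiE L) xM _ (xiE_gt0 lk) eM dsg csg.
- by rewrite /L (omega0 lk) mulr0.
- by rewrite /L (omegaE lk) mulr0.
(* If the graph were at or beyond the node, the node would lie between an interior point of the
   chord and a point of the interface: it would be on the interface or in the interior of the
   element, both impossible. *)
- move=> /andP[m0 mE]; rewrite ltNge; apply/negP => le_om.
  have tY := (graph_on lk (x := xM)); rewrite !ltW// in tY; have [gY tYS] := tY isT.
  have om0 : omega L xM != 0.
    by apply/eqP => E; move: (lt_le_trans eM le_om); rewrite E mulr0 ltxx.
  pose t := eta_of P T M / omega L xM.
  have tE : t * omega L xM = eta_of P T M by rewrite /t divfK.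
  have so : 0 < sgb b * omega L xM by exact: lt_le_trans le_om.
  have tb : 0 < t <= 1.
    have tE' : t = (sgb b * eta_of P T M) / (sgb b * omega L xM).
      by rewrite /t invfM mulrACA divff ?mul1r//; case: (b); rewrite /sgb ?oner_eq0// oppr_eq0 oner_eq0.
    by rewrite tE' divr_gt0//= ler_pdivrMr// mul1r.
  have MS : M = seg_pt (ptD L + xM *: tau L) (graph_pt L xM) t.
    rewrite /seg_pt /graph_pt -/L [X in t *: X](_ : _ = omega L xM *: nbar L).
      by rewrite scalerA tE -MF.
    by rewrite addrC addrA addNr add0r.
  have [t1|t1] := eqVneq t 1.
    by apply: gM; rewrite MS t1 seg_pt1.
  apply: nM; rewrite MS; apply: eint_seg => //; last first.
    by move: tb => /andP[a c]; rewrite ltW//= lt_neqAle t1.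
  have -> : ptD L + xM *: tau L = seg_pt (ptD L) (ptE L) (xM / xiE L).
    rewrite /seg_pt (ptE_E lk) -/L [ptD L + _ - _]addrC addrA addNr add0r scalerA divfK//.
    by rewrite gt_eqF// (xiE_gt0 lk).
  by apply: chord_eint; rewrite divr_gt0//= ?(xiE_gt0 lk)// ltr_pdivrMr ?(xiE_gt0 lk)// mul1r.
have [gY tY] : Gam (graph_pt L x) /\ TS (graph_pt L x).
  by apply: (graph_on lk); move: xb => /andP[a c]; rewrite !ltW.
set Y := graph_pt L x in gY tY; have TY : Ti Y by exact: graph_eint.
pose v1 := M - Y; pose v0 := sgb b *: normal L Y.
have xiY : xi_of L Y = x by exact: (xi_graph lk).
have sp : 0 < speed L x by rewrite /speed sqrtr_gt0 ltr_pwDl// sqr_ge0.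
have G1 : 0 < sgb b * (dot v1 (nbar L) - derive1 (omega L) x * dot v1 (tau L)).
  have dd (w : plane) : dot v1 w = dot (M - ptD L) w - dot (Y - ptD L) w.
    exact: dot_sub3.
  have e1 : dot v1 (nbar L) = eta_of P T M - omega L x.
    by rewrite dd -(eta_graph lk x).
  have e2 : dot v1 (tau L) = xM - x by rewrite dd -[in RHS]xiY.
  by rewrite e1 e2; move: Gx; lra.
have G0 : 0 < sgb b * (dot v0 (nbar L) - derive1 (omega L) x * dot v0 (tau L)).
  rewrite /v0 !(dotZl (sgb b)) /normal xiY !(dotZl (speed L x)^-1) !dot_addl !dotNl.
  rewrite !(dotZl (derive1 (omega L) x)) tau_dot_nbar (nbar_unit lk) (nbar_tau lk) (tau_unit lk).
  set w := derive1 (omega L) x.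
  have -> : sgb b * (sgb b * ((speed L x)^-1 * (1 - w * 0)) - w * (sgb b * ((speed L x)^-1 * (0 - w * 1))))
    = (sgb b * sgb b) * ((speed L x)^-1 * (1 + w ^+ 2)) by ring.
  by rewrite sgb_mul mul1r mulr_gt0 ?invr_gt0// ltr_pwDl// sqr_ge0.
have [d d0 Hd] := near_graph_side xb G0 G1.
have TY' : (Tset ft P T)° Y by rewrite /Tset (interior_eset _ _ h0).
have [_ _ _ /(_ Y gY TY')[nt nf] _] := lk.
have nb : \forall t \near 0^'+, Tsub ft P T b (Y + t *: v0).
  have -> : v0 = if b then normal L Y else - normal L Y.
    by rewrite /v0 /sgb; case: (b); rewrite ?scale1r ?scaleN1r.
  case: (b); first exact: nt.
  by near=> t; rewrite scalerN; near: t; exact: nf.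
(* For small [t] the shift of Y along the oriented normal is on the side [b]; being below [d] also
   keeps the segment from there to [Y + t v1] off the interface. *)
have [t [t0 td t1 bt]] : exists t, [/\ 0 < t, t < d, t < 1 & Tsub ft P T b (Y + t *: v0)].
  have [e /= e0 He] := nb.
  have [u u0 [u1 u2]] := min_half d0 (ltr01 : 0 < 1 :> R).
  have [w w0 [w1 w2]] := min_half u0 e0.
  exists w; split => //; [exact: lt_trans u1|exact: lt_trans u2|].
  by apply: He => //; rewrite /ball /= sub0r normrN gtr0_norm.
have tdb : 0 < t < d by rewrite t0.
have sideY : O b (Y + t *: v1).
  pose c a := seg_pt (Y + t *: v0) (Y + t *: v1) a.
  have cE a : c a = Y + t *: seg_pt v0 v1 a.
    exact: seg_pt_dir.
  have cA : connected (c @` `[0, 1]) by apply: connected_seg; exact: interval_is_interval.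
  apply: (connected_same_side sh iT cA _ _ _ (bt.2)).
  - by move=> Z [a /=]; rewrite in_itv /= => ab <-; rewrite cE; case: (Hd t a tdb ab).
  - by apply/seteqP; split => // Z [[a /=]]; rewrite in_itv /= => ab <-; rewrite cE; case: (Hd t a tdb ab).
  - by exists 0; rewrite /c ?seg_pt0//= in_itv /= lexx ler01.
  - by exists 1; rewrite /c ?seg_pt1//= in_itv /= lexx ler01.
(* Y is itself on the interface, so a further meeting point would make it obscure. *)
have nG s : 0 < s < 1 -> ~ Gam (seg_pt Y M s).
  move=> /andP[s0 s1] gs; have : 0 = s.
    apply: (seg_Gamma_unique nob (i := i) (X := Y)) => //; rewrite ?lexx ?ler01 ?seg_pt0 ?ltW//.
    exact: node_neq.
  by move=> E; rewrite -E ltxx in s0.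
apply: (side_disj sh (X := seg_pt Y M t)); last exact: sideY.
apply: (seg_final_side sh iT nob TY (a := 0)) => //; first by rewrite lexx ltr01.
by rewrite t0.
Unshelve. all: by end_near. Qed.

Lemma nside_pos i : 0 < eta_of P T (nodeP P T i) -> nside P T i.
Proof. by move=> e; rewrite (@node_side_sign i true)// /sgb mul1r. Qed.

Lemma nside_neg i : eta_of P T (nodeP P T i) < 0 -> ~~ nside P T i.
Proof. by move=> e; rewrite (@node_side_sign i false)// /sgb mulN1r oppr_gt0. Qed.

End NodeSign.

(** * Bounds on IFE functions on an element *)

Section Pullback.
Context {R : realType}.
Local Notation plane := (R * R)%type.
Implicit Types (ft : fe_type) (h : R) (T : element R) (X Y : plane) (p : shape_poly R).

Definition refl T (v : plane) : plane := ((-1) ^+ flipx T * v.1, (-1) ^+ flipy T * v.2).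

Lemma dot_refl T v w : dot (refl T v) (refl T w) = dot v w.
Proof.
rewrite /dot /refl /=; have -> : (-1) ^+ flipx T * v.1 * ((-1) ^+ flipx T * w.1) =
  ((-1) ^+ flipx T * (-1) ^+ flipx T) * (v.1 * w.1) by ring.
have -> : (-1) ^+ flipy T * v.2 * ((-1) ^+ flipy T * w.2) =
  ((-1) ^+ flipy T * (-1) ^+ flipy T) * (v.2 * w.2) by ring.
by rewrite !signrb !mul1r.
Qed.

Lemma reflZ T a v : refl T (a *: v) = a *: refl T v.
Proof. by rewrite /refl; apply/pair_equal_spec; split; rewrite /= /GRing.scale /=; ring. Qed.

Lemma eunmapB h T X Y : eunmap h T X - eunmap h T Y = h^-1 *: refl T (X - Y).
Proof.
rewrite /eunmap /refl; apply/pair_equal_spec; split; rewrite /= /GRing.scale /=; ring.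
Qed.

Lemma emapD h T x v : h != 0 -> emap h T (x + h^-1 *: refl T v) = emap h T x + v.
Proof.
move=> h0; rewrite /emap /refl; apply/pair_equal_spec; split; rewrite /= /GRing.scale /=.
  have -> : (base T).1 + (-1) ^+ flipx T * h * (x.1 + h^-1 * ((-1) ^+ flipx T * v.1)) =
    (base T).1 + (-1) ^+ flipx T * h * x.1 + ((-1) ^+ flipx T * (-1) ^+ flipx T) * v.1 by field.
  by rewrite signrb mul1r.
have -> : (base T).2 + (-1) ^+ flipy T * h * (x.2 + h^-1 * ((-1) ^+ flipy T * v.2)) =
    (base T).2 + (-1) ^+ flipy T * h * x.2 + ((-1) ^+ flipy T * (-1) ^+ flipy T) * v.2 by field.
by rewrite signrb mul1r.
Qed.

(** The composition of [p] with [emap], read off from its expansion at [base T]. Reflections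
    preserve the second degree term of rotated-Q1 but may change the sign of [x y]. *)
Definition ppull ft h T p : shape_poly R :=
  let g := pgrad ft p (base T) in
  ShapePoly (peval ft p (base T)) ((-1) ^+ flipx T * h * g.1) ((-1) ^+ flipy T * h * g.2)
    (match ft with
     | FE_bilinear => ((-1) ^+ flipx T * (-1) ^+ flipy T) * h ^+ 2 * cd p
     | _ => h ^+ 2 * cd p end).

Lemma peval_ppull ft h T p X : peval ft (ppull ft h T p) X = peval ft p (emap h T X).
Proof.
rewrite /peval /ppull /emap /peval /pgrad /quad_term; case: ft => /=; try ring.
set sx := (-1) ^+ flipx T; set sy := (-1) ^+ flipy T.
have ex : sx * sx = 1 by exact: signrb.
have ey : sy * sy = 1 by exact: signrb.
have -> : ((base T).1 + sx * h * X.1) ^+ 2 - ((base T).2 + sy * h * X.2) ^+ 2 =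
  (base T).1 ^+ 2 + 2 * (base T).1 * sx * h * X.1 + (sx * sx) * h ^+ 2 * X.1 ^+ 2
  - ((base T).2 ^+ 2 + 2 * (base T).2 * sy * h * X.2 + (sy * sy) * h ^+ 2 * X.2 ^+ 2) by ring.
by rewrite ex ey; ring.
Qed.

Lemma pgrad_ppull ft h T p X :
  pgrad ft (ppull ft h T p) X = h *: refl T (pgrad ft p (emap h T X)).
Proof.
rewrite /ppull /emap /pgrad /refl; case: ft => /=; apply/pair_equal_spec; split;
  rewrite /= /GRing.scale /=; try ring.
  set sx := (-1) ^+ flipx T; have ex : sx * sx = 1 by exact: signrb.
  have -> : h * (sx * (cx p + cd p * (2 * ((base T).1 + sx * h * X.1)))) =
    sx * h * (cx p + cd p * (2 * (base T).1)) + (sx * sx) * h ^+ 2 * cd p * (2 * X.1) by ring.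
  by rewrite ex; ring.
set sy := (-1) ^+ flipy T; have ey : sy * sy = 1 by exact: signrb.
have -> : h * (sy * (cy p - cd p * (2 * ((base T).2 + sy * h * X.2)))) =
  sy * h * (cy p - cd p * (2 * (base T).2)) - (sy * sy) * h ^+ 2 * cd p * (2 * X.2) by ring.
by rewrite ey; ring.
Qed.

Lemma cd_ppull ft h T p q : cd p = cd q -> cd (ppull ft h T p) = cd (ppull ft h T q).
Proof. by rewrite /ppull /= => ->. Qed.

End Pullback.

(** * Interface elements as reference configurations *)

Section Configuration.
Context {R : realType}.
Local Notation plane := (R * R)%type.
Variables (ft : fe_type) (P : interface_problem R) (T : element R) (eps kbar la : R).
Hypothesis (sh : standing_hypotheses ft P) (iT : interface_element ft P T).
Hypothesis (epsb : 0 < eps < Num.sqrt 2 / 2) (kb : 0 < kbar <= 1) (lab : 0 < la < 1).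
Hypothesis (uc : unisolvence_conditions ft P eps kbar la).
Hypothesis (nob : forall X, ~ obscure ft P T X).
Let L := local P T.
Let h := mesh_size P.
Let s := Num.sqrt kbar.
Let h0 : 0 < h := mesh_size_gt0 sh.
Let hn : h != 0 := lt0r_neq0 h0.
Let lk : local_interface_ok ft P T := lok sh iT.
Let km := hyp_curvature sh.
Let k0 : 0 <= kappa P := kappa_ge0 km.

Lemma rho_gt0 : 0 < rho P.
Proof.
have /andP[b0 b1] := hyp_beta sh; rewrite /rho divr_gt0//.
exact: lt_le_trans b1.
Qed.

Lemma rho_le1 : rho P <= 1.
Proof.
have /andP[b0 b1] := hyp_beta sh; rewrite /rho ler_pdivrMr ?mul1r//.
exact: lt_le_trans b1.
Qed.

Lemma sqrt_kbar : [/\ 0 < s, s <= 1 & s ^+ 2 = kbar].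
Proof.
move: kb => /andP[a b]; split; first by rewrite sqrtr_gt0.
  by rewrite -[1]sqrtr1 ler_sqrt.
by rewrite sqr_sqrtr// ltW.
Qed.

Lemma sqrt2_sqr : Num.sqrt 2 ^+ 2 = 2 :> R.
Proof. by rewrite sqr_sqrtr. Qed.

(** The power of [1 - 2 eps ^ 2] in the mesh condition is at least 1, so its bracket is at least 2,
    and the chord is no longer than [sqrt 2 * h]. *)
Lemma kappa_chord : 2 * (kappa P * xiE L) < s.
Proof.
have q2 := sqrt2_sqr; have q0 : 0 < Num.sqrt 2 :> R by rewrite sqrtr_gt0.
apply: le_lt_trans (uni_h1 uc).
set p := _ `^ _; have p1 : 1 <= p.
  move: epsb => /andP[e0 e1].
  have e2 : eps ^+ 2 < 1 / 2.
    have -> : 1 / 2 = (Num.sqrt 2 / 2) ^+ 2 :> R by rewrite exprMn q2; field.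
    by rewrite ltrXn2r// ?nnegrE ?ltW// divr_gt0.
  have b0 : 0 < 1 - 2 * eps ^+ 2 by lra.
  have b1 : 1 - 2 * eps ^+ 2 <= 1 by have := sqr_ge0 eps; lra.
  rewrite /p powRN invr_ge1.
  - apply: (@le_trans _ _ (1 `^ (3 / 2))); last by rewrite powR1.
    by apply: ge0_ler_powR => //; rewrite nnegrE ltW.
  - by rewrite unitfE gt_eqF// powR_gt0.
  - by rewrite powR_gt0.
have xh : xiE L <= Num.sqrt 2 * mesh_size P.
  rewrite -(@ler_pXn2r _ 2)//; last 2 first.
  - by rewrite nnegrE ltW// (xiE_gt0 lk).
  - by rewrite nnegrE mulr_ge0// ltW.
  by rewrite exprMn q2; exact: (xiE_le h0 lk).
have u1 : kappa P * xiE L <= kappa P * (Num.sqrt 2 * mesh_size P) by exact: ler_wpM2l.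
have u2 : 0 <= mesh_size P * (Num.sqrt 2 * kappa P) * (p - 1).
  apply: mulr_ge0; last by rewrite subr_ge0.
  by apply: mulr_ge0; [exact: ltW|apply: mulr_ge0 => //; exact: ltW].
lra.
Qed.

Lemma slope_sqr x : 0 <= x <= xiE L ->
  derive1 (omega L) x ^+ 2 <= s ^+ 2 / 4 * (1 + derive1 (omega L) x ^+ 2).
Proof.
move=> xb; have H := omega_slope lk km xb; apply: le_trans H _.
have kc := kappa_chord; have [s0 _ _] := sqrt_kbar.
have k_ge : 0 <= kappa P * xiE L by rewrite mulr_ge0// ltW// (xiE_gt0 lk).
rewrite ler_wpM2r//; first by rewrite addr_ge0// sqr_ge0.
have -> : s ^+ 2 / 4 = (s / 2) ^+ 2 by field.
by apply: lerXn2r; rewrite ?nnegrE//; lra.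
Qed.

(** The squared slope satisfies [w2 <= q (1 + w2)] with [q = s ^ 2 / 4 <= 1/4]; it therefore stays
    below any [W ^ 2] for which the reverse inequality holds. *)
Lemma slope_le W x : 0 <= W -> s ^+ 2 / 4 * (1 + W ^+ 2) <= W ^+ 2 -> 0 <= x <= xiE L ->
  `|derive1 (omega L) x| <= W.
Proof.
move=> W0 sW xb; rewrite -(@ler_pXn2r _ 2)// ?nnegrE// real_normK ?num_real//.
have := slope_sqr xb; have [s0 s1 _] := sqrt_kbar.
have s2 : s ^+ 2 <= 1 by rewrite expr_le1// ltW.
set w2 := _ ^+ 2 => H; rewrite leNgt; apply/negP => lt.
have : s ^+ 2 / 4 * (w2 - W ^+ 2) <= 1 / 4 * (w2 - W ^+ 2).
  by apply: ler_wpM2r; lra.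
lra.
Qed.

Lemma height_le W x : 0 <= W -> s ^+ 2 / 4 * (1 + W ^+ 2) <= W ^+ 2 -> 0 <= x <= xiE L ->
  `|omega L x| <= W * h.
Proof.
move=> W0 sW xb.
have := graph_height_bound (xiE_gt0 lk) (omega_is_derive lk) (omega0 lk) (omegaE lk)
  (fun y yb => slope_le W0 sW yb) xb.
move/le_trans; apply; rewrite ler_wpM2l//.
have xh : xiE L <= 2 * h.
  rewrite -(@ler_pXn2r _ 2)//; last 2 first.
  - by rewrite nnegrE ltW// (xiE_gt0 lk).
  - by rewrite nnegrE mulr_ge0// ltW.
  by apply: le_trans (xiE_le h0 lk) _; rewrite -/h exprMn; have := sqr_ge0 h; lra.
lra.
Qed.

Let xF := xi_of L (ptF L).
Let wF := derive1 (omega L) xF.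

Lemma F_on : [/\ Tset ft P T (ptF L), 0 <= xF <= xiE L & ptF L = graph_pt L xF].
Proof.
have [_ _ _ _ [gF tF]] := lk; have [a _ b] := on_graph lk gF tF.
by split.
Qed.

Lemma wF_triangular : triangular ft -> wF = 0.
Proof.
move=> tri; have : normal L (ptF L) = nbar L by have := uni_F uc iT; move: tri; case: (ft).
move=> E; have : dot (normal L (ptF L)) (tau L) = 0 by rewrite E (nbar_tau lk).
rewrite /normal -/xF -/wF dotZl dot_addl dotNl (dotZl wF) (nbar_tau lk) (tau_unit lk).
move/eqP; rewrite mulf_eq0 invr_eq0 gt_eqF /=; last by rewrite /speed sqrtr_gt0 ltr_pwDl// sqr_ge0.
by rewrite sub0r mulr1 oppr_eq0 => /eqP.
Qed.

Let Dh := eunmap h T (ptD L).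
Let Eh := eunmap h T (ptE L).
Let Fh := eunmap h T (ptF L).
Let nh := refl T (nbar L).
Let th := refl T (tau L).

Lemma bd_on_square X : ebd ft h T X -> ~~ triangular ft -> on_square_bd (eunmap h T X).
Proof.
rewrite /ebd (interior_eset _ _ h0) => -[sX nX] tri.
have [i i0] : exists i : 'I_(nv ft), ecstr ft h T i X = 0.
  apply: contrapT => H; apply: nX => i; rewrite lt_neqAle ((eset_cstr _ _ h0 _).1 sX) andbT eq_sym.
  by apply/eqP => E; apply: H; exists i.
move: i0; rewrite /ecstr /ref_cstr (negbTE tri) /on_square_bd.
case: i => -[|[|[|i]]] /= _ E; [by right; right; left|right; left; lra|right; right; right; lra|by left].
Qed.

Lemma not_same_edge (i : 'I_(nv ft)) : ecstr ft h T i (ptD L) = 0 -> ecstr ft h T i (ptE L) = 0 -> False.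
Proof.
move=> D0 E0; have mT : mesh P T by case: iT.
have [_ [tD _]] := ptD_on lk; have [_ [tE _]] := ptE_on lk.
apply: (@hyp_boundary _ _ _ sh _ mT _ _ (DE_neq lk) (Gamma_bd lk) i).
by move=> X [|] ->; exact: ecstr_edge.
Qed.

Lemma Fh_E (a : R) : ptD L + xF *: tau L = ptD L + a *: (ptE L - ptD L) ->
  Fh = Dh + a *: (Eh - Dh) + (omega L xF / h) *: nh.
Proof.
move=> aE; have [_ _ FE] := F_on.
have : Fh - Dh = h^-1 *: refl T (a *: (ptE L - ptD L) + omega L xF *: nbar L).
  rewrite /Fh /Dh eunmapB FE /graph_pt -/L aE; congr (_ *: refl T _).
  by rewrite addrAC [ptD L + _]addrC addrK.
move/(congr1 (fun v => Dh + v)); rewrite addrC subrK => ->.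
rewrite -addrA; congr (_ + _); rewrite /Eh /Dh eunmapB /refl.
by apply/pair_equal_spec; split; rewrite /= /GRing.scale /=; ring.
Qed.

Lemma ref_config_ok : ref_config ft (rho P) la Dh Eh nh th Fh wF (omega L xF / h).
Proof.
have [tF xb FE] := F_on.
have [_ bD] := ptD_on lk; have [_ bE] := ptE_on lk.
have [tD _] := bD; have [tE _] := bE.
have [s0 s1 s2] := sqrt_kbar.
split; first by split; apply/(esetE ft T h0).
split.
  split; rewrite ?dot_refl.
  - exact: (nbar_unit lk).
  - exact: (tau_unit lk).
  - exact: (nbar_tau lk).
  - by rewrite /Eh /Dh eunmapB dotZl dot_refl dotC; case: lk => _ [_ -> _ _ _]; rewrite mulr0.
have Fu := uni_F uc iT.
have mid := bd_on_square bD; have mie := bd_on_square bE.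
have nse := not_same_edge.
have trF := wF_triangular.
have scaleh (W x : R) : `|x| <= W * h -> `|x / h| <= W.
  by rewrite normrM normfV (gtr0_norm h0) ler_pdivrMr.
have FhE := Fh_E.
have ub := uni_bilinear uc; have ur := uni_rotated uc.
have slW := slope_le; have heW := height_le.
case: (ft) Fu mid mie nse trF FhE ub ur => Fu mid mie nse trF FhE ub ur; try exact: trF.
- have b0 : (0 : R) <= 1 / 10 by lra.
  (* The condition on [kbar] gives [s ^ 2 <= 1/32], and [1.01 / 128 < 1 / 100]. *)
  have b1 : s ^+ 2 / 4 * (1 + (1 / 10) ^+ 2) <= (1 / 10) ^+ 2.
    have sb := ub erefl; have q2 := sqrt2_sqr; have q0 : 0 < Num.sqrt 2 :> R by rewrite sqrtr_gt0.
    have H : s ^+ 2 <= (1 / (4 * Num.sqrt 2)) ^+ 2.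
      apply: lerXn2r; [by rewrite nnegrE ltW| |exact: ltW].
      by rewrite nnegrE divr_ge0// mulr_ge0// ltW.
    have E : (1 / (4 * Num.sqrt 2)) ^+ 2 = 1 / 32 :> R.
      by rewrite mul1r exprVn exprMn q2; field.
    rewrite E in H; lra.
  split; [exact: slW|by apply: scaleh; exact: heW| |by split; [exact: mid|exact: mie]|split].
  + rewrite (FhE 2^-1); last first.
      rewrite Fu; apply/pair_equal_spec; split; rewrite /= /GRing.scale /=; by field.
    by congr (_ + _); apply/pair_equal_spec; split; rewrite /= /GRing.scale /=; field.
  + by move=> [d e]; apply: (nse (Ordinal (isT : (3 < 4)%N))).
  + move=> [d e]; apply: (nse (Ordinal (isT : (1 < 4)%N))).
      by transitivity (1 - Dh.1); [|rewrite d subrr].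
    by transitivity (1 - Eh.1); [|rewrite e subrr].
  + by move=> [d e]; apply: (nse (Ordinal (isT : (0 < 4)%N))).
  + move=> [d e]; apply: (nse (Ordinal (isT : (2 < 4)%N))).
      by transitivity (1 - Dh.2); [|rewrite d subrr].
    by transitivity (1 - Eh.2); [|rewrite e subrr].
- have b0 : 0 <= 3 / 5 * s by rewrite mulr_ge0// ltW.
  (* After division by [s ^ 2] this is [(1 + 9/25 s ^ 2) / 4 <= 9/25], true for [s <= 1] as
     [0.34 <= 0.36]. *)
  have b1 : s ^+ 2 / 4 * (1 + (3 / 5 * s) ^+ 2) <= (3 / 5 * s) ^+ 2.
    have q1 : s ^+ 2 <= 1 by rewrite expr_le1// ltW.
    have q0 := sqr_ge0 s; have q : 0 <= s ^+ 2 * (1 - s ^+ 2) by rewrite mulr_ge0 ?subr_ge0.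
    by rewrite exprMn; lra.
  (* The last witness is the relative position on the chord of the projection of F. *)
  exists (3 / 5 * s), s, (xF / xiE L); split; last first.
    split => //; first exact: ltW.
    (* With the positive denominator multiplied out, the bound on [sqrt kbar] is exactly
       [4 s (1 - rho) <= rho (1 - la) (1 - s)]. *)
    have sb := ur erefl; rewrite -/s in sb; have r0 := rho_gt0; have r1 := rho_le1.
    move: lab => /andP[l0 l1].
    have rl : la * rho P <= rho P by rewrite ler_piMl// ltW.
    have rl1 : la * rho P <= la by rewrite ler_piMr// ltW.
    have den : 0 < 4 - (3 + la) * rho P by lra.
    move: sb; rewrite ler_pdivlMr//; lra.
  split => //; [exact: slW| | |].
  + by apply: scaleh; apply: le_trans (heW _ _ b0 b1 xb) _; rewrite ler_pM2r//; lra.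
  + move: xb => /andP[x0 x1]; rewrite divr_ge0//= ?ler_pdivrMr ?(xiE_gt0 lk)//; first by rewrite mul1r.
    by rewrite ltW// (xiE_gt0 lk).
  + have xE0 : xiE L != 0 by rewrite gt_eqF// (xiE_gt0 lk).
    have EmD : ptE L - ptD L = xiE L *: tau L by rewrite /tau scalerA divff// scale1r.
    by apply: FhE; rewrite EmD scalerA divfK.
Qed.

Lemma IFE_bound (phi : bool -> shape_poly R) (y : 'I_(nv ft) -> R) (Y : R) :
  (forall t, peval ft (phi false) (ptD L + t *: tau L) = peval ft (phi true) (ptD L + t *: tau L)) ->
  (~~ triangular ft -> cd (phi false) = cd (phi true)) ->
  beta P false * dot (pgrad ft (phi false) (ptF L)) (normal L (ptF L))
    = beta P true * dot (pgrad ft (phi true) (ptF L)) (normal L (ptF L)) ->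
  (forall i, peval ft (phi (nside P T i)) (nodeP P T i) = y i) -> (forall i, `|y i| <= Y) ->
  forall X, Tset ft P T X ->
  let C := 5200 / la * Y in
  let gain (s : bool) := if s then IFE_gain ft (rho P) else rho P in
  forall s, [/\ gain s * `|peval ft (phi s) X| <= C,
     gain s * (h * `|(pgrad ft (phi s) X).1|) <= C & gain s * (h * `|(pgrad ft (phi s) X).2|) <= C].
Proof.
move=> Hl Hd Hf Hn yY X tX C gain s'.
have r0 := rho_gt0; have r1 := rho_le1; have /andP[l0 l1] := lab.
have [tF xb FE] := F_on.
have FK : emap h T Fh = ptF L by rewrite /Fh eunmapK.
have NE (i : 'I_(nv ft)) : emap h T (refnode ft i) = nodeP P T i by rewrite /nodeP node_emap.
have etaE (i : 'I_(nv ft)) : dot (refnode ft i - Dh) nh = h^-1 * eta_of P T (nodeP P T i).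
  rewrite -(emapK T (refnode ft i) hn) NE /Dh eunmapB dotZl dot_refl.
  by [].
have hi : 0 < h^-1 by rewrite invr_gt0.
have w1 : ft <> FE_linear -> ft <> FE_crouzeix_raviart -> `|wF| <= 1.
  move=> _ _; apply: slope_le => //; have [s0 s1 _] := sqrt_kbar.
  have : s ^+ 2 <= 1 by rewrite expr_le1// ltW.
  by rewrite expr1n; lra.
have := @IFE_ref_bound R ft (rho P) la Dh Eh nh th Fh wF (omega L xF / h) (nside P T)
  (fun b => ppull ft h T (phi b)) y Y r0 r1 l0 l1 ref_config_ok w1.
(* The reference normal is not normalised: it is [speed] times the unit normal, and the gradient
   scales by [h]. The common factor cancels in the flux condition. *)
have refl_n b : dot (pgrad ft (ppull ft h T (phi b)) Fh) (nh - wF *: th) =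
    h * speed L xF * dot (pgrad ft (phi b) (ptF L)) (normal L (ptF L)).
  have sp : speed L xF != 0 by rewrite gt_eqF// /speed sqrtr_gt0 ltr_pwDl// sqr_ge0.
  rewrite pgrad_ppull FK dotZl /normal -/xF -/wF dotZr -mulrA; congr (_ * _).
  have -> : nh - wF *: th = refl T (nbar L - wF *: tau L).
    by rewrite /nh /th /refl; apply/pair_equal_spec; split; rewrite /= /GRing.scale /=; ring.
  by rewrite dot_refl mulrA divff// mul1r.
move=> /(_ _ _ _ _ _ _ yY (eunmap h T X)) H.
have [|||||||v0 v1 [a0 a1] [b0 b1]] := H.
- by move=> i; rewrite etaE pmulr_rgt0// => /(nside_pos sh iT nob).
- by move=> i; rewrite etaE pmulr_rlt0// => /(nside_neg sh iT nob).
- move=> t; rewrite !peval_ppull.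
  have -> : Dh + t *: th = Dh + h^-1 *: refl T ((t * h) *: tau L).
    by rewrite reflZ scalerA mulrCA mulVf// mulr1.
  by rewrite emapD// /Dh eunmapK.
- by move=> tri; apply: cd_ppull; exact: Hd.
- rewrite !refl_n mulrCA [RHS]mulrC -[in RHS]mulrC; congr (_ * _).
  have b0 : beta P true != 0 by have /andP[? ?] := hyp_beta sh; rewrite gt_eqF//; apply: lt_le_trans; eassumption.
  by apply: (mulfI b0); rewrite -Hf /rho mulrA mulrCA divff// mulr1.
- by move=> i; rewrite peval_ppull NE.
- exact/(esetE ft T h0).
have XK : emap h T (eunmap h T X) = X by rewrite eunmapK.
have gr b : (pgrad ft (ppull ft h T (phi b)) (eunmap h T X)).1 = h * ((-1) ^+ flipx T * (pgrad ft (phi b) X).1) /\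
    (pgrad ft (ppull ft h T (phi b)) (eunmap h T X)).2 = h * ((-1) ^+ flipy T * (pgrad ft (phi b) X).2).
  by rewrite pgrad_ppull XK.
have nr (b : bool) (x : R) : `|h * ((-1) ^+ b * x)| = h * `|x|.
  by rewrite !normrM normr_sign mul1r gtr0_norm.
move: v0 v1 a0 a1 b0 b1.
rewrite !peval_ppull XK !(gr _).1 !(gr _).2 !nr => *.
by rewrite /gain; case: s'; split.
Qed.

End Configuration.

(** * Pointwise error for piecewise smooth functions *)

Section GradientJump.
Context {R : realType}.
Local Notation plane := (R * R)%type.

Lemma dot_bound (g v : plane) (c : R) : `|v.1| <= c -> `|v.2| <= c ->
  `|dot g v| <= (`|g.1| + `|g.2|) * c.
Proof.
move=> v1 v2; rewrite /dot; apply: le_trans (ler_normD _ _) _; rewrite mulrDl.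
by apply: lerD; rewrite normrM ler_wpM2l.
Qed.

Lemma near_is_derive_unique (f g : R -> R) (x a b : R) :
  (\forall t \near x, f t = g t) -> is_derive x (1 : R) f a -> is_derive x (1 : R) g b -> a = b.
Proof.
move=> fg fa gb.
have fb : is_derive x (1 : R) f b.
  apply: (@near_eq_is_derive _ _ _ g f x 1 b) => //.
  by near=> t; apply: esym; near: t.
by case: fa => _ <-; case: fb => _ <-.
Unshelve. all: by end_near. Qed.

Variables (ft : fe_type) (P : interface_problem R) (T : element R).
Hypothesis (sh : standing_hypotheses ft P) (iT : interface_element ft P T).
Let L := local P T.
Let lk : local_interface_ok ft P T := lok sh iT.

Variables (U : bool -> plane -> R).
Hypotheses (cU : forall s, Ck 2 (U s))
  (jU : forall X, (Gamma P `&` Tset ft P T) X -> U true X = U false X)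
  (fU : forall X, (Gamma P `&` Tset ft P T) X ->
     beta P true * dot (grad (U true) X) (normal L X) = beta P false * dot (grad (U false) X) (normal L X)).

Lemma speed_gt0 x : 0 < speed L x.
Proof. by rewrite /speed sqrtr_gt0 ltr_pwDl// sqr_ge0. Qed.

Lemma speed_sqr x : speed L x ^+ 2 = 1 + derive1 (omega L) x ^+ 2.
Proof. by rewrite /speed sqr_sqrtr// addr_ge0// sqr_ge0. Qed.

Definition tangent x : plane := (speed L x)^-1 *: (tau L + derive1 (omega L) x *: nbar L).

Lemma normal_graph x : normal L (graph_pt L x) = (speed L x)^-1 *: (nbar L - derive1 (omega L) x *: tau L).
Proof. by rewrite /normal (xi_graph lk). Qed.

Lemma tangent_frame x : let n := normal L (graph_pt L x) in
  [/\ dot n n = 1, dot (tangent x) (tangent x) = 1 & dot n (tangent x) = 0].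
Proof.
move=> n; rewrite /n normal_graph /tangent; set w := derive1 (omega L) x.
have nn := nbar_unit lk; have tt := tau_unit lk; have nt := nbar_tau lk.
have tn : dot (tau L) (nbar L) = 0 by rewrite dotC.
have sp := speed_gt0 x; have sn : speed L x != 0 by rewrite gt_eqF.
have s2 := speed_sqr x; rewrite -/w in s2.
split; rewrite dotZl dotZr !(dot_addl, dot_addr) ?(dotNl, dotNr) !(dotZl w) !(dotZr _ _ w) ?(dotNl, dotNr) nn tt nt tn.
- by have -> : 1 + - (w * 0) + (- (w * 0) + - - (w * (w * 1))) = speed L x ^+ 2; [rewrite s2; ring|field].
- by have -> : 1 + w * 0 + (w * 0 + w * (w * 1)) = speed L x ^+ 2; [rewrite s2; ring|field].
- by ring.
Qed.

Lemma graph_derive s x : is_derive x (1 : R) (fun t => U s (graph_pt L t))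
  (dot (grad (U s) (graph_pt L x)) (tau L + derive1 (omega L) x *: nbar L)).
Proof.
have [d1 d2] := graph_coord_derive lk x.
have d := C1_curve (Ck_pred (cU s)) d1 d2.
have E : (fun t => U s (graph_pt L t)) = (fun t => U s ((graph_pt L t).1, (graph_pt L t).2)).
  by apply: funext => t; case: (graph_pt L t).
rewrite E; apply: is_derive_eq d _.
by rewrite -surjective_pairing.
Qed.

Lemma tangential_jump x : 0 < x < xiE L ->
  dot (grad (U true) (graph_pt L x)) (tangent x) = dot (grad (U false) (graph_pt L x)) (tangent x).
Proof.
move=> /andP[x0 xE]; rewrite /tangent !dotZr; congr (_ * _).
apply: (near_is_derive_unique _ (graph_derive true x) (graph_derive false x)).
near=> t; apply: jU; apply: (graph_on lk); apply/andP; split; apply: ltW; near: t.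
- exact: lt_nbhsr.
- exact: lt_nbhsl.
Unshelve. all: by end_near. Qed.

Lemma beta_gt0 s : 0 < beta P s.
Proof. by have /andP[b0 b1] := hyp_beta sh; case: s => //; apply: lt_le_trans b1. Qed.

(** Both pieces agree along the interface, so the tangential derivatives coincide, and the flux
    condition scales the normal one. The jump of the gradient thus points along the normal. *)
Lemma grad_jump s x v : 0 < x < xiE L ->
  let Y := graph_pt L x in let n := normal L Y in let g := grad (U s) Y in
  dot (grad (U (~~ s)) Y) v = dot g v + (beta P s / beta P (~~ s) - 1) * dot g n * dot n v.
Proof.
move=> xb Y n g; have [nn tt nt] := tangent_frame x; rewrite -/Y -/n in nn nt.
have YG : (Gamma P `&` Tset ft P T) Y by apply: (graph_on lk); move: xb => /andP[? ?]; rewrite !ltW.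
have bn := beta_gt0 (~~ s).
have fl : dot (grad (U (~~ s)) Y) n = beta P s / beta P (~~ s) * dot g n.
  apply: (mulfI (lt0r_neq0 bn)); rewrite [RHS]mulrA (mulrC (beta P (~~ s)) (_ / _)) divfK ?gt_eqF//.
  by have := fU YG; rewrite /g; case: (s).
have tg : dot (grad (U (~~ s)) Y) (tangent x) = dot g (tangent x).
  by have := tangential_jump xb; rewrite /g -/Y; case: (s).
rewrite (dot_decomp _ v nn tt nt) (dot_decomp g v nn tt nt) fl tg; ring.
Qed.

End GradientJump.

Section DefectArithmetic.
Context {R : realType}.

Lemma defect_arith_same (ar h2 J kG : R) : 0 <= ar -> 0 <= h2 -> 0 <= J -> 0 <= kG ->
  2 * h2 * J <= (2 + 44 * ar) * (h2 * (J + kG)).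
Proof.
move=> a0 h0 J0 k0.
have := mulr_ge0 a0 (mulr_ge0 h0 (addr_ge0 J0 k0)); have := mulr_ge0 h0 k0; lra.
Qed.

Lemma defect_arith_cross (ar h2 J kap G a b : R) : 0 <= ar -> 0 <= h2 -> 0 <= J -> 0 <= kap * G ->
  a <= (2 + 4 * ar) * h2 * J -> b <= ar * (44 * (kap * h2) * G) ->
  a + b <= (2 + 44 * ar) * (h2 * (J + kap * G)).
Proof.
move=> a0 h0 J0 k0.
have := mulr_ge0 a0 (mulr_ge0 h0 J0); have := mulr_ge0 h0 k0; lra.
Qed.

Lemma normal_defect_arith (kap h d1 d2 d3 w : R) : 0 <= h -> d1 <= 8 * (kap * h) -> d2 <= 8 * (kap * h) ->
  d3 <= (d1 + d2) * h -> w <= 4 * (kap * h ^+ 2) -> d3 + w <= 20 * (kap * h ^+ 2).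
Proof.
move=> h0 H1 H2 H3 Hw; have : (d1 + d2) * h <= (16 * (kap * h)) * h by apply: ler_wpM2r => //; lra.
lra.
Qed.

Lemma flux_defect_arith (kap h G a b : R) : a <= G * 1 * (20 * (kap * h ^+ 2)) ->
  b <= G * (12 * (kap * h)) * (2 * h) -> a + b <= 44 * (kap * h ^+ 2) * G.
Proof. lra. Qed.

End DefectArithmetic.

Section Pointwise.
Context {R : realType}.
Local Notation plane := (R * R)%type.
Local Notation mR := (measurableTypeR R).
Local Notation mplane := (mR * mR)%type.
Variables (ft : fe_type) (P : interface_problem R) (T : element R) (eps kbar la : R).
Hypothesis (sh : standing_hypotheses ft P) (iT : interface_element ft P T).
Hypothesis (epsb : 0 < eps < Num.sqrt 2 / 2) (kb : 0 < kbar <= 1) (lab : 0 < la < 1).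
Hypothesis (uc : unisolvence_conditions ft P eps kbar la).
Hypothesis (nob : forall X, ~ obscure ft P T X).
Let L := local P T.
Let h := mesh_size P.
Let h0 : 0 < h := mesh_size_gt0 sh.
Let lk : local_interface_ok ft P T := lok sh iT.
Let kap := kappa P.
Let kap0 : 0 <= kap := kappa_ge0 (hyp_curvature sh).

Lemma xiE_le2 : xiE L <= 2 * h.
Proof.
rewrite -(@ler_pXn2r _ 2)//; last 2 first.
- by rewrite nnegrE ltW// (xiE_gt0 lk).
- by rewrite nnegrE mulr_ge0// ltW.
by apply: le_trans (xiE_le h0 lk) _; rewrite -/h exprMn; have := sqr_ge0 h; lra.
Qed.

(** With [k = kappa |DE| <= 1/2] the curvature bound gives [|w| <= 2 k], and [|DE| <= 2 h]. Being
    linear in [kappa], this is the source of the factor [1 + kappa]. *)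
Lemma slope_kappa x : 0 <= x <= xiE L -> `|derive1 (omega L) x| <= 4 * (kap * h).
Proof.
move=> xb; have H := omega_slope lk (hyp_curvature sh) xb.
have kc : 2 * (kappa P * xiE L) < Num.sqrt kbar by exact: (kappa_chord sh iT epsb uc).
have [s0 s1 _] := sqrt_kbar kb.
have xE := xiE_le2; have xE0 := xiE_gt0 lk.
have kx : kap * xiE L <= kap * (2 * h) by exact: ler_wpM2l.
rewrite -/kap -/L in H kc kx; set k := kap * xiE L in H kc kx; set w := derive1 _ _ in H *.
have k_ge : 0 <= k by rewrite mulr_ge0// ltW.
have k2 : k ^+ 2 <= 1 / 4.
  have -> : 1 / 4 = (1 / 2) ^+ 2 :> R by field.
  by apply: lerXn2r; rewrite ?nnegrE//; lra.
have w2 : w ^+ 2 <= (2 * k) ^+ 2.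
  have q : k ^+ 2 * w ^+ 2 <= 1 / 4 * w ^+ 2 by rewrite ler_wpM2r// sqr_ge0.
  have q2 := sqr_ge0 k.
  rewrite exprMn; lra.
have wk : `|w| <= 2 * k.
  rewrite -(@ler_pXn2r _ 2)// ?real_normK ?num_real// nnegrE// mulr_ge0//.
by apply: le_trans wk _; lra.
Qed.

Lemma height_kappa x : 0 <= x <= xiE L -> `|omega L x| <= 4 * (kap * h ^+ 2).
Proof.
move=> xb.
have := graph_height_bound (xiE_gt0 lk) (omega_is_derive lk) (omega0 lk) (omegaE lk) slope_kappa xb.
move/le_trans; apply.
have -> : 4 * (kap * h ^+ 2) = 4 * (kap * h) * h by ring.
apply: ler_wpM2l; first by rewrite !mulr_ge0// ltW.
by have := xiE_le2; rewrite -/L; lra.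
Qed.

Lemma normal_close x : 0 <= x <= xiE L -> let n := normal L (graph_pt L x) in
  [/\ `|n.1| <= 1 /\ `|n.2| <= 1,
      `|(n - nbar L).1| <= 8 * (kap * h) & `|(n - nbar L).2| <= 8 * (kap * h)].
Proof.
move=> xb n; have [nn _ _] := tangent_frame sh iT x.
split; first exact: (unit_coord nn).
all: have [n1 n2] := unit_coord (nbar_unit lk); have [t1 t2] := unit_coord (tau_unit lk).
all: have w4 := slope_kappa xb.
all: have sp := speed_gt0 P T x; have s2 := speed_sqr P T x.
all: rewrite /n (normal_graph sh iT) -/L; rewrite -/L in sp s2 n1 n2 t1 t2.
all: set w := derive1 (omega L) x in w4 s2 *; set S := speed L x in sp s2 *.
all: have S1 : 1 <= S by rewrite -(@ler_pXn2r _ 2) ?nnegrE ?(ltW sp)// expr1n s2 lerDl sqr_ge0.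
all: have w0 : 0 <= 1 + `|w| by exact: addr_ge0.
all: have w1 : 0 <= `|w| by [].
all: have Sw : S <= 1 + `|w|.
1,3: rewrite -(@ler_pXn2r _ 2) ?nnegrE ?(ltW sp)// s2.
1,2: by rewrite -[X in 1 + X <= _]real_normK ?num_real//; lra.
all: have Si : `|S^-1 - 1| <= `|w|.
1,3: have -> : S^-1 - 1 = - ((S - 1) / S) by field; rewrite gt_eqF.
1,2: rewrite normrN normrM normfV (gtr0_norm sp) ger0_norm ?subr_ge0// ler_pdivrMr//.
1,2: by apply: (@le_trans _ _ `|w|); [lra|rewrite ler_peMr].
all: have Sw' : `|S^-1 * w| <= `|w| by rewrite normrM ler_piMl// normfV (gtr0_norm sp) invf_le1.
all: have aux (a b : R) : `|a| <= 1 -> `|b| <= 1 -> `|S^-1 * (a - w * b) - a| <= 8 * (kap * h).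
1,3: move=> a1 b1; have -> : S^-1 * (a - w * b) - a = (S^-1 - 1) * a - S^-1 * w * b by ring.
1,2: apply: le_trans (ler_normB _ _) _.
1,2: have p1 : `|(S^-1 - 1) * a| <= `|w| * 1 by rewrite normrM ler_pM.
1,2: have p2 : `|S^-1 * w * b| <= `|w| * 1 by rewrite normrM ler_pM.
1,2: lra.
all: exact: aux.
Qed.

Definition Taylor_poly (u : plane -> R) (X : plane) : shape_poly R :=
  ShapePoly (u X - dot (grad u X) X) (grad u X).1 (grad u X).2 0.

Lemma peval_Taylor u X Z : peval ft (Taylor_poly u X) Z = u X + dot (grad u X) (Z - X).
Proof. by rewrite /peval /Taylor_poly /dot /=; ring. Qed.

Lemma pgrad_Taylor u X Z : pgrad ft (Taylor_poly u X) Z = grad u X.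
Proof. by rewrite /pgrad /Taylor_poly; case: ft; rewrite /= ?mul0r ?subr0 ?addr0. Qed.

Variables (U : bool -> plane -> R) (B : R).
Hypotheses (cU : forall s, Ck 2 (U s))
  (jU : forall X, (Gamma P `&` Tset ft P T) X -> U true X = U false X)
  (fU : forall X, (Gamma P `&` Tset ft P T) X ->
     beta P true * dot (grad (U true) X) (normal L X) = beta P false * dot (grad (U false) X) (normal L X)).

(** The broken second derivatives extended by 0 to the plane, so that one function serves for both
    parts of a crossing segment. *)
Definition hessT (Y : plane) : R :=
  (hess_norm (U true) \_ (Tsub ft P T true)) Y + (hess_norm (U false) \_ (Tsub ft P T false)) Y.

Lemma hessT_side s Y : Tsub ft P T s Y -> hessT Y = hess_norm (U s) Y.
Proof.
move=> sY; rewrite /hessT !patchE.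
have d t : Tsub ft P T t Y -> t = s by move=> tY; exact: (side_disj sh tY.2 sY.2).
case: s sY d => sY d.
  by rewrite mem_set// memNset ?addr0// => /d.
by rewrite memNset ?mem_set ?add0r// => /d.
Qed.

Hypotheses (hB : forall Y, Tset ft P T Y -> forall s, hess_norm (U s) Y <= B).

Lemma measurable_Tsub s : measurable (Tsub ft P T s).
Proof.
apply: measurableI; first exact: (measurable_eset ft T h0).
by apply: open_measurable2; exact: (open_side sh).
Qed.

Lemma measurable_hessT : measurable_fun [set: mplane] (hessT : mplane -> R).
Proof.
have mh s : measurable_fun [set: mplane] (hess_norm (U s) \_ (Tsub ft P T s) : mplane -> R).
  apply/(measurable_restrictT _ (@measurable_Tsub s)).
  apply: measurable_funTS; apply: continuous_measurable2; exact: hess_norm_continuous.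
exact: measurable_funD.
Qed.

Lemma hessT_ge0 Y : 0 <= hessT Y.
Proof. by rewrite /hessT !patchE; apply: addr_ge0; case: ifP => // _; exact: hess_norm_ge0. Qed.

Lemma hessT_le Y : 0 <= B -> hessT Y <= B.
Proof.
move=> B0; have [[s sY]|no] := pselect (exists s, Tsub ft P T s Y).
  by rewrite (hessT_side sY); apply: hB; case: sY.
by rewrite /hessT !patchE !memNset ?addr0// => sY; apply: no; [exists false|exists true].
Qed.

Let nu := nbar L - derive1 (omega L) (xi_of L (ptF L)) *: tau L.
Let r s := beta P s / beta P (~~ s).

(* The only IFE function that agrees with [U s] to first order at [X], seen
   from the side [s]: the kink along the chord restores the flux condition. *)
Definition IFE_jet s X (b : bool) : shape_poly R :=
  if b == s then Taylor_poly (U s) X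
  else padd (Taylor_poly (U s) X) (pscale ((r s - 1) * dot (grad (U s) X) nu) (plin (ptD L) (nbar L))).

Definition node_defect s X (i : 'I_(nv ft)) : R :=
  U (nside P T i) (nodeP P T i) - peval ft (IFE_jet s X (nside P T i)) (nodeP P T i).

Definition gsum (u : plane -> R) (X : plane) := `|'D_ex u X| + `|'D_ey u X|.

(** For a node on the other side, the exact continuation uses the normal at the crossing and the
    distance to its tangent there, whereas the jet uses the normal at F and the distance to the
    chord. Replacing one by the other costs [kappa h ^ 2] times the gradient at [X]. *)
Lemma node_defect_bound s X i : 0 <= B -> eint ft h T X -> Omega_ P s X ->
  `|node_defect s X i| <= (2 + 44 * `|r s - 1|) * (h ^+ 2 * (seg_avg hessT (nodeP P T i) X + kap * gsum (U s) X)).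
Proof.
move=> B0 eX sX; set M := nodeP P T i.
have HB := fun Y => hessT_le Y B0.
have [d1 d2] := eset_diam h0 (eint_eset h0 eX) (nodeP_eset P T i).
rewrite -/M in d1 d2.
set J := seg_avg _ _ _; set G := gsum _ _.
have G0 : 0 <= G by exact: addr_ge0.
have J0 : 0 <= J by apply: (seg_avg_ge0 _ hessT_ge0).
have [t0 /andP[t00 t01] [tl tr tG]] := seg_sides sh iT nob i eX sX; rewrite -/M in tl tr tG.
have inT t : 0 <= t < 1 -> Tset ft P T (seg_pt X M t).
  by move=> tb; apply: (eint_eset h0); apply: eint_seg => //; exact: nodeP_eset.
have hs (b : bool) t : 0 <= t < 1 -> Omega_ P b (seg_pt X M t) ->
    hess_norm (U b) (seg_pt X M t) <= hessT (seg_pt X M t).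
  by move=> tb bt; rewrite (@hessT_side b) //; split => //; exact: inT.
have hl t : 0 < t < t0 -> hess_norm (U s) (seg_pt X M t) <= hessT (seg_pt X M t).
  move=> /andP[a b]; apply: hs; first by rewrite (ltW a) (lt_trans b).
  by apply: tl; rewrite (ltW a).
have hr t : t0 < t < 1 -> hess_norm (U (nside P T i)) (seg_pt X M t) <= hessT (seg_pt X M t).
  move=> /andP[a b]; apply: hs; first by rewrite b (le_trans (ltW t00)) ?ltW.
  by apply: tr; rewrite a.
have ar : 0 <= `|r s - 1| by [].
have kG : 0 <= kap * G by exact: mulr_ge0.
have JG : 0 <= J + kap * G by exact: addr_ge0.
have h2 : 0 <= h ^+ 2 by exact: sqr_ge0.
rewrite /node_defect -/M /IFE_jet.
have [E|E] := eqVneq (nside P T i) s.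
  rewrite E peval_Taylor.
  (* The segment may still touch the interface at [t0], which is the exceptional parameter allowed
     here. *)
  apply: le_trans (Taylor_same measurable_hessT hessT_ge0 HB d1 d2 (cU s) (ltW t00) (ltW t01) _) _.
    move=> t /andP[a b] tn; have [lt|gt|eq] := ltgtP t t0.
    - by apply: hl; rewrite a.
    - by rewrite -E; apply: hr; rewrite gt.
    - by rewrite eq eqxx in tn.
  rewrite -/J.
  exact: defect_arith_same.
have sdE : nside P T i = ~~ s by move: E; case: (nside P T i); case: (s).
case: tG => [gY|]; last by move/eqP: E.
have tY : Tset ft P T (seg_pt X M t0) by apply: inT; rewrite (ltW t00).
have eY : eint ft h T (seg_pt X M t0) by apply: eint_seg => //; [exact: nodeP_eset|rewrite (ltW t00)].
have [xb _ YE] := on_graph lk gY tY.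
rewrite -/L in xb YE; set x := xi_of _ _ in xb YE.
(* The crossing is in the interior of the element, whereas the graph ends at D and E on its
   boundary. *)
have xb' : 0 < x < xiE L.
  have [_ [_ nD]] := ptD_on lk; have [_ [_ nE]] := ptE_on lk.
  rewrite /ebd in nD nE; rewrite (interior_eset _ _ h0) in nD nE.
  move: xb => /andP[x0 x1]; rewrite !lt_neqAle x0 x1 !andbT; apply/andP; split; apply/eqP => Ex.
    by apply: nD; rewrite -/h -/L; move: eY; rewrite YE -Ex /graph_pt (omega0 lk) !scale0r !addr0.
  by apply: nE; rewrite -/h -/L; move: eY; rewrite YE Ex /graph_pt (omegaE lk) scale0r addr0 -(ptE_E lk).
set n := normal L (graph_pt L x).
have [[n1 n2] c1 c2] := normal_close xb; rewrite -/n in n1 n2 c1 c2.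
have UY : U s (seg_pt X M t0) = U (~~ s) (seg_pt X M t0).
  by have := jU (conj gY tY); case: (s).
have gJ v : dot (grad (U (~~ s)) (seg_pt X M t0)) v = dot (grad (U s) (seg_pt X M t0)) v
    + (r s - 1) * dot (grad (U s) (seg_pt X M t0)) n * dot n v.
  by rewrite YE; exact: (grad_jump sh iT cU jU fU s v xb').
rewrite sdE in hr *.
have TC := Taylor_cross measurable_hessT hessT_ge0 HB d1 d2 (cU s) (cU (~~ s)) (ltW t00) (ltW t01)
  n1 n2 UY gJ hl hr.
rewrite peval_padd peval_Taylor peval_pscale peval_plin -/(eta_of P T M).
set g := grad (U s) X in TC *; set Y := seg_pt X M t0 in TC tY YE *.
have GE (v : plane) (c : R) : `|v.1| <= c -> `|v.2| <= c -> `|dot g v| <= G * c.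
  by move=> v1 v2; exact: dot_bound.
have eM : `|eta_of P T M| <= 2 * h.
  have [_ [tD _]] := ptD_on lk; have [a1 a2] := eset_diam h0 tD (nodeP_eset P T i).
  have [b1 b2] := unit_coord (nbar_unit lk).
  rewrite /eta_of; apply: le_trans (dot_bound _ b1 b2) _.
  by rewrite mulr1 [2 * h]mulr_natl mulr2n; exact: lerD.
have [y1 y2] := eset_diam h0 tY (nodeP_eset P T i); rewrite -/M in y1 y2.
have etaY : eta_of P T Y = omega L x by rewrite YE (eta_graph lk).
(* The tilt of the normal contributes 8 per coordinate over a distance [h], the height of the
   crossing over the chord contributes 4. *)
have dY : `|dot n (M - Y) - eta_of P T M| <= 20 * (kap * h ^+ 2).
  have -> : dot n (M - Y) - eta_of P T M = dot (n - nbar L) (M - Y) - omega L x.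
    by rewrite -etaY /eta_of -/L (dotC n) (dotC (n - nbar L)) dot_addr dotNr (dot_sub3 M Y (ptD L) (nbar L)); ring.
  apply: le_trans (ler_normB _ _) _; have H1 := height_kappa xb.
  exact: (normal_defect_arith (ltW h0) c1 c2 (dot_bound (n - nbar L) y1 y2) H1).
(* 8 from the normal at the crossing and 4 from the slope at F, both measured against the normal of
   the chord. *)
have nn : `|dot g (n - nu)| <= G * (12 * (kap * h)).
  have [_ xF _] := F_on sh iT; have wF := slope_kappa xF; rewrite -/L in wF.
  have [a1 a2] := unit_coord (tau_unit lk).
  have e : n - nu = (n - nbar L) + derive1 (omega L) (xi_of L (ptF L)) *: tau L.
    by rewrite /nu opprB addrA addrAC.
  have aux (p q w b : R) : `|p| <= 8 * (kap * h) -> `|q| <= 1 -> `|w| <= 4 * (kap * h) -> `|p + w * q| <= 12 * (kap * h).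
    move=> p1 q1 w1; apply: le_trans (ler_normD _ _) _.
    have : `|w * q| <= `|w| by rewrite normrM ler_piMr.
    lra.
  by rewrite e; apply: GE; exact: aux.
have gn : `|dot g n| <= G * 1 by exact: GE.
set A := dot g (M - X) in TC *; set D1 := dot n (M - Y) in TC dY *; set eta := eta_of P T M in eM dY *.
(* [44 = 20 + 12 * 2], the last factor bounding the distance of the node to the chord by [2 h]. *)
have dl : `|dot g n * D1 - dot g nu * eta| <= 44 * (kap * h ^+ 2) * G.
  have -> : dot g n * D1 - dot g nu * eta = dot g n * (D1 - eta) + dot g (n - nu) * eta.
    by rewrite dot_addr dotNr; ring.
  apply: le_trans (ler_normD _ _) _; rewrite !normrM.
  have p1 : `|dot g n| * `|D1 - eta| <= G * 1 * (20 * (kap * h ^+ 2)) by exact: ler_pM.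
  have p2 : `|dot g (n - nu)| * `|eta| <= G * (12 * (kap * h)) * (2 * h) by exact: ler_pM.
  exact: flux_defect_arith p1 p2.
have -> : U (~~ s) M - (U s X + A + (r s - 1) * dot g nu * eta) =
  U (~~ s) M - (U s X + A + (r s - 1) * dot g n * D1) + (r s - 1) * (dot g n * D1 - dot g nu * eta) by ring.
apply: le_trans (ler_normD _ _) _; rewrite normrM.
have p3 : `|r s - 1| * `|dot g n * D1 - dot g nu * eta| <= `|r s - 1| * (44 * (kap * h ^+ 2) * G).
  by apply: ler_wpM2l.
exact: (defect_arith_cross ar h2 J0 kG TC p3).
Qed.

End Pointwise.

(** * The interpolation error as a combination of shape functions *)

Section ErrorIdentity.
Context {R : realType}.
Local Notation plane := (R * R)%type.
Variables (ft : fe_type) (P : interface_problem R) (T : element R) (eps kbar la : R).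
Hypothesis (sh : standing_hypotheses ft P) (iT : interface_element ft P T).
Hypothesis (epsb : 0 < eps < Num.sqrt 2 / 2) (kb : 0 < kbar <= 1) (lab : 0 < la < 1).
Hypothesis (uc : unisolvence_conditions ft P eps kbar la).
Hypothesis (nob : forall X, ~ obscure ft P T X).
Variable (phi : 'I_(nv ft) -> bool -> shape_poly R).
Hypothesis (shape : IFE_shape_functions P T phi).
Let L := local P T.
Let h := mesh_size P.
Let h0 : 0 < h := mesh_size_gt0 sh.
Let lk : local_interface_ok ft P T := lok sh iT.
Let kap := kappa P.

Definition side_gain (s : bool) := if s then IFE_gain ft (rho P) else rho P.

Lemma shape_node i j : peval ft (phi i (nside P T j)) (nodeP P T j) = (i == j)%:R.
Proof. by have [_ _ _ H] := shape i; apply: H; exact: (node_closure sh iT nob). Qed.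

Lemma shape_bound i s X : Tset ft P T X ->
  [/\ side_gain s * `|peval ft (phi i s) X| <= 5200 / la,
     side_gain s * (h * `|(pgrad ft (phi i s) X).1|) <= 5200 / la
   & side_gain s * (h * `|(pgrad ft (phi i s) X).2|) <= 5200 / la].
Proof.
move=> tX; have [Hl Hd Hf _] := shape i; rewrite !grad_peval in Hf.
have y1 j : `|(i == j)%:R : R| <= 1 by case: eqP; rewrite ?normr1 ?normr0.
have := IFE_bound sh iT epsb kb lab uc nob Hl Hd Hf (shape_node i) y1 tX s.
by rewrite /= mulr1.
Qed.

Definition line_cond (psi : bool -> shape_poly R) := [/\
  forall t, peval ft (psi false) (ptD L + t *: tau L) = peval ft (psi true) (ptD L + t *: tau L),
  ~~ triangular ft -> cd (psi false) = cd (psi true) &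
  beta P false * dot (pgrad ft (psi false) (ptF L)) (normal L (ptF L))
    = beta P true * dot (pgrad ft (psi true) (ptF L)) (normal L (ptF L))].

Lemma IFE_gain_gt0 s : 0 < side_gain s.
Proof.
have r0 := rho_gt0 sh; rewrite /side_gain /IFE_gain; case: s => //.
by case: (ft) => //; rewrite sqrtr_gt0.
Qed.

(** The pair minus its own nodal interpolant satisfies the interface conditions and has zero nodal
    values, so the a priori bound with [Y = 0] forces its values and gradients to vanish. *)
Lemma IFE_expansion (psi : bool -> shape_poly R) s X : line_cond psi -> Tset ft P T X ->
  peval ft (psi s) X = \sum_i peval ft (psi (nside P T i)) (nodeP P T i) * peval ft (phi i s) X /\
  pgrad ft (psi s) X = pgrad ft
    (psum (fun i => peval ft (psi (nside P T i)) (nodeP P T i)) (fun i => phi i s)) X.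
Proof.
move=> [pl pd pf] tX.
pose a (i : 'I_(nv ft)) := peval ft (psi (nside P T i)) (nodeP P T i).
pose D b := padd (psi b) (pscale (-1) (psum a (fun i => phi i b))).
have [|||i|i|H0 H1 H2] := IFE_bound sh iT epsb kb lab uc nob (phi := D) (y := fun=> 0) (Y := 0) _ _ _ _ _ tX s.
- move=> t; rewrite /D !peval_padd !peval_pscale !peval_psum pl; congr (_ + _ * _).
  by apply: eq_bigr => i _; have [Hl _ _ _] := shape i; rewrite Hl.
- move=> tri; rewrite /D /= !cd_psum pd//; congr (_ + _ * _).
  by apply: eq_bigr => i _; have [_ Hd _ _] := shape i; rewrite Hd.
- rewrite -/L /D !pgrad_padd !pgrad_pscale !pgrad_psum [LHS]mulrDr [RHS]mulrDr pf; congr (_ + _).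
  rewrite mulrCA [RHS]mulrCA; congr (_ * _); rewrite !mulr_sumr.
  by apply: eq_bigr => i _; have [_ _ Hf _] := shape i; rewrite !grad_peval -/L in Hf; rewrite mulrCA Hf mulrCA.
- rewrite /D peval_padd peval_pscale peval_psum (bigD1 i)//= big1 => [|j ji].
    by rewrite shape_node eqxx mulr1 addr0 mulN1r subrr.
  by rewrite shape_node (negbTE ji) mulr0.
- by rewrite normr0.
move: H0 H1 H2; rewrite mulr0 -/(side_gain s) !pmulr_rle0 ?IFE_gain_gt0//.
rewrite !normr_le0 => /eqP E0 /eqP E1 /eqP E2; split.
  by move: E0; rewrite /D peval_padd peval_pscale peval_psum mulN1r => /eqP; rewrite subr_eq0 => /eqP.
have e1 (v : plane) : v.1 = dot v ex by rewrite /dot /= mulr1 mulr0 addr0.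
have e2 (v : plane) : v.2 = dot v ey by rewrite /dot /= mulr1 mulr0 add0r.
rewrite [LHS]surjective_pairing [RHS]surjective_pairing; apply/pair_equal_spec; split.
  move: E1; rewrite /D !e1 pgrad_padd pgrad_pscale mulN1r => /eqP.
  by rewrite subr_eq0 => /eqP.
move: E2; rewrite /D !e2 pgrad_padd pgrad_pscale mulN1r => /eqP.
by rewrite subr_eq0 => /eqP.
Qed.

Variables (U : bool -> plane -> R) (B : R).
Hypotheses (cU : forall s, Ck 2 (U s))
  (jU : forall X, (Gamma P `&` Tset ft P T) X -> U true X = U false X)
  (fU : forall X, (Gamma P `&` Tset ft P T) X ->
     beta P true * dot (grad (U true) X) (normal L X) = beta P false * dot (grad (U false) X) (normal L X))
  (B0 : 0 <= B)
  (hB : forall Y, Tset ft P T Y -> forall s, hess_norm (U s) Y <= B).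

Lemma IFE_jet_cond s X : line_cond (IFE_jet P T U s X).
Proof.
have nn := nbar_unit lk; have nt := nbar_tau lk.
have ntl t : dot (ptD L + t *: tau L - ptD L) (nbar L) = 0.
  by rewrite addrC addKr dotZl dotC nt mulr0.
split.
- by move=> t; rewrite /IFE_jet; case: s => /=; rewrite peval_padd peval_pscale peval_plin ntl mulr0 addr0.
- by rewrite /IFE_jet; case: s => /=; rewrite mulr0 addr0.
have [_ xb FE] := F_on sh iT.
set xF := xi_of L (ptF L) in xb FE.
have sp := speed_gt0 P T xF; have sn : speed L xF != 0 by rewrite gt_eqF.
have bs (b : bool) : beta P b != 0 by rewrite gt_eqF// (beta_gt0 sh).
set g := grad (U s) X; set N := normal L (ptF L).
have NE : N = (speed L xF)^-1 *: (nbar L - derive1 (omega L) xF *: tau L) by [].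
(* The kink L has slope [1 / speed] along the unit normal at F, while its coefficient in the jet
   uses a normal that is [speed] times too long; the factors cancel. *)
have nN : dot (nbar L) N = (speed L xF)^-1.
  by rewrite NE dotZr dot_addr dotNr dotZr nn nt mulr0 subr0 mulr1.
have gN : dot g (nbar L - derive1 (omega L) xF *: tau L) = speed L xF * dot g N.
  by rewrite NE dotZr mulrA divff// mul1r.
suff E : beta P (~~ s) * dot (pgrad ft (IFE_jet P T U s X (~~ s)) (ptF L)) N =
         beta P s * dot (pgrad ft (IFE_jet P T U s X s) (ptF L)) N by case: (s) E => /= E.
rewrite /IFE_jet eqxx (_ : ~~ s == s = false); last by case: (s).
rewrite pgrad_padd pgrad_pscale pgrad_plin pgrad_Taylor -/g -/L -/xF gN nN.
by field; rewrite sn bs.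
Qed.

Lemma beta_ratio s : `|beta P s / beta P (~~ s) - 1| <= (if s then (rho P)^-1 else 1).
Proof.
have r0 := rho_gt0 sh; have r1 := rho_le1 sh; case: s => /=.
  have -> : beta P true / beta P false = (rho P)^-1 by rewrite /rho invf_div.
  have : 1 <= (rho P)^-1 by rewrite invf_ge1.
  by move=> r2; rewrite ger0_norm; lra.
by rewrite -/(rho P) ler0_norm; lra.
Qed.

(** Cost of continuing a jet across the chord from the side [s]: the ratio of coefficients is
    [1 / rho] from the side + and [rho] from the side -. *)
Definition side_mult (s : bool) : R := if s then (rho P)^-1 else 1.

Lemma side_mult_ge1 s : 1 <= side_mult s.
Proof.
by have r0 := rho_gt0 sh; have r1 := rho_le1 sh; rewrite /side_mult; case: s => //; rewrite invf_ge1.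
Qed.

(** The data [q] will be the nodal values of the function [u] that [U] only approximates, whence the
    first term. The constant 46 is [2 + 44], as [side_mult] is at least 1 and bounds the ratio of
    coefficients minus 1. *)
Definition defect_bound (q : 'I_(nv ft) -> R) s X : R := \sum_i
  (`|q i - U (nside P T i) (nodeP P T i)|
   + 46 * side_mult s * (h ^+ 2 * (seg_avg (hessT ft P T U) (nodeP P T i) X + kap * gsum (U s) X))).

Lemma interpolation_error q s X : eint ft h T X -> Omega_ P s X ->
  [/\ side_gain s * `|\sum_i q i * peval ft (phi i s) X - U s X| <= 5200 / la * defect_bound q s X,
   side_gain s * (h * `|(pgrad ft (psum q (fun i => phi i s)) X).1 - 'D_ex (U s) X|)
     <= 5200 / la * defect_bound q s X
 & side_gain s * (h * `|(pgrad ft (psum q (fun i => phi i s)) X).2 - 'D_ey (U s) X|)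
     <= 5200 / la * defect_bound q s X].
Proof.
move=> eX sX; have tX := eint_eset h0 eX.
have [E1 E2] := IFE_expansion s (IFE_jet_cond s X) tX.
set a := (fun i => _) in E2.
have Jv : peval ft (IFE_jet P T U s X s) X = U s X.
  by rewrite /IFE_jet eqxx peval_Taylor subrr /dot /= !mulr0 !addr0.
have Jg : pgrad ft (IFE_jet P T U s X s) X = grad (U s) X.
  by rewrite /IFE_jet eqxx pgrad_Taylor.
have qa i : `|q i - a i| <= `|q i - U (nside P T i) (nodeP P T i)|
   + 46 * side_mult s * (h ^+ 2 * (seg_avg (hessT ft P T U) (nodeP P T i) X + kap * gsum (U s) X)).
  have -> : q i - a i = (q i - U (nside P T i) (nodeP P T i)) + node_defect P T U s X i.
    by rewrite /node_defect /a; ring.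
  apply: le_trans (ler_normD _ _) _; rewrite lerD2l.
  apply: le_trans (node_defect_bound sh iT epsb kb uc nob cU jU fU hB i B0 eX sX) _.
  apply: ler_wpM2r.
    rewrite mulr_ge0 ?sqr_ge0// addr_ge0// ?seg_avg_ge0//; first by move=> Y; exact: hessT_ge0.
    by rewrite mulr_ge0 ?addr_ge0// (kappa_ge0 (hyp_curvature sh)).
  by have := beta_ratio s; have := side_mult_ge1 s; rewrite -/(side_mult s); lra.
have sum_bound (z : 'I_(nv ft) -> R) : (forall i, side_gain s * `|z i| <= 5200 / la) ->
    side_gain s * `|\sum_i (q i - a i) * z i| <= 5200 / la * defect_bound q s X.
  move=> zb; have g0 := ltW (IFE_gain_gt0 s).
  apply: (@le_trans _ _ (side_gain s * \sum_i `|(q i - a i) * z i|)).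
    by apply: ler_wpM2l => //; exact: ler_norm_sum.
  rewrite /defect_bound !mulr_sumr; apply: ler_sum => i _.
  by rewrite normrM mulrCA mulrC; apply: ler_pM => //; rewrite mulr_ge0.
have gr v : dot (pgrad ft (psum q (fun i => phi i s)) X) v - dot (grad (U s) X) v =
    \sum_i (q i - a i) * dot (pgrad ft (phi i s) X) v.
  rewrite -Jg E2 !pgrad_psum -sumrB; apply: eq_bigr => i _; ring.
have e1 (v : plane) : v.1 = dot v ex by rewrite /dot /= mulr1 mulr0 addr0.
have e2 (v : plane) : v.2 = dot v ey by rewrite /dot /= mulr1 mulr0 add0r.
have nh (x : R) : h * `|x| = `|h * x| by rewrite normrM (gtr0_norm h0).
split.
- rewrite -Jv E1 -sumrB.
  under eq_bigr do rewrite -mulrBl.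
  by apply: sum_bound => i; have [] := shape_bound i s tX.
- rewrite nh.
  rewrite [_.1]e1 -[X in _ - X]/((grad (U s) X).1) [(grad _ _).1]e1 gr mulr_sumr.
  under eq_bigr do rewrite mulrCA.
  apply: sum_bound => i; have [_ H _] := shape_bound i s tX.
  by rewrite normrM (gtr0_norm h0) -e1.
- rewrite nh.
  rewrite [_.2]e2 -[X in _ - X]/((grad (U s) X).2) [(grad _ _).2]e2 gr mulr_sumr.
  under eq_bigr do rewrite mulrCA.
  apply: sum_bound => i; have [_ _ H] := shape_bound i s tX.
  by rewrite normrM (gtr0_norm h0) -e2.
Qed.

End ErrorIdentity.

(** * Error in the L^2 norm *)

Section MoreL2.
Context {R : realType}.
Local Notation plane := (R * R)%type.
Local Notation mR := (measurableTypeR R).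
Local Notation mplane := (mR * mR)%type.
Local Notation leb := (@lebesgue_measure R).
Local Notation leb2 := (leb \x leb)%E.
Implicit Types (G : set mplane) (f g : plane -> R).

Lemma L2norm_le_ae G f g : measurable G -> L2 G f -> L2 G g ->
  {ae leb2, forall X, G X -> `|f X| <= `|g X|} -> L2norm G f <= L2norm G g.
Proof.
move=> mG fL gL fg; rewrite -(ler_pXn2r (isT : 0 < 2)%N) ?nnegrE ?L2norm_ge0//.
rewrite -lee_fin !L2norm_sqr//.
have [mf _] := (L2P f mG).1 fL; have [mg _] := (L2P g mG).1 gL.
apply: ae_ge0_le_integral => //.
- by move=> X _; rewrite lee_fin sqr_ge0.
- by apply/measurable_EFinP; exact: measurable_funX.
- by move=> X _; rewrite lee_fin sqr_ge0.
- by apply/measurable_EFinP; exact: measurable_funX.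
- apply: (@filterS _ _ (ae_filter_ringOfSetsType leb2) _ _ _ fg) => X /= fgX GX.
  rewrite lee_fin -[f X ^+ 2]real_normK ?num_real// -[g X ^+ 2]real_normK ?num_real//.
  by rewrite ler_pXn2r ?nnegrE//; exact: fgX.
Qed.

Lemma L2norm_subset G G' f : measurable G -> measurable G' -> G `<=` G' -> L2 G' f ->
  L2 G f /\ L2norm G f <= L2norm G' f.
Proof.
move=> mG mG' GG' fL; have [mf fi] := (L2P f mG').1 fL.
have le_int : (\int[leb2]_(X in G) ((f X) ^+ 2)%:E <= \int[leb2]_(X in G') ((f X) ^+ 2)%:E)%E.
  apply: ge0_subset_integral => //; last by move=> X _; rewrite lee_fin sqr_ge0.
  by apply/measurable_EFinP; exact: measurable_funX.
have fL' : L2 G f.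
  apply/L2P => //; split; first exact: measurable_funS mf.
  exact: le_lt_trans fi.
split=> //; rewrite -(ler_pXn2r (isT : 0 < 2)%N) ?nnegrE ?L2norm_ge0//.
by rewrite -lee_fin !L2norm_sqr.
Qed.

Lemma L2_patch G f : L2 setT (f \_ G) = L2 G f.
Proof. by rewrite /L2 patch_setT. Qed.

Lemma L2norm_patch G f : L2norm setT (f \_ G) = L2norm G f.
Proof. by rewrite /L2norm patch_setT. Qed.

Lemma L2_patchD G G' f g : L2 G f -> L2 G' g ->
  L2 setT (fun X => (f \_ G) X + (g \_ G') X) /\
  L2norm setT (fun X => (f \_ G) X + (g \_ G') X) <= L2norm G f + L2norm G' g.
Proof.
move=> fL gL; have fL' : L2 setT (f \_ G) by rewrite L2_patch.
have gL' : L2 setT (g \_ G') by rewrite L2_patch.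
split; first exact: L2D.
by apply: le_trans (L2normD fL' gL') _; rewrite !L2norm_patch.
Qed.

Lemma L2_abs G f : measurable G -> L2 G f -> L2 G (fun X => `|f X|) /\ L2norm G (fun X => `|f X|) = L2norm G f.
Proof.
move=> mG fL; have [mf _] := (L2P f mG).1 fL.
have aL : L2 G (fun X => `|f X|).
  by apply: (L2_le mG _ fL) => [|X _]; [exact: measurableT_comp mf|rewrite normr_id].
by split=> //; apply/eqP; rewrite eq_le; apply/andP; split; apply: L2norm_le => // X _; rewrite normr_id.
Qed.

Lemma L2_abs3 G f g k : measurable G -> L2 G f -> L2 G g -> L2 G k ->
  L2 G (fun X => `|f X| + `|g X| + `|k X|) /\
  L2norm G (fun X => `|f X| + `|g X| + `|k X|) <= L2norm G f + L2norm G g + L2norm G k.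
Proof.
move=> mG /(L2_abs mG)[fL <-] /(L2_abs mG)[gL <-] /(L2_abs mG)[kL <-].
split; first by apply: L2D => //; exact: L2D.
apply: le_trans (L2normD (L2D fL gL) kL) _; rewrite lerD2r; exact: L2normD.
Qed.

Lemma L2norm_sum G n (f : 'I_n -> plane -> R) : measurable G -> (forall i, L2 G (f i)) ->
  L2 G (fun X => \sum_i f i X) /\ L2norm G (fun X => \sum_i f i X) <= \sum_i L2norm G (f i).
Proof.
move=> mG; elim: n f => [|n IH] f fL.
  have E : (fun X => \sum_(i < 0) f i X) = (fun X : plane => 0 * 0).
    by apply/funext => X; rewrite big_ord0 mul0r.
  have z : L2 G (fun X : plane => 0).
    apply/L2P => //; split; first exact: measurable_cst.
    by rewrite integral0_eq// => X _; rewrite expr0n.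
  rewrite E big_ord0; split; first by rewrite mul0r.
  by rewrite (L2normZ 0 z) normr0 mul0r.
have E : (fun X => \sum_(i < n.+1) f i X) = (fun X => f ord0 X + \sum_i f (lift ord0 i) X).
  by apply/funext => X; rewrite big_ord_recl.
have [sL sn] := IH (fun i => f (lift ord0 i)) (fun i => fL _).
rewrite E big_ord_recl; split; first exact: L2D.
by apply: le_trans (L2normD (fL _) sL) _; rewrite lerD2l.
Qed.

End MoreL2.

(** * Norms on the two sides of an element *)

Section ElementBounds.
Context {R : realType}.
Local Notation plane := (R * R)%type.
Local Notation mR := (measurableTypeR R).
Local Notation mplane := (mR * mR)%type.
Local Notation leb := (@lebesgue_measure R).
Local Notation leb2 := (leb \x leb)%E.
Variables (ft : fe_type) (P : interface_problem R) (T : element R).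
Hypothesis (sh : standing_hypotheses ft P).
Let h := mesh_size P.
Let h0 : 0 < h := mesh_size_gt0 sh.
Let A := Tsub ft P T.

Lemma element_box : exists2 N : R, 0 < N & forall X, Tset ft P T X -> `|X.1| < N /\ `|X.2| < N.
Proof.
set C := ecentre ft h T; have tC : Tset ft P T C by apply: (eint_eset h0); exact: ecentre_eint.
exists (`|C.1| + `|C.2| + h + 1) => [|X tX].
  by rewrite ltr_wpDl// !addr_ge0// ltW.
have [a b] := eset_diam h0 tC tX.
have := ler_normD C.1 ((X - C).1); have := ler_normD C.2 ((X - C).2).
rewrite (_ : C.2 + _ = X.2); last by rewrite /=; ring.
rewrite (_ : C.1 + _ = X.1); last by rewrite /=; ring.
by have := normr_ge0 C.1; have := normr_ge0 C.2; move: a b; rewrite -/h; lra.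
Qed.

Lemma eint_side_interior s X : eint ft h T X -> Omega_ P s X -> (A s)° X.
Proof.
move=> eX sX; apply: (@filterS _ _ _ (eint ft h T `&` Omega_ P s)).
  by move=> Y [eY sY]; split => //; exact: (eint_eset h0 eY).
apply: open_nbhs_nbhs; split => //; apply: openI; first exact: open_eint.
exact: (open_side sh).
Qed.

Lemma Tsub_null s : leb2.-negligible (A s `\` (A s)°).
Proof.
apply: negligibleS (eset_null ft T h0) => X [[tX sX] nX]; split => // eX.
by apply: nX; exact: eint_side_interior.
Qed.

Lemma ae_eint s : {ae leb2, forall X, A s X -> eint ft h T X}.
Proof.
apply: negligibleS (eset_null ft T h0) => X /= nX.
have [[tX sX] eX] : A s X /\ ~ eint ft h T X by apply/not_implyP.
by split.
Qed.

Lemma L2_continuous_Tsub s f : continuous f -> L2 (A s) f.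
Proof.
move=> cf; have [N _ HN] := element_box.
by apply: (continuous_L2 (N := N)) cf _ => [|X [/HN]//]; exact: (measurable_Tsub T sh).
Qed.

Lemma wderiv_Tsub s v f : axis v -> Ck 1 f -> wderiv (A s) v f ('D_v f).
Proof.
move=> av cf; have [N _ HN] := element_box.
by apply: (classical_wderiv (N := N)) => // [|X [/HN]//]; exact: (measurable_Tsub T sh).
Qed.

Lemma hess_bounded (U : bool -> plane -> R) : (forall s, Ck 2 (U s)) ->
  exists2 B, 0 <= B & forall Y, Tset ft P T Y -> forall s, hess_norm (U s) Y <= B.
Proof.
move=> cU; have [N _ HN] := element_box.
have [B1 b1 H1] := continuous_box_bounded N (hess_norm_continuous (cU true)).
have [B2 b2 H2] := continuous_box_bounded N (hess_norm_continuous (cU false)).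
exists (B1 + B2) => [|Y /HN [/ltW y1 /ltW y2] s]; first by rewrite addr_ge0// ltW.
apply: le_trans (ler_norm _) _; case: s.
  by apply: le_trans (H1 Y y1 y2) _; rewrite lerDl ltW.
by apply: le_trans (H2 Y y1 y2) _; rewrite lerDr ltW.
Qed.

Definition hessN (U : bool -> plane -> R) s : R :=
  L2norm (A s) ('D_ex ('D_ex (U s))) + L2norm (A s) ('D_ey ('D_ex (U s))) + L2norm (A s) ('D_ey ('D_ey (U s))).

Definition gradN (u : plane -> R) s : R := L2norm (A s) ('D_ex u) + L2norm (A s) ('D_ey u).

Lemma Ck2_D (u : plane -> R) v w : axis v -> axis w -> Ck 2 u -> continuous ('D_v ('D_w u)).
Proof.
by move=> av aw cu; apply: (@Ck_continuous _ 0); apply: Ck_derive_axis => //; apply: Ck_derive_axis.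
Qed.

Lemma hess_L2 (U : bool -> plane -> R) s : Ck 2 (U s) ->
  L2 (A s) (hess_norm (U s)) /\ L2norm (A s) (hess_norm (U s)) <= hessN U s.
Proof.
move=> cU; apply: (L2_abs3 (measurable_Tsub T sh s)).
all: by apply: L2_continuous_Tsub; apply: Ck2_D => //; rewrite /axis; auto.
Qed.

Lemma hessT_L2 (U : bool -> plane -> R) : (forall s, Ck 2 (U s)) ->
  L2 setT (hessT ft P T U) /\ L2norm setT (hessT ft P T U) <= hessN U true + hessN U false.
Proof.
move=> cU; have [L1 n1] := hess_L2 (cU true); have [L2' n2] := hess_L2 (cU false).
have [HL Hn] := L2_patchD L1 L2'; split; first exact: HL.
exact: (le_trans Hn (lerD n1 n2)).
Qed.

Lemma gsum_L2 (u : plane -> R) s : Ck 2 u -> L2 (A s) (gsum u) /\ L2norm (A s) (gsum u) <= gradN u s.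
Proof.
move=> cu; have mA := measurable_Tsub T sh s.
have aL v : axis v -> L2 (A s) ('D_v u).
  by move=> av; apply: L2_continuous_Tsub; apply: (@Ck_continuous _ 1); apply: Ck_derive_axis.
have [xL nx] := L2_abs mA (aL ex (or_introl erefl)); have [yL ny] := L2_abs mA (aL ey (or_intror erefl)).
rewrite /gsum /gradN; split; first exact: (L2D xL yL).
by apply: le_trans (L2normD xL yL) _; rewrite nx ny.
Qed.

Lemma cst_L2 s (c : R) : L2 (A s) (cst c) /\ L2norm (A s) (cst c) = `|c| * L2norm (A s) (cst 1).
Proof.
have L1 : L2 (A s) (cst 1) by apply: L2_continuous_Tsub => X; exact: cvg_cst.
have -> : cst c = (fun X : plane => c * cst 1 X) by apply/funext => X; rewrite mulr1.
by split; [exact: L2Z|exact: L2normZ].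
Qed.

Lemma defect_bound_L2 (U : bool -> plane -> R) (q : 'I_(nv ft) -> R) s : (forall s, Ck 2 (U s)) ->
  L2 (A s) (defect_bound P T U q s) /\
  L2norm (A s) (defect_bound P T U q s) <=
    (\sum_i `|q i - U (nside P T i) (nodeP P T i)|) * L2norm (A s) (cst 1)
    + 184 * side_mult P s * (h ^+ 2 * (hessN U true + hessN U false + kappa P * gradN (U s) s)).
Proof.
move=> cU; have mA := measurable_Tsub T sh s.
have [B B0 hB] := hess_bounded cU.
have [HL Hn] := hessT_L2 cU; have [GL Gn] := gsum_L2 s (cU s).
have k0 : 0 <= kappa P := kappa_ge0 (hyp_curvature sh).
have m1 := side_mult_ge1 sh s.
set Z := hessN U true + hessN U false + _; pose c := 46 * side_mult P s * h ^+ 2.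
have m0 : 0 <= side_mult P s := le_trans ler01 m1.
have c0 : 0 <= c by apply: mulr_ge0; [exact: mulr_ge0|exact: sqr_ge0].
have S i : L2 (A s) (fun X => `|q i - U (nside P T i) (nodeP P T i)| + 46 * side_mult P s *
      (h ^+ 2 * (seg_avg (hessT ft P T U) (nodeP P T i) X + kappa P * gsum (U s) X))) /\
   L2norm (A s) (fun X => `|q i - U (nside P T i) (nodeP P T i)| + 46 * side_mult P s *
      (h ^+ 2 * (seg_avg (hessT ft P T U) (nodeP P T i) X + kappa P * gsum (U s) X))) <=
   `|q i - U (nside P T i) (nodeP P T i)| * L2norm (A s) (cst 1) + c * Z.
  have HB Y : hessT ft P T U Y <= B by exact: (hessT_le sh hB).
  have [JL Jn] := seg_avg_L2 (nodeP P T i) (measurable_hessT T sh cU) (hessT_ge0 ft P T U) HB mA HL.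
  set d := `|q i - _|; have [dL dn] := cst_L2 s d.
  have E : (fun X => d + 46 * side_mult P s * (h ^+ 2 * (seg_avg (hessT ft P T U) (nodeP P T i) X + kappa P * gsum (U s) X)))
    = (fun X => cst d X + c * (seg_avg (hessT ft P T U) (nodeP P T i) X + kappa P * gsum (U s) X)).
    by apply/funext => X; rewrite /c /=; ring.
  have SL : L2 (A s) (fun X => seg_avg (hessT ft P T U) (nodeP P T i) X + kappa P * gsum (U s) X).
    by apply: L2D => //; exact: L2Z.
  rewrite E; split; first by apply: L2D => //; exact: L2Z.
  apply: le_trans (L2normD dL (L2Z c SL)) _; rewrite dn normr_id lerD2l (L2normZ c SL) (ger0_norm c0).
  apply: ler_wpM2l => //; apply: le_trans (L2normD JL (L2Z _ GL)) _; apply: lerD.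
    exact: le_trans Jn Hn.
  by rewrite (L2normZ _ GL) (ger0_norm k0) ler_wpM2l.
have [DL Dn] := L2norm_sum mA (fun i => (S i).1).
split=> //; apply: le_trans Dn _.
apply: (@le_trans _ _ (\sum_i (`|q i - U (nside P T i) (nodeP P T i)| * L2norm (A s) (cst 1) + c * Z))).
  by apply: ler_sum => i _; exact: (S i).2.
have Z0 : 0 <= Z.
  by rewrite /Z /hessN /gradN !(addr_ge0, mulr_ge0)// L2norm_ge0.
rewrite big_split /= -mulr_suml lerD2l sumr_const card_ord -[_ *+ nv ft]mulr_natl.
(* [184 = 4 * 46], for at most four nodes. *)
have -> : 184 * side_mult P s * (h ^+ 2 * Z) = 4 * (c * Z) by rewrite /c; ring.
by apply: ler_wpM2r; [exact: mulr_ge0|rewrite ler_nat; case: (ft)].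
Qed.

End ElementBounds.

(** * Passage to the limit *)

Section PointBound.
Context {R : realType}.
Local Notation plane := (R * R)%type.
Local Notation mR := (measurableTypeR R).
Local Notation mplane := (mR * mR)%type.
Local Notation leb := (@lebesgue_measure R).
Local Notation leb2 := (leb \x leb)%E.
Implicit Types (G : set mplane) (f g : plane -> R).

Lemma CkB k f g : Ck k f -> Ck k g -> Ck k (fun X => f X - g X).
Proof.
elim: k f g => [|k IH] f g; first by move=> cf cg X; apply: cvgB; [exact: cf|exact: cg].
move=> [cf df fx fy] [cg dg gx gy]; split.
- by move=> X; apply: cvgB; [exact: cf|exact: cg].
- by move=> X; have [a b] := df X; have [c d] := dg X; split; apply: derivableB.
- rewrite (_ : (fun X => _) = fun X => 'D_ex f X - 'D_ex g X); first exact: IH.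
  by apply/funext => X; have [a _] := df X; have [c _] := dg X; exact: deriveB.
- rewrite (_ : (fun X => _) = fun X => 'D_ey f X - 'D_ey g X); first exact: IH.
  by apply/funext => X; have [_ b] := df X; have [_ d] := dg X; exact: deriveB.
Qed.

Lemma derive_axisB v k f g : axis v -> Ck k.+1 f -> Ck k.+1 g ->
  'D_v (fun X => f X - g X) = fun X => 'D_v f X - 'D_v g X.
Proof.
move=> av [_ df _ _] [_ dg _ _]; apply/funext => X.
by have [a b] := df X; have [c d] := dg X; case: av => ->; exact: deriveB.
Qed.

Lemma eq_L2norm G f g : (forall X, G X -> f X = g X) -> L2norm G f = L2norm G g.
Proof.
move=> fg; rewrite /L2norm (_ : f \_ G = g \_ G)//.
by apply/funext => X; rewrite !patchE; case: ifPn => // /set_mem; exact: fg.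
Qed.

Lemma open_measure_gt0 (G : set plane) : open G -> G !=set0 -> (0 < leb2 G)%E.
Proof.
move=> oG [X GX]; have : nbhs X G by exact: open_nbhs_nbhs.
move=> /nbhs_ballP[e /= e0 eG].
have sub : obox (X.1 - e) (X.1 + e) (X.2 - e) (X.2 + e) `<=` G.
  move=> Y [/=]; rewrite !in_itv /= => /andP[a b] /andP[c d]; apply: eG; split; rewrite /ball /= distrC ltr_norml.
    by rewrite ltrBrDr ltrBlDr addrC a addrC b.
  by rewrite ltrBrDr ltrBlDr addrC c addrC d.
apply: lt_le_trans (_ : leb2 (obox (X.1 - e) (X.1 + e) (X.2 - e) (X.2 + e)) <= _)%E; last first.
  by apply: le_measure; rewrite ?inE//; [exact: measurable_obox|exact: open_measurable2].
have lt (x : R) : x - e < x + e by rewrite ltrD2l gtrN.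
rewrite /obox product_measure1E; [|exact: measurable_itv|exact: measurable_itv].
have lp (x : R) : (0 < leb `](x - e)%R, (x + e)%R[%classic)%E.
  by rewrite lebesgue_measure_itv /= lte_fin lt -EFinB lte_fin subr_gt0.
by apply: mule_gt0; exact: lp.
Qed.

Lemma L2norm1_gt0 (G : set plane) : open G -> G !=set0 -> L2 G (cst 1) -> 0 < L2norm G (cst 1).
Proof.
move=> oG nG L1; rewrite lt_neqAle L2norm_ge0 andbT eq_sym; apply/eqP => E.
have := L2norm_sqr (open_measurable2 oG) L1.
rewrite E expr0n /=; under eq_integral do rewrite expr1n.
rewrite integral_cst ?mul1e; last exact: open_measurable2.
by move=> E'; have := open_measure_gt0 oG nG; rewrite -E' ltxx.
Qed.

(** Taylor's formula at every [X] of the convex set [G], evaluated at [M], followed by the L^2 norm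
    in [X]: the constant [f M] has norm [|f M|] times that of 1, and the segment averages contract.
    This replaces the Sobolev embedding. *)
Lemma point_bound (G : set mplane) (f : plane -> R) (h B : R) M :
  measurable G -> (forall X Y t, G X -> G Y -> 0 <= t <= 1 -> G (seg_pt X Y t)) ->
  (forall X Y, G X -> G Y -> `|(Y - X).1| <= h /\ `|(Y - X).2| <= h) -> 0 <= h ->
  Ck 2 f -> 0 <= B -> (forall X, G X -> hess_norm f X <= B) -> (forall g, continuous g -> L2 G g) -> G M ->
  `|f M| * L2norm G (cst 1) <= L2norm G f + h * (L2norm G ('D_ex f) + L2norm G ('D_ey f))
    + 2 * h ^+ 2 * L2norm G (hess_norm f).
Proof.
move=> mG cG dG hp cf B0 fB cL GM.
pose K := hess_norm f \_ G; have cH := hess_norm_continuous cf.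
have mK : measurable_fun [set: mplane] (K : mplane -> R).
  by apply/(measurable_restrictT _ mG); apply: measurable_funTS; exact: continuous_measurable2.
have K0 X : 0 <= K X by rewrite /K patchE; case: ifP => // _; exact: hess_norm_ge0.
have KB X : K X <= B by rewrite /K patchE; case: ifPn => // /set_mem; exact: fB.
have KL : L2 setT K by rewrite L2_patch; exact: cL.
have [JL Jn] := seg_avg_L2 M mK K0 KB mG KL.
have Dc v : axis v -> continuous ('D_v f).
  by move=> av; apply: (@Ck_continuous _ 1); apply: Ck_derive_axis.
have [xL xn] := L2_abs mG (cL _ (Dc ex (or_introl erefl))).
have [yL yn] := L2_abs mG (cL _ (Dc ey (or_intror erefl))).
have [fL fn] := L2_abs mG (cL _ (Ck_continuous cf)).
have sL := L2Z h (L2D xL yL); have tL := L2Z (2 * h ^+ 2) JL.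
have cn : L2norm G (cst (`|f M|)) = `|f M| * L2norm G (cst 1).
  have -> : cst `|f M| = (fun X : plane => `|f M| * cst 1 X) by apply/funext => X; rewrite mulr1.
  rewrite L2normZ ?normr_id//; apply: cL => X; exact: cvg_cst.
rewrite -cn.
have h2 : 0 <= 2 * h ^+ 2 by rewrite mulr_ge0// sqr_ge0.
apply: (@le_trans _ _ (L2norm G (fun X => `|f X| + h * (`|'D_ex f X| + `|'D_ey f X|) + 2 * h ^+ 2 * seg_avg K M X))).
  apply: L2norm_le => //; first by apply: cL => X; exact: cvg_cst.
    by apply: L2D => //; exact: L2D.
  move=> X GX; rewrite /= normr_id.
  have [d1 d2] := dG X M GX GM.
  have TS := Taylor_same mK K0 KB d1 d2 cf ler01 (lexx 1) _.
  have {TS} : `|f M - (f X + dot (grad f X) (M - X))| <= 2 * h ^+ 2 * seg_avg K M X.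
    apply: TS => t /andP[t0 t1] _; rewrite /K patchE mem_set// /=.
    by apply: cG => //; rewrite !ltW.
  have := dot_bound (grad f X) d1 d2; rewrite /=.
  set D := dot _ _; set J := seg_avg _ _ _; set a := `|'D_ex f X|; set b := `|'D_ey f X|.
  have J0 : 0 <= J by apply: seg_avg_ge0.
  move=> H1 H2; rewrite [X in _ <= X]ger0_norm; last first.
    apply: addr_ge0; last exact: mulr_ge0.
    by apply: addr_ge0 => //; apply: mulr_ge0 => //; apply: addr_ge0; rewrite normr_ge0.
  have -> : f M = f X + D + (f M - (f X + D)) by ring.
  apply: le_trans (ler_normD _ _) _; apply: lerD => //.
  by apply: le_trans (ler_normD _ _) _; rewrite lerD2l mulrC.
apply: le_trans (L2normD (L2D fL sL) tL) _; apply: lerD; last first.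
  rewrite (L2normZ _ JL) (ger0_norm h2); apply: ler_wpM2l => //.
  by apply: le_trans Jn _; rewrite /K L2norm_patch.
apply: le_trans (L2normD fL sL) _; rewrite fn lerD2l (L2normZ _ (L2D xL yL)) (ger0_norm hp).
by apply: ler_wpM2l => //; apply: le_trans (L2normD xL yL) _; rewrite xn yn.
Qed.

End PointBound.

(** * Nodal values under approximation *)

Section Density.
Context {R : realType}.
Local Notation plane := (R * R)%type.
Local Notation mR := (measurableTypeR R).
Local Notation mplane := (mR * mR)%type.
Local Notation leb := (@lebesgue_measure R).
Local Notation leb2 := (leb \x leb)%E.
Variables (ft : fe_type) (P : interface_problem R) (T : element R).
Hypothesis (sh : standing_hypotheses ft P) (iT : interface_element ft P T).
Hypothesis (nob : forall X, ~ obscure ft P T X).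
Let h := mesh_size P.
Let h0 : 0 < h := mesh_size_gt0 sh.
Let A := Tsub ft P T.

Lemma sqrt_sum6_ge (a b c d e k : R)
    (z := Num.sqrt (a ^+ 2 + Num.sqrt (b ^+ 2 + c ^+ 2) ^+ 2 + Num.sqrt (d ^+ 2 + e ^+ 2 + k ^+ 2) ^+ 2)) :
  0 <= a -> 0 <= b -> 0 <= c -> 0 <= d -> 0 <= e -> 0 <= k ->
  [/\ a <= z, b <= z, c <= z & [/\ d <= z, e <= z & k <= z]].
Proof.
move=> a0 b0 c0 d0 e0 k0.
have aux (x y : R) : 0 <= x -> x ^+ 2 <= y -> x <= Num.sqrt y.
  by move=> x0 xy; rewrite -(ger0_norm x0) -sqrtr_sqr ler_wsqrtr.
rewrite /z !sqr_sqrtr ?addr_ge0 ?sqr_ge0//.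
have a2 := sqr_ge0 a; have b2 := sqr_ge0 b; have c2 := sqr_ge0 c.
have d2 := sqr_ge0 d; have e2 := sqr_ge0 e; have k2 := sqr_ge0 k.
by split; [| | |split]; apply: aux => //; lra.
Qed.

Lemma H2norm_ge (G : set plane) f (z := H2norm G f) :
  [/\ L2norm G f <= z, L2norm G (wD G ex f) <= z, L2norm G (wD G ey f) <= z &
    [/\ L2norm G (wD G ex (wD G ex f)) <= z, L2norm G (wD G ey (wD G ex f)) <= z
      & L2norm G (wD G ey (wD G ey f)) <= z]].
Proof. by rewrite /z; apply: sqrt_sum6_ge; rewrite L2norm_ge0. Qed.

(* [U s] plays the role of a piecewise smooth approximation of [u] on [T^s]. *)
Record H2_close (u : plane -> R) (U : bool -> plane -> R) (e : R) : Prop := H2Close {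
  close_0 : forall s, L2norm (A s) (fun X => u X - U s X) <= e;
  close_1 : forall s v, axis v -> L2norm (A s) (fun X => wD (A s) v u X - 'D_v (U s) X) <= e;
  close_xx : forall s, L2norm (A s) (fun X => wD (A s) ex (wD (A s) ex u) X - 'D_ex ('D_ex (U s)) X) <= e;
  close_yx : forall s, L2norm (A s) (fun X => wD (A s) ey (wD (A s) ex u) X - 'D_ey ('D_ex (U s)) X) <= e;
  close_yy : forall s, L2norm (A s) (fun X => wD (A s) ey (wD (A s) ey u) X - 'D_ey ('D_ey (U s)) X) <= e
}.

Lemma H2_close_le u U d e : d <= e -> H2_close u U d -> H2_close u U e.
Proof.
move=> de [n0 n1 nxx nyx nyy]; split=> [s|s v av|s|s|s].
- exact: le_trans (n0 s) de.
- exact: le_trans (n1 s v av) de.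
- exact: le_trans (nxx s) de.
- exact: le_trans (nyx s) de.
- exact: le_trans (nyy s) de.
Qed.

Lemma wderiv_sub_Tsub s v (f : plane -> R) g : axis v -> L2 (A s) f -> has_wD (A s) v f -> Ck 1 g ->
  wderiv (A s) v (fun X => f X - g X) (fun X => wD (A s) v f X - 'D_v g X).
Proof.
move=> av fL fw cg; apply: wderivB => //.
- exact: (measurable_Tsub T sh).
- by apply: (L2_continuous_Tsub T sh); exact: Ck_continuous cg.
- exact: wderiv_wD.
- exact: (wderiv_Tsub T sh).
Qed.

(** The density hypothesis speaks of the chosen weak derivatives of [u - w]. By uniqueness they
    equal almost everywhere those of [u] minus the classical ones of [U]; for second derivatives
    this is applied twice. *)
Lemma density_close u w U e : (forall s, H2 (A s) u) -> (forall s, Ck 2 (U s)) ->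
  (forall s X, closure (A s) X -> w X = U s X) ->
  pnorm2 ft P T (fun=> (fun X => u X - w X)) < e -> H2_close u U e.
Proof.
move=> uH cU wU ue; pose z X := u X - w X.
have ne s : H2norm (A s) z <= e.
  apply: le_trans (ltW ue); rewrite /pnorm2 -[X in X <= _]ger0_norm ?sqrtr_ge0// -sqrtr_sqr ler_wsqrtr//.
  by rewrite (bigD1 s)//= lerDl sumr_ge0// => b _; exact: sqr_ge0.
have mA s : measurable (A s) := measurable_Tsub T sh s.
have zE s X : A s X -> u X - U s X = z X by move=> /subset_closure sX; rewrite /z (wU s).
have d1 s v : axis v -> wderiv (A s) v z (fun X => wD (A s) v u X - 'D_v (U s) X).
  move=> av; apply: (eq_wderiv (zE s)); apply: wderiv_sub_Tsub => //.
  - by case: (uH s) => -[].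
  - by case: (uH s) => -[_ hx hy] _ _; case: av => ->; [exact: hx|exact: hy].
  - by apply: (@Ck_pred _ 1).
have ae1 s v : axis v -> {ae leb2, forall X, A s X -> wD (A s) v u X - 'D_v (U s) X = wD (A s) v z X}.
  move=> av; have := wD_ae (mA s) (Tsub_null T sh s) (d1 s v av).
  by apply: (@filterS _ _ (ae_filter_ringOfSetsType leb2)) => X HX sX; rewrite HX.
have zL s v : axis v -> L2 (A s) (wD (A s) v z).
  by move=> av; have [] := wderiv_wD (wderiv_has (d1 s v av)).
have d2 s v v' : axis v -> axis v' -> H1 (A s) (wD (A s) v u) ->
    wderiv (A s) v' (wD (A s) v z) (fun X => wD (A s) v' (wD (A s) v u) X - 'D_v' ('D_v (U s)) X).
  move=> av av' [vL hx hy].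
  apply: (wderiv_ae (mA s) av' _ _ (ae1 s v av)).
  - apply: L2B => //; apply: (L2_continuous_Tsub T sh).
    by apply: (@Ck_continuous _ 1); apply: Ck_derive_axis.
  - exact: zL.
  - have c1 : Ck 1 ('D_v (U s)) := Ck_derive_axis av (cU s).
    have hv : has_wD (A s) v' (wD (A s) v u) by case: av' => ->; [exact: hx|exact: hy].
    exact: (wderiv_sub_Tsub av' vL hv c1).
split=> s.
- by rewrite (eq_L2norm (zE s)); apply: le_trans (ne s); have [] := H2norm_ge (A s) z.
- move=> v av; rewrite -(L2norm_wD (mA s) (Tsub_null T sh s) (d1 s v av)).
  by apply: le_trans (ne s); have [_ hx hy _] := H2norm_ge (A s) z; case: av => ->; [exact: hx|exact: hy].
all: have [_ hx hy] := uH s; have [_ _ _ [nxx nyx nyy]] := H2norm_ge (A s) z.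
- rewrite -(L2norm_wD (mA s) (Tsub_null T sh s) (d2 s ex ex (or_introl erefl) (or_introl erefl) hx)).
  exact: le_trans (ne s).
- rewrite -(L2norm_wD (mA s) (Tsub_null T sh s) (d2 s ex ey (or_introl erefl) (or_intror erefl) hx)).
  exact: le_trans (ne s).
- rewrite -(L2norm_wD (mA s) (Tsub_null T sh s) (d2 s ey ey (or_intror erefl) (or_intror erefl) hy)).
  exact: le_trans (ne s).
Qed.

Definition patch_at i (e : R) : set plane := ball (nodeP (ft := ft) P T i) e `&` eint ft h T.

Lemma patch_at_open i e : open (patch_at i e).
Proof. by apply: openI; [exact: ball_open|exact: open_eint]. Qed.

Lemma patch_at_nonempty i e : 0 < e -> patch_at i e !=set0.
Proof.
move=> e0; have nn : nbhs (nodeP P T i) (ball (nodeP P T i) e) by exact: nbhsx_ballx.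
have [t /andP[t0 t1] b1] := near1 (ecentre ft h T) ltr01 nn.
exists (seg_pt (ecentre ft h T) (nodeP P T i) t); split=> //.
by apply: eint_seg => //; [exact: ecentre_eint|exact: nodeP_eset|rewrite t1 ltW].
Qed.

Lemma patch_at_seg i e X Y t : patch_at i e X -> patch_at i e Y -> 0 <= t <= 1 -> patch_at i e (seg_pt X Y t).
Proof.
move=> [bX eX] [bY eY] tb; split; first exact: ball_seg.
have [->|t1] := eqVneq t 1; first by rewrite seg_pt1.
by apply: eint_seg => //; [exact: (eint_eset h0)|case/andP: tb => -> tl; rewrite lt_neqAle t1].
Qed.

Lemma patch_at_L2 i e f : continuous f -> L2 (patch_at i e) f.
Proof.
move=> cf; have [N _ HN] := element_box T sh.
apply: (continuous_L2 (N := N)) cf _; first by apply: open_measurable2; exact: patch_at_open.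
by move=> X [_ /(eint_eset h0)/HN].
Qed.

(** Both approximations are within [d] of [u], so every derivative of their difference has L^2 norm
    at most [2 d] on the patch, and the point bound applies to this smooth function. *)
Lemma difference_bound i e U U' d u : (forall s, H2 (A s) u) ->
  (forall s, Ck 2 (U s)) -> (forall s, Ck 2 (U' s)) ->
  H2_close u U d -> H2_close u U' d -> patch_at i e `<=` A (nside P T i) ->
  forall M, patch_at i e M ->
  `|U' (nside P T i) M - U (nside P T i) M| * L2norm (patch_at i e) (cst 1) <= 2 * (1 + 2 * h + 6 * h ^+ 2) * d.
Proof.
move=> uH cU cU' cl cl' sub M QM; set s := nside P T i in sub *; set Q := patch_at i e in QM sub *.
have mA : measurable (A s) := measurable_Tsub T sh s.
have mQ : measurable Q by apply: open_measurable2; exact: patch_at_open.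
have [B B0 hB] := hess_bounded T sh cU; have [B' B0' hB'] := hess_bounded T sh cU'.
pose z X := U' s X - U s X.
have cz : Ck 2 z by exact: CkB.
have [Bz Bz0 hz] := hess_bounded T sh (fun _ : bool => cz).
have xE v : axis v -> 'D_v z = fun X => 'D_v (U' s) X - 'D_v (U s) X.
  by move=> av; exact: (derive_axisB av (cU' s) (cU s)).
have xxE v w : axis v -> axis w -> 'D_v ('D_w z) = fun X => 'D_v ('D_w (U' s)) X - 'D_v ('D_w (U s)) X.
  move=> av aw; rewrite (xE w aw).
  exact: (derive_axisB av (Ck_derive_axis aw (cU' s)) (Ck_derive_axis aw (cU s))).
have Qn f g g' k : L2 (A s) g -> L2 (A s) g' -> L2 (A s) k -> (forall X, f X = g' X - g X) ->
    L2norm (A s) (fun X => k X - g X) <= d -> L2norm (A s) (fun X => k X - g' X) <= d ->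
    L2norm Q f <= 2 * d.
  move=> gL gL' kL fE n1 n2.
  have fE' X : Q X -> f X = (k X - g X) - (k X - g' X) by move=> _; rewrite fE; ring.
  rewrite (eq_L2norm fE').
  have L1 := L2B kL gL; have L2' := L2B kL gL'.
  have [_ n3] := L2norm_subset mQ mA sub (L2B L1 L2').
  apply: le_trans n3 _; apply: le_trans (L2normB L1 L2') _; lra.
have ax : axis (ex : plane) by left.
have ay : axis (ey : plane) by right.
have cL (f : plane -> R) : continuous f -> L2 (A s) f by exact: (L2_continuous_Tsub T sh).
have c1 (v : plane) (f : plane -> R) : axis v -> Ck 2 f -> continuous ('D_v f).
  by move=> av cf; apply: (@Ck_continuous _ 1); apply: Ck_derive_axis.
have [[uL hux huy] [uxL uxx uxy] [uyL uyx uyy]] := uH s.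
have wL v f : has_wD (A s) v f -> L2 (A s) (wD (A s) v f) by move=> /wderiv_wD [].
have n0 : L2norm Q z <= 2 * d.
  by apply: (Qn _ (U s) (U' s) u) => //; [apply: cL; exact: Ck_continuous (cU s)|
    apply: cL; exact: Ck_continuous (cU' s)|exact: (close_0 cl)|exact: (close_0 cl')].
have nx v : axis v -> L2norm Q ('D_v z) <= 2 * d.
  move=> av; apply: (Qn _ ('D_v (U s)) ('D_v (U' s)) (wD (A s) v u)).
  - exact: (cL _ (c1 _ _ av (cU s))).
  - exact: (cL _ (c1 _ _ av (cU' s))).
  - by apply: wL; case: av => ->; [exact: hux|exact: huy].
  - by move=> X; exact: (congr1 (fun f => f X) (xE v av)).
  - exact: (close_1 cl).
  - exact: (close_1 cl').
have nxx : L2norm Q ('D_ex ('D_ex z)) <= 2 * d.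
  apply: (Qn _ ('D_ex ('D_ex (U s))) ('D_ex ('D_ex (U' s))) (wD (A s) ex (wD (A s) ex u))).
  - exact: (cL _ (Ck2_D ax ax (cU s))).
  - exact: (cL _ (Ck2_D ax ax (cU' s))).
  - exact: wL.
  - by move=> X; exact: (congr1 (fun f => f X) (xxE _ _ ax ax)).
  - exact: (close_xx cl).
  - exact: (close_xx cl').
have nyx : L2norm Q ('D_ey ('D_ex z)) <= 2 * d.
  apply: (Qn _ ('D_ey ('D_ex (U s))) ('D_ey ('D_ex (U' s))) (wD (A s) ey (wD (A s) ex u))).
  - exact: (cL _ (Ck2_D ay ax (cU s))).
  - exact: (cL _ (Ck2_D ay ax (cU' s))).
  - exact: wL.
  - by move=> X; exact: (congr1 (fun f => f X) (xxE _ _ ay ax)).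
  - exact: (close_yx cl).
  - exact: (close_yx cl').
have nyy : L2norm Q ('D_ey ('D_ey z)) <= 2 * d.
  apply: (Qn _ ('D_ey ('D_ey (U s))) ('D_ey ('D_ey (U' s))) (wD (A s) ey (wD (A s) ey u))).
  - exact: (cL _ (Ck2_D ay ay (cU s))).
  - exact: (cL _ (Ck2_D ay ay (cU' s))).
  - exact: wL.
  - by move=> X; exact: (congr1 (fun f => f X) (xxE _ _ ay ay)).
  - exact: (close_yy cl).
  - exact: (close_yy cl').
have QL f : continuous f -> L2 Q f by exact: patch_at_L2.
have nh : L2norm Q (hess_norm z) <= 6 * d.
  have [_ n3] := L2_abs3 mQ (QL _ (Ck2_D ax ax cz)) (QL _ (Ck2_D ay ax cz)) (QL _ (Ck2_D ay ay cz)).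
  apply: le_trans n3 _; have -> : 6 * d = 2 * d + 2 * d + 2 * d by ring.
  exact: (lerD (lerD nxx nyx) nyy).
apply: le_trans (point_bound mQ (@patch_at_seg i e) _ (ltW h0) cz Bz0 _ QL QM) _.
- move=> X Y [_ eX] [_ eY]; exact: (eset_diam h0 (eint_eset h0 eX) (eint_eset h0 eY)).
- by move=> X [_ eX]; apply: (hz X (eint_eset h0 eX) true).
have e1 : h * (L2norm Q ('D_ex z) + L2norm Q ('D_ey z)) <= h * (4 * d).
  rewrite ler_pM2l//; have -> : 4 * d = 2 * d + 2 * d by ring.
  exact: (lerD (nx _ ax) (nx _ ay)).
have e2 : 2 * h ^+ 2 * L2norm Q (hess_norm z) <= 2 * h ^+ 2 * (6 * d).
  by apply: ler_wpM2l nh; rewrite mulr_ge0// sqr_ge0.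
have -> : 2 * (1 + 2 * h + 6 * h ^+ 2) * d = 2 * d + h * (4 * d) + 2 * h ^+ 2 * (6 * d) by ring.
exact: (lerD (lerD n0 e1) e2).
Qed.

(** Only continuity of [u] at the node is available pointwise. If [U] missed the nodal value by more
    than [K e], a second and much better approximation [U'], close to [U] pointwise on the fixed
    patch, would stay away from [u] on a small patch around the node, against its L^2 error. The
    constant [K] depends on the fixed patch only. *)
Lemma nodal_close u (i : 'I_(nv ft)) : PH2_int ft P T u -> exists2 K, 0 < K & forall U e, (forall s, Ck 2 (U s)) ->
  0 < e -> H2_close u U e -> `|u (nodeP P T i) - U (nside P T i) (nodeP P T i)| <= K * e.
Proof.
move=> uP; have [uH uc _ _] := uP; set M := nodeP P T i; set s := nside P T i.
have [e0 e00 He0] := nsideP sh iT nob i.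
have sub e : e <= e0 -> patch_at i e `<=` A s.
  move=> ee X [bX eX]; split; first exact: (eint_eset h0 eX).
  by apply: He0 => //; exact: le_ball bX.
set c1 := L2norm (patch_at i e0) (cst 1).
have c10 : 0 < c1.
  apply: L2norm1_gt0; [exact: patch_at_open|exact: patch_at_nonempty|].
  by apply: patch_at_L2 => X; exact: cvg_cst.
have p0 : 0 < 2 * (1 + 2 * h + 6 * h ^+ 2).
  by have := sqr_ge0 h; have := h0; lra.
exists (2 * (1 + 2 * h + 6 * h ^+ 2) / c1); first exact: divr_gt0.
move=> U e cU ep cl; set K := _ / c1.
rewrite leNgt; apply/negP => lt.
set eta := `|u M - U s M| in lt; pose d0 := (eta - K * e) / 4.
have d00 : 0 < d0 by rewrite /d0 divr_gt0// subr_gt0.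
have MS : (Tset ft P T `\` [set ptD (local P T); ptE (local P T)]) M.
  split; first exact: nodeP_eset.
  have nG := node_notin_Gamma sh iT nob (i := i).
  have [gD _] := ptD_on (lok sh iT); have [gE _] := ptE_on (lok sh iT).
  by move=> [] E; apply: nG; rewrite -/M E.
have um : \forall X \near M, (Tset ft P T `\` [set ptD (local P T); ptE (local P T)]) X -> `|u M - u X| < d0.
  by have /cvgrPdist_lt/(_ _ d00) := (subspace_continuousP _ _).1 uc M MS.
have Um : \forall X \near M, `|U s M - U s X| < d0.
  by have cU0 : continuous (U s) := Ck_continuous (cU s); have /cvgrPdist_lt/(_ _ d00) := cU0 M.
have nn : nbhs M ([set X | (Tset ft P T `\` [set ptD (local P T); ptE (local P T)]) X -> `|u M - u X| < d0]
    `&` [set X | `|U s M - U s X| < d0]) by exact: (filterI um Um).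
move/nbhs_ballP: nn => [e2 /= e20 He2].
pose e1 := Num.min e0 e2.
have e10 : 0 < e1 by rewrite lt_min e00.
have c20 : 0 < L2norm (patch_at i e1) (cst 1).
  apply: L2norm1_gt0; [exact: patch_at_open|exact: patch_at_nonempty|].
  by apply: patch_at_L2 => X; exact: cvg_cst.
set c2 := L2norm _ _ in c20.
(* [c2] is the norm of 1 on the small patch, so a function that is at least [2 d0] there has norm
   larger than [d]. *)
pose d := Num.min e (d0 * c2).
have dp : 0 < d by rewrite lt_min ep mulr_gt0.
have [w [U' [cU' wU' _ _]] ud] := hyp_dense sh iT uP dp.
have cl' := density_close uH cU' wU' ud.
have de : d <= e by rewrite ge_min lexx.
have dd : d <= d0 * c2 by rewrite ge_min lexx orbT.
have cl2 : H2_close u U' e := H2_close_le de cl'.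
(* By the choice of [d0] the gap at the node is [K e + 4 d0]; the oscillations of [u] and [U] take
   [d0] each, and [U' - U] takes at most [K e]. *)
have key X : patch_at i e1 X -> 2 * d0 <= `|u X - U' s X|.
  move=> QX; have Q0 : patch_at i e0 X.
    by case: QX => bX eX; split => //; apply: le_ball bX; rewrite ge_min lexx.
  have zX : `|U' s X - U s X| <= K * e.
    by rewrite /K mulrAC ler_pdivlMr//; exact: (difference_bound uH cU cU' cl cl2 (sub e0 (lexx _)) Q0).
  have [bX eX] := QX.
  have bX2 : ball M e2 X by apply: le_ball bX; rewrite ge_min lexx orbT.
  have [Hu HU] := He2 X bX2.
  have XS : (Tset ft P T `\` [set ptD (local P T); ptE (local P T)]) X.
    split; first exact: (eint_eset h0 eX).
    have [_ [_ nD]] := ptD_on (lok sh iT); have [_ [_ nE]] := ptE_on (lok sh iT).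
    rewrite /ebd (interior_eset _ _ h0) in nD nE.
    by move=> [] E; [apply: nD|apply: nE]; rewrite -E.
  have Hu' : `|u M - u X| < d0 := Hu XS.
  have HU' : `|U s M - U s X| < d0 := HU.
  have t1 : eta <= `|u M - u X| + (`|u X - U' s X| + (`|U' s X - U s X| + `|U s M - U s X|)).
    rewrite /eta; have -> : u M - U s M = (u M - u X) + ((u X - U' s X) + ((U' s X - U s X) - (U s M - U s X))) by ring.
    apply: le_trans (ler_normD _ _) _; rewrite lerD2l.
    apply: le_trans (ler_normD _ _) _; rewrite lerD2l; exact: ler_normB.
  have e4 : eta = K * e + 4 * d0 by rewrite /d0; field.
  clear - t1 e4 Hu' HU' zX; move: t1 e4 Hu' HU' zX; clearbody eta d0; lra.
have mQ : measurable (patch_at i e1) by apply: open_measurable2; exact: patch_at_open.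
have mA : measurable (A s) := measurable_Tsub T sh s.
have L1 : L2 (A s) (fun X => u X - U' s X).
  apply: L2B; first by have [[]] := uH s.
  by apply: (L2_continuous_Tsub T sh); exact: Ck_continuous (cU' s).
have se : e1 <= e0 by rewrite ge_min lexx.
have [Lq nq] := L2norm_subset mQ mA (sub e1 se) L1.
have Lc : L2 (patch_at i e1) (cst 1) by apply: patch_at_L2 => X; exact: cvg_cst.
have : 2 * d0 * c2 <= d.
  apply: le_trans (le_trans nq (close_0 cl' s)).
  have d02 : 0 <= 2 * d0 by rewrite mulr_ge0// ltW.
  rewrite -[X in X * _](ger0_norm d02) /c2 -(L2normZ _ Lc).
  apply: L2norm_le => //; first exact: L2Z.
  by move=> X QX; rewrite mulr1 (ger0_norm d02); exact: key.
have := mulr_gt0 d00 c20; move: dd; lra.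
Qed.

End Density.

Section Polynomials.
Context {R : realType}.
Local Notation plane := (R * R)%type.

Lemma continuous_peval ft (p : shape_poly R) : continuous (peval ft p).
Proof.
have c1 : continuous (fun X : plane => X.1) by exact: continuous_fst.
have c2 : continuous (fun X : plane => X.2) by exact: continuous_snd.
move=> X; rewrite /peval; apply: cvgD; last first.
  apply: cvgM; first exact: cvg_cst.
  rewrite /quad_term; case: ft; first exact: cvg_cst.
  - by apply: cvgM; [exact: c1|exact: c2].
  - exact: cvg_cst.
  - by apply: cvgB; rewrite expr2; apply: cvgM; (exact: c1 || exact: c2).
apply: cvgD; first apply: cvgD; first exact: cvg_cst.
  by apply: cvgM; [exact: cvg_cst|exact: c1].
by apply: cvgM; [exact: cvg_cst|exact: c2].
Qed.

Lemma continuous_pgrad ft (p : shape_poly R) :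
  continuous (fun X => (pgrad ft p X).1) /\ continuous (fun X => (pgrad ft p X).2).
Proof.
have c1 : continuous (fun X : plane => X.1) by exact: continuous_fst.
have c2 : continuous (fun X : plane => X.2) by exact: continuous_snd.
have cst1 (c : R) : continuous (fun X : plane => c) by move=> X; exact: cvg_cst.
have lin (a b : R) f : continuous f -> continuous (fun X : plane => a + b * f X).
  move=> cf X; apply: cvgD; first exact: cvg_cst.
  by apply: cvgM; [exact: cvg_cst|exact: cf].
rewrite /pgrad; case: ft => /=; split; try exact: cst1; try exact: lin.
- apply: lin => X; apply: cvgM; [exact: cvg_cst|exact: c1].
- under eq_fun do rewrite -mulrN; apply: lin => X; apply: cvgN; apply: cvgM; [exact: cvg_cst|exact: c2].
Qed.

Lemma Ck1_peval ft (p : shape_poly R) : Ck 1 (peval ft p).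
Proof.
have E1 : (fun X => 'D_ex (peval ft p) X) = fun X => (pgrad ft p X).1.
  by apply/funext => X; rewrite -grad_peval.
have E2 : (fun X => 'D_ey (peval ft p) X) = fun X => (pgrad ft p X).2.
  by apply/funext => X; rewrite -grad_peval.
have [g1 g2] := continuous_pgrad ft p.
split; [exact: continuous_peval| |by rewrite E1|by rewrite E2].
by move=> X; have [[d1 _] [d2 _]] := peval_is_derive ft p X.
Qed.

End Polynomials.

Section Arithmetic.
Context {R : realType}.

Lemma sqrt_sum_sqr_le (a b : R) : 0 <= a -> 0 <= b -> Num.sqrt (a ^+ 2 + b ^+ 2) <= a + b.
Proof.
move=> a0 b0; rewrite -[X in _ <= X]ger0_norm ?addr_ge0// -sqrtr_sqr ler_wsqrtr//.
by rewrite sqrrD -addrA [_ *+ 2 + _]addrC addrA lerDl mulrn_wge0// mulr_ge0.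
Qed.

Lemma sqrt_sum2_ge (a b : R) (z := Num.sqrt (a ^+ 2 + b ^+ 2)) : 0 <= a -> 0 <= b -> a <= z /\ b <= z.
Proof.
have aux (x y : R) : 0 <= x -> 0 <= y -> x <= Num.sqrt (x ^+ 2 + y ^+ 2).
  by move=> x0 y0; rewrite -[X in X <= _](ger0_norm x0) -sqrtr_sqr ler_wsqrtr// lerDl sqr_ge0.
by move=> a0 b0; rewrite /z; split; [exact: aux|rewrite addrC; exact: aux].
Qed.

Lemma sqrt_sum3_ge (a b d : R) (z := Num.sqrt (a ^+ 2 + b ^+ 2 + d ^+ 2)) :
  0 <= a -> 0 <= b -> 0 <= d -> [/\ a <= z, b <= z & d <= z].
Proof.
have aux (x y : R) : 0 <= x -> x ^+ 2 <= y -> x <= Num.sqrt y.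
  by move=> x0 xy; rewrite -(ger0_norm x0) -sqrtr_sqr ler_wsqrtr.
have a2 := sqr_ge0 a; have b2 := sqr_ge0 b; have d2 := sqr_ge0 d.
by move=> a0 b0 d0; rewrite /z; split; apply: aux => //; lra.
Qed.

Lemma sqrt_sum_bool_ge (f : bool -> R) b : 0 <= f b -> f b <= Num.sqrt (\sum_s f s ^+ 2).
Proof.
move=> f0; rewrite -[X in X <= _](ger0_norm f0) -sqrtr_sqr ler_wsqrtr//.
by rewrite (bigD1 b)//= lerDl sumr_ge0// => s _; exact: sqr_ge0.
Qed.

Lemma sqrt_sum_bool_le (f : bool -> R) : (forall s, 0 <= f s) -> Num.sqrt (\sum_s f s ^+ 2) <= f false + f true.
Proof. by move=> f0; rewrite big_bool /= addrC; exact: sqrt_sum_sqr_le. Qed.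

(** [Z] gathers the coefficients of everything that vanishes with the approximation error [e]; the
    remaining constant is [3312 = 3 * 184 * 6]. *)
Lemma collect_bounds (la m k n1 h K e g p1 p2 s1 st sf ht hf gs S N : R)
    (c := 5200 / la)
    (Z := c * (K * n1) * 3 + 3 * (c * (184 * m * (h ^+ 2 * (6 + k * 2)))) + g * (1 + 2 * h)) :
  0 <= c -> 1 <= m -> 0 <= k -> 0 <= n1 -> s1 <= p1 -> st <= p2 -> sf <= p2 ->
  ht <= 3 * (st + e) -> hf <= 3 * (sf + e) -> gs <= 2 * (s1 + e) -> S <= K * e ->
  N <= S * n1 + 184 * m * (h ^+ 2 * (ht + hf + k * gs)) -> 0 <= p1 -> 0 <= p2 ->
  3 * (c * N) + g * (1 + 2 * h) * e <=
    Z * e + 3312 * (5200 / la) * m * (1 + k) * h ^+ 2 * (p1 + p2).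
Proof.
move=> c0 m1 k0 n10 l1 lt lf Ht Hf Gs HS HN p10 p20.
have m0 : 0 <= m by apply: le_trans m1; exact: ler01.
have nn n : 0 <= n%:R :> R by exact: ler0n.
have kg : k * gs <= k * (2 * (p1 + e)).
  by apply: ler_wpM2l => //; move: Gs l1; lra_goal.
have q : ht + hf + k * gs <= 6 * (p2 + e) + k * (2 * (p1 + e)).
  by move: Ht Hf lt lf kg; lra_goal.
have mh : 0 <= 184 * m * h ^+ 2 := mulr_ge0 (mulr_ge0 (nn 184) m0) (sqr_ge0 h).
have q1 : 184 * m * (h ^+ 2 * (ht + hf + k * gs)) <= 184 * m * h ^+ 2 * (6 * (p2 + e) + k * (2 * (p1 + e))).
  by rewrite mulrA; exact: ler_wpM2l.
have q2 : S * n1 <= K * e * n1 by exact: ler_wpM2r.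
have q3 : c * N <= c * (K * e * n1 + 184 * m * h ^+ 2 * (6 * (p2 + e) + k * (2 * (p1 + e)))).
  by apply: ler_wpM2l => //; apply: le_trans HN _; exact: lerD.
have q4 : 6 * p2 + 2 * (k * p1) <= 6 * ((1 + k) * (p1 + p2)).
  by move: (p10) (mulr_ge0 k0 p10) (mulr_ge0 k0 p20); lra_goal.
have q5 : c * (184 * m * h ^+ 2 * (6 * p2 + 2 * (k * p1))) <= c * (184 * m * h ^+ 2 * (6 * ((1 + k) * (p1 + p2)))).
  by apply: ler_wpM2l => //; exact: ler_wpM2l.
have -> : 3312 * (5200 / la) * m * (1 + k) * h ^+ 2 * (p1 + p2) =
    3 * (c * (184 * m * h ^+ 2 * (6 * ((1 + k) * (p1 + p2))))).
  by rewrite -/c /Z; clearbody c; clear; ring.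
apply: (@le_trans _ _ (3 * (c * (K * e * n1 + 184 * m * h ^+ 2 * (6 * (p2 + e) + k * (2 * (p1 + e))))) + g * (1 + 2 * h) * e)).
  by rewrite lerD2r ler_pM2l// ltr0n.
rewrite [leLHS](_ : _ = Z * e + 3 * (c * (184 * m * h ^+ 2 * (6 * p2 + 2 * (k * p1))))).
  by rewrite lerD2l ler_pM2l// ltr0n.
by rewrite /Z; clearbody c; clear; ring.
Qed.

Lemma collect_coef_gt0 (c m k n1 h K g : R) : 0 <= c -> 0 <= m -> 0 <= k -> 0 <= n1 -> 0 < h -> 0 <= K -> 0 < g ->
  0 < c * (K * n1) * 3 + 3 * (c * (184 * m * (h ^+ 2 * (6 + k * 2)))) + g * (1 + 2 * h).
Proof.
move=> c0 m0 k0 n0 hp K0 g0.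
have nn n : 0 <= n%:R :> R by exact: ler0n.
have t1 : 0 <= c * (K * n1) * 3 by apply: mulr_ge0 (nn 3) => //; apply: mulr_ge0 => //; exact: mulr_ge0.
have t2 : 0 <= h ^+ 2 * (6 + k * 2) by apply: mulr_ge0 (sqr_ge0 h) _; apply: addr_ge0 (nn 6) (mulr_ge0 k0 (nn 2)).
have t3 : 0 <= 3 * (c * (184 * m * (h ^+ 2 * (6 + k * 2)))).
  by apply: mulr_ge0 (nn 3) (mulr_ge0 c0 (mulr_ge0 (mulr_ge0 (nn 184) m0) t2)).
apply: ltr_wpDl (addr_ge0 t1 t3) _; apply: mulr_gt0 => //.
by apply: addr_gt0 ltr01 (mulr_gt0 _ hp); rewrite ltr0n.
Qed.

Lemma combine_bounds (g h e N a0 a1 a2 b0 b1 b2 S : R) : 0 < g -> 0 < h ->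
  a0 <= b0 + e -> S <= a1 + a2 -> g * b0 <= N -> g * (h * b2) <= N -> g * (h * b1) <= N ->
  a2 <= b2 + e -> a1 <= b1 + e -> g * (a0 + h * S) <= 3 * N + g * (1 + 2 * h) * e.
Proof.
move=> g0 hp H0 HS n0 n2 n1 H2 H1.
have h1 : h * S <= h * (b1 + b2 + 2 * e) by rewrite ler_pM2l//; lra.
have h2 : g * (a0 + h * S) <= g * (b0 + e + h * (b1 + b2 + 2 * e)).
  by rewrite ler_pM2l//; apply: lerD.
by apply: le_trans h2 _; lra.
Qed.

End Arithmetic.

(** * The estimate on each side *)

Section FinalEstimate.
Context {R : realType}.
Local Notation plane := (R * R)%type.
Local Notation mR := (measurableTypeR R).
Local Notation mplane := (mR * mR)%type.
Local Notation leb := (@lebesgue_measure R).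
Local Notation leb2 := (leb \x leb)%E.
Variables (ft : fe_type) (P : interface_problem R) (T : element R) (eps kbar la : R).
Hypothesis (sh : standing_hypotheses ft P) (iT : interface_element ft P T).
Hypothesis (epsb : 0 < eps < Num.sqrt 2 / 2) (kb : 0 < kbar <= 1) (lab : 0 < la < 1).
Hypothesis (uc : unisolvence_conditions ft P eps kbar la).
Hypothesis (nob : forall X, ~ obscure ft P T X).
Variable (phi : 'I_(nv ft) -> bool -> shape_poly R).
Hypothesis (shape : IFE_shape_functions P T phi).
Let h := mesh_size P.
Let h0 : 0 < h := mesh_size_gt0 sh.
Let A := Tsub ft P T.
Let c := 5200 / la.
Let c0 : 0 <= c.
Proof. have /andP[l0 _] := lab; apply: divr_ge0; [exact: ler0n|exact: ltW]. Qed.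

Definition nodal_poly (u : plane -> R) s : shape_poly R :=
  psum (fun i => u (nodeP P T i)) (fun i => phi i s).

Lemma interpolationE u s X : interpolation P T phi u s X = peval ft (nodal_poly u s) X.
Proof. by rewrite /interpolation peval_psum. Qed.

Lemma L2_of_pointwise (g a : R) (f D : plane -> R) s : 0 <= g -> 0 <= a ->
  L2 (A s) f -> L2 (A s) D -> (forall X, eint ft h T X -> Omega_ P s X -> g * `|f X| <= a * D X) ->
  g * L2norm (A s) f <= a * L2norm (A s) D.
Proof.
move=> g0 a0 fL DL fD.
rewrite -[X in X * _ <= _](ger0_norm g0) -(L2normZ _ fL) -[X in _ <= X * _](ger0_norm a0) -(L2normZ _ DL).
apply: L2norm_le_ae; [exact: (measurable_Tsub T sh)|exact: L2Z|exact: L2Z|].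
apply: (@filterS _ _ (ae_filter_ringOfSetsType leb2) _ _ _ (ae_eint T sh s)) => X HX sX.
rewrite normrM (ger0_norm g0); apply: le_trans (fD X (HX sX) _) (ler_norm _).
by case: sX.
Qed.

Lemma side_error_smooth u U s
    (N := c * L2norm (A s) (defect_bound P T U (fun i : 'I_(nv ft) => u (nodeP P T i)) s)) :
  (forall s, Ck 2 (U s)) ->
  (forall X, (Gamma P `&` Tset ft P T) X -> U true X = U false X) ->
  (forall X, (Gamma P `&` Tset ft P T) X ->
     beta P true * dot (grad (U true) X) (normal (local P T) X)
       = beta P false * dot (grad (U false) X) (normal (local P T) X)) ->
  side_gain ft P s * L2norm (A s) (fun X => peval ft (nodal_poly u s) X - U s X) <= N /\
  forall v, axis v ->
  side_gain ft P s * (h * L2norm (A s) (fun X => 'D_v (peval ft (nodal_poly u s)) X - 'D_v (U s) X)) <= N.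
Proof.
move=> cU jU fU; have [B B0 hB] := hess_bounded T sh cU.
set q := fun i => _ in N *; have [DL _] := defect_bound_L2 T sh q s cU.
have IE X := @interpolation_error _ _ _ _ _ _ _ sh iT epsb kb lab uc nob phi shape U B cU jU fU B0 hB q s X.
have g0 : 0 <= side_gain ft P s by rewrite ltW// (IFE_gain_gt0 sh).
have pL (f g : plane -> R) : continuous f -> continuous g -> L2 (A s) (fun X => f X - g X).
  by move=> cf cg; apply: L2B; apply: (L2_continuous_Tsub T sh).
split.
  apply: L2_of_pointwise => //.
    by apply: pL; [exact: continuous_peval|exact: Ck_continuous (cU s)].
  by move=> X eX sX; rewrite /nodal_poly peval_psum; have [] := IE X eX sX.
move=> v av; rewrite mulrA; apply: L2_of_pointwise => //.
- by rewrite mulr_ge0// ltW.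
- apply: pL; first exact: (@Ck_continuous _ 0 _ (Ck_derive_axis av (Ck1_peval ft (nodal_poly u s)))).
  exact: (Ck_continuous (Ck_derive_axis av (cU s))).
move=> X eX sX; rewrite -mulrA; have [_ H1 H2] := IE X eX sX.
have := grad_peval ft (nodal_poly u s) X; rewrite /grad => E.
have E1 : 'D_ex (peval ft (nodal_poly u s)) X = (pgrad ft (nodal_poly u s) X).1 by rewrite -E.
have E2 : 'D_ey (peval ft (nodal_poly u s)) X = (pgrad ft (nodal_poly u s) X).2 by rewrite -E.
by case: av => ->; [rewrite E1; exact: H1|rewrite E2; exact: H2].
Qed.

Lemma side_error_close u U e s : PH2_int ft P T u -> (forall s, Ck 2 (U s)) -> H2_close ft P T u U e ->
  let err := fun X => interpolation P T phi u s X - u X in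
  let N := c * L2norm (A s) (defect_bound P T U (fun i : 'I_(nv ft) => u (nodeP P T i)) s) in
  side_gain ft P s * L2norm (A s) (fun X => peval ft (nodal_poly u s) X - U s X) <= N ->
  (forall v, axis v ->
    side_gain ft P s * (h * L2norm (A s) (fun X => 'D_v (peval ft (nodal_poly u s)) X - 'D_v (U s) X)) <= N) ->
  side_gain ft P s * (L2norm (A s) err + h * semi1 (A s) err) <= 3 * N + side_gain ft P s * (1 + 2 * h) * e.
Proof.
move=> uP cU cl err N n0 n1.
have [uH _ _ _] := uP; have [[uL ux uy] _ _] := uH s.
have g0 : 0 < side_gain ft P s := IFE_gain_gt0 sh s.
have mA : measurable (A s) := measurable_Tsub T sh s.
have cL (f : plane -> R) : continuous f -> L2 (A s) f by exact: (L2_continuous_Tsub T sh).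
set p := peval ft (nodal_poly u s) in n0 n1.
have cp : Ck 1 p := Ck1_peval ft (nodal_poly u s).
have pL : L2 (A s) p := cL _ (Ck_continuous cp).
have UL : L2 (A s) (U s) := cL _ (Ck_continuous (cU s)).
have errE : err = fun X => (p X - U s X) - (u X - U s X).
  by apply/funext => X; rewrite /err interpolationE -/p; ring.
have e0 : L2norm (A s) err <= L2norm (A s) (fun X => p X - U s X) + e.
  rewrite errE; apply: le_trans (L2normB (L2B pL UL) (L2B uL UL)) _.
  by rewrite lerD2l; exact: (close_0 cl).
have e1 v : axis v -> L2norm (A s) (wD (A s) v err) <=
    L2norm (A s) (fun X => 'D_v p X - 'D_v (U s) X) + e.
  move=> av.
  have uw : wderiv (A s) v u (wD (A s) v u) by apply: wderiv_wD; case: av => ->; [exact: ux|exact: uy].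
  have pw : wderiv (A s) v p ('D_v p) := wderiv_Tsub T sh s av cp.
  have ew : wderiv (A s) v err (fun X => 'D_v p X - wD (A s) v u X).
    apply: eq_wderiv (wderivB mA av pL uL pw uw) => X _.
    by rewrite /err interpolationE.
  rewrite (L2norm_wD mA (Tsub_null T sh s) ew).
  have DL : L2 (A s) ('D_v (U s)) := cL _ (Ck_continuous (Ck_derive_axis av (cU s))).
  have [DpL _] := pw; have [DuL _] := uw.
  have -> : (fun X => 'D_v p X - wD (A s) v u X) =
      fun X => ('D_v p X - 'D_v (U s) X) - (wD (A s) v u X - 'D_v (U s) X).
    by apply/funext => X; ring.
  apply: le_trans (L2normB (L2B DpL DL) (L2B DuL DL)) _.
  by rewrite lerD2l; exact: (close_1 cl).
have ax : axis (ex : plane) by left.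
have ay : axis (ey : plane) by right.
have s1 : semi1 (A s) err <= L2norm (A s) (wD (A s) ex err) + L2norm (A s) (wD (A s) ey err).
  exact: (sqrt_sum_sqr_le (L2norm_ge0 _ _) (L2norm_ge0 _ _)).
exact: (combine_bounds g0 h0 e0 s1 n0 (n1 ey ay) (n1 ex ax) (e1 ey ay) (e1 ex ax)).
Qed.

Lemma hessN_close u U e s : PH2_int ft P T u -> (forall s, Ck 2 (U s)) -> H2_close ft P T u U e ->
  hessN ft P T U s <= 3 * (semi2 (A s) u + e) /\ gradN ft P T (U s) s <= 2 * (semi1 (A s) u + e).
Proof.
move=> uP cU cl.
have [uH _ _ _] := uP; have [[uL ux uy] [uxL uxx uyx] [uyL uxy uyy]] := uH s.
have ax : axis (ex : plane) by left.
have ay : axis (ey : plane) by right.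
have cL (f : plane -> R) : continuous f -> L2 (A s) f by exact: (L2_continuous_Tsub T sh).
have aux (f g : plane -> R) (S : R) : L2 (A s) f -> L2 (A s) g -> L2norm (A s) (fun X => g X - f X) <= e ->
    L2norm (A s) g <= S -> L2norm (A s) f <= S + e.
  move=> fL gL gf gS; have -> : f = fun X => g X - (g X - f X) by apply/funext => X; ring.
  by apply: le_trans (L2normB gL (L2B gL fL)) _; exact: lerD.
have wL v f : has_wD (A s) v f -> L2 (A s) (wD (A s) v f) by move=> /wderiv_wD [].
have [sxx syx syy] := sqrt_sum3_ge (L2norm_ge0 (A s) (wD (A s) ex (wD (A s) ex u)))
  (L2norm_ge0 (A s) (wD (A s) ey (wD (A s) ex u))) (L2norm_ge0 (A s) (wD (A s) ey (wD (A s) ey u))).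
have [sx sy] := sqrt_sum2_ge (L2norm_ge0 (A s) (wD (A s) ex u)) (L2norm_ge0 (A s) (wD (A s) ey u)).
have Dx : L2 (A s) ('D_ex (U s)) := cL _ (Ck_continuous (Ck_derive_axis ax (cU s))).
have Dy : L2 (A s) ('D_ey (U s)) := cL _ (Ck_continuous (Ck_derive_axis ay (cU s))).
have Dxx := cL _ (Ck2_D ax ax (cU s)); have Dyx := cL _ (Ck2_D ay ax (cU s)).
have Dyy := cL _ (Ck2_D ay ay (cU s)).
split; last first.
  have -> : 2 * (semi1 (A s) u + e) = (semi1 (A s) u + e) + (semi1 (A s) u + e) by ring.
  exact: (lerD (aux _ _ _ Dx uxL (close_1 cl s ax) sx) (aux _ _ _ Dy uyL (close_1 cl s ay) sy)).
have -> : 3 * (semi2 (A s) u + e) = (semi2 (A s) u + e) + (semi2 (A s) u + e) + (semi2 (A s) u + e) by ring.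
exact: (lerD (lerD (aux _ _ _ Dxx (wL _ _ uxx) (close_xx cl s) sxx)
  (aux _ _ _ Dyx (wL _ _ uyx) (close_yx cl s) syx)) (aux _ _ _ Dyy (wL _ _ uyy) (close_yy cl s) syy)).
Qed.

(** The estimate is shown up to an arbitrary [d > 0]: approximating [u] to within [e = d / Z] makes
    all terms caused by the approximation add up to [d]. *)
Lemma side_error_bound u s (err := fun X => interpolation P T phi u s X - u X) : PH2_int ft P T u ->
  side_gain ft P s * (L2norm (A s) err + h * semi1 (A s) err) <=
    3312 * (5200 / la) * side_mult P s * (1 + kappa P) * h ^+ 2
      * (psemi1 ft P T (fun=> u) + psemi2 ft P T (fun=> u)).
Proof.
move=> uP; have [K [K0 HK]] : exists K, 0 <= K /\ forall U e, (forall s, Ck 2 (U s)) ->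
    0 < e -> H2_close ft P T u U e ->
    \sum_i `|u (nodeP (ft := ft) P T i) - U (nside P T i) (nodeP P T i)| <= K * e.
  pose Kf i := projT1 (cid2 (nodal_close sh iT nob i uP)).
  have KP i := projT2 (cid2 (nodal_close sh iT nob i uP)).
  exists (\sum_i Kf i); split; first by apply: sumr_ge0 => i _; case: (KP i) => /ltW.
  move=> U e cU ep cl; rewrite mulr_suml; apply: ler_sum => i _.
  by have [_] := KP i; apply.
have k0 : 0 <= kappa P := kappa_ge0 (hyp_curvature sh).
have m1 := side_mult_ge1 sh s; have g0 := IFE_gain_gt0 sh s.
set p1 := psemi1 _ _ _ _; set p2 := psemi2 _ _ _ _.
have [sp1 sp2] : (forall b, semi1 (A b) u <= p1) /\ (forall b, semi2 (A b) u <= p2).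
  by split=> b; apply: sqrt_sum_bool_ge; exact: sqrtr_ge0.
pose Z := c * (K * L2norm (A s) (cst 1)) * 3 + 3 * (c * (184 * side_mult P s * (h ^+ 2 * (6 + kappa P * 2))))
  + side_gain ft P s * (1 + 2 * h).
have n1 : 0 <= L2norm (A s) (cst 1) := L2norm_ge0 _ _.
have Z0 : 0 < Z by exact: (collect_coef_gt0 c0 (le_trans ler01 m1) k0 n1 h0 K0 g0).
apply/ler_addgt0Pl => d dp.
have [w [U [cU wU jU fU]] ud] := hyp_dense sh iT uP (divr_gt0 dp Z0).
have [uH _ _ _] := uP.
have cl := density_close sh uH cU wU ud.
set e := d / Z in cl ud; have ep : 0 < e := divr_gt0 dp Z0.
have [ns nv] := side_error_smooth u s cU jU fU.
apply: le_trans (side_error_close uP cU cl ns nv) _.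
have [_ DB] := defect_bound_L2 T sh (fun i : 'I_(Defs.nv ft) => u (nodeP P T i)) s cU.
have [ht _] := hessN_close true uP cU cl; have [hf _] := hessN_close false uP cU cl.
have [_ gs] := hessN_close s uP cU cl.
have HKe := HK U e cU ep cl.
have dE : d = Z * e by rewrite /e mulrC divfK// gt_eqF.
rewrite dE.
have p10 : 0 <= p1 := sqrtr_ge0 _; have p20 : 0 <= p2 := sqrtr_ge0 _.
have H := collect_bounds (side_gain ft P s) c0 m1 k0 n1 (sp1 s) (sp2 true) (sp2 false) ht hf gs HKe DB p10 p20.
exact: H.
Qed.

End FinalEstimate.

Section Exponents.
Context {R : realType}.

Lemma scale_bound (g m w E C k h2 S : R) : 0 < g -> 0 < w -> m * w = g ->
  g * E <= C * m * (1 + k) * h2 * S -> E <= C * ((1 + k) / w) * h2 * S.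
Proof.
move=> g0 w0 mw H; rewrite -(ler_pM2l g0); apply: le_trans H _.
have -> : g * (C * ((1 + k) / w) * h2 * S) = C * m * (1 + k) * h2 * S; last by [].
by rewrite -mw; field; rewrite gt_eqF.
Qed.

(** The exponents in the theorem, solved from [side_mult * rho ^ r = side_gain] on the side + : the
    gain is 1, [rho] or [sqrt rho]. *)
Lemma rho_power (r : R) : 0 < r ->
  [/\ r^-1 * r `^ 1 = 1, r^-1 * r `^ 2 = r & r^-1 * r `^ (3 / 2) = Num.sqrt r].
Proof.
move=> r0; have rn : r != 0 by rewrite gt_eqF.
split.
- by rewrite powRr1 ?ltW// mulVf.
- by rewrite powR_mulrn ?ltW// expr2 mulrA mulVf// mul1r.
have -> : (3 / 2 : R) = 1 + 2^-1 by field.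
by rewrite powRD ?rn ?implybT// powRr1 ?ltW// mulrA mulVf// mul1r powR12_sqrt// ltW.
Qed.

End Exponents.

Theorem theorem5p5 (R : realType) (ft : fe_type) (eps kbar lam : R) :
  0 < eps < Num.sqrt 2 / 2 -> 0 < kbar <= 1 -> 0 < lam < 1 ->
  exists C : R,
  forall P : interface_problem R,
    standing_hypotheses ft P -> unisolvence_conditions ft P eps kbar lam ->
  forall T : element R,
    interface_element ft P T -> (forall X, ~ obscure ft P T X) ->
  forall phi : 'I_(nv ft) -> bool -> shape_poly R,
    IFE_shape_functions P T phi ->
  forall u : R * R -> R, PH2_int ft P T u ->
  let err (s : bool) (X : R * R) := interpolation P T phi u s X - u X in
  let side_err (s : bool) :=
    L2norm (Tsub ft P T s) (err s) + mesh_size P * semi1 (Tsub ft P T s) (err s) in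
  let broken_err := pnorm0 ft P T err + mesh_size P * psemi1 ft P T err in
  let bound (r : R) :=
    C * ((1 + kappa P) / rho P `^ r) * mesh_size P ^+ 2
      * (psemi1 ft P T (fun=> u) + psemi2 ft P T (fun=> u)) in
  match ft with
  | FE_rotated_Q1 | FE_crouzeix_raviart =>
      side_err false <= bound 1 /\ side_err true <= bound 2
  | FE_linear => side_err false <= bound 1 /\ side_err true <= bound (3 / 2)
  | FE_bilinear => broken_err <= bound 1
  end.
Proof.
move=> epsb kb lab; pose C0 := 3312 * (5200 / lam).
have C00 : 0 <= C0.
  have /andP[l0 _] := lab; apply: mulr_ge0; first exact: ler0n.
  by apply: divr_ge0; [exact: ler0n|exact: ltW].
(* [C0] works on each side separately; it is doubled because the bilinear estimate adds the two
   sides. *)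
exists (C0 + C0) => P sh uc T iT nob phi shape u uP err side_err broken_err bound.
have SB s := side_error_bound sh iT epsb kb lab uc nob shape s uP.
have k0 : 0 <= kappa P := kappa_ge0 (hyp_curvature sh).
have r0 := rho_gt0 sh; have h0 := mesh_size_gt0 sh.
have [r1 r2 r3] := rho_power r0.
have p0 r : 0 < rho P `^ r by exact: powR_gt0.
pose Y r := C0 * ((1 + kappa P) / rho P `^ r) * mesh_size P ^+ 2
      * (psemi1 ft P T (fun=> u) + psemi2 ft P T (fun=> u)).
have Y0 r : 0 <= Y r.
  have p1 : 0 <= psemi1 ft P T (fun=> u) := sqrtr_ge0 _.
  have p2 : 0 <= psemi2 ft P T (fun=> u) := sqrtr_ge0 _.
  apply: mulr_ge0 (addr_ge0 p1 p2); apply: mulr_ge0 (sqr_ge0 _); apply: mulr_ge0 => //.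
  by apply: divr_ge0 (ltW (p0 r)); exact: addr_ge0 ler01 k0.
have boundE r : bound r = Y r + Y r by rewrite /bound /Y; ring.
have step s r : side_mult P s * rho P `^ r = side_gain ft P s -> side_err s <= Y r.
  by move=> E; exact: (scale_bound (IFE_gain_gt0 sh s) (p0 r) E (SB s)).
have weak s r : side_mult P s * rho P `^ r = side_gain ft P s -> side_err s <= bound r.
  by move=> /step H; rewrite boundE; apply: le_trans H _; rewrite lerDl.
have f1 : side_err false <= Y 1.
  by apply: step; rewrite /side_mult /side_gain mul1r powRr1// ltW.
have f2 : side_err false <= bound 1.
  by apply: weak; rewrite /side_mult /side_gain mul1r powRr1// ltW.
have bE : ft = FE_bilinear -> broken_err <= bound 1.
  move=> ftE; have t1 : side_err true <= Y 1.
    by apply: step; rewrite /side_mult /side_gain ftE.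
  rewrite boundE; apply: le_trans (lerD f1 t1); rewrite /broken_err /side_err addrACA -mulrDr.
  apply: lerD; first exact: (sqrt_sum_bool_le (fun s => L2norm_ge0 _ _)).
  rewrite ler_pM2l//; apply: sqrt_sum_bool_le => s; exact: sqrtr_ge0.
case E : ft; [split=> //|exact: bE|split=> //|split=> //].
all: by apply: weak; rewrite /side_mult /side_gain /IFE_gain E ?r2 ?r3.
Qed.
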